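(* Let $V:\mathbb{Z}\to\mathbb{R}$ satisfy $|V(n)|\lesssim\langle n\rangle^{-\beta}$ for some $\beta>0$, let $H=\Delta^2+V$, and assume $H$ has no eigenvalues in $(0,16)$. Then there exists $\mu_0>0$ small enough such that $(M^\pm(\cdot))^{-1}$ satisfies the following expansions on $\ell^2(\mathbb{Z})$ for all $0<\mu<\mu_0$: (i) If $0$ is a regular point of $H$ and $\beta>15$, then $$\left(M^{\pm}(\mu)\right)^{-1}=S_0A_{01}S_0+\mu QA^{\pm}_{11}Q+\mu^2\left(QA^{\pm}_{21}Q+S_0A^{\pm}_{22}+A^{\pm}_{23}S_0\right)+\mu^3A^{\pm}_{31}+\Gamma_{4}(\mu).$$ (ii) If $16$ is a regular point of $H$ and $\beta>7$, then $$\left(M^{\pm}(2-\mu)\right)^{-1}=\widetilde{Q}B_{01}\widetilde{Q}+\mu^{\frac12}B^{\pm}_{11}+\Gamma_{1}(\mu).$$ Here $A_{01},A^\pm_{kj},B_{01},B^\pm_{11}$ are $\mu$-independent bounded operators on $\ell^2(\mathbb{Z})$ ($A_{01}$ and $B_{01}$ being the same for both signs), and $\Gamma_4(\mu)$, $\Gamma_1(\mu)$ are $\mu$-dependent operators (allowed to depend on the sign $\pm$) of the type described in the context.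
   Context: $(\Delta\phi)(n)=\phi(n+1)+\phi(n-1)-2\phi(n)$ on $\ell^2(\mathbb{Z})$; $V$ acts by multiplication; $\langle n\rangle=(1+|n|^2)^{1/2}$; $a\lesssim b$ means $a\le cb$ for a constant $c>0$. $\ell^{2,s}(\mathbb{Z})=\{\phi:\sum_n\langle n\rangle^{2s}|\phi(n)|^2<\infty\}$; $\mathbb{B}(s,s')$ is the space of bounded operators from $\ell^{2,s}(\mathbb{Z})$ to $\ell^{2,s'}(\mathbb{Z})$; $W_\sigma(\mathbb{Z})=\bigcap_{s>\sigma}\ell^{2,-s}(\mathbb{Z})$. Regular points: $0$ is a regular point of $H$ if $H\phi=0$ has no nonzero solution in $W_{3/2}(\mathbb{Z})$; $16$ is a regular point of $H$ if $H\phi=16\phi$ has no nonzero solution in $W_{1/2}(\mathbb{Z})$. For $\mu\in(0,2)$, $R_0^\pm(\mu^4)=\lim_{\varepsilon\downarrow0}(\Delta^2-\mu^4\mp i\varepsilon)^{-1}$ (limit in $\mathbb{B}(s,-s)$, $s>1/2$). Put $v(n)=\sqrt{|V(n)|}$, $U(n)=\mathrm{sign}(V(n))$ (with $U(n)=1$ where $V(n)=0$), and $$M^\pm(\mu)=U+vR_0^\pm(\mu^4)v,\qquad \mu\in(0,2),$$ an operator on $\ell^2(\mathbb{Z})$; $(M^\pm(\mu))^{-1}$ is its inverse. With $v_1(n)=nv(n)$ and $\tilde v(n)=(-1)^nv(n)$, $Q$, $S_0$, $\widetilde Q$ are the orthogonal projections in $\ell^2(\mathbb{Z})$ onto $(\mathrm{span}\{v\})^\perp$,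 $(\mathrm{span}\{v,v_1\})^\perp$, $(\mathrm{span}\{\tilde v\})^\perp$ respectively. For $k>0$, $\Gamma_k(\mu)$ denotes a $\mu$-dependent operator on $\ell^2(\mathbb{Z})$ with $\|\Gamma_k(\mu)\|_{\mathbb{B}(0,0)}+\mu\|\partial_\mu\Gamma_k(\mu)\|_{\mathbb{B}(0,0)}\lesssim\mu^k$ (for $0<\mu<\mu_0$). *)

(* Defs.v *)
From HB Require Import structures.
From mathcomp Require Import all_boot all_order all_algebra.
From mathcomp Require Import all_classical all_reals all_analysis.
From mathcomp Require Export complex.

Set Implicit Arguments.
Unset Strict Implicit.
Unset Printing Implicit Defensive.

Import Order.TTheory GRing.Theory Num.Theory.
Import numFieldNormedType.Exports.

Local Open Scope classical_set_scope.
Local Open Scope complex_scope.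
Local Open Scope ring_scope.

(* An operator is a total map on all complex sequences over Z; only its values
   on the weighted space under consideration are meaningful. *)
Notation seqZ R := (int -> R[i]).
Notation opZ R := (seqZ R -> seqZ R).

Section Spaces.
Context {R : realType}.
Implicit Types (s : R) (phi psi : seqZ R) (A B : opZ R).

Definition jap (n : int) : R := Num.sqrt (1 + `|n%:~R| ^+ 2).

(* +oo when phi is not in l^{2,s} *)
Definition wnorm s phi : \bar R :=
  ((\esum_(n in [set: int])
      (jap n `^ (2 * s) * Normc.normc (phi n) ^+ 2)%:E) `^ 2^-1)%E.

Definition l2w s : set (seqZ R) := [set phi | (wnorm s phi < +oo)%E].

Definition Wspace (sigma : R) : set (seqZ R) :=
  [set phi | forall s, sigma < s -> l2w (- s) phi].

(* +oo when A is not bounded from l^{2,s} to l^{2,s'} *)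
Definition opnorm s s' A : \bar R :=
  ereal_sup [set wnorm s' (A phi) | phi in [set phi | (wnorm s phi <= 1)%E]].

Definition linear_on (E : set (seqZ R)) A :=
  forall (a : R[i]) phi psi, E phi -> E psi ->
    A (a *: phi + psi) = a *: A phi + A psi.

Definition Bop s s' A := linear_on (l2w s) A /\ (opnorm s s' A < +oo)%E.

Definition op_inverse A B :=
  [/\ Bop 0 0 A, Bop 0 0 B &
      forall phi, l2w 0 phi -> A (B phi) = phi /\ B (A phi) = phi].

(* Sum over Z of an absolutely summable family. *)
Definition rsum (f : int -> R) : R :=
  fine (\esum_(n in [set: int]) (EFin \o f)^\+ n)%E
  - fine (\esum_(n in [set: int]) (EFin \o f)^\- n)%E.

Definition csum (f : seqZ R) : R[i] :=
  Complex (rsum (fun n => complex.Re (f n))) (rsum (fun n => complex.Im (f n))).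

Definition inner phi psi : R[i] := csum (fun n => phi n * (psi n)^*).

Definition span1 phi : set (seqZ R) := [set psi | exists a, psi = a *: phi].

Definition span2 phi1 phi2 : set (seqZ R) :=
  [set psi | exists a b, psi = a *: phi1 + b *: phi2].

Definition orth (E : set (seqZ R)) : set (seqZ R) :=
  [set phi | l2w 0 phi /\ forall psi, E psi -> inner phi psi = 0].

(* The orthogonal projection onto a closed subspace E of l^2; determined on l^2
   only. *)
Definition oproj (E : set (seqZ R)) : opZ R :=
  xget (0 : opZ R) [set P | forall phi, l2w 0 phi ->
    E (P phi) /\ forall psi, E psi -> inner (phi - P phi) psi = 0].

End Spaces.

Section Operators.
Context {R : realType}.
Implicit Types (phi : seqZ R) (A : opZ R) (V : int -> R) (pm : bool).

Definition lap phi : seqZ R :=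
  fun n => phi (n + 1) + phi (n - 1) - 2%:R * phi n.

Definition bilap : opZ R := lap \o lap.

Definition mulop V : opZ R := fun phi n => (V n)%:C * phi n.

Definition Hop V : opZ R := bilap + mulop V.

Definition eigenvalue_of A (lambda : R) :=
  exists phi, [/\ l2w 0 phi, phi <> 0 & A phi = lambda%:C *: phi].

Definition regular0 V :=
  ~ exists phi, [/\ Wspace (3 / 2) phi, phi <> 0 & Hop V phi = 0].

Definition regular16 V :=
  ~ exists phi, [/\ Wspace (1 / 2) phi, phi <> 0
                  & Hop V phi = (16 : R)%:C *: phi].

(* (A - z)^{-1} on l^2 *)
Definition resolvent A (z : R[i]) : opZ R :=
  xget (0 : opZ R) [set B | op_inverse (fun phi => A phi - z *: phi) B].

(* pm = true is the sign +, pm = false the sign -. *)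
Definition pmsign pm : R := if pm then 1 else -1.

(* R_0^{pm}(lambda): one operator, defined on the union of the l^{2,s} with
   s > 1/2, that is the limit in each B(s,-s). *)
Definition R0 pm (lambda : R) : opZ R :=
  xget (0 : opZ R) [set T | forall s : R, 1 / 2 < s ->
    Bop s (- s) T /\
    opnorm s (- s)
      (resolvent bilap (Complex lambda (pmsign pm * eps)) - T)
      @[eps --> (0 : R)^'+] --> 0%E].

Definition vpot V (n : int) : R := Num.sqrt `|V n|.
Definition Upot V (n : int) : R := if 0 <= V n then 1 else -1.

Definition Mop V pm (mu : R) : opZ R :=
  mulop (Upot V) + (mulop (vpot V) \o R0 pm (mu ^+ 4) \o mulop (vpot V)).

Definition vC V : seqZ R := fun n => (vpot V n)%:C.
Definition v1C V : seqZ R := fun n => (n%:~R * vpot V n)%:C.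
Definition vtC V : seqZ R := fun n => ((-1) ^ n * vpot V n)%:C.

Definition Qproj V : opZ R := oproj (orth (span1 (vC V))).
Definition S0proj V : opZ R := oproj (orth (span2 (vC V) (v1C V))).
Definition Qtproj V : opZ R := oproj (orth (span1 (vtC V))).

(* DG is the derivative of G at mu in the norm of B(0,0). *)
Definition op_derive (G : R -> opZ R) (mu : R) (DG : opZ R) :=
  opnorm 0 0 ((h^-1)%:C *: (G (mu + h) - G mu) - DG)
    @[h --> (0 : R)^'] --> 0%E.

Definition is_Gamma (k mu0 : R) (G : R -> opZ R) :=
  exists DG : R -> opZ R,
    (forall mu, 0 < mu < mu0 ->
       [/\ Bop 0 0 (G mu), Bop 0 0 (DG mu) & op_derive G mu (DG mu)]) /\
    exists2 c : R, 0 < c & forall mu, 0 < mu < mu0 ->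
      (opnorm 0 0 (G mu) + mu%:E * opnorm 0 0 (DG mu) <= (c * mu `^ k)%:E)%E.

End Operators.

(* Main.v *)
Require Import Defs.
From HB Require Import structures.
From mathcomp Require Import all_boot all_order all_algebra.
From mathcomp Require Import all_classical all_reals all_analysis.
From mathcomp Require Import finmap ring lra zify.

Set Implicit Arguments.
Unset Strict Implicit.
Unset Printing Implicit Defensive.

Import Order.TTheory GRing.Theory Num.Theory.
Import numFieldNormedType.Exports.

Local Open Scope classical_set_scope.
Local Open Scope complex_scope.
Local Open Scope ring_scope.

Notation nc := Normc.normc.

Section ComplexModulus.
Context {R : realType}.
Implicit Types (x y z : R[i]) (a : R).

Lemma normcE_nc z : `|z| = (nc z)%:C.
Proof. by case: z. Qed.

Lemma nc_ge0 z : 0 <= nc z.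
Proof. by case: z => a b; exact: sqrtr_ge0. Qed.

Lemma ncD x y : nc (x + y) <= nc x + nc y.
Proof. exact: le_normcD. Qed.

Lemma ncN x : nc (- x) = nc x.
Proof. exact: normcN. Qed.

Lemma ncB x y : nc (x - y) <= nc x + nc y.
Proof. by rewrite -(ncN y); exact: ncD. Qed.

Lemma ncM x y : nc (x * y) = nc x * nc y.
Proof. exact: Normc.normcM. Qed.

Lemma nc0 : nc (0 : R[i]) = 0.
Proof. exact: Normc.normc0. Qed.

Lemma nc1 : nc (1 : R[i]) = 1.
Proof. exact: Normc.normc1. Qed.

Lemma ncX x n : nc (x ^+ n) = nc x ^+ n.
Proof. by elim: n => [|n IH]; rewrite ?expr0 ?nc1 // !exprS ncM IH. Qed.

Lemma ncC a : nc a%:C = `|a|.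
Proof. by rewrite /= expr0n addr0 sqrtr_sqr. Qed.

Lemma nc_conj z : nc z^* = nc z.
Proof. by case: z => a b /=; rewrite sqrrN. Qed.

Lemma nc_eq0 z : (nc z == 0) = (z == 0).
Proof.
by apply/eqP/eqP => [|->]; [exact: Normc.eq0_normc | exact: nc0].
Qed.

Lemma nc_sum I (s : seq I) (f : I -> R[i]) :
  nc (\sum_(i <- s) f i) <= \sum_(i <- s) nc (f i).
Proof.
elim: s => [|i s IH]; rewrite ?big_nil ?nc0 // !big_cons.
by apply: le_trans (ncD _ _) _; rewrite lerD2l.
Qed.

Lemma nc_Re z : `|complex.Re z| <= nc z.
Proof.
case: z => a b /=; rewrite -sqrtr_sqr ler_wsqrtr // lerDl; exact: sqr_ge0.
Qed.

Lemma nc_Im z : `|complex.Im z| <= nc z.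
Proof.
case: z => a b /=; rewrite -sqrtr_sqr ler_wsqrtr // lerDr; exact: sqr_ge0.
Qed.

Lemma nc_le_ReIm z : nc z <= `|complex.Re z| + `|complex.Im z|.
Proof.
case: z => a b /=; rewrite -[leRHS]ger0_norm ?addr_ge0 // -sqrtr_sqr ler_wsqrtr //.
by rewrite sqrrD !real_normK ?num_real // addrAC lerDl mulrn_wge0 ?mulr_ge0.
Qed.

Lemma nc_dist x y : `|nc x - nc y| <= nc (x - y).
Proof.
rewrite ler_norml; apply/andP; split; last first.
  by rewrite lerBlDr; apply: le_trans (ncD _ _); rewrite subrK.
rewrite lerNl opprB lerBlDr -(ncN (x - y)) opprB.
by apply: le_trans (ncD _ _); rewrite subrK.
Qed.

End ComplexModulus.

Section Sums.
Context {R : realType}.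
Implicit Types (f g : seqZ R) (phi psi : seqZ R) (c d : R) (s : seq int).

(* Finite sums determine the norms and sums used throughout: they are
   suprema, respectively limits, over duplicate-free lists of indices. *)
Definition sumle f c := forall s, uniq s -> \sum_(n <- s) nc (f n) <= c.

Lemma nneg_sum_lim (h : int -> R) c : (forall n, 0 <= h n) ->
  (forall s, uniq s -> \sum_(n <- s) h n <= c) ->
  (forall s, uniq s -> \sum_(n <- s) h n <= fine (\esum_(n in [set: int]) (h n)%:E)%E) /\
  (forall e, 0 < e -> exists2 s, uniq s &
    fine (\esum_(n in [set: int]) (h n)%:E)%E - e < \sum_(n <- s) h n).
Proof.
move=> h0 hc.
have inS s : uniq s -> [set (\sum_(x \in A) (h x)%:E)%E | A in fsets [set: int]]
    (\sum_(n <- s) h n)%:E.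
  move=> us; exists [set` s]; first by split; [exact: finite_seq|].
  by rewrite -fsbig_seq // sumEFin.
have ub : (\esum_(n in [set: int]) (h n)%:E <= c%:E)%E.
  apply: ge_ereal_sup => _ [A [finA _] <-].
  rewrite fsbig_finite //= sumEFin lee_fin; apply: hc; exact: fset_uniq.
have ge0 : (0 <= \esum_(n in [set: int]) (h n)%:E)%E.
  by apply: esum_ge0 => n _; rewrite lee_fin.
have fin : (\esum_(n in [set: int]) (h n)%:E)%E \is a fin_num.
  by rewrite ge0_fin_numE //; apply: le_lt_trans ub _; rewrite ltry.
split=> [s us|e e0].
  rewrite -lee_fin fineK //; exact: ereal_sup_ubound (inS _ us).
have [_ [A [finA _] <-]] := ub_ereal_sup_adherent e0 fin.
rewrite fsbig_finite //= sumEFin => H; exists (fset_set A); first exact: fset_uniq.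
by rewrite -lte_fin EFinB fineK.
Qed.

Lemma sub_sum_le (h : int -> R) s1 s2 : (forall n, 0 <= h n) ->
  uniq s1 -> uniq s2 -> {subset s1 <= s2} ->
  \sum_(n <- s1) h n <= \sum_(n <- s2) h n.
Proof.
move=> h0 u1 u2 sub; rewrite [leRHS](bigID (mem s1)) /=.
rewrite -[leLHS]addr0 lerD ?sumr_ge0 // -(big_filter s2).
rewrite (perm_big [seq n <- s2 | n \in s1]) //=.
apply: uniq_perm => //; first exact: filter_uniq.
move=> n; rewrite mem_filter; case: (boolP (n \in s1)) => //= H.
by rewrite sub.
Qed.

Lemma rsum_lim (h : int -> R) c :
  (forall s, uniq s -> \sum_(n <- s) `|h n| <= c) ->
  forall e, 0 < e -> exists2 s0, uniq s0 & forall s, uniq s -> {subset s0 <= s} ->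
    `|\sum_(n <- s) h n - rsum h| <= e.
Proof.
move=> hc e e0.
pose p n := Num.max (h n) 0; pose m n := Num.max (- h n) 0.
have p0 n : 0 <= p n by rewrite /p le_max lexx orbT.
have m0 n : 0 <= m n by rewrite /m le_max lexx orbT.
have ple n : p n <= `|h n| by rewrite /p ge_max ler_norm normr_ge0.
have mle n : m n <= `|h n| by rewrite /m ge_max -normrN ler_norm normr_ge0.
have pm n : h n = p n - m n.
  rewrite /p /m; case: (lerP (h n) 0) => H.
    by rewrite max_l ?oppr_ge0 // sub0r opprK.
  by rewrite max_r ?subr0 // oppr_le0 ltW.
have e2 : 0 < e / 2 by rewrite divr_gt0.
have [p1 p2] := nneg_sum_lim p0 (fun s us => le_trans (ler_sum _ (fun n _ => ple n)) (hc s us)).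
have [m1 m2] := nneg_sum_lim m0 (fun s us => le_trans (ler_sum _ (fun n _ => mle n)) (hc s us)).
have [sp up Hp] := p2 _ e2; have [sm um Hm] := m2 _ e2.
exists (undup (sp ++ sm)); first exact: undup_uniq.
move=> s us sub.
have Hp' := le_trans (ltW Hp) (sub_sum_le p0 up us
   (fun n Hn => sub n ltac:(by rewrite mem_undup mem_cat Hn))).
have Hm' := le_trans (ltW Hm) (sub_sum_le m0 um us
   (fun n Hn => sub n ltac:(by rewrite mem_undup mem_cat Hn orbT))).
have -> : rsum h = fine (\esum_(n in [set: int]) (p n)%:E)%E
   - fine (\esum_(n in [set: int]) (m n)%:E)%E.
  rewrite /rsum; congr (fine _ - fine _); apply: eq_esum => n _.
    by rewrite funeposE /= EFin_max.
  by rewrite funenegE /= EFin_max.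
rewrite (eq_bigr _ (fun n _ => pm n)) sumrB.
have {}p1 := p1 s us; have {}m1 := m1 s us.
by rewrite ler_norml; apply/andP; split; lra.
Qed.

Lemma csum_lim f c : sumle f c ->
  forall e, 0 < e -> exists2 s0, uniq s0 & forall s, uniq s -> {subset s0 <= s} ->
    nc (\sum_(n <- s) f n - csum f) <= e.
Proof.
move=> fc e e0; have e2 : 0 < e / 2 by rewrite divr_gt0.
have [|s1 u1 H1] := @rsum_lim (fun n => complex.Re (f n)) c _ _ e2.
  by move=> s us; apply: le_trans (fc s us); apply: ler_sum => n _; exact: nc_Re.
have [|s2 u2 H2] := @rsum_lim (fun n => complex.Im (f n)) c _ _ e2.
  by move=> s us; apply: le_trans (fc s us); apply: ler_sum => n _; exact: nc_Im.
exists (undup (s1 ++ s2)); first exact: undup_uniq.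
move=> s us sub.
have ReS : complex.Re (\sum_(n <- s) f n) = \sum_(n <- s) complex.Re (f n).
  exact: (raddf_sum (@complex.Re R : Rcomplex R -> R)).
have ImS : complex.Im (\sum_(n <- s) f n) = \sum_(n <- s) complex.Im (f n).
  exact: (raddf_sum (@complex.Im R : Rcomplex R -> R)).
apply: le_trans (nc_le_ReIm _) _.
have {}H1 := H1 s us (fun n Hn => sub n ltac:(by rewrite mem_undup mem_cat Hn)).
have {}H2 := H2 s us (fun n Hn => sub n ltac:(by rewrite mem_undup mem_cat Hn orbT)).
rewrite [e]splitr lerD //.
- by move: H1; rewrite -ReS /csum; case: (\sum_(n <- s) f n).
- by move: H2; rewrite -ImS /csum; case: (\sum_(n <- s) f n).
Qed.

Lemma csum_unique f c l : sumle f c ->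
  (forall e, 0 < e -> exists2 s0, uniq s0 & forall s, uniq s -> {subset s0 <= s} ->
    nc (\sum_(n <- s) f n - l) <= e) -> csum f = l.
Proof.
move=> fc Hl; apply/eqP; rewrite -subr_eq0 -nc_eq0; apply/negPn/negP => Hn.
have e0 : 0 < nc (csum f - l) / 3.
  by rewrite divr_gt0 // lt_neqAle eq_sym Hn nc_ge0.
have [s1 u1 H1] := csum_lim fc e0; have [s2 u2 H2] := Hl _ e0.
pose s := undup (s1 ++ s2); have us : uniq s by exact: undup_uniq.
have {}H1 := H1 s us (fun n Hn => ltac:(by rewrite mem_undup mem_cat Hn)).
have {}H2 := H2 s us (fun n Hn => ltac:(by rewrite mem_undup mem_cat Hn orbT)).
have : nc (csum f - l) <= nc (csum f - l) / 3 + nc (csum f - l) / 3.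
  apply: le_trans (lerD H1 H2); rewrite -(ncN (_ - csum f)) opprB.
  by apply: le_trans (ncD _ _); rewrite addrA subrK.
lra.
Qed.

Lemma sumle_le f c d : c <= d -> sumle f c -> sumle f d.
Proof. by move=> cd H s /H /le_trans; apply. Qed.

Lemma sumle_ge0 f c : sumle f c -> 0 <= c.
Proof. by move/(_ [::] isT); rewrite big_nil. Qed.

Lemma sumleD f g c d : sumle f c -> sumle g d -> sumle (fun n => f n + g n) (c + d).
Proof.
move=> fc gd s us; apply: le_trans (lerD (fc s us) (gd s us)).
by rewrite -big_split; apply: ler_sum => n _; exact: ncD.
Qed.

Lemma sumleZ a f c : sumle f c -> sumle (fun n => a * f n) (nc a * c).
Proof.
move=> fc s us; under eq_bigr do rewrite ncM.
by rewrite -mulr_sumr ler_wpM2l ?nc_ge0 ?fc.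
Qed.

Lemma sumle_dom f g c : (forall n, nc (f n) <= nc (g n)) -> sumle g c -> sumle f c.
Proof. by move=> fg gc s us; apply: le_trans (gc s us); exact: ler_sum. Qed.

Lemma csum_norm f c : sumle f c -> nc (csum f) <= c.
Proof.
move=> fc; apply/ler_addgt0Pr => e e0.
have [s us H] := csum_lim fc e0.
have {}H := H s us (fun n Hn => Hn).
rewrite -[csum f](subrK (\sum_(n <- s) f n)) addrC.
apply: le_trans (ncD _ _) _; rewrite lerD //.
  by apply: le_trans (nc_sum _ _) (fc s us).
by rewrite -ncN opprB.
Qed.

Lemma csumD f g c d : sumle f c -> sumle g d ->
  csum (fun n => f n + g n) = csum f + csum g.
Proof.
move=> fc gd; apply: (csum_unique (sumleD fc gd)) => e e0.
have e2 : 0 < e / 2 by rewrite divr_gt0.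
have [s1 u1 H1] := csum_lim fc e2; have [s2 u2 H2] := csum_lim gd e2.
exists (undup (s1 ++ s2)); first exact: undup_uniq.
move=> s us sub.
have {}H1 := H1 s us (fun n Hn => sub n ltac:(by rewrite mem_undup mem_cat Hn)).
have {}H2 := H2 s us (fun n Hn => sub n ltac:(by rewrite mem_undup mem_cat Hn orbT)).
rewrite big_split /= opprD addrACA [e]splitr.
by apply: le_trans (ncD _ _) (lerD H1 H2).
Qed.

Lemma csumZ a f c : sumle f c -> csum (fun n => a * f n) = a * csum f.
Proof.
move=> fc; apply: (csum_unique (sumleZ a fc)) => e e0.
have a1 : 0 < nc a + 1 by rewrite ltr_wpDl ?nc_ge0.
have [s0 u0 H0] := csum_lim fc (divr_gt0 e0 a1).
exists s0 => // s us sub; rewrite -mulr_sumr -mulrBr ncM.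
apply: le_trans (ler_wpM2l (nc_ge0 _) (H0 s us sub)) _.
by rewrite mulrCA ger_pMr // ler_pdivrMr // mul1r lerDl.
Qed.

Lemma csum_fin f s0 : uniq s0 -> (forall n, n \notin s0 -> f n = 0) ->
  csum f = \sum_(n <- s0) f n.
Proof.
move=> u0 f0.
have E s : uniq s -> {subset s0 <= s} -> \sum_(n <- s) f n = \sum_(n <- s0) f n.
  move=> us sub; rewrite (bigID (mem s0)) /= [X in _ + X]big1.
    rewrite addr0 -(big_filter s) (perm_big s0) //=.
    apply: uniq_perm => //; first exact: filter_uniq.
    move=> n; rewrite mem_filter; case: (boolP (n \in s0)) => //= H.
    by rewrite sub.
  by move=> n /f0.
have fc : sumle f (\sum_(n <- s0) nc (f n)).
  move=> s us; rewrite (bigID (mem s0)) /= [X in _ + X]big1.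
    rewrite addr0 -(big_filter s); apply: sub_sum_le => //.
    - by move=> n; exact: nc_ge0.
    - exact: filter_uniq.
    - by move=> n; rewrite mem_filter => /andP[].
  by move=> n /f0 ->; rewrite nc0.
apply: (csum_unique fc) => e e0; exists s0 => // s us sub.
by rewrite E // subrr nc0 ltW.
Qed.

Lemma csum_reindex f c (h h' : int -> int) : cancel h h' -> cancel h' h ->
  sumle f c -> sumle (fun n => f (h n)) c /\ csum (fun n => f (h n)) = csum f.
Proof.
move=> hK h'K fc.
have E (g : int -> R) s : \sum_(n <- s) g (h n) = \sum_(n <- map h s) g n.
  by rewrite big_map.
have fc' : sumle (fun n => f (h n)) c.
  move=> s us; rewrite -(big_map h xpredT (fun n => nc (f n))); apply: fc.
  by rewrite map_inj_uniq //; exact: can_inj hK.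
split=> //; apply: (csum_unique fc') => e e0.
have [s0 u0 H0] := csum_lim fc e0.
exists (map h' s0); first by rewrite map_inj_uniq //; exact: can_inj h'K.
move=> s us sub; rewrite -(big_map h xpredT f); apply: H0.
  by rewrite map_inj_uniq //; exact: can_inj hK.
move=> n Hn; rewrite -(h'K n) map_f // sub // map_f //.
Qed.

Lemma eq_csum f g : f =1 g -> csum f = csum g.
Proof. by move=> /funext ->. Qed.

End Sums.

Section SquareSummable.
Context {R : realType}.
Implicit Types (phi psi : seqZ R) (c d : R) (s : seq int) (K : int -> int -> R[i]).

Definition l2le phi c := 0 <= c /\ forall s, uniq s ->
  \sum_(n <- s) nc (phi n) ^+ 2 <= c ^+ 2.

Lemma jap_ge1 (n : int) : 1 <= jap n :> R.
Proof. by rewrite -[leLHS]sqrtr1 ler_wsqrtr // lerDl sqr_ge0. Qed.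

Lemma jap_gt0 (n : int) : 0 < jap n :> R.
Proof. exact: lt_le_trans ltr01 (jap_ge1 n). Qed.

Lemma jap_ge0 (n : int) : 0 <= jap n :> R.
Proof. exact: ltW (jap_gt0 n). Qed.

Lemma powR_sq (x p : R) : (x `^ p) ^+ 2 = x `^ (2 * p).
Proof. by rewrite -powR_mulrn ?powR_ge0 // -powRrM mulrC. Qed.

(* The weighted space l^{2,t} is l^2 transported by multiplication by <n>^t. *)
Definition jmul (t : R) phi : seqZ R := fun n => (jap n `^ t)%:C * phi n.

Lemma wnorm_jmul t phi : wnorm t phi = wnorm 0 (jmul t phi).
Proof.
rewrite /wnorm; congr poweR; apply: eq_esum => n _; congr EFin.
rewrite mulr0 powRr0 mul1r /jmul ncM ncC ger0_norm ?powR_ge0 //.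
by rewrite exprMn powR_sq.
Qed.

Lemma jmul0 phi : jmul 0 phi = phi.
Proof. by apply/funext => n; rewrite /jmul powRr0 mul1r. Qed.

Lemma jmulK t phi : jmul (- t) (jmul t phi) = phi.
Proof.
apply/funext => n; rewrite /jmul mulrA -rmorphM /= -powRD ?addNr ?powRr0 ?mul1r //.
by rewrite eqxx gt_eqF ?jap_gt0.
Qed.

Lemma wnormP phi c : 0 <= c -> (wnorm 0 phi <= c%:E)%E <-> l2le phi c.
Proof.
move=> c0; rewrite /wnorm.
set S := (\esum_(n in _) _)%E.
have SE : S = (\esum_(n in [set: int]) (nc (phi n) ^+ 2)%:E)%E.
  by apply: eq_esum => n _; rewrite mulr0 powRr0 mul1r.
have S0 : (0 <= S)%E by rewrite SE; apply: esum_ge0 => n _; rewrite lee_fin sqr_ge0.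
have -> : ((S `^ 2^-1 <= c%:E)%E : Prop) = ((S <= (c ^+ 2)%:E)%E : Prop).
  rewrite poweR12_sqrt //; case: (S) S0 => [x||] //=.
    rewrite !lee_fin => x0; congr is_true; apply/idP/idP => H.
      by rewrite -[x]sqr_sqrtr // lerXn2r ?nnegrE ?sqrtr_ge0.
    by rewrite -[c]ger0_norm // -sqrtr_sqr ler_wsqrtr.
split=> [H|[_ H]].
  split=> // s us; rewrite -lee_fin; apply: le_trans H; rewrite SE.
  rewrite -sumEFin fsbig_seq //; apply: ereal_sup_ubound; exists [set` s] => //.
  by split => //; exact: finite_seq.
rewrite SE; apply: ge_ereal_sup => _ [A [finA _] <-].
rewrite fsbig_finite //= sumEFin lee_fin; apply: H; exact: fset_uniq.
Qed.

Lemma wnorm_ge0 t phi : (0 <= wnorm t phi)%E.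
Proof. exact: poweR_ge0. Qed.

Lemma l2P phi : l2w 0 phi <-> exists c, l2le phi c.
Proof.
split=> [H|[c H]].
  have F : wnorm 0 phi \is a fin_num by rewrite ge0_fin_numE ?wnorm_ge0.
  exists (fine (wnorm 0 phi)); apply/wnormP; first by rewrite fine_ge0 ?wnorm_ge0.
  by rewrite fineK.
rewrite /l2w /=; have c0 := H.1.
by move/(wnormP _ c0): H => H; apply: le_lt_trans H _; rewrite ltry.
Qed.

Definition nrm2 phi : R := fine (wnorm 0 phi).

Lemma nrm2_ge0 phi : 0 <= nrm2 phi.
Proof. by rewrite fine_ge0 ?wnorm_ge0. Qed.

Lemma nrm2P phi : l2w 0 phi -> l2le phi (nrm2 phi).
Proof.
move=> H; have F : wnorm 0 phi \is a fin_num by rewrite ge0_fin_numE ?wnorm_ge0.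
by apply/wnormP; rewrite ?nrm2_ge0 // /nrm2 fineK.
Qed.

Lemma l2le_l2 phi c : l2le phi c -> l2w 0 phi.
Proof. by move=> H; apply/l2P; exists c. Qed.

Lemma nrm2_le phi c : l2le phi c -> nrm2 phi <= c.
Proof.
move=> H; have F : wnorm 0 phi \is a fin_num.
  by rewrite ge0_fin_numE ?wnorm_ge0 //; exact: (l2le_l2 H).
by rewrite -lee_fin fineK //; apply/wnormP => //; case: H.
Qed.

Lemma l2le_le phi c d : c <= d -> l2le phi c -> l2le phi d.
Proof.
move=> cd [c0 H]; split; first exact: le_trans cd.
by move=> s /H /le_trans; apply; rewrite lerXn2r // nnegrE // (le_trans c0).
Qed.

Lemma l2le_dom phi psi c : (forall n, nc (phi n) <= nc (psi n)) -> l2le psi c -> l2le phi c.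
Proof.
move=> H [c0 Hc]; split=> // s /Hc; apply: le_trans; apply: ler_sum => n _.
by rewrite lerXn2r ?nnegrE ?nc_ge0.
Qed.

Lemma l2le0 : l2le 0 0.
Proof. by split=> // s _; rewrite big1 ?expr0n // => n _; rewrite nc0 expr0n. Qed.

Lemma l2leZ (z : R[i]) phi c : l2le phi c -> l2le (z *: phi) (nc z * c).
Proof.
move=> [c0 H]; split; first by rewrite mulr_ge0 ?nc_ge0.
move=> s us; rewrite exprMn.
under eq_bigr => n _ do rewrite [(z *: phi) n](_ : _ = z * phi n) // ncM exprMn.
by rewrite -mulr_sumr ler_wpM2l ?sqr_ge0 ?H.
Qed.

Lemma l2leN phi c : l2le phi c -> l2le (- phi) c.
Proof. by apply: l2le_dom => n; rewrite -ncN opprK. Qed.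

Lemma l2le_eps phi c : 0 <= c -> (forall e, 0 < e -> l2le phi (c + e)) -> l2le phi c.
Proof.
move=> c0 H; split=> // s us; have S0 : 0 <= \sum_(n <- s) nc (phi n) ^+ 2.
  by apply: sumr_ge0 => n _; exact: sqr_ge0.
suff : Num.sqrt (\sum_(n <- s) nc (phi n) ^+ 2) <= c.
  by move=> h; rewrite -[leLHS]sqr_sqrtr // lerXn2r ?nnegrE ?sqrtr_ge0.
apply/ler_addgt0Pr => e e0; have [h1 h2] := H e e0.
by rewrite -[leRHS]ger0_norm // -sqrtr_sqr ler_wsqrtr // h2.
Qed.

Lemma sqrD_young (a b x y : R) : 0 < a -> 0 < b ->
  (x + y) ^+ 2 <= (1 + b / a) * x ^+ 2 + (1 + a / b) * y ^+ 2.
Proof.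
move=> a0 b0; rewrite -subr_ge0.
suff -> : (1 + b / a) * x ^+ 2 + (1 + a / b) * y ^+ 2 - (x + y) ^+ 2
    = (b * x - a * y) ^+ 2 / (a * b).
  by rewrite divr_ge0 ?sqr_ge0 ?mulr_ge0 ?(ltW a0) ?(ltW b0).
by field; rewrite !gt_eqF.
Qed.

Lemma l2leD phi psi c d : l2le phi c -> l2le psi d -> l2le (phi + psi) (c + d).
Proof.
have pos (a b : R) : 0 < a -> 0 < b -> l2le phi a -> l2le psi b -> l2le (phi + psi) (a + b).
  move=> a0 b0 [_ Ha] [_ Hb]; split; first by rewrite addr_ge0 // ltW.
  move=> s us; apply: (@le_trans _ _ ((1 + b / a) * a ^+ 2 + (1 + a / b) * b ^+ 2)); last first.
    by rewrite le_eqVlt; apply/orP; left; apply/eqP; field; rewrite !gt_eqF.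
  apply: le_trans (lerD (ler_wpM2l _ (Ha s us)) (ler_wpM2l _ (Hb s us))); rewrite ?addr_ge0 ?divr_ge0 ?(ltW a0) ?(ltW b0) //.
  rewrite !mulr_sumr -big_split /=. apply: ler_sum => n _ /=.
  apply: le_trans (sqrD_young _ _ a0 b0).
  by rewrite lerXn2r ?nnegrE ?addr_ge0 ?nc_ge0 //; exact: ncD.
move=> Hc Hd; have c0 := Hc.1; have d0 := Hd.1.
apply: l2le_eps; first by rewrite addr_ge0.
move=> e e0; have e2 : 0 < e / 2 by rewrite divr_gt0.
rewrite [e]splitr addrACA; apply: pos; rewrite ?ltr_wpDl //.
  by apply: l2le_le Hc; rewrite lerDl ltW.
by apply: l2le_le Hd; rewrite lerDl ltW.
Qed.

Lemma l2le_coord phi c n : l2le phi c -> nc (phi n) <= c.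
Proof.
move=> [c0 /(_ [:: n] isT)]; rewrite big_seq1 => H.
by rewrite -(ler_pXn2r (n:=2)) ?nnegrE ?nc_ge0.
Qed.

Lemma l2le_fatou (f : nat -> seqZ R) phi c : (forall j, l2le (f j) c) ->
  (forall n e, 0 < e -> exists j0, forall j, (j0 <= j)%N -> nc (f j n - phi n) <= e) ->
  l2le phi c.
Proof.
move=> fc fl; have c0 := (fc 0%N).1.
apply: l2le_eps => // e e0; split; first by rewrite addr_ge0 // ltW.
move=> s us.
have [j Hj] : exists j, forall n, n \in s -> nc (f j n - phi n) <= e / (size s).+1%:R.
  have e1 : 0 < e / (size s).+1%:R by rewrite divr_gt0.
  have : exists j0, forall j, (j0 <= j)%N -> forall n, n \in s -> nc (f j n - phi n) <= e / (size s).+1%:R.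
    elim: s (e / (size s).+1%:R) e1 {us} => [|m s IH] e' e1; first by exists 0%N.
    have [j1 H1] := IH _ e1; have [j2 H2] := fl m _ e1.
    exists (maxn j1 j2) => j; rewrite geq_max => /andP[l1 l2] n.
    by rewrite inE => /orP[/eqP ->|]; [exact: H2|exact: H1].
  by move=> [j H]; exists j; exact: H.
pose g : seqZ R := fun n => if n \in s then phi n - f j n else 0.
have gl : l2le g e.
  split; first exact: ltW.
  move=> s' us'.
  have gb n : nc (g n) ^+ 2 <= (if n \in s then (e / (size s).+1%:R) ^+ 2 else 0).
    rewrite /g; case: ifP => [ns|_]; last by rewrite nc0 expr0n.
    rewrite lerXn2r ?nnegrE ?nc_ge0 ?divr_ge0 ?(ltW e0) //.
    by rewrite -ncN opprB Hj.
  apply: le_trans (ler_sum _ (fun n _ => gb n)) _.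
  rewrite -big_mkcond /= -big_filter.
  have szle : (size [seq n <- s' | n \in s] <= size s)%N.
    apply: uniq_leq_size; first exact: filter_uniq.
    by move=> n; rewrite mem_filter => /andP[].
  rewrite big_const_seq count_predT iter_addr_0 -[leLHS]mulr_natr expr_div_n.
  have k0 : (size s).+1%:R ^+ 2 != 0 :> R by rewrite expf_neq0 // pnatr_eq0.
  rewrite -[leRHS](divfK k0). rewrite ler_wpM2l ?divr_ge0 ?sqr_ge0 //.
  rewrite -natrX ler_nat; apply: leq_trans szle _.
  by rewrite expnS expn1; apply: leq_trans (leqnSn _) _; rewrite leq_pmulr.
have [_ H] := l2leD (fc j) gl; have {}H := H s us.
apply: le_trans H; rewrite big_seq [leRHS]big_seq; apply: ler_sum => n ns.
by rewrite [(f j + g) n](_ : _ = f j n + g n) // /g ns addrC subrK.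
Qed.

Lemma sum_CS phi psi c d : l2le phi c -> l2le psi d ->
  forall s, uniq s -> \sum_(n <- s) nc (phi n) * nc (psi n) <= c * d.
Proof.
have pos (a b : R) : 0 < a -> 0 < b -> l2le phi a -> l2le psi b ->
    forall s, uniq s -> \sum_(n <- s) nc (phi n) * nc (psi n) <= a * b.
  move=> a0 b0 [_ Ha] [_ Hb] s us.
  have P (x y : R) : x * y <= b / (2 * a) * x ^+ 2 + a / (2 * b) * y ^+ 2.
    rewrite -subr_ge0.
    suff -> : b / (2 * a) * x ^+ 2 + a / (2 * b) * y ^+ 2 - x * y
        = (b * x - a * y) ^+ 2 / (2 * (a * b)).
      by rewrite divr_ge0 ?sqr_ge0 ?mulr_ge0 ?(ltW a0) ?(ltW b0).
    by field; rewrite !gt_eqF.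
  apply: le_trans (ler_sum _ (fun n _ => P (nc (phi n)) (nc (psi n)))) _.
  rewrite big_split /= -!mulr_sumr.
  apply: le_trans (lerD (ler_wpM2l _ (Ha s us)) (ler_wpM2l _ (Hb s us))) _; rewrite ?divr_ge0 ?mulr_ge0 ?(ltW a0) ?(ltW b0) //.
  by rewrite le_eqVlt; apply/orP; left; apply/eqP; field; rewrite !gt_eqF.
move=> Hc Hd s us; have c0 := Hc.1; have d0 := Hd.1.
apply/ler_addgt0Pr => e e0.
pose k := c + d + 1; have k0 : 0 < k by rewrite /k; lra.
pose t := Num.min 1 (e / k).
have t0 : 0 < t by rewrite lt_min ltr01 divr_gt0.
have t1 : t <= 1 by rewrite ge_min lexx.
have tk : t * k <= e by rewrite -ler_pdivlMr // ge_min lexx orbT.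
apply: (@le_trans _ _ ((c + t) * (d + t))).
  apply: pos; rewrite ?ltr_wpDl //.
    by apply: l2le_le Hc; rewrite lerDl ltW.
  by apply: l2le_le Hd; rewrite lerDl ltW.
apply: le_trans (_ : c * d + t * k <= _); last by rewrite lerD2l.
rewrite -subr_ge0 (_ : _ - _ = t * (1 - t)); last by rewrite /k; ring.
by rewrite mulr_ge0 ?subr_ge0 // ltW.
Qed.

Lemma sumle_CS phi psi c d : l2le phi c -> l2le psi d ->
  sumle (fun n => phi n * psi n) (c * d).
Proof.
move=> Hc Hd s us; under eq_bigr do rewrite ncM.
exact: sum_CS.
Qed.

Definition offseq (s0 : seq int) phi : seqZ R := fun n => if n \in s0 then 0 else phi n.

Lemma l2_tail phi c : l2le phi c -> forall e, 0 < e ->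
  exists2 s0, uniq s0 & l2le (offseq s0 phi) e.
Proof.
move=> [c0 H] e e0; have e2 : 0 < e ^+ 2 by rewrite exprn_gt0.
have [H1 H2] := nneg_sum_lim (fun n => sqr_ge0 (nc (phi n))) H.
have [s0 u0 Hs0] := H2 _ e2.
exists s0 => //; split; first exact: ltW.
move=> s us.
pose s' := [seq n <- s | n \notin s0].
have -> : \sum_(n <- s) nc (offseq s0 phi n) ^+ 2 = \sum_(n <- s') nc (phi n) ^+ 2.
  rewrite big_filter [RHS]big_mkcond; apply: eq_bigr => n _; rewrite /offseq.
  by case: (n \in s0); rewrite //= ?expr0n ?addr0 ?sqrtr0 ?expr0n.
have u' : uniq (s0 ++ s').
  rewrite cat_uniq u0 filter_uniq // andbT; apply/hasPn => n.
  by rewrite mem_filter => /andP[].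
have := H1 _ u'; rewrite big_cat /=; lra.
Qed.

Definition kop K : opZ R := fun phi n => csum (fun m => K n m * phi m).

Section KernelOperator.
Variables (K : int -> int -> R[i]) (a : seqZ R) (C S : R).
Hypotheses (C0 : 0 <= C) (aS : l2le a S)
  (Ka : forall n m, nc (K n m) <= C * (nc (a n) * nc (a m))).

Lemma kop_sumle phi c n : l2le phi c ->
  sumle (fun m => K n m * phi m) (C * nc (a n) * (S * c)).
Proof.
move=> H s us; under eq_bigr do rewrite ncM.
apply: (@le_trans _ _ (\sum_(m <- s) C * nc (a n) * (nc (a m) * nc (phi m)))).
  apply: ler_sum => m _; rewrite !mulrA ler_wpM2r ?nc_ge0 //.
  by rewrite -mulrA.
by rewrite -mulr_sumr ler_wpM2l ?mulr_ge0 ?nc_ge0 // (sum_CS aS H).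
Qed.

Lemma kop_coord phi c n : l2le phi c -> nc (kop K phi n) <= nc (a n) * (C * S * c).
Proof.
move=> /(kop_sumle n) /csum_norm H; apply: le_trans H _.
by rewrite le_eqVlt; apply/orP; left; apply/eqP; ring.
Qed.

Lemma kop_bound phi c : l2le phi c -> l2le (kop K phi) (C * S * S * c).
Proof.
move=> H; have c0 := H.1; have S0 := aS.1.
have d0 : 0 <= C * S * c by rewrite !mulr_ge0.
have -> : C * S * S * c = nc (C * S * c)%:C * S by rewrite ncC ger0_norm //; ring.
apply: l2le_dom (l2leZ _ aS) => n.
rewrite [((C * S * c)%:C *: a) n](_ : _ = (C * S * c)%:C * a n) // ncM ncC ger0_norm // mulrC.
exact: kop_coord.
Qed.

Lemma kop_linear : linear_on (l2w 0) (kop K).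
Proof.
move=> z phi psi /l2P[c Hc] /l2P[d Hd]; apply/funext => n.
rewrite [RHS](_ : _ = z * kop K phi n + kop K psi n) // /kop.
rewrite -(csumZ z (kop_sumle n Hc)) -(csumD (sumleZ z (kop_sumle n Hc)) (kop_sumle n Hd)).
apply: eq_csum => m; rewrite [(z *: phi + psi) m](_ : _ = z * phi m + psi m) //.
by ring.
Qed.

End KernelOperator.

End SquareSummable.

Section BoundedOperators.
Context {R : realType}.
Implicit Types (phi psi : seqZ R) (c d : R).

#[local] Hint Extern 0 (l2w 0 _) => (eapply l2le_l2; eassumption) : core.

Definition bounded_op (A : opZ R) := linear_on (l2w 0) A /\
  exists2 C, 0 <= C & forall phi c, l2le phi c -> l2le (A phi) (C * c).

(* The value 0 outside l^2 makes equality of operators extensional equality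
   on l^2. *)
Record bop := BOp { bfun :> opZ R; bop_bounded : bounded_op bfun;
  bop_zero : forall phi, ~ l2w 0 phi -> bfun phi = 0 }.

Lemma bop_eq (A B : bop) : (forall phi, l2w 0 phi -> A phi = B phi) -> A = B.
Proof.
case: A B => [a a1 a2] [b b1 b2] /= H.
have E : a = b.
  apply/funext => phi; have [/H //|Hn] := pselect (l2w 0 phi).
  by rewrite a2 ?b2.
by case: b / E b1 b2 {H} => b1 b2; congr BOp; exact: Prop_irrelevance.
Qed.

Definition restr (A : opZ R) : opZ R := fun phi => if pselect (l2w 0 phi) then A phi else 0.

Lemma restr_in A phi : l2w 0 phi -> restr A phi = A phi.
Proof. by rewrite /restr; case: pselect. Qed.

Lemma restr_out A phi : ~ l2w 0 phi -> restr A phi = 0.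
Proof. by rewrite /restr; case: pselect. Qed.

Lemma l2_0 : l2w 0 (0 : seqZ R).
Proof. exact: l2le_l2 l2le0. Qed.

Lemma l2_lin (z : R[i]) phi psi : l2w 0 phi -> l2w 0 psi -> l2w 0 (z *: phi + psi).
Proof.
by move=> /l2P[c Hc] /l2P[d Hd]; exact: l2le_l2 (l2leD (l2leZ z Hc) Hd).
Qed.

Lemma l2Z (z : R[i]) phi : l2w 0 phi -> l2w 0 (z *: phi).
Proof. by move=> H; rewrite -[z *: phi]addr0; apply: l2_lin => //; exact: l2_0. Qed.

Lemma l2D phi psi : l2w 0 phi -> l2w 0 psi -> l2w 0 (phi + psi).
Proof. by move=> *; rewrite -[phi]scale1r; exact: l2_lin. Qed.

Lemma l2B phi psi : l2w 0 phi -> l2w 0 psi -> l2w 0 (phi - psi).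
Proof. by move=> *; rewrite addrC -scaleN1r; exact: l2_lin. Qed.

Lemma restr_bounded A : bounded_op A -> bounded_op (restr A).
Proof.
move=> [Al [C C0 Ab]]; split.
  by move=> z phi psi h1 h2; rewrite !restr_in ?Al //; exact: l2_lin.
by exists C => // phi c H; rewrite restr_in //; exact: Ab.
Qed.

Lemma bounded0 : bounded_op (0 : opZ R).
Proof.
split=> [z phi psi _ _|]; first by rewrite /= [0 (_ : seqZ R)](_ : _ = 0) // scaler0 addr0.
by exists 0 => // phi c [c0 _]; rewrite mul0r; exact: l2le0.
Qed.

Definition bzero_op : bop := BOp bounded0 (fun phi _ => erefl).

Definition mkB (A : opZ R) : bop :=
  match pselect (bounded_op A) with
  | left H => BOp (restr_bounded H) (@restr_out A)
  | right _ => bzero_op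
  end.

Lemma mkBE A phi : bounded_op A -> l2w 0 phi -> mkB A phi = A phi.
Proof. by move=> HA Hp; rewrite /mkB; case: pselect => //= _; exact: restr_in. Qed.

Lemma bopl2 (A : bop) phi : l2w 0 phi -> l2w 0 (A phi).
Proof.
by move=> /l2P[c Hc]; case: (bop_bounded A) => _ [C _ /(_ _ _ Hc)]; exact: l2le_l2.
Qed.

Lemma bop_lin (A : bop) z phi psi : l2w 0 phi -> l2w 0 psi ->
  A (z *: phi + psi) = z *: A phi + A psi.
Proof. by case: (bop_bounded A) => + _; exact. Qed.

Lemma bopD (A : bop) phi psi : l2w 0 phi -> l2w 0 psi -> A (phi + psi) = A phi + A psi.
Proof. by move=> *; rewrite -[phi in LHS]scale1r bop_lin // scale1r. Qed.

Lemma bop0 (A : bop) : A 0 = 0.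
Proof.
have := bopD A l2_0 l2_0; rewrite addr0 => H.
by apply: (addrI (A 0)); rewrite addr0 -H.
Qed.

Lemma bopZ (A : bop) z phi : l2w 0 phi -> A (z *: phi) = z *: A phi.
Proof. by move=> H; rewrite -[z *: phi]addr0 bop_lin ?bop0 ?addr0 //; exact: l2_0. Qed.

Lemma bopB (A : bop) phi psi : l2w 0 phi -> l2w 0 psi -> A (phi - psi) = A phi - A psi.
Proof.
by move=> h1 h2; rewrite addrC -scaleN1r bop_lin // scaleN1r addrC.
Qed.

Lemma bounded_add (A B : bop) : bounded_op ((A : opZ R) + B).
Proof.
split=> [z phi psi h1 h2|].
  rewrite [LHS](_ : _ = A (z *: phi + psi) + B (z *: phi + psi)) // !bop_lin //.
  rewrite [((A : opZ R) + B) phi](_ : _ = A phi + B phi) // scalerDr.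
  by rewrite [((A : opZ R) + B) psi](_ : _ = A psi + B psi) // addrACA.
case: (bop_bounded A) (bop_bounded B) => _ [C C0 HC] [_ [D D0 HD]].
exists (C + D) => [|phi c H]; first exact: addr_ge0.
by rewrite mulrDl; exact: l2leD (HC _ _ H) (HD _ _ H).
Qed.

Lemma bounded_scale z (A : bop) : bounded_op (z *: (A : opZ R)).
Proof.
split=> [w phi psi h1 h2|].
  rewrite [LHS](_ : _ = z *: A (w *: phi + psi)) // bop_lin //.
  rewrite [RHS](_ : _ = w *: (z *: A phi) + z *: A psi) // scalerDr.
  by rewrite !scalerA mulrC.
case: (bop_bounded A) => _ [C C0 HC].
exists (nc z * C) => [|phi c H]; first by rewrite mulr_ge0 ?nc_ge0.
by rewrite -mulrA; exact: l2leZ (HC _ _ H).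
Qed.

Lemma bounded_comp (A B : bop) : bounded_op (A \o B).
Proof.
split=> [z phi psi h1 h2|].
  by rewrite /= !bop_lin //; exact: bopl2.
case: (bop_bounded A) (bop_bounded B) => _ [C C0 HC] [_ [D D0 HD]].
exists (C * D) => [|phi c H]; first exact: mulr_ge0.
by rewrite -mulrA; exact: HC _ _ (HD _ _ H).
Qed.

Lemma bounded_id : bounded_op id.
Proof. by split=> //; exists 1 => // phi c; rewrite mul1r. Qed.

End BoundedOperators.
Arguments bop R : clear implicits.

(* The operations are sealed: unification must not unfold them. *)
HB.lock Definition badd (R : realType) (A B : bop R) : bop R := mkB ((A : opZ R) + B).
HB.lock Definition bscale (R : realType) (z : R[i]) (A : bop R) : bop R :=
  mkB (z *: (A : opZ R)).
HB.lock Definition bmul (R : realType) (A B : bop R) : bop R := mkB (A \o B).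
HB.lock Definition bone (R : realType) : bop R := mkB id.
HB.lock Definition onrm (R : realType) (A : bop R) : R := fine (opnorm 0 0 A).

Section OperatorAlgebra.
Context {R : realType}.
Implicit Types (phi psi : seqZ R) (c d : R).
Local Notation bop := (bop R).
#[local] Hint Extern 0 (l2w 0 _) => (eapply l2le_l2; eassumption) : core.

Lemma baddE A B phi : l2w 0 phi -> badd A B phi = A phi + B phi.
Proof. by move=> H; rewrite badd.unlock mkBE //; exact: bounded_add. Qed.
Lemma bscaleE z A phi : l2w 0 phi -> bscale z A phi = z *: A phi.
Proof. by move=> H; rewrite bscale.unlock mkBE //; exact: bounded_scale. Qed.
Lemma bmulE A B phi : l2w 0 phi -> bmul A B phi = A (B phi).
Proof. by move=> H; rewrite bmul.unlock mkBE //; exact: bounded_comp. Qed.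
Lemma boneE phi : l2w 0 phi -> bone R phi = phi.
Proof. by move=> H; rewrite bone.unlock mkBE //; exact: bounded_id. Qed.

HB.instance Definition _ := gen_eqMixin bop.
HB.instance Definition _ := gen_choiceMixin bop.

Lemma baddA : associative (@badd R).
Proof. by move=> A B C; apply: bop_eq => phi H; rewrite !baddE // addrA. Qed.
Lemma baddC : commutative (@badd R).
Proof. by move=> A B; apply: bop_eq => phi H; rewrite !baddE // addrC. Qed.
Lemma badd0 : left_id bzero_op (@badd R).
Proof. by move=> A; apply: bop_eq => phi H; rewrite !baddE // add0r. Qed.
Lemma baddN : left_inverse bzero_op (bscale (-1)) (@badd R).
Proof. by move=> A; apply: bop_eq => phi H; rewrite baddE // bscaleE // scaleN1r addNr. Qed.

HB.instance Definition _ := GRing.isZmodule.Build bop baddA baddC badd0 baddN.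

Lemma bmulA : associative (@bmul R).
Proof.
by move=> A B C; apply: bop_eq => phi H; rewrite !bmulE //; exact: bopl2.
Qed.
Lemma bmul1l : left_id (bone R) (@bmul R).
Proof. by move=> A; apply: bop_eq => phi H; rewrite bmulE // boneE //; exact: bopl2. Qed.
Lemma bmul1r : right_id (bone R) (@bmul R).
Proof. by move=> A; apply: bop_eq => phi H; rewrite bmulE // boneE. Qed.
Lemma bmulDl : left_distributive (@bmul R) +%R.
Proof.
move=> A B C; apply: bop_eq => phi H.
by rewrite bmulE // [RHS]baddE // !bmulE // baddE //; exact: bopl2.
Qed.
Lemma bmulDr : right_distributive (@bmul R) +%R.
Proof.
move=> A B C; apply: bop_eq => phi H.
by rewrite bmulE // [RHS]baddE // !bmulE // baddE // bopD //; exact: bopl2.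
Qed.

HB.instance Definition _ := GRing.Zmodule_isPzRing.Build bop
  bmulA bmul1l bmul1r bmulDl bmulDr.

Definition delta (m : int) : seqZ R := fun n => if n == m then 1 else 0.

Lemma l2le_delta m : l2le (delta m) 1.
Proof.
split=> // s us; have E n : n != m -> nc (delta m n) ^+ 2 = 0.
  by rewrite /delta => /negbTE ->; rewrite nc0 expr0n.
case: (boolP (m \in s)) => ms.
  rewrite (bigD1_seq m) //= big1; last by move=> n /E.
  by rewrite addr0 /delta eqxx nc1.
rewrite big_seq big1 // => n ns; apply: E.
by apply: contraNneq ms => <-.
Qed.

Lemma bop_one_neq0 : (1 : bop) != 0.
Proof.
apply/eqP => /(congr1 (fun A : bop => A (delta 0) 0)).
rewrite [LHS](_ : _ = delta 0 0); last by rewrite [1]lock -lock boneE //; exact: l2le_l2 (l2le_delta 0).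
by rewrite /delta eqxx => /eqP; rewrite oner_eq0.
Qed.

HB.instance Definition _ := GRing.PzSemiRing_isNonZero.Build bop bop_one_neq0.

Lemma bscaleA a b (A : bop) : bscale a (bscale b A) = bscale (a * b) A.
Proof. by apply: bop_eq => phi H; rewrite !bscaleE // scalerA. Qed.
Lemma bscale1 : left_id 1 (@bscale R).
Proof. by move=> A; apply: bop_eq => phi H; rewrite bscaleE // scale1r. Qed.
Lemma bscaleDr : right_distributive (@bscale R) +%R.
Proof.
move=> z A B; apply: bop_eq => phi H.
by rewrite bscaleE // [RHS]baddE // !bscaleE // baddE // scalerDr.
Qed.
Lemma bscaleDl (A : bop) : {morph (@bscale R)^~ A : a b / a + b}.
Proof.
move=> a b; apply: bop_eq => phi H.
by rewrite bscaleE // [RHS]baddE // !bscaleE // scalerDl.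
Qed.

HB.instance Definition _ := GRing.Zmodule_isLmodule.Build R[i] bop
  bscaleA bscale1 bscaleDr bscaleDl.

Lemma bscaleAl a (A B : bop) : a *: (A * B) = (a *: A) * B.
Proof.
apply: bop_eq => phi H; rewrite bscaleE // [RHS]bmulE // bscaleE; last exact: bopl2.
by rewrite bmulE.
Qed.

HB.instance Definition _ := GRing.LSemiModule_isLSemiAlgebra.Build R[i] bop bscaleAl.

Lemma bscaleAr a (A B : bop) : a *: (A * B) = A * (a *: B).
Proof.
apply: bop_eq => phi H; rewrite bscaleE // [RHS]bmulE // bscaleE // bmulE //.
by rewrite bopZ //; exact: bopl2.
Qed.

HB.instance Definition _ := GRing.LSemiAlgebra_isSemiAlgebra.Build R[i] bop bscaleAr.

Lemma boD (A B : bop) phi : l2w 0 phi -> (A + B) phi = A phi + B phi.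
Proof. exact: baddE. Qed.
Lemma boZ z (A : bop) phi : l2w 0 phi -> (z *: A) phi = z *: A phi.
Proof. exact: bscaleE. Qed.
Lemma boM (A B : bop) phi : l2w 0 phi -> (A * B) phi = A (B phi).
Proof. exact: bmulE. Qed.
Lemma bo1 phi : l2w 0 phi -> (1 : bop) phi = phi.
Proof. exact: boneE. Qed.
Lemma boN (A : bop) phi : l2w 0 phi -> (- A) phi = - A phi.
Proof. by move=> H; rewrite [LHS]bscaleE // scaleN1r. Qed.
Lemma boB (A B : bop) phi : l2w 0 phi -> (A - B) phi = A phi - B phi.
Proof. by move=> H; rewrite boD // boN. Qed.
Lemma bo0 phi : (0 : bop) phi = 0.
Proof. by []. Qed.


Lemma opnorm_bop_le (A : bop) C : 0 <= C ->
  (forall phi c, l2le phi c -> l2le (A phi) (C * c)) -> (opnorm 0 0 A <= C%:E)%E.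
Proof.
move=> C0 H; apply: ge_ereal_sup => _ [phi /= p1 <-].
by apply/wnormP => //; rewrite -[C]mulr1; apply: H; apply/wnormP.
Qed.

Lemma opnorm_bop_fin (A : bop) : opnorm 0 0 A \is a fin_num.
Proof.
have [_ [C C0 H]] := bop_bounded A.
rewrite ge0_fin_numE; first by apply: le_lt_trans (opnorm_bop_le C0 H) _; rewrite ltry.
apply: le_ereal_sup_tmp; exists (wnorm 0 (A 0)); last exact: wnorm_ge0.
by exists 0 => //=; apply/wnormP => //; apply: l2le_le l2le0.
Qed.

Lemma onrmE (A : bop) : (onrm A)%:E = opnorm 0 0 A.
Proof. by rewrite onrm.unlock fineK ?opnorm_bop_fin. Qed.

Lemma onrm_le (A : bop) C : 0 <= C ->
  (forall phi c, l2le phi c -> l2le (A phi) (C * c)) -> onrm A <= C.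
Proof.
by move=> C0 H; rewrite -lee_fin onrmE; exact: opnorm_bop_le.
Qed.

Lemma onrm_ge0 (A : bop) : 0 <= onrm A.
Proof.
rewrite -lee_fin onrmE; apply: le_ereal_sup_tmp; exists (wnorm 0 (A 0)); last exact: wnorm_ge0.
by exists 0 => //=; apply/wnormP => //; apply: l2le_le l2le0.
Qed.

Lemma onrm_app (A : bop) phi c : l2le phi c -> l2le (A phi) (onrm A * c).
Proof.
move=> H; have c0 := H.1; have N0 := onrm_ge0 A.
have main d : 0 < d -> l2le phi d -> l2le (A phi) (onrm A * d).
  move=> d0 Hd.
  have -> : phi = d%:C *: (d^-1%:C *: phi).
    by rewrite scalerA -rmorphM /= divff ?gt_eqF // scale1r.
  have L2 : l2le (d^-1%:C *: phi) 1.
    have := l2leZ d^-1%:C Hd; rewrite ncC ger0_norm ?invr_ge0 ?(ltW d0) //.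
    by rewrite mulVf ?gt_eqF.
  rewrite bopZ; last exact: l2le_l2 L2.
  have : l2le (A (d^-1%:C *: phi)) (onrm A).
    apply/wnormP => //; rewrite onrmE; apply: ereal_sup_ubound.
    by exists (d^-1%:C *: phi) => //=; apply/wnormP.
  by move/(l2leZ d%:C); rewrite ncC ger0_norm ?(ltW d0) // mulrC.
apply: l2le_eps; first by rewrite mulr_ge0.
move=> e e0; have N1 : 0 < onrm A + 1 by rewrite ltr_wpDl.
apply: l2le_le (main (c + e / (onrm A + 1)) _ _).
- rewrite mulrDr lerD2l mulrCA ger_pMr // ler_pdivrMr // mul1r lerDl //.
- by rewrite ltr_wpDl // divr_gt0.
- by apply: l2le_le H; rewrite lerDl divr_ge0 ?ltW.
Qed.

Lemma onrmD (A B : bop) : onrm (A + B) <= onrm A + onrm B.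
Proof.
apply: onrm_le => [|phi c H]; first by rewrite addr_ge0 ?onrm_ge0.
by rewrite boD // mulrDl; apply: l2leD; exact: onrm_app.
Qed.

Lemma onrmM (A B : bop) : onrm (A * B) <= onrm A * onrm B.
Proof.
apply: onrm_le => [|phi c H]; first by rewrite mulr_ge0 ?onrm_ge0.
by rewrite boM // -mulrA; do 2 apply: onrm_app.
Qed.

Lemma onrmZ z (A : bop) : onrm (z *: A) <= nc z * onrm A.
Proof.
apply: onrm_le => [|phi c H]; first by rewrite mulr_ge0 ?nc_ge0 ?onrm_ge0.
by rewrite boZ // -mulrA; apply: l2leZ; exact: onrm_app.
Qed.

Lemma onrm1 : onrm 1 <= 1.
Proof.
by apply: onrm_le => // phi c H; rewrite bo1 // mul1r.
Qed.

Lemma bop_Bop (A : bop) : Bop 0 0 A.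
Proof.
split; first by case: (bop_bounded A).
by rewrite -onrmE ltry.
Qed.

Lemma mkB_onrm A C : 0 <= C -> linear_on (l2w 0) A ->
  (forall phi c, l2le phi c -> l2le (A phi) (C * c)) ->
  bounded_op A /\ onrm (mkB A) <= C.
Proof.
move=> C0 Al HC; have HA : bounded_op A by split=> //; exists C.
split=> //; apply: onrm_le => // phi c H; rewrite mkBE //.
exact: HC.
Qed.

End OperatorAlgebra.

Section Neumann.
Context {R : realType}.
Implicit Types (phi psi : seqZ R) (c d : R) (X Y : bop R).

#[local] Hint Extern 0 (l2w 0 _) => (eapply l2le_l2; eassumption) : core.

Lemma geom_cvg_real (u : nat -> R) (c r : R) : 0 <= r < 1 ->
  (forall j, `|u j| <= c * r ^+ j) ->
  exists l, forall e, 0 < e -> exists j0, forall j, (j0 <= j)%N ->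
    `|\sum_(i < j) u i - l| <= e.
Proof.
move=> /andP[r0 r1] H.
have cv : cvgn (series u).
  apply: normed_cvg; apply: (@series_le_cvg _ _ (geometric c r)) => //.
  - by move=> j; exact: normr_ge0.
  - by move=> j /=; apply: le_trans (normr_ge0 _) (H j).
  - by apply: is_cvg_geometric_series; rewrite ger0_norm.
exists (limn (series u)) => e e0.
move/cvgrPdist_le : cv => /(_ _ e0) [j0 _ Hj].
by exists j0 => j jj; have := Hj j jj; rewrite distrC /series /= big_mkord.
Qed.

Lemma geom_cvg (u : nat -> R[i]) (c r : R) : 0 <= r < 1 ->
  (forall j, nc (u j) <= c * r ^+ j) ->
  exists l, forall e, 0 < e -> exists j0, forall j, (j0 <= j)%N ->
    nc (\sum_(i < j) u i - l) <= e.
Proof.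
move=> r01 H.
have [l1 H1] := geom_cvg_real r01 (fun j => le_trans (nc_Re _) (H j)).
have [l2 H2] := geom_cvg_real r01 (fun j => le_trans (nc_Im _) (H j)).
exists (Complex l1 l2) => e e0; have e2 : 0 < e / 2 by rewrite divr_gt0.
have [j1 {}H1] := H1 _ e2; have [j2 {}H2] := H2 _ e2.
exists (maxn j1 j2) => j; rewrite geq_max => /andP[/H1 {}H1 /H2 {}H2].
have ReS : complex.Re (\sum_(i < j) u i) = \sum_(i < j) complex.Re (u i).
  exact: (raddf_sum (@complex.Re R : Rcomplex R -> R)).
have ImS : complex.Im (\sum_(i < j) u i) = \sum_(i < j) complex.Im (u i).
  exact: (raddf_sum (@complex.Im R : Rcomplex R -> R)).
apply: le_trans (nc_le_ReIm _) _; rewrite [e]splitr lerD //.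
- by move: H1; rewrite -ReS; case: (\sum_(i < j) u i).
- by move: H2; rewrite -ImS; case: (\sum_(i < j) u i).
Qed.

Lemma onrmX X k : onrm (X ^+ k) <= onrm X ^+ k.
Proof.
elim: k => [|k IH]; first by rewrite !expr0 onrm1.
by rewrite !exprS; apply: le_trans (onrmM _ _) (ler_wpM2l (onrm_ge0 _) IH).
Qed.

Lemma bo_sum I (s : seq I) (F : I -> bop R) phi : l2w 0 phi ->
  (\sum_(i <- s) F i) phi = \sum_(i <- s) F i phi.
Proof.
move=> H; elim: s => [|i s IH]; first by rewrite !big_nil bo0.
by rewrite !big_cons boD // IH.
Qed.

Lemma seqZ_sum I (s : seq I) (F : I -> seqZ R) n :
  (\sum_(i <- s) F i) n = \sum_(i <- s) F i n.
Proof.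
elim: s => [|i s IH]; first by rewrite !big_nil.
by rewrite !big_cons -IH.
Qed.

Lemma geom_sum_le (r : R) j : 0 <= r < 1 -> \sum_(i < j) r ^+ i <= (1 - r)^-1.
Proof.
move=> /andP[r0 r1]; have r1' : 0 < 1 - r by rewrite subr_gt0.
rewrite -[leRHS]mul1r ler_pdivlMr //.
have -> : (\sum_(i < j) r ^+ i) * (1 - r) = 1 - r ^+ j.
  by apply: oppr_inj; rewrite opprB subrX1 -mulrN opprB mulrC.
by rewrite lerBlDr lerDl exprn_ge0.
Qed.

Lemma expr_small (r K e : R) : 0 <= r < 1 -> 0 < e -> exists j, r ^+ j * K <= e.
Proof.
move=> /andP[r0 r1] e0.
have K1 : 0 < `|K| + 1 by rewrite ltr_wpDl.
have nr : `|r| < 1 by rewrite ger0_norm.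
have /cvgrPdist_le /(_ _ (divr_gt0 e0 K1)) [j _ Hj] := cvg_expr nr.
exists j; have := Hj j (leqnn j); rewrite sub0r normrN => H.
apply: le_trans (ler_norm _) _; rewrite normrM.
apply: le_trans (ler_wpM2r (normr_ge0 _) H) _.
rewrite -mulrA ger_pMr // mulrC ler_pdivrMr // mul1r lerDl //.
Qed.

Lemma l2le_small0 phi (r K : R) : 0 <= r < 1 -> (forall j, l2le phi (r ^+ j * K)) -> phi = 0.
Proof.
move=> r01 H; apply/funext => n; apply/eqP; rewrite -nc_eq0 eq_le nc_ge0 andbT.
apply/ler_addgt0Pr => e e0; rewrite add0r.
have [j Hj] := expr_small K r01 e0.
exact: le_trans (l2le_coord n (H j)) Hj.
Qed.

Section NeumannSeries.
Variable X : bop R.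
Hypothesis X1 : onrm X < 1.
Let r := onrm X.
Let r01 : 0 <= r < 1. Proof. by rewrite onrm_ge0. Qed.
Let r1 : 0 < 1 - r. Proof. by rewrite subr_gt0. Qed.
Let rV : 0 <= (1 - r)^-1. Proof. by rewrite invr_ge0 ltW. Qed.
Let P j : bop R := \sum_(i < j) X ^+ i.

Let Plim phi n (l : R[i]) := forall e, 0 < e -> exists j0, forall j, (j0 <= j)%N ->
    nc (P j phi n - l) <= e.
Let Y : opZ R := fun phi n => xget 0 [set l | Plim phi n l].

Let onP j : onrm (P j) <= (1 - r)^-1.
Proof.
apply: le_trans (geom_sum_le j r01); rewrite /P.
elim: j => [|j IH]; first by rewrite !big_ord0; apply: onrm_le => // phi c _; rewrite bo0 mul0r; exact: l2le0.
by rewrite !big_ord_recr /=; apply: le_trans (onrmD _ _) (lerD IH (onrmX _ _)).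
Qed.

Let YP phi n : l2w 0 phi -> Plim phi n (Y phi n).
Proof.
move=> H; rewrite /Y; have [c Hc] := (l2P phi).1 H; have c0 := Hc.1.
have [|l Hl] := @geom_cvg (fun j => (X ^+ j) phi n) c r r01 _.
  move=> j; apply: le_trans (l2le_coord n (onrm_app (X ^+ j) Hc)) _.
  by rewrite mulrC ler_wpM2l // onrmX.
have Hl' : Plim phi n l.
  move=> e /Hl [j0 Hj]; exists j0 => j /Hj.
  by rewrite /P bo_sum // seqZ_sum.
exact: xgetPex (ex_intro _ l Hl').
Qed.

Let Ytail phi c j : l2le phi c -> l2le (Y phi - P j phi) (r ^+ j * (1 - r)^-1 * c).
Proof.
move=> Hc; have c0 := Hc.1; have H : l2w 0 phi by [].
apply: (@l2le_fatou _ (fun k => P (j + k) phi - P j phi)).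
  move=> k; rewrite -boB //.
  have -> : P (j + k) - P j = X ^+ j * P k.
    rewrite /P big_split_ord /= [LHS]addrC addKr mulr_sumr.
    by apply: eq_bigr => i _; rewrite exprD.
  apply: l2le_le (onrm_app _ Hc); rewrite ler_wpM2r //.
  apply: le_trans (onrmM _ _) _.
  apply: le_trans (ler_wpM2r (onrm_ge0 _) (onrmX _ _)) _.
  apply: ler_wpM2l; [exact: exprn_ge0 _ (onrm_ge0 _)|exact: onP].
move=> n e e0; have [j0 Hj] := YP n H e0.
exists j0 => k kj; have := Hj (j + k)%N (leq_trans kj (leq_addl _ _)).
rewrite [X in nc X <= _ -> _](_ : _ = (P (j + k) phi - P j phi) n - (Y phi - P j phi) n) //.
rewrite [(P (j + k) phi - P j phi) n](_ : _ = P (j + k) phi n - P j phi n) //.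
rewrite [(Y phi - P j phi) n](_ : _ = Y phi n - P j phi n) //; ring.
Qed.

Let Yl2 phi c : l2le phi c -> l2le (Y phi) ((1 - r)^-1 * c).
Proof.
move=> Hc; have := Ytail 0 Hc; rewrite /P big_ord0 bo0 expr0 mul1r.
by rewrite subr0.
Qed.

Let inj phi : l2w 0 phi -> (1 - X) phi = 0 -> phi = 0.
Proof.
move=> H; rewrite boB // bo1 // => /eqP; rewrite subr_eq0 => /eqP E.
have [c Hc] := (l2P phi).1 H.
apply: (@l2le_small0 phi r c r01).
elim=> [|j IH]; first by rewrite mul1r.
by rewrite E exprS -mulrA; exact: onrm_app.
Qed.

Let YX phi : l2w 0 phi -> (1 - X) (Y phi) = phi.
Proof.
move=> H; have [c Hc] := (l2P phi).1 H; have YH := Yl2 Hc.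
apply/eqP; rewrite -subr_eq0; apply/eqP.
apply: (@l2le_small0 _ r (onrm (1 - X) * ((1 - r)^-1 * c) + c) r01) => j.
have -> : (1 - X) (Y phi) - phi = (1 - X) (Y phi - P j phi) - (X ^+ j) phi.
  rewrite bopB //; last exact: bopl2.
  rewrite -[(1 - X) (P j phi)]boM // -addrA -opprD -boD //; congr (_ - _).
  rewrite [_ * P j + _](_ : _ = 1) ?bo1 //.
  by rewrite /P -opprB mulNr -subrX1 opprB subrK.
rewrite mulrDr; apply: l2leD.
  apply: l2le_le (onrm_app _ (Ytail j Hc)).
  by rewrite le_eqVlt; apply/orP; left; apply/eqP; ring.
apply: l2leN; apply: l2le_le (onrm_app _ Hc).
by rewrite ler_wpM2r ?onrmX //; case: Hc.
Qed.

Lemma neumann : exists Z : bop R,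
  [/\ (1 - X) * Z = 1, Z * (1 - X) = 1 & onrm Z <= (1 - onrm X)^-1].
Proof.
have Ylin : linear_on (l2w 0) Y.
  move=> z phi psi h1 h2; have h3 := l2_lin z h1 h2.
  have L chi : l2w 0 chi -> l2w 0 (Y chi) by move=> /l2P[c /Yl2]; exact: l2le_l2.
  apply/eqP; rewrite -subr_eq0; apply/eqP; apply: inj.
    by apply: l2B; [exact: L|apply: l2_lin; exact: L].
  rewrite bopB; [|exact: L|by apply: l2_lin; exact: L].
  by rewrite bop_lin ?YX ?subrr //; exact: L.
have [HY nY] := mkB_onrm rV Ylin Yl2.
exists (mkB Y); split=> //.
  by apply: bop_eq => phi H; rewrite boM // mkBE // YX // bo1.
apply: bop_eq => phi H; rewrite boM // bo1 //.
have H' : l2w 0 ((1 - X) phi) by exact: bopl2.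
rewrite mkBE //; apply/eqP; rewrite -subr_eq0; apply/eqP.
have [c /Yl2 Hc] := (l2P _).1 H'.
by apply: inj; [exact: l2B|rewrite bopB // YX // subrr].
Qed.

End NeumannSeries.

End Neumann.

Section Fredholm.
Context {R : realType}.
Implicit Types (phi psi : seqZ R) (c d : R) (X Y k A : bop R) (s : seq int).

#[local] Hint Extern 0 (l2w 0 _) => (eapply l2le_l2; eassumption) : core.

Lemma offseq_dom s phi n : nc (offseq s phi n) <= nc (phi n).
Proof. by rewrite /offseq; case: ifP => _; rewrite ?nc0 ?nc_ge0. Qed.

Lemma offseq_lin s : linear_on (l2w 0) (@offseq R s).
Proof.
move=> z phi psi _ _; apply/funext => n; rewrite /offseq.
rewrite [RHS](_ : _ = z * (if n \in s then 0 else phi n) + (if n \in s then 0 else psi n)) //.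
by case: ifP => // _; rewrite mulr0 addr0.
Qed.

Lemma offseq_bound s phi c : l2le phi c -> l2le (offseq s phi) (1 * c).
Proof. by rewrite mul1r; apply: l2le_dom => n; exact: offseq_dom. Qed.

Definition offop s : bop R := mkB (@offseq R s).

Lemma offopE s phi : l2w 0 phi -> offop s phi = offseq s phi.
Proof.
by move=> H; rewrite mkBE //; exact: (mkB_onrm ler01 (@offseq_lin s) (@offseq_bound s)).1.
Qed.

Lemma offop1 s : onrm (offop s) <= 1.
Proof. exact: (mkB_onrm ler01 (@offseq_lin s) (@offseq_bound s)).2. Qed.

Lemma offop_sub s1 s2 : {subset s1 <= s2} -> offop s2 = offop s2 * offop s1.
Proof.
move=> sub; apply: bop_eq => phi H; rewrite boM // !offopE //; last first.
  by rewrite -offopE //; exact: bopl2.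
apply/funext => n; rewrite /offseq; case: ifP => // /negP n2.
by case: ifP => // /sub.
Qed.

(* Every compact operator has this property; the converse is not needed. *)
Definition small_tails k := forall e, 0 < e -> exists2 s, uniq s & onrm (offop s * k) <= e.

Lemma small_tailsD k1 k2 : small_tails k1 -> small_tails k2 -> small_tails (k1 + k2).
Proof.
move=> h1 h2 e e0; have e2 : 0 < e / 2 by rewrite divr_gt0.
have [s1 u1 H1] := h1 _ e2; have [s2 u2 H2] := h2 _ e2.
exists (undup (s1 ++ s2)); first exact: undup_uniq.
rewrite mulrDr [e]splitr; apply: le_trans (onrmD _ _) _; apply: lerD.
  rewrite (@offop_sub s1); last by move=> n Hn; rewrite mem_undup mem_cat Hn.
  rewrite -mulrA; apply: le_trans (onrmM _ _) _; apply: le_trans H1.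
  by rewrite -[leRHS]mul1r ler_wpM2r ?onrm_ge0 ?offop1.
rewrite (@offop_sub s2); last by move=> n Hn; rewrite mem_undup mem_cat Hn orbT.
rewrite -mulrA; apply: le_trans (onrmM _ _) _; apply: le_trans H2.
by rewrite -[leRHS]mul1r ler_wpM2r ?onrm_ge0 ?offop1.
Qed.

Lemma small_tailsMr k X : small_tails k -> small_tails (k * X).
Proof.
move=> h e e0; have n1 : 0 < onrm X + 1 by rewrite ltr_wpDl ?onrm_ge0.
have [s us H] := h _ (divr_gt0 e0 n1); exists s => //.
rewrite mulrA; apply: le_trans (onrmM _ _) _.
apply: le_trans (ler_wpM2r (onrm_ge0 _) H) _.
by rewrite -mulrA ger_pMr // mulrC ler_pdivrMr // mul1r lerDl.
Qed.

Lemma small_tailsZ z k : small_tails k -> small_tails (z *: k).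
Proof. by move=> h; rewrite -[k]mulr1 scalerAr; exact: small_tailsMr. Qed.

Lemma small_tailsN k : small_tails k -> small_tails (- k).
Proof. by move=> h; rewrite -scaleN1r; exact: small_tailsZ. Qed.

Lemma small_tailsB k1 k2 : small_tails k1 -> small_tails k2 -> small_tails (k1 - k2).
Proof. by move=> h1 h2; apply: small_tailsD => //; exact: small_tailsN. Qed.

Lemma small_tailsMl k X : (forall s, offop s * X = X * offop s) -> small_tails k ->
  small_tails (X * k).
Proof.
move=> C h e e0; have n1 : 0 < onrm X + 1 by rewrite ltr_wpDl ?onrm_ge0.
have [s us H] := h _ (divr_gt0 e0 n1); exists s => //.
rewrite mulrA C -mulrA; apply: le_trans (onrmM _ _) _.
apply: le_trans (ler_wpM2l (onrm_ge0 _) H) _.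
by rewrite mulrCA ger_pMr // ler_pdivrMr // mul1r lerDl.
Qed.

Lemma small_tails_kop (K : int -> int -> R[i]) (a : seqZ R) (C S : R) :
  0 <= C -> l2le a S ->
  (forall n m, nc (K n m) <= C * (nc (a n) * nc (a m))) -> small_tails (mkB (kop K)).
Proof.
move=> C0 aS Ka e e0; have S0 := aS.1.
have [HK _] := mkB_onrm (mulr_ge0 (mulr_ge0 C0 S0) S0) (kop_linear C0 aS Ka) (kop_bound C0 aS Ka).
have CS1 : 0 < C * S + 1 by rewrite ltr_wpDl ?mulr_ge0.
have [s us Hs] := l2_tail aS (divr_gt0 e0 CS1).
exists s => //; apply: onrm_le => [|phi c H]; first exact: ltW.
have c0 := H.1.
rewrite boM // mkBE // offopE; last exact: l2le_l2 (kop_bound C0 aS Ka H).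
have d0 : 0 <= C * S * c by rewrite !mulr_ge0.
apply: (@l2le_le _ _ (C * S * c * (e / (C * S + 1)))).
  have -> : C * S * c * (e / (C * S + 1)) = e * c * (C * S / (C * S + 1)).
    by field; rewrite gt_eqF.
  by rewrite ler_piMr ?mulr_ge0 ?(ltW e0) // ler_pdivrMr // mul1r lerDl.
have := l2leZ (C * S * c)%:C Hs; rewrite ncC ger0_norm //; apply: l2le_dom => n.
rewrite [(_ *: offseq s a) n](_ : _ = (C * S * c)%:C * offseq s a n) // /offseq.
case: ifP => _; first by rewrite nc0 nc_ge0.
by rewrite ncM ncC ger0_norm // mulrC; exact: (kop_coord C0 aS Ka).
Qed.

Definition unit_op (p q : int) : bop R := mkB (fun phi => phi q *: delta p).

Lemma unit_op_bounded p q : bounded_op (fun phi : seqZ R => phi q *: delta p).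
Proof.
apply: (mkB_onrm ler01 _ _).1.
  move=> z phi psi _ _; rewrite [(z *: phi + psi) q](_ : _ = z * phi q + psi q) //.
  by rewrite scalerDl scalerA.
move=> phi c H; have := l2leZ (phi q) (@l2le_delta R p).
by apply: l2le_le; rewrite mulr1 mul1r (l2le_coord _ H).
Qed.

Lemma unit_opE p q phi : l2w 0 phi -> unit_op p q phi = phi q *: delta p.
Proof. by move=> H; rewrite mkBE //; exact: unit_op_bounded. Qed.

Lemma l2_delta p : l2w 0 (delta p : seqZ R).
Proof. exact: l2le_l2 (l2le_delta p). Qed.

Lemma onop_sum s phi : uniq s -> l2w 0 phi ->
  (1 - offop s) phi = \sum_(p <- s) phi p *: delta p.
Proof.
move=> us H; rewrite boB // bo1 // offopE //; apply/funext => n.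
rewrite seqZ_sum [LHS](_ : _ = phi n - offseq s phi n) // /offseq.
case: (boolP (n \in s)) => ns.
  rewrite (bigD1_seq n) //= big1 ?addr0 ?subr0.
    by rewrite [RHS](_ : _ = phi n * delta n n) // /delta eqxx mulr1.
  move=> m mn; rewrite [LHS](_ : _ = phi m * delta m n) // /delta.
  by rewrite eq_sym (negbTE mn) mulr0.
rewrite subrr big_seq big1 // => m ms.
rewrite [LHS](_ : _ = phi m * delta m n) // /delta ifF ?mulr0 //.
by apply/eqP => E; move: ns; rewrite E ms.
Qed.

Lemma finite_rank_inverse s A : uniq s ->
  (forall phi, l2w 0 phi -> (1 + (1 - offop s) * A) phi = 0 -> phi = 0) ->
  exists W, (1 + (1 - offop s) * A) * W = 1.
Proof.
move=> us inj; pose N := size s; pose p (i : 'I_N) := nth 0 s i.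
pose B : 'M[R[i]]_N := \matrix_(j, i) ((j == i)%:R + A (delta (p j)) (p i)).
pose comb (u : 'rV[R[i]]_N) : seqZ R := \sum_j u 0 j *: delta (p j).
have sumE (F : int -> seqZ R) : \sum_(q <- s) F q = \sum_(i < N) F (p i).
  by rewrite (big_nth 0) big_mkord.
have comb2 u : l2w 0 (comb u).
  rewrite /comb; elim: (index_enum _) => [|i r IH]; first by rewrite big_nil; exact: l2_0.
  by rewrite big_cons; apply: l2_lin => //; exact: l2_delta.
have A_comb u : A (comb u) = \sum_j u 0 j *: A (delta (p j)).
  rewrite /comb; elim: (index_enum _) => [|i r IH]; first by rewrite !big_nil bop0.
  rewrite !big_cons bop_lin ?IH //; first exact: l2_delta.
  elim: r {IH} => [|k r IH]; first by rewrite big_nil; exact: l2_0.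
  by rewrite big_cons; apply: l2_lin => //; exact: l2_delta.
have GB u : (1 + (1 - offop s) * A) (comb u) = comb (u *m B).
  rewrite boD // bo1 // boM // onop_sum //; last exact: bopl2.
  rewrite sumE /comb -big_split; apply: eq_bigr => i _ /=.
  rewrite -scalerDl; congr (_ *: _).
  rewrite mxE; under [RHS]eq_bigr do rewrite [B _ _]mxE mulrDr.
  rewrite big_split /=; congr (_ + _).
    rewrite (bigD1 i) //= eqxx mulr1 big1 ?addr0 // => j /negbTE ->.
    by rewrite mulr0.
  by rewrite -/(comb u) A_comb seqZ_sum.
have comb0 u : comb u = 0 -> u = 0.
  move=> H; apply/rowP => i; rewrite mxE.
  have := congr1 (fun f : seqZ R => f (p i)) H.
  rewrite /comb seqZ_sum (bigD1 i) //= big1 ?addr0.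
    by rewrite [LHS](_ : _ = u 0 i * delta (p i) (p i)) // /delta eqxx mulr1.
  move=> j ji; rewrite [LHS](_ : _ = u 0 j * delta (p j) (p i)) // /delta.
  by rewrite nth_uniq // eq_sym -val_eqE in ji *; rewrite (negbTE ji) mulr0.
have Bu : B \in unitmx.
  rewrite -row_free_unit; apply: inj_row_free => u uB.
  apply: comb0; apply: inj => //; rewrite GB uB.
  by rewrite /comb big1 // => j _; rewrite mxE scale0r.
pose b phi : 'rV[R[i]]_N := \row_i A phi (p i).
pose W : bop R := 1 - \sum_j \sum_i (invmx B i j) *: (unit_op (p j) (p i) * A).
exists W; apply: bop_eq => phi H; rewrite boM // bo1 //.
have -> : W phi = phi - comb (b phi *m invmx B).
  rewrite boB // bo1 //; congr (_ - _); rewrite bo_sum // /comb; apply: eq_bigr => j _.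
  rewrite bo_sum // mxE scaler_suml; apply: eq_bigr => i _.
  rewrite boZ // boM // unit_opE ?scalerA; last exact: bopl2.
  by rewrite mxE mulrC.
rewrite bopB // GB -mulmxA mulVmx // mulmx1.
rewrite boD // bo1 // boM // onop_sum //; last exact: bopl2.
rewrite sumE /comb; under [X in _ - X]eq_bigr do rewrite mxE.
by rewrite addrK.
Qed.

Lemma inv_of_right_inv X Z : (forall phi, l2w 0 phi -> X phi = 0 -> phi = 0) ->
  X * Z = 1 -> Z * X = 1.
Proof.
move=> inj XZ; apply: bop_eq => phi H; apply/eqP; rewrite -subr_eq0; apply/eqP.
have h1 : l2w 0 ((Z * X) phi) by exact: bopl2.
rewrite bo1 //; apply: inj; first exact: l2B.
by rewrite bopB // -boM // mulrA XZ mul1r subrr.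
Qed.

Lemma fredholm k : small_tails k ->
  (forall phi, l2w 0 phi -> (1 + k) phi = 0 -> phi = 0) ->
  exists Z, (1 + k) * Z = 1 /\ Z * (1 + k) = 1.
Proof.
move=> hk inj; have [s us Hs] := hk (1 / 2) (divr_gt0 ltr01 (ltr0n _ 2)).
have [F [EF FE _]] : exists Z : bop R,
  [/\ (1 - - (offop s * k)) * Z = 1, Z * (1 - - (offop s * k)) = 1 &
     onrm Z <= (1 - onrm (- (offop s * k)))^-1].
  apply: neumann; rewrite -scaleN1r; apply: le_lt_trans (onrmZ _ _) _.
  by rewrite ncN nc1 mul1r; apply: le_lt_trans Hs _; rewrite ltr_pdivrMr // mul1r ltr1n.
rewrite opprK in EF FE.
have E : (1 + k) * F = 1 + (1 - offop s) * (k * F).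
  transitivity ((1 + offop s * k) * F + (1 - offop s) * k * F); last by rewrite EF mulrA.
  by rewrite -mulrDl; congr (_ * F); rewrite mulrBl mul1r addrACA subrr addr0.
have [W HW] : exists W, (1 + (1 - offop s) * (k * F)) * W = 1.
  apply: finite_rank_inverse => // phi H; rewrite -E boM // => H0.
  have F0 : F phi = 0 by apply: inj => //; exact: bopl2.
  rewrite -[phi]bo1 // -EF boM // F0 bop0 //.
have ZZ : (1 + k) * (F * W) = 1 by rewrite mulrA E.
by exists (F * W); split=> //; exact: inv_of_right_inv.
Qed.

End Fredholm.

Section AbelianGroup.
Variable V : zmodType.
Implicit Types x y z : V.

Lemma pull_summand x y s s' : s = y + s' -> x + s = y + (x + s').
Proof. by move=> ->; rewrite addrCA. Qed.

Lemma cancel_summand x s s' : s = - x + s' -> s' = 0 -> x + s = 0.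
Proof. by move=> -> ->; rewrite addr0 subrr. Qed.

Lemma cancel_opp_summand x s s' : s = x + s' -> s' = 0 -> - x + s = 0.
Proof. by move=> -> ->; rewrite addr0 addNr. Qed.

End AbelianGroup.

(* Equality of terms up to the choice of canonical instances. *)
Ltac same x y :=
  first [ constr_eq x y
        | lazymatch x with
          | - ?x1 => lazymatch y with - ?y1 => same x1 y1 end
          | ?x1 * ?x2 => lazymatch y with ?y1 * ?y2 => same x1 y1; same x2 y2 end
          | ?x1 *: ?x2 => lazymatch y with ?y1 *: ?y2 => same x1 y1; same x2 y2 end
          | _ => fail
          end ].

Ltac find_summand y s k :=
  lazymatch s with
  | ?x + ?t =>
    first [ same x y; k constr:(erefl s)
          | find_summand y t ltac:(fun pf => k constr:(pull_summand x pf)) ]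
  end.

(* Large atoms make rewriting by ring laws very slow, so they are generalized. *)
Ltac generalize_atom t :=
  tryif is_var t then idtac else (let a := fresh "a" in move: (t) => a).

Ltac generalize_products t :=
  lazymatch t with
  | ?x + ?y => generalize_products x; generalize_products y
  | - ?x => generalize_products x
  | _ * _ => generalize_atom t
  | _ *: _ => generalize_atom t
  | _ => idtac
  end.

Ltac generalize_atoms t :=
  lazymatch t with
  | ?x + ?y => generalize_atoms x; generalize_atoms y
  | - ?x => generalize_atoms x
  | 0 => idtac
  | _ => generalize_atom t
  end.

Ltac generalize_ring_atoms t :=
  lazymatch t with
  | ?x + ?y => generalize_ring_atoms x; generalize_ring_atoms y
  | - ?x => generalize_ring_atoms x
  | ?x * ?y => generalize_ring_atoms x; generalize_ring_atoms y
  | ?x *: ?y => generalize_ring_atoms y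
  | 0 => idtac
  | 1 => idtac
  | _ => generalize_atom t
  end.

(* Proves identities of abelian groups by cancelling opposite summands. *)
Ltac abel :=
  lazymatch goal with |- ?x = ?y => generalize_products x; generalize_products y end;
  lazymatch goal with |- ?x = ?y => generalize_atoms x; generalize_atoms y end;
  apply/eqP; rewrite -subr_eq0; apply/eqP;
  rewrite ?(opprD, opprK, addr0, add0r, oppr0);
  rewrite -[LHS]addr0 -?addrA;
  repeat first
    [ lazymatch goal with
      | |- 0 = 0 => reflexivity
      | |- - ?x + ?s = 0 => find_summand x s ltac:(fun pf => refine (cancel_opp_summand pf _))
      | |- ?x + ?s = 0 => find_summand constr:(- x) s ltac:(fun pf => refine (cancel_summand pf _))
      end ].

Ltac nring :=
  lazymatch goal with |- ?x = ?y => generalize_ring_atoms x; generalize_ring_atoms y end;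
  rewrite ?(mulrDl, mulrDr, mulNr, mulrN, mulr1, mul1r, mulr0, mul0r, mulrA,
  scalerDr, scalerN, scaler0, =^~ scalerAl, =^~ scalerAr); abel.

Section Calculus.
Context {R : realType}.
Implicit Types (F G Y : R -> bop R) (t h d : R) (k : nat).

Definition small k F := exists C d, [/\ 0 <= C, 0 < d &
  forall h, `|h| < d -> onrm (F h) <= C * `|h| ^+ k].

Lemma small_eq k F G : (exists2 d, 0 < d & forall h, `|h| < d -> F h = G h) ->
  small k F -> small k G.
Proof.
move=> [d d0 E] [C [d' [C0 d'0 H]]]; exists C, (Num.min d d'); split=> //.
  by rewrite lt_min d0.
by move=> h; rewrite lt_min => /andP[h1 h2]; rewrite -E // H.
Qed.

Lemma small_ext k F G : (forall h, F h = G h) -> small k F -> small k G.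
Proof. by move=> E; apply: small_eq; exists 1. Qed.

Lemma smallD k F G : small k F -> small k G -> small k (fun h => F h + G h).
Proof.
move=> [C [d [C0 d0 H]]] [C' [d' [C'0 d'0 H']]].
exists (C + C'), (Num.min d d'); split; rewrite ?addr_ge0 ?lt_min ?d0 // => h.
rewrite lt_min => /andP[h1 h2]; apply: le_trans (onrmD _ _) _.
by rewrite mulrDl; apply: lerD; [exact: H|exact: H'].
Qed.

Lemma smallM k l F G : small k F -> small l G -> small (k + l) (fun h => F h * G h).
Proof.
move=> [C [d [C0 d0 H]]] [C' [d' [C'0 d'0 H']]].
exists (C * C'), (Num.min d d'); split; rewrite ?mulr_ge0 ?lt_min ?d0 // => h.
rewrite lt_min => /andP[h1 h2]; apply: le_trans (onrmM _ _) _.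
rewrite exprD [leRHS]mulrACA; by apply: ler_pM; [exact: onrm_ge0|exact: onrm_ge0|exact: H|exact: H'].
Qed.

Lemma small_const X : small 0 (fun _ => X).
Proof.
exists (onrm X), 1; split; rewrite ?onrm_ge0 // => h _.
by rewrite expr0 mulr1.
Qed.

Lemma small_h X : small 1 (fun h => h%:C *: X).
Proof.
exists (onrm X), 1; split; rewrite ?onrm_ge0 // => h _.
by apply: le_trans (onrmZ _ _) _; rewrite ncC expr1 mulrC.
Qed.

Lemma small_weak k l F : (l <= k)%N -> small k F -> small l F.
Proof.
move=> lk [C [d [C0 d0 H]]]; exists C, (Num.min d 1); split; rewrite ?lt_min ?d0 //= => h.
rewrite lt_min => /andP[h1 h2]; apply: le_trans (H h h1) _.
rewrite ler_wpM2l //; apply: ler_wiXn2l => //; exact: ltW.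
Qed.

Lemma smallZ k z F : small k F -> small k (fun h => z *: F h).
Proof.
move=> H; apply: (@small_ext _ (fun h => (z *: 1) * F h)).
  by move=> h; rewrite -scalerAl mul1r.
by rewrite -[k]add0n; apply: smallM => //; exact: small_const.
Qed.

Lemma smallN k F : small k F -> small k (fun h => - F h).
Proof. by move/(smallZ (-1)); apply: small_ext => h; rewrite scaleN1r. Qed.

Definition qder G t D := small 2 (fun h => G (t + h) - G t - h%:C *: D).

Lemma qder_diff G t D : qder G t D -> small 1 (fun h => G (t + h) - G t).
Proof.
move=> H; apply: (@small_ext _ (fun h => (G (t + h) - G t - h%:C *: D) + h%:C *: D)).
  by move=> h; rewrite subrK.
by apply: smallD (small_h _); apply: small_weak H.
Qed.

Lemma qder_cont G t D : qder G t D -> small 0 (fun h => G (t + h)).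
Proof.
move=> H; apply: (@small_ext _ (fun h => (G (t + h) - G t) + G t)).
  by move=> h; rewrite subrK.
by apply: smallD (small_const _); apply: small_weak (qder_diff H).
Qed.

Lemma qder_const X t : qder (fun _ => X) t 0.
Proof.
exists 0, 1; split => // h _; rewrite subrr scaler0 subr0 mul0r.
by apply: onrm_le => // phi c _; rewrite bo0 mul0r; exact: l2le0.
Qed.

Lemma qderD F G t D E : qder F t D -> qder G t E -> qder (fun s => F s + G s) t (D + E).
Proof.
move=> HF HG; apply: small_ext (smallD HF HG) => h.
by rewrite scalerDr !opprD addrACA [X in X + _]addrACA.
Qed.

Lemma qderM F G t D E : qder F t D -> qder G t E ->
  qder (fun s => F s * G s) t (D * G t + F t * E).
Proof.
move=> HF HG.
have s1 : small 2 (fun h => (F (t + h) - F t - h%:C *: D) * G (t + h)).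
  by rewrite -[2%N]addn0; apply: smallM HF (qder_cont HG).
have s2 : small 2 (fun h => F t * (G (t + h) - G t - h%:C *: E)).
  by rewrite -[2%N]add0n; apply: smallM (small_const _) HG.
have s3 : small 2 (fun h => (h%:C *: D) * (G (t + h) - G t)).
  by rewrite -[2%N]/(1 + 1)%N; apply: smallM (small_h _) (qder_diff HG).
apply: small_ext (smallD (smallD s1 s2) s3) => h.
rewrite !mulrBl !mulrBr scalerDr -!scalerAl -!scalerAr.
move: (F (t + h) * G (t + h)) (F t * G (t + h)) (F t * G t) (h%:C *: (D * G (t + h)))
  (h%:C *: (F t * E)) (h%:C *: (D * G t)) => a b c u v w.
by abel.
Qed.

Lemma qderZ z F t D : qder F t D -> qder (fun s => z *: F s) t (z *: D).
Proof.
move/(smallZ z); apply: small_ext => h.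
by rewrite !scalerBr !scalerA mulrC.
Qed.

Lemma qder_eq F G t D : (exists2 d, 0 < d & forall h, `|h| < d -> F (t + h) = G (t + h)) ->
  qder F t D -> qder G t D.
Proof.
move=> [d d0 E]; apply: small_eq; exists d => // h hd.
by rewrite E // -[in G t](addr0 t) -[in F t](addr0 t) E // normr0.
Qed.

Lemma qder_inv Y Z t D : (exists2 d, 0 < d & forall h, `|h| < d ->
    Y (t + h) * Z (t + h) = 1 /\ Z (t + h) * Y (t + h) = 1) ->
  small 0 (fun h => Z (t + h)) -> qder Y t D -> qder Z t (- (Z t * D * Z t)).
Proof.
move=> [d d0 inv] bZ HY.
have inv0 := inv 0; rewrite normr0 addr0 in inv0; have [Y0 Z0] := inv0 d0.
have dZ : small 1 (fun h => Z (t + h) - Z t).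
  have : small 1 (fun h => - (Z (t + h) * ((Y (t + h) - Y t) * Z t))).
    apply: smallN; rewrite -[1%N]/(0 + (1 + 0))%N.
    by apply: smallM bZ (smallM (qder_diff HY) (small_const _)).
  apply: small_eq; exists d => // h hd; have [h1 h2] := inv h hd.
  rewrite mulrBl mulrBr mulrA h2 mul1r Y0 mulr1 opprB //.
have s1 : small 2 (fun h => - (Z (t + h) * ((Y (t + h) - Y t - h%:C *: D) * Z t))).
  apply: smallN; rewrite -[2%N]/(0 + (2 + 0))%N.
  by apply: smallM bZ (smallM HY (small_const _)).
have s2 : small 2 (fun h => - ((Z (t + h) - Z t) * ((h%:C *: D) * Z t))).
  apply: smallN; rewrite -[2%N]/(1 + (1 + 0))%N.
  by apply: smallM dZ (smallM (small_h _) (small_const _)).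
apply: (small_eq _ (smallD s1 s2)); exists d => // h hd; have [h1 h2] := inv h hd.
rewrite [(_ - _ - _) * Z t]mulrBl mulrBr [(_ - _) * Z t]mulrBl [Z (t + h) * (_ - _)]mulrBr.
rewrite [Z (t + h) * (Y (t + h) * _)]mulrA h2 mul1r Y0 mulr1 [(Z _ - Z _) * _]mulrBl.
rewrite scalerN opprK -!scalerAl -!scalerAr !mulrA.
by abel.
Qed.

End Calculus.

Section Expansions.
Context {R : realType}.
Implicit Types (F G Y : R -> bop R) (t h d : R) (k : nat) (X : bop R).

Definition bG d G := exists DG C, 0 <= C /\ forall t, 0 < t < d ->
  [/\ qder G t (DG t), onrm (G t) <= C & t * onrm (DG t) <= C].

(* [E k d G]: on (0,d), G is a polynomial of degree < k in t plus t^k times a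
   function H such that H and t H' are bounded. *)
Fixpoint E k d G : Prop :=
  if k is k'.+1 then
    exists (G0 : bop R) (G' : R -> bop R), E k' d G' /\ forall t, 0 < t < d -> G t = G0 + t%:C *: G' t
  else bG d G.

Lemma qder_in F G t d D : 0 < t < d -> (forall s, 0 < s < d -> F s = G s) ->
  qder F t D -> qder G t D.
Proof.
move=> /andP[t0 td] FG; apply: qder_eq; exists (Num.min t (d - t)).
  by rewrite lt_min t0 subr_gt0.
move=> h; rewrite lt_min => /andP[h1 h2]; apply: FG.
move: h1 h2; rewrite !ltr_norml => /andP[a1 a2] /andP[b1 b2].
by apply/andP; split; lra.
Qed.

Lemma bG_eq d F G : (forall t, 0 < t < d -> F t = G t) -> bG d F -> bG d G.
Proof.
move=> FG [D [C [C0 H]]]; exists D, C; split=> // t td.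
have [h1 h2 h3] := H t td; split=> //; last by rewrite -FG.
exact: qder_in FG h1.
Qed.

Lemma E_eq k d F G : (forall t, 0 < t < d -> F t = G t) -> E k d F -> E k d G.
Proof.
case: k => [|k] FG; first exact: bG_eq.
move=> [F0 [F' [HF' H]]]; exists F0, F'; split=> // t td.
by rewrite -FG // H.
Qed.

Lemma bG_sub d d' G : d' <= d -> bG d G -> bG d' G.
Proof.
move=> dd [D [C [C0 H]]]; exists D, C; split=> // t /andP[t0 td].
by apply: H; rewrite t0 (lt_le_trans td).
Qed.

Lemma E_sub k d d' G : d' <= d -> E k d G -> E k d' G.
Proof.
move=> dd; elim: k G => [|k IH] G; first exact: bG_sub.
move=> [G0 [G' [HG' H]]]; exists G0, G'; split; first exact: IH.
by move=> t /andP[t0 td]; apply: H; rewrite t0 (lt_le_trans td).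
Qed.

Lemma onrm0 : onrm (0 : bop R) <= 0.
Proof. by apply: onrm_le => // phi c _; rewrite bo0 mul0r; exact: l2le0. Qed.

Lemma bG_const d X : bG d (fun _ => X).
Proof.
exists (fun _ => 0), (onrm X); split; first exact: onrm_ge0.
move=> t /andP[t0 _]; split => //; first exact: qder_const.
apply: le_trans (ler_wpM2l (ltW t0) onrm0) _; rewrite mulr0; exact: onrm_ge0.
Qed.

Lemma bGD d F G : bG d F -> bG d G -> bG d (fun t => F t + G t).
Proof.
move=> [D [C [C0 H]]] [D' [C' [C'0 H']]].
exists (fun t => D t + D' t), (C + C'); split; first exact: addr_ge0.
move=> t td; have [h1 h2 h3] := H t td; have [h1' h2' h3'] := H' t td.
have t0 : 0 <= t by case/andP: td => /ltW.
split; first exact: qderD.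
  by apply: le_trans (onrmD _ _) (lerD h2 h2').
apply: le_trans (lerD h3 h3'); rewrite -mulrDr.
by apply: ler_wpM2l => //; exact: onrmD.
Qed.

Lemma bGM d F G : bG d F -> bG d G -> bG d (fun t => F t * G t).
Proof.
move=> [D [C [C0 H]]] [D' [C' [C'0 H']]].
exists (fun t => D t * G t + F t * D' t), (C * C' + C * C'); split.
  by rewrite addr_ge0 ?mulr_ge0.
move=> t td; have [h1 h2 h3] := H t td; have [h1' h2' h3'] := H' t td.
have t0 : 0 <= t by case/andP: td => /ltW.
split; first exact: qderM.
  apply: le_trans (onrmM _ _) _; apply: (@le_trans _ _ (C * C')).
    by apply: ler_pM => //; exact: onrm_ge0.
  by rewrite lerDl mulr_ge0.
apply: le_trans (ler_wpM2l t0 (onrmD _ _)) _; rewrite mulrDr; apply: lerD.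
  apply: le_trans (ler_wpM2l t0 (onrmM _ _)) _; rewrite mulrA.
  by apply: ler_pM => //; [apply: mulr_ge0 => //; exact: onrm_ge0|exact: onrm_ge0].
apply: le_trans (ler_wpM2l t0 (onrmM _ _)) _; rewrite mulrCA.
by apply: ler_pM => //; [exact: onrm_ge0|apply: mulr_ge0 => //; exact: onrm_ge0].
Qed.

Lemma bG_t d : bG d (fun t => t%:C *: 1).
Proof.
exists (fun _ => 1), `|d|; split=> // t /andP[t0 td].
have td' : t <= `|d| by apply: le_trans (ltW td) (ler_norm _).
split.
- exists 0, 1; split=> // h _.
  have -> : (t + h)%:C *: 1 - t%:C *: 1 - h%:C *: 1 = 0 :> bop R.
    by rewrite rmorphD /= scalerDl; abel.
  by rewrite mul0r; exact: onrm0.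
- apply: le_trans (onrmZ _ _) _; rewrite ncC gtr0_norm //.
  by apply: le_trans td'; rewrite -[leRHS]mulr1 ler_wpM2l ?(ltW t0) // onrm1.
- by apply: le_trans td'; rewrite -[leRHS]mulr1 ler_wpM2l ?(ltW t0) // onrm1.
Qed.

Lemma E_const k d X : E k d (fun _ => X).
Proof.
elim: k X => [|k IH] X; first exact: bG_const.
exists X, (fun _ => 0); split; first exact: IH.
by move=> t _; rewrite scaler0 addr0.
Qed.

Lemma E_D k d F G : E k d F -> E k d G -> E k d (fun t => F t + G t).
Proof.
elim: k F G => [|k IH] F G; first exact: bGD.
move=> [F0 [F' [HF HF']]] [G0 [G' [HG HG']]].
exists (F0 + G0), (fun t => F' t + G' t); split; first exact: IH.
by move=> t td; rewrite HF' // HG' // scalerDr addrACA.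
Qed.

Lemma bG_tM d G : bG d G -> bG d (fun t => t%:C *: G t).
Proof.
move=> H; apply: bG_eq (bGM (bG_t d) H) => t _.
by rewrite -scalerAl mul1r.
Qed.

Lemma E_weak k d G : E k.+1 d G -> E k d G.
Proof.
elim: k G => [|k IH] G.
  move=> [G0 [G' [HG' H]]]; apply: (@bG_eq _ (fun t => G0 + t%:C *: G' t)).
    by move=> t td; rewrite H.
  by apply: bGD; [exact: bG_const|exact: bG_tM].
move=> [G0 [G' [HG' H]]]; exists G0, G'; split=> //; exact: IH.
Qed.

Lemma E_le k l d G : (k <= l)%N -> E l d G -> E k d G.
Proof.
move=> /subnK <-; elim: (l - k)%N => [|m IH] //.
by rewrite addSn => /E_weak /IH.
Qed.

Lemma E_tS k d G : E k d G -> E k.+1 d (fun t => t%:C *: G t).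
Proof. by move=> H; exists 0, G; split=> // t _; rewrite add0r. Qed.

Lemma E_t k d G : E k d G -> E k d (fun t => t%:C *: G t).
Proof. by move/E_tS/E_weak. Qed.

Lemma E_M k d F G : E k d F -> E k d G -> E k d (fun t => F t * G t).
Proof.
elim: k F G => [|k IH] F G; first exact: bGM.
move=> HF1 HG1.
have [F0 [F' [HF HF']]] := HF1; have [G0 [G' [HG HG']]] := HG1.
exists (F0 * G0), (fun t => F0 * G' t + F' t * G0 + t%:C *: (F' t * G' t)); split.
  apply: E_D; last by apply: E_t; exact: IH.
  by apply: E_D; apply: IH => //; exact: E_const.
move=> t td; rewrite HF' // HG' //.
rewrite mulrDl !mulrDr !scalerDr -!scalerAl -!scalerAr.
by abel.
Qed.

Lemma E_cM k d X F : E k d F -> E k d (fun t => X * F t).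
Proof. by apply: E_M; exact: E_const. Qed.

Lemma E_Mc k d X F : E k d F -> E k d (fun t => F t * X).
Proof. by move=> H; apply: E_M => //; exact: E_const. Qed.

Lemma E_Z k d z F : E k d F -> E k d (fun t => z *: F t).
Proof.
move=> H; apply: (@E_eq _ _ (fun t => (z *: 1) * F t)); last exact: E_cM.
by move=> t _; rewrite -scalerAl mul1r.
Qed.

Lemma E_N k d F : E k d F -> E k d (fun t => - F t).
Proof. by move/(E_Z (-1)); apply: E_eq => t _; rewrite scaleN1r. Qed.

Lemma E_B k d F G : E k d F -> E k d G -> E k d (fun t => F t - G t).
Proof. by move=> h1 h2; apply: E_D => //; exact: E_N. Qed.

(* Since F0 Y = 1 - t F' Y, an expansion of Y to order k yields one to order k+1. *)
Lemma E_inv_step k d (F0 X0 : bop R) F' Y : X0 * F0 = 1 -> E k d F' -> bG d Y ->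
  (forall t, 0 < t < d -> (F0 + t%:C *: F' t) * Y t = 1) ->
  E k d (fun t => - (X0 * F' t * Y t)) /\
  forall t, 0 < t < d -> Y t = X0 + t%:C *: - (X0 * F' t * Y t).
Proof.
move=> X0F0 HF' HY FY.
have YE t : 0 < t < d -> Y t = X0 + t%:C *: - (X0 * F' t * Y t).
  move=> td; have := congr1 (fun Z => X0 * Z) (FY t td).
  rewrite /= mulrA mulrDr X0F0 mulr1 mulrDl mul1r -scalerAr -scalerAl => YE.
  by rewrite scalerN; apply/eqP; rewrite eq_sym subr_eq; apply/eqP.
have EY j : (j <= k)%N -> E j d Y.
  elim: j => [//|j IH] jk.
  exists X0, (fun t => - (X0 * F' t * Y t)); split=> //.
  apply: E_N; apply: E_M; last exact/IH/ltnW.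
  by apply: E_cM; exact: E_le (ltnW jk) HF'.
split=> //; apply: E_N; apply: E_M; last exact: EY.
exact: E_cM.
Qed.

Lemma E_inv k d (F0 X0 : bop R) F' : 0 < d -> X0 * F0 = 1 -> F0 * X0 = 1 -> E k d F' ->
  exists d' Y, [/\ 0 < d' <= d,
    forall t, 0 < t < d' -> (F0 + t%:C *: F' t) * Y t = 1 /\ Y t * (F0 + t%:C *: F' t) = 1
  & exists2 Y', E k d' Y' & forall t, 0 < t < d' -> Y t = X0 + t%:C *: Y' t].
Proof.
move=> d0 X0F0 F0X0 HF'.
have [D [C [C0 HC]]] : bG d (fun t => X0 * F' t).
  by apply: (E_cM (k := 0)); apply: E_le HF'.
pose d' := Num.min d (2 * (C + 1))^-1.
have C1 : 0 < 2 * (C + 1) by rewrite mulr_gt0 // ltr_wpDl.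
have d'0 : 0 < d' by rewrite lt_min d0 invr_gt0.
have d'd : d' <= d by rewrite ge_min lexx.
have sm t : 0 < t < d' -> onrm (- (t%:C *: (X0 * F' t))) <= 1 / 2.
  move=> /andP[t0 td']; have td : 0 < t < d by rewrite t0 (lt_le_trans td').
  have [_ h _] := HC t td.
  rewrite -scaleN1r scalerA; apply: le_trans (onrmZ _ _) _.
  rewrite ncM ncN nc1 mul1r ncC gtr0_norm //.
  apply: (@le_trans _ _ ((2 * (C + 1))^-1 * C)).
    apply: ler_pM => //; [exact: ltW|exact: onrm_ge0|].
    by apply: le_trans (ltW td') _; rewrite ge_min lexx orbT.
  rewrite mulrC ler_pdivrMr // mulrA divfK ?pnatr_eq0 // mul1r lerDl //.
have ex t : exists Z : bop R, 0 < t < d' ->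
    [/\ (F0 + t%:C *: F' t) * Z = 1, Z * (F0 + t%:C *: F' t) = 1 & onrm Z <= 2 * onrm X0].
  have [td|] := pselect (0 < t < d'); last by move=> nt; exists 0.
  have lt1 : onrm (- (t%:C *: (X0 * F' t))) < 1.
    by apply: le_lt_trans (sm t td) _; rewrite ltr_pdivrMr // mul1r ltr1n.
  have [Z [Z1 Z2 Z3]] := neumann lt1; rewrite opprK in Z1 Z2.
  have FE : F0 + t%:C *: F' t = F0 * (1 + t%:C *: (X0 * F' t)).
    by rewrite mulrDr mulr1 -scalerAr mulrA F0X0 mul1r.
  exists (Z * X0) => _; split.
  - by rewrite FE -mulrA (mulrA _ Z) Z1 mul1r.
  - by rewrite FE mulrA -(mulrA Z) X0F0 mulr1.
  - apply: le_trans (onrmM _ _) _; apply: ler_wpM2r; first exact: onrm_ge0.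
    apply: le_trans Z3 _; rewrite -[leRHS]invrK lef_pV2 ?posrE ?invr_gt0 ?subr_gt0 //.
    have := sm t td; lra.
pose Y t := projT1 (cid (ex t)).
have HY t : 0 < t < d' -> [/\ (F0 + t%:C *: F' t) * Y t = 1,
    Y t * (F0 + t%:C *: F' t) = 1 & onrm (Y t) <= 2 * onrm X0].
  exact: (projT2 (cid (ex t))).
have HF : bG d' (fun t => F0 + t%:C *: F' t).
  apply: (E_D (k := 0)); first exact: E_const.
  by apply: (E_t (k := 0)); apply: E_sub d'd _; apply: E_le HF'.
have bY : bG d' Y.
  have [DF [CF [CF0 HDF]]] := HF.
  exists (fun t => - (Y t * DF t * Y t)), (2 * onrm X0 + 2 * onrm X0 * CF * (2 * onrm X0)).
  have N0 : 0 <= 2 * onrm X0 by rewrite mulr_ge0 ?onrm_ge0.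
  have N1 : 0 <= 2 * onrm X0 * CF * (2 * onrm X0).
    by apply: mulr_ge0 => //; apply: mulr_ge0.
  split; first exact: addr_ge0.
  move=> t td; have [y1 y2 y3] := HY t td; have [q1 q2 q3] := HDF t td.
  have near_in : exists2 e, 0 < e & forall h, `|h| < e -> 0 < t + h < d'.
    case/andP: td => t0 td; exists (Num.min t (d' - t)).
      by rewrite lt_min t0 subr_gt0.
    move=> h; rewrite lt_min => /andP[h1 h2].
    move: h1 h2; rewrite !ltr_norml => /andP[a1 a2] /andP[b1 b2].
    by apply/andP; split; lra.
  have [e e0 He] := near_in.
  split.
  - apply: qder_inv q1; first by exists e => // h /He /HY [].
    exists (2 * onrm X0), e; split=> // h /He /HY [_ _].
    by rewrite expr0 mulr1.
  - by apply: le_trans y3 _; rewrite lerDl.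
  - have t0 : 0 <= t by case/andP: td => /ltW.
    rewrite -scaleN1r; apply: le_trans (ler_wpM2l t0 (onrmZ _ _)) _.
    rewrite ncN nc1 mul1r.
    apply: (@le_trans _ _ (t * (onrm (Y t) * onrm (DF t) * onrm (Y t)))).
      apply: ler_wpM2l => //; apply: le_trans (onrmM _ _) _.
      by apply: ler_wpM2r; [exact: onrm_ge0|exact: onrmM].
    rewrite mulrA [t * (_ * _)]mulrCA.
    apply: (@le_trans _ _ (2 * onrm X0 * CF * (2 * onrm X0))); last by rewrite lerDr.
    apply: ler_pM => //.
    + by apply: mulr_ge0; [exact: onrm_ge0|apply: mulr_ge0 => //; exact: onrm_ge0].
    + exact: onrm_ge0.
    + apply: ler_pM => //; [exact: onrm_ge0|apply: mulr_ge0 => //; exact: onrm_ge0].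
have [h1 h2] := E_inv_step X0F0 (E_sub d'd HF') bY (fun t td => (fun '(And3 a _ _) => a) (HY t td)).
exists d', Y; split; first by rewrite d'0.
  by move=> t /HY [].
by exists (fun t => - (X0 * F' t * Y t)).
Qed.

End Expansions.

Section DividedDifferences.
Context {R : realType}.
Variable z0 : R[i].
Implicit Types (z a b : R[i]) (m N : nat).

(* Iterated divided differences at z0 of the monomial z^N: by [Sp_taylor] below,
   z^N = sum_(m < k) Sp m N z0 (z - z0)^m + (z - z0)^k Sp k N z. *)
Fixpoint Sp m N z : R[i] :=
  match N with
  | 0 => if m is 0 then 1 else 0
  | N'.+1 => if m is m'.+1 then z0 * Sp m N' z + Sp m' N' z else z * Sp 0 N' z
  end.

Fixpoint DSp m N z : R[i] :=
  match N with
  | 0 => 0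
  | N'.+1 => if m is m'.+1 then z0 * DSp m N' z + DSp m' N' z
             else Sp 0 N' z + z * DSp 0 N' z
  end.

Lemma Sp0 N z : Sp 0 N z = z ^+ N.
Proof. by elim: N => [|N /= ->]; rewrite ?expr0 ?exprS. Qed.

Lemma Sp_taylor m N z : Sp m N z = Sp m N z0 + (z - z0) * Sp m.+1 N z.
Proof.
elim: N m => [|N IH] m; first by rewrite /= mulr0 addr0; case: m.
case: m => [|m] /=.
  by have := IH 0%N; move: (Sp 0 N z) (Sp 0 N z0) (Sp 1 N z) => x y w ->; ring.
have := IH m; have := IH m.+1.
move: (Sp m N z) (Sp m N z0) (Sp m.+1 N z) (Sp m.+1 N z0) (Sp m.+2 N z) => x y w u v -> ->.
by ring.
Qed.

Lemma DSp_taylor m N z : DSp m N z = Sp m.+1 N z + (z - z0) * DSp m.+1 N z.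
Proof.
elim: N m => [|N IH] m; first by rewrite /= mulr0 addr0.
case: m => [|m] /=.
  have := IH 0%N; have := @Sp_taylor 0 N z.
  by move: (Sp 0 N z) (Sp 0 N z0) (Sp 1 N z) (DSp 0 N z) (DSp 1 N z) => x y w u v -> ->; ring.
have := IH m; have := IH m.+1.
move: (Sp m.+1 N z) (Sp m.+2 N z) (DSp m N z) (DSp m.+1 N z) (DSp m.+2 N z) => x y w u v -> ->.
by ring.
Qed.

Hypothesis z01 : nc z0 <= 1.

Let powS (n k : nat) : (n%:R ^+ k.+1 + n%:R ^+ k <= n.+1%:R ^+ k.+1 :> R).
Proof.
rewrite exprS -[X in _ + X]mul1r -mulrDl exprS -natr1.
apply: ler_wpM2l; first by rewrite addr_ge0.
by apply: lerXn2r; rewrite ?nnegrE ?addr_ge0 // lerDl.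
Qed.

Lemma Sp_bound m N z : nc z <= 1 -> nc (Sp m N z) <= N%:R ^+ m.
Proof.
move=> z1; elim: N m => [|N IH] m.
  by case: m => [|m]; rewrite [Sp _ _ _]/= ?nc1 ?nc0 ?expr0 // exprn_ge0.
case: m => [|m].
  rewrite [Sp _ _ _]/= ncM expr0; have := IH 0%N; rewrite expr0 => H.
  by rewrite mulr_ile1 ?nc_ge0.
rewrite [Sp _ _ _]/=; apply: le_trans (powS _ _); apply: le_trans (ncD _ _) _.
apply: lerD (IH m); rewrite ncM; apply: le_trans (IH m.+1).
by rewrite ler_piMl ?nc_ge0.
Qed.

Lemma DSp_bound m N z : nc z <= 1 -> nc (DSp m N z) <= N%:R ^+ m.+1.
Proof.
move=> z1; elim: N m => [|N IH] m.
  by case: m => [|m]; rewrite [DSp _ _ _]/= nc0 exprn_ge0.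
case: m => [|m]; rewrite [DSp _ _ _]/=; apply: le_trans (powS _ _); apply: le_trans (ncD _ _) _.
  rewrite addrC; apply: lerD (Sp_bound 0 N z1); rewrite ncM; apply: le_trans (IH 0%N).
  by rewrite ler_piMl ?nc_ge0.
apply: lerD (IH m); rewrite ncM; apply: le_trans (IH m.+1).
by rewrite ler_piMl ?nc_ge0.
Qed.

Lemma Sp_diff2 m N a b : nc a <= 1 -> nc b <= 1 ->
  nc (Sp m N a - Sp m N b - (a - b) * DSp m N b) <= nc (a - b) ^+ 2 * N%:R ^+ m.+2.
Proof.
move=> a1 b1; elim: N m => [|N IH] m.
  by rewrite [Sp _ _ _]/= [Sp _ _ b]/= [DSp _ _ _]/= mulr0 subr0 subrr nc0 mulr_ge0 ?sqr_ge0 ?exprn_ge0.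
have c0 : 0 <= nc (a - b) ^+ 2 by rewrite sqr_ge0.
case: m => [|m]; rewrite [Sp _ _ a]/= [Sp _ _ b]/= [DSp _ _ b]/=.
  have -> : a * Sp 0 N a - b * Sp 0 N b - (a - b) * (Sp 0 N b + b * DSp 0 N b)
    = a * (Sp 0 N a - Sp 0 N b - (a - b) * DSp 0 N b) + (a - b) ^+ 2 * DSp 0 N b by ring.
  apply: le_trans (ncD _ _) _.
  apply: le_trans (ler_wpM2l c0 (powS _ _)); rewrite [leRHS]mulrDr; apply: lerD.
    by rewrite ncM; apply: le_trans (IH 0%N); rewrite ler_piMl ?nc_ge0.
  by rewrite ncM ncX; apply: ler_wpM2l => //; exact: DSp_bound.
have -> : z0 * Sp m.+1 N a + Sp m N a - (z0 * Sp m.+1 N b + Sp m N b)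
     - (a - b) * (z0 * DSp m.+1 N b + DSp m N b)
    = z0 * (Sp m.+1 N a - Sp m.+1 N b - (a - b) * DSp m.+1 N b)
     + (Sp m N a - Sp m N b - (a - b) * DSp m N b) by ring.
apply: le_trans (ncD _ _) _.
apply: le_trans (ler_wpM2l c0 (powS _ _)); rewrite [leRHS]mulrDr; apply: lerD (IH m).
by rewrite ncM; apply: le_trans (IH m.+1); rewrite ler_piMl ?nc_ge0.
Qed.

End DividedDifferences.

Section ConvolutionKernel.
Context {R : realType}.
Variables (w : int -> R) (p : nat) (S : R).

Definition wgt : seqZ R := fun n => (jap n ^+ p * w n)%:C.

Hypotheses (w0 : forall n, 0 <= w n) (wS : l2le wgt S).

Implicit Types (g : int -> R[i]) (C : R).

Definition growth C g := forall x : int, nc (g x) <= C * jap x ^+ p.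

Lemma jap_sq (n : int) : jap n ^+ 2 = 1 + n%:~R ^+ 2 :> R.
Proof. by rewrite /jap sqr_sqrtr ?addr_ge0 ?sqr_ge0 // real_normK ?num_real. Qed.

Lemma jap_sub (n m : int) : jap (n - m) <= 2 * (jap n * jap m) :> R.
Proof.
rewrite -(ler_pXn2r (n := 2)) ?nnegrE ?mulr_ge0 ?jap_ge0 // !exprMn !jap_sq rmorphB /=.
set a : R := n%:~R; set b : R := m%:~R.
have := sqr_ge0 (a + b); have := sqr_ge0 (a * b); have := sqr_ge0 a; have := sqr_ge0 b; nra.
Qed.

Definition cker g (n m : int) : R[i] := (w n)%:C * g (n - m) * (w m)%:C.

Definition Op g : bop R := mkB (kop (cker g)).

Lemma cker_bound C g : 0 <= C -> growth C g ->
  forall n m, nc (cker g n m) <= (C * 2 ^+ p) * (nc (wgt n) * nc (wgt m)).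
Proof.
move=> C0 H n m; rewrite /cker /wgt !ncM !ncC !ger0_norm ?mulr_ge0 ?exprn_ge0 ?jap_ge0 //.
have J := jap_sub n m.
have Jp : jap (n - m) ^+ p <= (2 * (jap n * jap m)) ^+ p :> R.
  by apply: lerXn2r => //; rewrite nnegrE ?mulr_ge0 ?jap_ge0.
rewrite !exprMn in Jp.
have H2 : nc (g (n - m)) <= C * (2 ^+ p * (jap n ^+ p * jap m ^+ p)).
  by apply: le_trans (H _) _; apply: ler_wpM2l.
have -> : C * 2 ^+ p * (jap n ^+ p * w n * (jap m ^+ p * w m))
   = w n * (C * (2 ^+ p * (jap n ^+ p * jap m ^+ p))) * w m by ring.
by apply: ler_wpM2r => //; apply: ler_wpM2l.
Qed.

Let M := 2 ^+ p * S * S.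

Lemma growth_const_ge0 C g : growth C g -> 0 <= C.
Proof.
move=> /(_ 0) H; have j0 : 0 < jap 0 ^+ p :> R by rewrite exprn_gt0 ?jap_gt0.
by have := le_trans (nc_ge0 _) H; rewrite pmulr_lge0.
Qed.

Lemma Op_bounded C g : growth C g -> bounded_op (kop (cker g)) /\ onrm (Op g) <= C * M.
Proof.
move=> H; have C0 := growth_const_ge0 H.
have C2 : 0 <= C * 2 ^+ p by rewrite mulr_ge0 ?exprn_ge0.
have [h1 h2] := mkB_onrm (mulr_ge0 (mulr_ge0 C2 wS.1) wS.1)
  (kop_linear C2 wS (cker_bound C0 H)) (kop_bound C2 wS (cker_bound C0 H)).
by split=> //; apply: le_trans h2 _; rewrite /M !mulrA.
Qed.

Lemma Op_tails C g : growth C g -> small_tails (Op g).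
Proof.
move=> H; have C0 := growth_const_ge0 H.
have C2 : 0 <= C * 2 ^+ p by rewrite mulr_ge0 ?exprn_ge0.
exact: small_tails_kop C2 wS (cker_bound C0 H).
Qed.

Lemma OpE C g phi n : growth C g -> l2w 0 phi ->
  Op g phi n = csum (fun m => cker g n m * phi m).
Proof. by move=> H Hp; rewrite mkBE //; case: (Op_bounded H). Qed.

Lemma Op_sumle C g phi n : growth C g -> l2w 0 phi ->
  exists c, sumle (fun m => cker g n m * phi m) c.
Proof.
move=> H /l2P[c Hc]; have C0 := growth_const_ge0 H.
have C2 : 0 <= C * 2 ^+ p by rewrite mulr_ge0 ?exprn_ge0.
by eexists; exact: (kop_sumle C2 wS (cker_bound C0 H) n Hc).
Qed.

Lemma Op_lin C C' z g g' : growth C g -> growth C' g' ->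
  Op (fun x => z * g x + g' x) = z *: Op g + Op g'.
Proof.
move=> H H'; have C0 := growth_const_ge0 H; have C0' := growth_const_ge0 H'.
have H2 : growth (nc z * C + C') (fun x => z * g x + g' x).
  move=> x; apply: le_trans (ncD _ _) _; rewrite mulrDl; apply: lerD => //.
  by rewrite ncM -mulrA; apply: ler_wpM2l => //; exact: nc_ge0.
apply: bop_eq => phi Hp; apply/funext => n.
rewrite (OpE _ H2) // boD // boZ // [RHS](_ : _ = z * Op g phi n + Op g' phi n) //.
rewrite (OpE _ H) // (OpE _ H') //.
have [c Hc] := Op_sumle n H Hp; have [c' Hc'] := Op_sumle n H' Hp.
rewrite -(csumZ z Hc) -(csumD (sumleZ z Hc) Hc').
by apply: eq_csum => m; rewrite /cker; ring.
Qed.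

Lemma growth0 : growth 0 (fun _ => 0).
Proof. by move=> x; rewrite nc0 mul0r. Qed.

Lemma Op_eq g g' : (forall x, g x = g' x) -> Op g = Op g'.
Proof. by move=> /funext ->. Qed.

Lemma OpZ C z g : growth C g -> Op (fun x => z * g x) = z *: Op g.
Proof.
move=> H; have E0 : Op (fun _ => 0) = 0.
  have := Op_lin (-1) growth0 growth0; rewrite scaleN1r addNr => <-.
  by apply: Op_eq => x; rewrite mulr0 addr0.
have := Op_lin z H growth0; rewrite E0 addr0 => <-.
by apply: Op_eq => x; rewrite addr0.
Qed.

Lemma OpD C C' g g' : growth C g -> growth C' g' ->
  Op (fun x => g x + g' x) = Op g + Op g'.
Proof.
move=> H H'; rewrite -[Op g]scale1r -(Op_lin 1 H H').
by apply: Op_eq => x; rewrite mul1r.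
Qed.

Lemma growthZ C z g : growth C g -> growth (nc z * C) (fun x => z * g x).
Proof. by move=> H x; rewrite ncM -mulrA; apply: ler_wpM2l => //; exact: nc_ge0. Qed.

Lemma growthD C C' g g' : growth C g -> growth C' g' -> growth (C + C') (fun x => g x + g' x).
Proof.
by move=> H H' x; apply: le_trans (ncD _ _) _; rewrite mulrDl; exact: lerD.
Qed.

Lemma growthB C C' g g' : growth C g -> growth C' g' -> growth (C + C') (fun x => g x - g' x).
Proof.
by move=> H H' x; apply: le_trans (ncB _ _) _; rewrite mulrDl; exact: lerD.
Qed.

Lemma OpB C C' g g' : growth C g -> growth C' g' ->
  Op (fun x => g x - g' x) = Op g - Op g'.
Proof.
move=> H H'; rewrite -scaleN1r -(OpZ (-1) H') -(OpD H (growthZ (-1) H')).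
by apply: Op_eq => x; rewrite mulN1r.
Qed.

Lemma Op_qder (g : R -> int -> R[i]) g' t C : (forall s, exists c, growth c (g s)) ->
  (exists c, growth c g') ->
  (exists2 d, 0 < d & forall h, `|h| < d ->
    growth (C * `|h| ^+ 2) (fun x => g (t + h) x - g t x - h%:C * g' x)) ->
  qder (fun s => Op (g s)) t (Op g').
Proof.
move=> Hg [c' Hg'] [d d0 H].
have M0 : 0 <= M by rewrite /M !mulr_ge0 ?exprn_ge0 ?wS.1.
have C0 : 0 <= C.
  have dd : `|d / 2| < d by rewrite gtr0_norm ?divr_gt0 // ltr_pdivrMr // mulr_natr mulr2n ltrDl.
  have := growth_const_ge0 (H _ dd).
  by rewrite pmulr_lge0 // exprn_gt0 // normr_gt0 gt_eqF ?divr_gt0.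
exists (C * M), d; split=> //; first exact: mulr_ge0.
move=> h /H Hh; have [c1 H1] := Hg (t + h); have [c2 H2] := Hg t.
have -> : Op (g (t + h)) - Op (g t) - h%:C *: Op g'
    = Op (fun x => g (t + h) x - g t x - h%:C * g' x).
  by rewrite -(OpB H1 H2) -(OpZ _ Hg') -(OpB (growthB H1 H2) (growthZ h%:C Hg')).
by apply: le_trans (Op_bounded Hh).2 _; rewrite mulrAC.
Qed.

End ConvolutionKernel.

Section ScalarFunctions.
Context {R : realType}.
Implicit Types (f g : R -> R[i]) (t h d : R) (k : nat) (X : bop R) (G : R -> bop R).

Definition sq f t (f' : R[i]) := exists C d : R, [/\ 0 <= C, 0 < d & forall h, `|h| < d ->
  nc (f (t + h) - f t - h%:C * f') <= C * `|h| ^+ 2].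

Lemma sq_qder f t (f' : R[i]) X : sq f t f' -> qder (fun s => f s *: X) t (f' *: X).
Proof.
move=> [C [d [C0 d0 H]]]; exists (C * onrm X), d; split=> //.
  by rewrite mulr_ge0 ?onrm_ge0.
move=> h /H Hh; rewrite -scalerBl scalerA -scalerBl.
by apply: le_trans (onrmZ _ _) _; rewrite mulrAC; apply: ler_wpM2r => //; exact: onrm_ge0.
Qed.

Definition entry X : R[i] := X (delta 0) 0.

Lemma entry_le X : nc (entry X) <= onrm X.
Proof.
have := l2le_coord 0 (onrm_app X (@l2le_delta R 0)).
by rewrite mulr1.
Qed.

Lemma entryZ z X : entry (z *: X) = z * entry X.
Proof. by rewrite /entry boZ //; exact: l2_delta. Qed.

Lemma entryB X X' : entry (X - X') = entry X - entry X'.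
Proof. by rewrite /entry boB //; exact: l2_delta. Qed.

Lemma entry1 : entry 1 = 1.
Proof. by rewrite /entry bo1 ?/delta ?eqxx //; exact: l2_delta. Qed.

Lemma qder_sq f t D : qder (fun s => f s *: 1) t D -> sq f t (entry D).
Proof.
move=> [C [d [C0 d0 H]]]; exists C, d; split=> // h /H; apply: le_trans.
apply: le_trans (entry_le _).
by rewrite !entryB !entryZ entry1 !mulr1.
Qed.

Definition sE k d f := E k d (fun t => f t *: (1 : bop R)).

Lemma sE_scale k d f G : sE k d f -> E k d G -> E k d (fun t => f t *: G t).
Proof.
move=> hf hG; apply: (@E_eq _ _ _ (fun t => (f t *: 1) * G t)).
  by move=> t _; rewrite -scalerAl mul1r.
exact: E_M.
Qed.

Lemma sE_eq k d f g : (forall t, 0 < t < d -> f t = g t) -> sE k d f -> sE k d g.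
Proof. by move=> fg; apply: E_eq => t /fg ->. Qed.

Lemma sE_const k d (z : R[i]) : sE k d (fun _ => z).
Proof. exact: E_const. Qed.

Lemma sE_D k d f g : sE k d f -> sE k d g -> sE k d (fun t => f t + g t).
Proof.
by move=> hf hg; apply: E_eq (E_D hf hg) => t _; rewrite scalerDl.
Qed.

Lemma sE_M k d f g : sE k d f -> sE k d g -> sE k d (fun t => f t * g t).
Proof.
by move=> hf hg; apply: E_eq (sE_scale hf hg) => t _; rewrite scalerA.
Qed.

Lemma sE_Z k d z f : sE k d f -> sE k d (fun t => z * f t).
Proof. by apply: sE_M; exact: sE_const. Qed.

Lemma sE_t k d : sE k d (fun t => t%:C).
Proof. by apply: E_eq (E_t (E_const k d 1)). Qed.

Lemma sE_X k d f n : sE k d f -> sE k d (fun t => f t ^+ n).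
Proof.
move=> hf; elim: n => [|n IH]; first by apply: sE_eq (sE_const k d 1) => t _; rewrite expr0.
by apply: sE_eq (sE_M hf IH) => t _; rewrite exprS.
Qed.

Lemma sE_S k d f (f0 : R[i]) f1 : sE k d f1 -> (forall t, 0 < t < d -> f t = f0 + t%:C * f1 t) ->
  sE k.+1 d f.
Proof.
move=> hf H; exists (f0 *: 1), (fun t => f1 t *: 1); split=> // t td.
by rewrite H // scalerDl scalerA.
Qed.

(* An equation f = f0 + t Phi(t, f) with polynomial Phi determines the expansion of f to all orders. *)
Lemma sE_fix d f (f0 : R[i]) (Phi : R -> R[i]) : bG d (fun t => f t *: 1) ->
  (forall k, sE k d f -> sE k d Phi) ->
  (forall t, 0 < t < d -> f t = f0 + t%:C * Phi t) -> forall k, sE k d f.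
Proof.
by move=> b0 HPhi H; elim=> [//|k IH]; apply: (sE_S (HPhi k IH) H).
Qed.

Lemma sE_inv0 d f c : 0 < c -> sE 0 d f -> (forall t, 0 < t < d -> c <= nc (f t)) ->
  sE 0 d (fun t => (f t)^-1).
Proof.
move=> c0 [D [C [C0 H]]] Hc.
have f0 t : 0 < t < d -> f t != 0.
  move=> /Hc h; apply/eqP => fe; move: h; rewrite fe nc0 => h.
  by have := lt_le_trans c0 h; rewrite ltxx.
have ncV t : 0 < t < d -> onrm ((f t)^-1 *: (1 : bop R)) <= c^-1.
  move=> td; apply: le_trans (onrmZ _ _) _.
  apply: le_trans (_ : nc (f t)^-1 * 1 <= _).
    by apply: ler_wpM2l; [exact: nc_ge0|exact: onrm1].
  rewrite mulr1 Normc.normcV lef_pV2 ?posrE ?Hc //.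
  exact: lt_le_trans c0 (Hc t td).
have cV : 0 <= c^-1 by rewrite invr_ge0 ltW.
exists (fun t => - (((f t)^-1 *: 1) * D t * ((f t)^-1 *: 1))), (c^-1 + c^-1 * C * c^-1); split.
  by rewrite addr_ge0 ?mulr_ge0.
move=> t td; have [q1 q2 q3] := H t td.
have [e e0 He] : exists2 e, 0 < e & forall h, `|h| < e -> 0 < t + h < d.
  case/andP: td => t0 td; exists (Num.min t (d - t)).
    by rewrite lt_min t0 subr_gt0.
  move=> h; rewrite lt_min => /andP[h1 h2].
  move: h1 h2; rewrite !ltr_norml => /andP[a1 a2] /andP[b1 b2].
  by apply/andP; split; lra.
have t0 : 0 <= t by case/andP: td => /ltW.
have P0 : 0 <= c^-1 * C * c^-1 by rewrite !mulr_ge0.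
split.
- apply: (qder_inv (Y := fun t => f t *: 1)) q1.
    exists e => // h /He /f0 fh.
    by rewrite -!scalerAl !mul1r !scalerA divff // mulVf // scale1r.
  by exists c^-1, e; split=> // h /He /ncV; rewrite expr0 mulr1.
- by apply: le_trans (ncV t td) _; rewrite lerDl.
- rewrite -scaleN1r; apply: le_trans (ler_wpM2l t0 (onrmZ _ _)) _.
  rewrite ncN nc1 mul1r.
  apply: (@le_trans _ _ (t * (c^-1 * onrm (D t) * c^-1))).
    apply: ler_wpM2l => //; apply: le_trans (onrmM _ _) _.
    apply: ler_pM; [exact: onrm_ge0|exact: onrm_ge0| |exact: ncV].
    apply: le_trans (onrmM _ _) _; apply: ler_wpM2r; [exact: onrm_ge0|exact: ncV].
  apply: (@le_trans _ _ (c^-1 * C * c^-1)); last by rewrite lerDr.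
  rewrite mulrA; apply: ler_wpM2r => //.
  by rewrite mulrCA; apply: ler_wpM2l.
Qed.

(* Square roots of real functions bounded away from 0. *)
Lemma sE_sqrt0 d (f : R -> R) c C (f' : R -> R) : 0 < c ->
  (forall t, 0 < t < d -> [/\ c <= f t, f t <= C, `|f' t| <= C & sq (fun s => (f s)%:C) t (f' t)%:C]) ->
  0 <= d <= 1 ->
  sE 0 d (fun t => (Num.sqrt (f t))%:C).
Proof.
move=> c0 H /andP[d0 d1].
pose u t := Num.sqrt (f t); pose k := Num.sqrt c.
have k0 : 0 < k by rewrite sqrtr_gt0.
have uk t : 0 < t < d -> k <= u t by move=> /H [h _ _ _]; rewrite ler_wsqrtr.
have u2 t : 0 < t < d -> u t ^+ 2 = f t.
  by move=> /H [h _ _ _]; rewrite sqr_sqrtr // (le_trans (ltW c0) h).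
have [C0|Cn] := lerP 0 C; last first.
  exists (fun _ => 0), 0; split=> // t /H [_ _ h _].
  by have := le_lt_trans (le_trans (normr_ge0 _) h) Cn; rewrite ltxx.
exists (fun t => (f' t / (2 * u t))%:C *: 1), (Num.sqrt C + C / (2 * k)); split.
  by rewrite addr_ge0 ?sqrtr_ge0 ?divr_ge0 ?mulr_ge0 ?(ltW k0).
move=> t td; have [h1 h2 h3 [C1 [e1 [C10 e10 He1]]]] := H t td.
have ut0 : 0 < u t by apply: lt_le_trans k0 (uk t td).
have t0 : 0 <= t by case/andP: td => /ltW.
have t1 : t <= 1 by case/andP: td => _ /ltW /le_trans; apply.
split.
- apply: sq_qder.
  have [e e0 He] : exists2 e, 0 < e & forall h, `|h| < e -> 0 < t + h < d.
    case/andP: td => t0' td; exists (Num.min t (d - t)).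
      by rewrite lt_min t0' subr_gt0.
    move=> h; rewrite lt_min => /andP[b1 b2].
    move: b1 b2; rewrite !ltr_norml => /andP[a1 a2] /andP[b1 b2].
    by apply/andP; split; lra.
  pose C2 := C1 / k + C * (C + C1) / (k * k * k).
  have C20 : 0 <= C2.
    by rewrite /C2 addr_ge0 ?divr_ge0 ?mulr_ge0 ?addr_ge0 ?(ltW k0).
  exists C2, (Num.min 1 (Num.min e e1)); split=> //; first by rewrite !lt_min ltr01 e0.
  move=> h; rewrite !lt_min => /andP[hh1 /andP[/He the /He1 Hh]].
  have uth0 : 0 < u (t + h) by apply: lt_le_trans k0 (uk _ the).
  have {}Hh : `|f (t + h) - f t - h * f' t| <= C1 * `|h| ^+ 2.
    by rewrite -ncC !rmorphB rmorphM.
  suff Hu : `|u (t + h) - u t - h * (f' t / (2 * u t))| <= C2 * `|h| ^+ 2.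
    by apply: le_trans Hu; rewrite -[leRHS]ncC !rmorphB (rmorphM _ h); exact: lexx.
  have U1 := u2 t td; have U2 := u2 _ the.
  set a := u (t + h) in uth0 U2 *; set b := u t in ut0 U1 *.
  have ka : k <= a by exact: uk. have kb : k <= b by exact: uk.
  set r := f (t + h) - f t - h * f' t in Hh.
  have ab0 : 0 < a + b by rewrite addr_gt0.
  have E1 : a - b = (r + h * f' t) / (a + b).
    apply: (mulIf (lt0r_neq0 ab0)); rewrite divfK ?lt0r_neq0 // /r -U1 -U2; ring.
  have E : a - b - h * (f' t / (2 * b)) = r / (a + b) - h * f' t * (a - b) / ((a + b) * (2 * b)).
    have -> : a - b - h * (f' t / (2 * b)) = (r + h * f' t) / (a + b) - h * (f' t / (2 * b)).
      by rewrite -E1.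
    by field; rewrite !lt0r_neq0.
  have abk : k <= a + b by apply: le_trans ka _; rewrite lerDl ltW.
  have abV : (a + b)^-1 <= k^-1 by rewrite lef_pV2 ?posrE.
  have abV0 : 0 <= (a + b)^-1 by rewrite invr_ge0 ltW.
  have b2k : k <= 2 * b by rewrite (le_trans kb) // mulr_natl mulr2n lerDr ltW.
  have bV : (2 * b)^-1 <= k^-1 by rewrite lef_pV2 ?posrE ?mulr_gt0.
  have bV0 : 0 <= (2 * b)^-1 by rewrite invr_ge0 mulr_ge0 ?(ltW ut0).
  have kV0 : 0 <= k^-1 by rewrite invr_ge0 ltW.
  have hh0 : `|h| ^+ 2 <= `|h|.
    by rewrite expr2 -[leRHS]mulr1 ler_wpM2l // ltW.
  have nab : `|a - b| <= `|h| * (C + C1) / k.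
    rewrite E1 normrM (ger0_norm abV0); apply: ler_pM => //.
    apply: le_trans (ler_normD _ _) _; rewrite normrM mulrDr addrC; apply: lerD.
      by apply: ler_wpM2l.
    by apply: le_trans Hh _; rewrite mulrC; apply: ler_wpM2r.
  rewrite E; apply: le_trans (ler_normB _ _) _; rewrite /C2 [leRHS]mulrDl; apply: lerD.
    rewrite normrM (ger0_norm abV0) mulrAC.
    by apply: ler_pM.
  rewrite normrM invfM [X in _ * X]normrM (ger0_norm abV0) (ger0_norm bV0) !normrM.
  have -> : C * (C + C1) / (k * k * k) * `|h| ^+ 2 = (`|h| * C * (`|h| * (C + C1) / k)) * (k^-1 * k^-1).
    by field; rewrite lt0r_neq0.
  apply: ler_pM; rewrite ?mulr_ge0 //.
    apply: ler_pM; rewrite ?mulr_ge0 //.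
    by apply: ler_wpM2l.
  by apply: ler_pM.
- apply: le_trans (onrmZ _ _) _; rewrite ncC ger0_norm ?sqrtr_ge0 //.
  apply: (@le_trans _ _ (Num.sqrt C * 1)).
    by apply: ler_pM; [exact: sqrtr_ge0|exact: onrm_ge0|rewrite ler_wsqrtr|exact: onrm1].
  by rewrite mulr1 lerDl divr_ge0 ?mulr_ge0 ?(ltW k0).
- apply: (@le_trans _ _ (1 * (C / (2 * k)))); last by rewrite mul1r lerDr sqrtr_ge0.
  apply: ler_pM => //; first exact: onrm_ge0.
  apply: le_trans (onrmZ _ _) _; rewrite ncC normrM.
  have V0 : 0 <= (2 * u t)^-1 by rewrite invr_ge0 mulr_ge0 ?(ltW ut0).
  rewrite (ger0_norm V0) -[leRHS]mulr1; apply: ler_pM; [by rewrite mulr_ge0|exact: onrm_ge0| |exact: onrm1].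
  apply: ler_pM => //; rewrite lef_pV2 ?posrE ?mulr_gt0 //.
  by apply: ler_wpM2l => //; exact: uk.
Qed.

End ScalarFunctions.

Section PowerExpansion.
Context {R : realType}.
Variables (w : int -> R) (p : nat) (S : R).
Hypotheses (w0 : forall n, 0 <= w n) (wS : l2le (wgt w p) S).
Variables (e : int -> R[i]) (c : nat) (z0 : R[i]).
Hypotheses (e1 : forall x, nc (e x) <= 1) (z01 : nc z0 <= 1).

Definition spk m (z : R[i]) (x : int) : R[i] := e x * Sp z0 m (c * `|x|)%N z.
Definition dspk m (z : R[i]) (x : int) : R[i] := e x * DSp z0 m (c * `|x|)%N z.

Let K : R := (c.+1)%:R ^+ p.

Lemma natX_bound (k l : nat) (x : int) : (k <= l)%N -> (c * `|x|)%:R ^+ k <= (c.+1)%:R ^+ l * jap x ^+ l :> R.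
Proof.
move=> kp; have j1 := @jap_ge1 R x.
have absx : `|x|%N%:R <= jap x :> R.
  rewrite -(ler_pXn2r (n := 2)) ?nnegrE ?jap_ge0 // jap_sq.
  by rewrite natr_absz intr_norm real_normK ?num_real // lerDr.
have cj : 1 <= c.+1%:R * jap x :> R.
  by rewrite -[leLHS]mul1r ler_pM // ler1n.
apply: (@le_trans _ _ ((c.+1%:R * jap x) ^+ k)).
  apply: lerXn2r; rewrite ?nnegrE ?mulr_ge0 ?jap_ge0 // natrM.
  by apply: ler_pM => //; rewrite ler_nat.
by rewrite -exprMn; apply: ler_weXn2l.
Qed.

Lemma growth_of_pow (k : nat) C (g : int -> R[i]) : (k <= p)%N -> 0 <= C ->
  (forall x, nc (g x) <= C * (c * `|x|)%:R ^+ k) -> growth p (C * K) g.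
Proof.
move=> kp C0 H x; apply: le_trans (H x) _; rewrite -mulrA.
by apply: ler_wpM2l => //; exact: natX_bound.
Qed.

Lemma spk_growth m z : (m <= p)%N -> nc z <= 1 -> growth p (1 * K) (spk m z).
Proof.
move=> mp z1; apply: (growth_of_pow mp) => // x; rewrite mul1r /spk ncM.
apply: le_trans (Sp_bound z01 m _ z1); rewrite ler_piMl ?nc_ge0 //.
Qed.

Lemma dspk_growth m z : (m.+1 <= p)%N -> nc z <= 1 -> growth p (1 * K) (dspk m z).
Proof.
move=> mp z1; apply: (growth_of_pow mp) => // x; rewrite mul1r /dspk ncM.
apply: le_trans (DSp_bound z01 m _ z1); rewrite ler_piMl ?nc_ge0 //.
Qed.

Variables (d : R) (z rho : R -> R[i]).
Hypotheses (d0 : 0 < d) (z1 : forall t, nc (z t) <= 1)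
  (zE : forall t, 0 < t < d -> z t = z0 + t%:C * rho t)
  (rhoE : forall k, sE k d rho).

Definition Opow m (t : R) : bop R := Op w (spk m (z t)).

Lemma Opow_taylor m t : (m.+1 <= p)%N -> 0 < t < d ->
  Opow m t = Op w (spk m z0) + t%:C *: (rho t *: Opow m.+1 t).
Proof.
move=> mp td; rewrite scalerA addrC /Opow.
have g1 := spk_growth mp (z1 t); have g2 := spk_growth (ltnW mp) z01.
rewrite -(Op_lin w0 wS _ g1 g2); apply: Op_eq => x; rewrite /spk (Sp_taylor _ m).
by rewrite zE // addrAC subrr add0r; ring.
Qed.

Lemma z_deriv : exists z' C, forall t, 0 < t < d -> sq z t (z' t) /\ nc (z' t) <= C.
Proof.
have [D [C [C0 H]]] := rhoE 0.
exists (fun t => entry (rho t *: 1 + t%:C *: D t)), (C + C) => t td.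
have [h1 h2 h3] := H t td; split.
  apply: qder_sq.
  have q : qder (fun s => s%:C *: 1) t (1 : bop R).
    exists 0, 1; split=> // h _; rewrite rmorphD /= scalerDl.
    have -> : t%:C *: 1 + h%:C *: 1 - t%:C *: 1 - h%:C *: 1 = 0 :> bop R by abel.
    by rewrite mul0r; exact: onrm0.
  have := qderM q h1; rewrite mul1r -scalerAl mul1r => q2.
  have q3 := qderD (qder_const (z0 *: 1) t) q2; rewrite add0r in q3.
  apply: qder_in td _ q3 => s sd; rewrite zE // scalerDl -!scalerAl mul1r scalerA.
  by [].
apply: le_trans (entry_le _) _; apply: le_trans (onrmD _ _) _; apply: lerD => //.
apply: le_trans (onrmZ _ _) _; rewrite ncC gtr0_norm //.
by case/andP: td.
Qed.

Lemma Opow_qder m : (m.+2 <= p)%N -> forall t z', 0 < t < d -> sq z t z' ->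
  qder (Opow m) t (Op w (fun x => dspk m (z t) x * z')).
Proof.
move=> mp t z' td [C [d1 [C0 d10 H]]].
have mp1 := ltnW mp; have mp2 := ltnW mp1.
have Lz h : `|h| < Num.min 1 d1 -> nc (z (t + h) - z t) <= (C + nc z') * `|h|.
  rewrite lt_min => /andP[h1 /H {}H].
  rewrite -[z (t + h) - z t](subrK (h%:C * z')); apply: le_trans (ncD _ _) _.
  rewrite ncM ncC mulrDl [nc z' * _]mulrC; apply: lerD => //; apply: le_trans H _.
  by rewrite expr2 mulrA ler_piMr ?mulr_ge0 // ltW.
pose B := C + nc z'; have B0 : 0 <= B by rewrite addr_ge0 ?nc_ge0.
apply: (Op_qder w0 wS (C := (B ^+ 2 + C) * K)).
- by move=> s; exists (1 * K); exact: spk_growth.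
- exists (nc z' * (1 * K)) => x; rewrite mulrC; exact: (growthZ z' (dspk_growth mp1 (z1 t))).
- exists (Num.min 1 d1); first by rewrite lt_min ltr01.
  move=> h hd; have L := Lz h hd; have hd1 : `|h| < d1 by move: hd; rewrite lt_min => /andP[].
  have Hh := H h hd1.
  have P1 : growth p (nc (z (t + h) - z t) ^+ 2 * K)
      (fun x => e x * (Sp z0 m (c * `|x|) (z (t + h)) - Sp z0 m (c * `|x|) (z t)
          - (z (t + h) - z t) * DSp z0 m (c * `|x|) (z t))).
    apply: (growth_of_pow mp); first exact: sqr_ge0.
    move=> x; rewrite ncM; apply: le_trans (Sp_diff2 z01 m _ (z1 _) (z1 _)).
    by rewrite ler_piMl ?nc_ge0.
  have P2 := growthZ (z (t + h) - z t - h%:C * z') (dspk_growth mp1 (z1 t)).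
  move=> x; have := growthD P1 P2 x.
  rewrite [X in nc X <= _ -> _](_ : _ = spk m (z (t + h)) x - spk m (z t) x
      - h%:C * (dspk m (z t) x * z')); last by rewrite /spk /dspk; ring.
  move=> Hx; apply: le_trans Hx _; apply: ler_wpM2r; first by rewrite exprn_ge0 ?jap_ge0.
  have K0 : 0 <= K by rewrite exprn_ge0.
  rewrite mul1r -mulrDl mulrAC; apply: ler_wpM2r => //; rewrite mulrDl; apply: lerD => //.
  by rewrite -exprMn; apply: lerXn2r; rewrite ?nnegrE ?nc_ge0 ?mulr_ge0.
Qed.

Lemma Opow_bound m t : (m <= p)%N -> onrm (Opow m t) <= 1 * K * (2 ^+ p * S * S).
Proof. by move=> mp; case: (Op_bounded w0 wS (spk_growth mp (z1 t))). Qed.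

Lemma Opow_bG_low m : (m.+2 <= p)%N -> d <= 1 -> bG d (Opow m).
Proof.
move=> mp dle1; have [z' [C HC]] := z_deriv.
have K0 : 0 <= K by rewrite exprn_ge0.
have M0 : 0 <= 2 ^+ p * S * S by rewrite !mulr_ge0 ?exprn_ge0 ?wS.1.
have B0 : 0 <= 1 * K * (2 ^+ p * S * S) by rewrite !mulr_ge0 ?mul1r ?exprn_ge0 ?wS.1.
exists (fun t => Op w (fun x => dspk m (z t) x * z' t)),
  (1 * K * (2 ^+ p * S * S) + `|C| * (1 * K) * (2 ^+ p * S * S)).
have C1 : 0 <= `|C| * (1 * K) * (2 ^+ p * S * S) by rewrite !mulr_ge0 ?wS.1.
split; first exact: addr_ge0.
move=> t td; have [h1 h2] := HC t td; split.
- exact: Opow_qder.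
- by apply: le_trans (Opow_bound t (ltnW (ltnW mp))) _; rewrite lerDl.
- have [t0 tlt] := andP td.
  have t1 : t <= 1 by apply: le_trans (ltW tlt) dle1.
  apply: (@le_trans _ _ (1 * (`|C| * (1 * K) * (2 ^+ p * S * S)))); last by rewrite mul1r lerDr.
  apply: ler_pM => //; [exact: ltW|exact: onrm_ge0|].
  have g : growth p (`|C| * (1 * K)) (fun x => dspk m (z t) x * z' t).
    move=> x; rewrite mulrC; apply: le_trans (growthZ (z' t) (dspk_growth (ltnW mp) (z1 t)) x) _.
    apply: ler_wpM2r; first by rewrite exprn_ge0 ?jap_ge0.
    by apply: ler_wpM2r; [rewrite mul1r|exact: le_trans h2 (ler_norm _)].
  by case: (Op_bounded w0 wS g).
Qed.

Hypotheses (dle1 : d <= 1) (c0 : R) (c0_gt0 : 0 < c0)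
  (rho_low : forall t, 0 < t < d -> c0 <= nc (rho t)) (p2 : (1 < p)%N).

Let rho_neq0 t : 0 < t < d -> t%:C * rho t != 0.
Proof.
move=> td; have /andP[t0 _] := td; rewrite mulf_neq0 //.
  by rewrite eq_complex /= negb_and gt_eqF.
by rewrite -nc_eq0 gt_eqF // (lt_le_trans c0_gt0) // rho_low.
Qed.

Let K0 : 0 <= K. Proof. by rewrite exprn_ge0. Qed.
Let M := 2 ^+ p * S * S.
Let M0 : 0 <= M. Proof. by rewrite /M !mulr_ge0 ?exprn_ge0 ?wS.1. Qed.

Lemma dspkE m t x : 0 < t < d ->
  (t%:C * rho t) * dspk m.+1 (z t) x = dspk m (z t) x - spk m.+1 (z t) x.
Proof.
move=> td; rewrite /dspk /spk (DSp_taylor z0 m) zE // [z0 + _]addrC addrK.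
by ring.
Qed.

(* The generic bound on the derivative loses one power of <x>, which the weight
   does not allow for m = p; dividing by t instead of losing that power suffices. *)
Lemma dspk_growth_high m t : (m.+1 <= p)%N -> 0 < t < d ->
  growth p ((nc (t%:C * rho t))^-1 * (2 * K)) (dspk m.+1 (z t)).
Proof.
move=> mp td x; have y0 := rho_neq0 td.
have y1 : 0 < nc (t%:C * rho t) by rewrite lt_neqAle eq_sym nc_eq0 y0 nc_ge0.
rewrite -mulrA -(ler_pM2l y1) [leRHS]mulrA divff ?gt_eqF // mul1r.
rewrite -ncM dspkE //; apply: le_trans (ncB _ _) _.
have h1 := dspk_growth mp (z1 t) x; have h2 := spk_growth mp (z1 t) x.
by apply: le_trans (lerD h1 h2) _; rewrite -mulrDl -mulrDl.
Qed.

Lemma Opow_qder_all m : (m <= p)%N -> forall t z', 0 < t < d -> sq z t z' ->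
  qder (Opow m) t (Op w (fun x => dspk m (z t) x * z')).
Proof.
elim: m => [|m IH] mp t z' td Hz; first exact: Opow_qder.
have IHm := IH (ltnW mp) t z' td Hz.
pose y s := s%:C * rho s.
have [t0 tlt] := andP td.
have [e' e'0 He] : exists2 e', 0 < e' & forall h, `|h| < e' -> 0 < t + h < d /\ t / 2 <= t + h.
  exists (Num.min (t / 2) (d - t)); first by rewrite lt_min divr_gt0 // subr_gt0.
  move=> h; rewrite lt_min => /andP[b1 b2].
  move: b1 b2; rewrite !ltr_norml => /andP[a1 a2] /andP[b1 b2].
  have tt : t = t / 2 + t / 2 by rewrite -splitr.
  by split; [apply/andP; split|]; lra.
have qy : qder (fun s => y s *: 1) t (z' *: (1 : bop R)).
  have := qderD (sq_qder 1 Hz) (qder_const (- z0 *: 1) t); rewrite addr0.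
  apply: qder_in td _ => s sd; rewrite -scalerDl zE // /y.
  by rewrite [z0 + _]addrC addrK.
have qV : qder (fun s => (y s)^-1 *: 1) t
    (- (((y t)^-1 *: (1 : bop R)) * (z' *: 1) * ((y t)^-1 *: 1))).
  apply: (qder_inv (Y := fun s => y s *: 1)) qy.
    exists e' => // h /He [/rho_neq0 yh _].
    by rewrite -!scalerAl !mul1r !scalerA divff // mulVf // scale1r.
  exists (t / 2 * c0)^-1, e'; split=> //; first by rewrite invr_ge0 mulr_ge0 ?divr_ge0 ?ltW.
  move=> h /He [sd th]; rewrite expr0 mulr1.
  apply: le_trans (onrmZ _ _) _; rewrite Normc.normcV.
  apply: (@le_trans _ _ ((nc (y (t + h)))^-1 * 1)).
    by apply: ler_wpM2l; [rewrite invr_ge0 nc_ge0|exact: onrm1].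
  have sd0 : 0 < t + h by case/andP: sd.
  have yl : t / 2 * c0 <= nc (y (t + h)).
    rewrite /y ncM ncC gtr0_norm //; apply: ler_pM => //; [by rewrite divr_ge0 ?ltW|exact: ltW|exact: rho_low].
  have tc : 0 < t / 2 * c0 by rewrite mulr_gt0 ?divr_gt0.
  by rewrite mulr1 lef_pV2 ?posrE // (lt_le_trans tc).
have q1 := qderD IHm (qder_const (- Op w (spk m z0)) t); rewrite addr0 in q1.
have q2 := qderM qV q1.
have step s : 0 < s < d -> ((y s)^-1 *: 1) * (Opow m s + - Op w (spk m z0)) = Opow m.+1 s.
  move=> sd; rewrite (Opow_taylor mp sd) addrAC subrr add0r -scalerAl mul1r.
  by rewrite !scalerA -/(y s) mulVf ?scale1r //; exact: rho_neq0.
have q3 := qder_in td step q2.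
move: q3; rewrite [X in qder _ _ X](_ : _ = Op w (fun x => dspk m.+1 (z t) x * z')) //.
have yt := rho_neq0 td; rewrite -/(y t) in yt.
have {}step : Opow m t + - Op w (spk m z0) = y t *: Opow m.+1 t.
  by rewrite (Opow_taylor mp td) addrAC subrr add0r scalerA.
have sM a (X : bop R) : (a *: 1) * X = a *: X by rewrite -scalerAl mul1r.
rewrite step mulNr -!mulrA !sM !scalerA.
have gd := growthZ z' (dspk_growth mp (z1 t)).
have gs := spk_growth mp (z1 t).
rewrite (_ : Op w (fun x => dspk m (z t) x * z') = Op w (fun x => z' * dspk m (z t) x)); last first.
  by apply: Op_eq => x; rewrite mulrC.
rewrite -scaleNr -(OpZ w0 wS _ gs) addrC.
rewrite -(Op_lin w0 wS _ gd (growthZ _ gs)); apply: Op_eq => x.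
have := dspkE m x td; rewrite -/(y t) => DE.
have -> : dspk m (z t) x = y t * dspk m.+1 (z t) x + spk m.+1 (z t) x by rewrite DE subrK.
by field.
Qed.

Lemma Opow_bG m : (m <= p)%N -> bG d (Opow m).
Proof.
case: m => [|m] mp; first exact: Opow_bG_low.
have [z' [C HC]] := z_deriv.
pose B1 := 1 * K * M; pose B2 := `|C| * (2 * K) * M / c0.
have B10 : 0 <= B1 by rewrite /B1 mul1r mulr_ge0.
have B20 : 0 <= B2.
  apply: divr_ge0; last exact: ltW.
  by apply: mulr_ge0 => //; apply: mulr_ge0 => //; apply: mulr_ge0.
exists (fun t => Op w (fun x => dspk m.+1 (z t) x * z' t)), (B1 + B2); split; first exact: addr_ge0.
move=> t td; have [h1 h2] := HC t td; split.
- exact: Opow_qder_all.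
- by apply: le_trans (Opow_bound t mp) _; rewrite lerDl.
- apply: (@le_trans _ _ B2); last by rewrite lerDr.
  have [t0 tlt] := andP td.
  have g := growthZ (z' t) (dspk_growth_high mp td).
  rewrite (_ : Op w (fun x => dspk m.+1 (z t) x * z' t) = Op w (fun x => z' t * dspk m.+1 (z t) x)); last first.
    by apply: Op_eq => x; rewrite mulrC.
  apply: le_trans (ler_wpM2l (ltW t0) (Op_bounded w0 wS g).2) _.
  rewrite -/M ncM ncC gtr0_norm // invfM /B2.
  have r0 := lt_le_trans c0_gt0 (rho_low td).
  have -> : t * (nc (z' t) * (t^-1 / nc (rho t) * (2 * K)) * M) = nc (z' t) * (2 * K) * M / nc (rho t).
    by field; rewrite !gt_eqF.
  have V0 : 0 <= (nc (rho t))^-1 by rewrite invr_ge0 nc_ge0.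
  apply: ler_pM => //.
  + apply: mulr_ge0 => //; apply: mulr_ge0; [exact: nc_ge0|exact: mulr_ge0].
  + apply: ler_wpM2r => //; apply: ler_wpM2r; first exact: mulr_ge0.
    exact: le_trans h2 (ler_norm _).
  + by rewrite lef_pV2 ?posrE ?rho_low.
Qed.

Lemma Opow_E k m : (m + k <= p)%N -> E k d (Opow m).
Proof.
elim: k m => [|k IH] m mp; first by apply: Opow_bG; rewrite addn0 in mp.
have mp1 : (m.+1 + k <= p)%N by rewrite addSnnS.
exists (Op w (spk m z0)), (fun t => rho t *: Opow m.+1 t); split.
  by apply: sE_scale (rhoE k) (IH _ mp1).
by move=> t td; apply: Opow_taylor => //; apply: leq_trans mp1; rewrite leq_addr.
Qed.

End PowerExpansion.

Section PSeries.
Context {R : realType}.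

Lemma powR_telescope (y q : R) : 1 <= y -> 0 < q ->
  q * (y + 1) `^ (- (q + 1)) <= y `^ (- q) - (y + 1) `^ (- q).
Proof.
move=> y1 q0; have y0 : 0 < y by apply: lt_le_trans y1.
have yy0 : 0 < y + 1 by rewrite addr_gt0.
have H : 1 + q / (y + 1) <= ((y + 1) / y) `^ q.
  apply: (@le_trans _ _ (expR (1 / (y + 1)) `^ q)).
    rewrite /powR gt_eqF ?expR_gt0 // expRK; apply: le_trans (expR_ge1Dx _) _.
    by rewrite mul1r.
  apply: ge0_ler_powR; rewrite ?nnegrE ?(ltW q0) ?expR_ge0 ?divr_ge0 ?(ltW y0) ?(ltW yy0) //.
  rewrite -[leRHS]invrK -[leLHS]invrK lef_pV2 ?posrE ?invr_gt0 ?divr_gt0 ?expR_gt0 //.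
  rewrite -expRN invf_div; apply: le_trans (expR_ge1Dx _).
  by rewrite le_eqVlt; apply/orP; left; apply/eqP; field; rewrite gt_eqF.
have yq : (y + 1) `^ q = ((y + 1) / y) `^ q * y `^ q.
  by rewrite -powRM ?divr_ge0 ?(ltW y0) ?(ltW yy0) // divfK // gt_eqF.
have P1 : 0 < (y + 1) `^ q by rewrite powR_gt0.
have P2 : 0 < y `^ q by rewrite powR_gt0.
have P3 : (y + 1) `^ (q + 1) = (y + 1) `^ q * (y + 1).
  by rewrite powRD ?powRr1 ?(ltW yy0) // (gt_eqF yy0) implybT.
rewrite !powRN P3 -subr_ge0.
have -> : (y `^ q)^-1 - ((y + 1) `^ q)^-1 - q * ((y + 1) `^ q * (y + 1))^-1
   = ((y + 1) `^ q / y `^ q - (1 + q / (y + 1))) / (y + 1) `^ q.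
  by field; rewrite !gt_eqF.
by rewrite divr_ge0 ?(ltW P1) // subr_ge0 yq mulfK ?gt_eqF.
Qed.

Lemma sum_absz_le (f : nat -> R) C : (forall k, 0 <= f k) ->
  (forall N, \sum_(k < N) f k <= C) ->
  forall s : seq int, uniq s -> \sum_(n <- s) f `|n|%N <= C + C.
Proof.
move=> f0 fC.
have main (s : seq int) : uniq s -> {in s &, injective absz} -> \sum_(n <- s) f `|n|%N <= C.
  move=> us inj; rewrite -(big_map absz xpredT f).
  set t := map absz s; have ut : uniq t by rewrite map_inj_in_uniq.
  pose N := (\max_(k <- t) k).+1.
  apply: le_trans (fC N); rewrite -(big_mkord xpredT f).
  rewrite [leRHS](bigID (mem t)) /= -[leLHS]addr0; apply: lerD; last exact: sumr_ge0.
  suff pe : perm_eq t [seq i <- index_iota 0 N | i \in t].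
    by rewrite -[leRHS]big_filter (perm_big _ pe).
  apply: uniq_perm => //; first by rewrite filter_uniq // iota_uniq.
  move=> k; rewrite mem_filter mem_index_iota /=; case: (boolP (k \in t)) => //= kt.
  by rewrite ltnS; symmetry; apply: (@leq_bigmax_seq _ t xpredT id).
move=> s us; rewrite (bigID (fun n : int => 0 <= n)) /=; apply: lerD.
  rewrite -big_filter; apply: main; first exact: filter_uniq.
  move=> x y; rewrite !mem_filter => /andP[x0 _] /andP[y0 _] /eqP.
  by rewrite -eqz_nat !gez0_abs // => /eqP.
rewrite -big_filter; apply: main; first exact: filter_uniq.
move=> x y; rewrite !mem_filter => /andP[x0 _] /andP[y0 _] /eqP.
rewrite -eqz_nat -!ltNge in x0 y0 *; rewrite !ltz0_abs // => /eqP.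
exact: oppr_inj.
Qed.

Lemma jap_abs_le (k : nat) (x : int) : `|x|%N = k -> k%:R <= jap x :> R.
Proof.
move=> <-; rewrite -(ler_pXn2r (n := 2)) ?nnegrE ?jap_ge0 // jap_sq.
by rewrite natr_absz intr_norm real_normK ?num_real // lerDr.
Qed.

Lemma jap_series (p : R) : 1 < p ->
  exists2 C, 0 <= C & forall s : seq int, uniq s -> \sum_(n <- s) jap n `^ (- p) <= C.
Proof.
move=> p1; pose q := p - 1; have q0 : 0 < q by rewrite subr_gt0.
have p0 : 0 < p by apply: lt_trans p1.
pose C := 3 `^ p / q; have C0 : 0 <= C by rewrite divr_ge0 ?powR_ge0 ?(ltW q0).
pose f (k : nat) := C * ((k.+1)%:R `^ (- q) - (k.+2)%:R `^ (- q)).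
have ff k : jap k%:Z `^ (- p) <= f k.
  have k1 : 1 <= k.+1%:R :> R by rewrite ler1n.
  have T := powR_telescope k1 q0.
  rewrite natr1 (_ : q + 1 = p) in T; last by rewrite /q subrK.
  apply: (@le_trans _ _ (C * (q * k.+2%:R `^ (- p)))); last by apply: ler_wpM2l.
  rewrite /C mulrA divfK ?gt_eqF // !powRN ler_pdivlMr ?powR_gt0 //.
  rewrite mulrC ler_pdivrMr ?powR_gt0 ?jap_gt0 // -powRM ?jap_ge0 //.
  apply: ge0_ler_powR; rewrite ?nnegrE ?mulr_ge0 ?jap_ge0 ?(ltW p0) //.
  have := @jap_ge1 R k%:Z; have := @jap_abs_le k k%:Z erefl.
  by rewrite -[k.+2]addn2 natrD => h1 h2; lra.
have f0 k : 0 <= f k by apply: le_trans (ff k); exact: powR_ge0.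
have fs N : \sum_(k < N) f k <= C.
  have -> : \sum_(k < N) f k = C * (1 - N.+1%:R `^ (- q)).
    elim: N => [|N IH]; first by rewrite big_ord0 powR1 subrr mulr0.
    rewrite big_ord_recr /= IH /f; ring.
  rewrite -[leRHS]mulr1; apply: ler_wpM2l => //.
exists (C + C); first exact: addr_ge0.
move=> s us; apply: le_trans (sum_absz_le f0 fs us).
apply: ler_sum => n _; apply: le_trans (ff _).
by rewrite /jap -!intr_norm abszE !normr_id.
Qed.

Lemma jap_l2 (q : R) : 1 / 2 < q -> exists S, l2le (fun n => (jap n `^ (- q))%:C) S.
Proof.
move=> q2; have p1 : 1 < 2 * q by move: q2; rewrite ltr_pdivrMr // mulrC.
have [C C0 H] := jap_series p1.
exists (Num.sqrt C); split; first exact: sqrtr_ge0.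
move=> s us; rewrite sqr_sqrtr //; apply: le_trans (H s us).
apply: ler_sum => n _; rewrite ncC ger0_norm ?powR_ge0 // powR_sq.
by rewrite mulrN.
Qed.

Lemma geom_int_sum (r : R) : 0 <= r < 1 -> forall s : seq int, uniq s ->
  \sum_(n <- s) r ^+ `|n|%N <= (1 - r)^-1 + (1 - r)^-1.
Proof.
move=> r01; apply: sum_absz_le; last by move=> N; exact: geom_sum_le.
by move=> k; rewrite exprn_ge0 //; case/andP: r01.
Qed.

End PSeries.

Section Convolution.
Context {R : realType}.
Implicit Types (G phi u : seqZ R) (c B : R).

Definition convol G : opZ R := kop (fun n m => G (n - m)).

Lemma sumle_bounded G phi B c : 0 <= c -> sumle G B -> (forall m, nc (phi m) <= c) ->
  sumle (fun m => G m * phi m) (B * c).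
Proof.
move=> c0 GB pc s us; apply: le_trans (ler_wpM2r c0 (GB s us)).
rewrite mulr_suml; apply: ler_sum => m _; rewrite ncM; apply: ler_wpM2l => //; exact: nc_ge0.
Qed.

Lemma sumle_shift G B (n : int) : sumle G B -> sumle (fun m => G (n - m)) B.
Proof.
move=> GB; have K : cancel (fun m : int => n - m) (fun m => n - m).
  by move=> m; rewrite opprB addrC subrK.
exact: (csum_reindex K K GB).1.
Qed.

Lemma convol_sumle G phi B c n : sumle G B -> l2le phi c ->
  sumle (fun m => G (n - m) * phi m) (B * c).
Proof.
move=> GB H; apply: sumle_bounded; [by case: H|exact: sumle_shift|].
by move=> m; exact: l2le_coord.
Qed.

Lemma convol_linear G B : sumle G B -> linear_on (l2w 0) (convol G).
Proof.
move=> GB z phi psi /l2P[c Hc] /l2P[d Hd]; apply/funext => n.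
rewrite [RHS](_ : _ = z * convol G phi n + convol G psi n) // /convol /kop.
rewrite -(csumZ z (convol_sumle n GB Hc)) -(csumD (sumleZ z (convol_sumle n GB Hc)) (convol_sumle n GB Hd)).
by apply: eq_csum => m; rewrite [(z *: phi + psi) m](_ : _ = z * phi m + psi m) //; ring.
Qed.

Lemma weighted_CS (a b : int -> R) (s : seq int) : uniq s ->
  (forall n, 0 <= a n) -> (forall n, 0 <= b n) ->
  (\sum_(n <- s) a n * b n) ^+ 2 <= (\sum_(n <- s) a n) * (\sum_(n <- s) a n * b n ^+ 2).
Proof.
move=> us a0 b0.
pose f (g : int -> R) : seqZ R := fun n => if n \in s then (g n)%:C else 0.
have fl g : l2le (f g) (Num.sqrt (\sum_(n <- s) g n ^+ 2)).
  split; first exact: sqrtr_ge0.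
  have S0 : 0 <= \sum_(n <- s) g n ^+ 2 by apply: sumr_ge0 => n _; exact: sqr_ge0.
  move=> t ut; rewrite sqr_sqrtr //.
  rewrite (bigID (mem s)) /= [X in _ + X]big1 ?addr0; last first.
    by move=> n /negbTE ns; rewrite /f ns nc0 expr0n.
  rewrite -big_filter.
  apply: le_trans (@sub_sum_le _ (fun n => g n ^+ 2) _ s (fun n => sqr_ge0 _) (filter_uniq (mem s) ut) us _).
    2: by move=> n; rewrite mem_filter => /andP[].
  rewrite le_eqVlt; apply/orP; left; apply/eqP.
  rewrite !big_filter; apply: eq_bigr => n ns; rewrite /f ns ncC.
  by rewrite real_normK ?num_real.
have A0 : 0 <= \sum_(n <- s) a n by exact: sumr_ge0.
have D0 : 0 <= \sum_(n <- s) a n * b n ^+ 2.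
  by apply: sumr_ge0 => n _; rewrite mulr_ge0 ?sqr_ge0.
have H := sum_CS (fl (fun n => Num.sqrt (a n))) (fl (fun n => Num.sqrt (a n) * b n)) us.
have E1 : \sum_(n <- s) nc (f (fun n => Num.sqrt (a n)) n) * nc (f (fun n => Num.sqrt (a n) * b n) n)
    = \sum_(n <- s) a n * b n.
  rewrite big_seq [RHS]big_seq; apply: eq_bigr => n ns; rewrite /f ns !ncC.
  by rewrite !ger0_norm ?mulr_ge0 ?sqrtr_ge0 // mulrA -expr2 sqr_sqrtr.
rewrite {}E1 in H.
have E2 : \sum_(n <- s) Num.sqrt (a n) ^+ 2 = \sum_(n <- s) a n.
  by apply: eq_bigr => n _; rewrite sqr_sqrtr.
have E3 : \sum_(n <- s) (Num.sqrt (a n) * b n) ^+ 2 = \sum_(n <- s) a n * b n ^+ 2.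
  by apply: eq_bigr => n _; rewrite exprMn sqr_sqrtr.
rewrite {}E2 {}E3 -sqrtrM // in H.
have L0 : 0 <= \sum_(n <- s) a n * b n by apply: sumr_ge0 => n _; rewrite mulr_ge0.
rewrite -[leRHS]sqr_sqrtr ?mulr_ge0 //.
by apply: lerXn2r; rewrite ?nnegrE ?sqrtr_ge0.
Qed.

Lemma convol_bound G B phi c : sumle G B -> l2le phi c -> l2le (convol G phi) (B * c).
Proof.
move=> GB H; have c0 := H.1; have B0 := sumle_ge0 GB.
have ex j : exists s0, uniq s0 /\ l2le (offseq s0 phi) (j.+1%:R^-1).
  by have [s0 us Hs] := l2_tail H (e := j.+1%:R^-1) ltac:(by rewrite invr_gt0); exists s0.
pose t j := projT1 (cid (ex j)).
have tP j : uniq (t j) /\ l2le (offseq (t j) phi) (j.+1%:R^-1) := projT2 (cid (ex j)).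
apply: (@l2le_fatou _ (fun j n => \sum_(m <- t j) G (n - m) * phi m)).
- move=> j; split; first exact: mulr_ge0.
  move=> s us; have [ut _] := tP j.
  apply: (@le_trans _ _ (\sum_(n <- s) B * \sum_(m <- t j) nc (G (n - m)) * nc (phi m) ^+ 2)).
    apply: ler_sum => n _.
    apply: (@le_trans _ _ ((\sum_(m <- t j) nc (G (n - m)) * nc (phi m)) ^+ 2)).
      apply: lerXn2r; rewrite ?nnegrE ?nc_ge0 //.
        by apply: sumr_ge0 => m _; rewrite mulr_ge0 ?nc_ge0.
      apply: le_trans (nc_sum _ _) _.
      by rewrite le_eqVlt; apply/orP; left; apply/eqP; apply: eq_bigr => m _; rewrite ncM.
    have W := weighted_CS ut (fun m => nc_ge0 (G (n - m))) (fun m => nc_ge0 (phi m)).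
    apply: le_trans W _; apply: ler_wpM2r.
      by apply: sumr_ge0 => m _; rewrite mulr_ge0 ?nc_ge0 ?sqr_ge0.
    exact: sumle_shift GB _ ut.
  rewrite -mulr_sumr exprMn [B ^+ 2]expr2 -mulrA; apply: ler_wpM2l => //.
  rewrite exchange_big /=.
  apply: (@le_trans _ _ (\sum_(m <- t j) B * nc (phi m) ^+ 2)).
    apply: ler_sum => m _; rewrite -mulr_suml; apply: ler_wpM2r; first exact: sqr_ge0.
    have K1 : cancel (fun n : int => n - m) (fun n => n + m) by move=> n; rewrite subrK.
    have K2 : cancel (fun n : int => n + m) (fun n => n - m) by move=> n; rewrite addrK.
    exact: (csum_reindex K1 K2 GB).1.
  by rewrite -mulr_sumr; apply: ler_wpM2l => //; case: H => _; apply.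
- move=> n e e0.
  pose j0 := Num.truncn (B / e); exists j0 => j jj.
  have [ut tl] := tP j.
  have cH := convol_sumle n GB H.
  have co := convol_sumle n GB tl.
  have E : convol G phi n = \sum_(m <- t j) G (n - m) * phi m
      + csum (fun m => G (n - m) * offseq (t j) phi m).
    pose g m := if m \in t j then G (n - m) * phi m else 0.
    have gf : csum g = \sum_(m <- t j) G (n - m) * phi m.
      rewrite (@csum_fin _ g (t j)) //; last by move=> m /negbTE h; rewrite /g h.
      by rewrite big_seq [RHS]big_seq; apply: eq_bigr => m h; rewrite /g h.
    have gc : sumle g (B * c).
      apply: sumle_dom cH => m; rewrite /g; case: ifP => // _; rewrite nc0; exact: nc_ge0.
    rewrite -gf -(csumD gc co); apply: eq_csum => m; rewrite /g /offseq.
    by case: ifP => _; rewrite ?mulr0 ?addr0 ?add0r.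
  rewrite E opprD addrA subrr sub0r ncN.
  apply: le_trans (csum_norm co) _.
  rewrite ler_pdivrMr // mulrC -ler_pdivrMr //.
  have := truncnS_gt (B / e); rewrite -/j0 => /ltW /le_trans; apply.
  by rewrite ler_nat.
Qed.

Lemma lap_convol G u : (forall n, exists c, sumle (fun m => G (n - m) * u m) c) ->
  lap (convol G u) = convol (lap G) u.
Proof.
move=> H; apply/funext => n; rewrite /lap /convol /kop.
have [c1 H1] := H (n + 1); have [c2 H2] := H (n - 1); have [c3 H3] := H n.
have -> : csum (fun m => (G (n - m + 1) + G (n - m - 1) - 2%:R * G (n - m)) * u m)
   = csum (fun m => (G (n + 1 - m) * u m + G (n - 1 - m) * u m) + (- 2%:R) * (G (n - m) * u m)).
  apply: eq_csum => m; rewrite [n + 1 - m]addrAC [n - 1 - m]addrAC; ring.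
rewrite (csumD (sumleD H1 H2) (sumleZ _ H3)) (csumD H1 H2) (csumZ _ H3).
by rewrite mulNr.
Qed.

Lemma convol_lap G B phi c : sumle G B -> l2le phi c ->
  convol G (lap phi) = convol (lap G) phi.
Proof.
move=> GB H; apply/funext => n; rewrite /lap /convol /kop.
have S3 := convol_sumle n GB H.
have K1 : cancel (fun m : int => m + 1) (fun m => m - 1) by move=> m; rewrite addrK.
have K2 : cancel (fun m : int => m - 1) (fun m => m + 1) by move=> m; rewrite subrK.
have [R1 E1] := csum_reindex K1 K2 (convol_sumle (n + 1) GB H).
have [R2 E2] := csum_reindex K2 K1 (convol_sumle (n - 1) GB H).
have -> : csum (fun m => G (n - m) * (phi (m + 1) + phi (m - 1) - 2%:R * phi m))
  = csum (fun m => (G (n + 1 - (m + 1)) * phi (m + 1) + G (n - 1 - (m - 1)) * phi (m - 1))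
        + (- 2%:R) * (G (n - m) * phi m)).
  apply: eq_csum => m.
  rewrite (_ : n + 1 - (m + 1) = n - m); last by ring.
  rewrite (_ : n - 1 - (m - 1) = n - m); last by ring.
  by ring.
rewrite (csumD (sumleD R1 R2) (sumleZ _ S3)) (csumD R1 R2) (csumZ _ S3) E1 E2.
rewrite -(csumZ _ S3) -(csumD (convol_sumle (n + 1) GB H) (convol_sumle (n - 1) GB H)).
rewrite -(csumD (sumleD (convol_sumle (n + 1) GB H) (convol_sumle (n - 1) GB H)) (sumleZ _ S3)).
apply: eq_csum => m; rewrite [n + 1 - m]addrAC [n - 1 - m]addrAC; ring.
Qed.

Lemma l2le_shift phi c (k : int) : l2le phi c -> l2le (fun n => phi (n + k)) c.
Proof.
move=> [c0 H]; split=> // s us; rewrite -(big_map (fun n => n + k) xpredT (fun n => nc (phi n) ^+ 2)).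
by apply: H; rewrite map_inj_uniq //; exact: addIr.
Qed.

Lemma lap_bound phi c : l2le phi c -> l2le (lap phi) (4 * c).
Proof.
move=> H; have h1 := l2le_shift 1 H; have h2 := l2le_shift (-1) H.
have := l2leD (l2leD h1 h2) (l2leZ (- 2%:R) H).
rewrite ncN (_ : nc 2%:R = 2); last by rewrite -(rmorph_nat (real_complex R)) ncC normr_nat.
rewrite (_ : c + c + 2 * c = 4 * c); last by ring.
congr (l2le _ _); apply/funext => n.
by rewrite /lap -[RHS]/(phi (n + 1) + phi (n - 1) - 2%:R * phi n) -mulNr.
Qed.

End Convolution.

Section FreeResolvent.
Context {R : realType}.
Implicit Types (z w zeta a : R[i]) (x : int).

Definition hker zeta x : R[i] := zeta ^+ `|x|%N / (zeta^-1 - zeta).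
Definition fker w zeta1 zeta2 x : R[i] := (2%:R * w)^-1 * (hker zeta1 x - hker zeta2 x).

Lemma lap_abs (f : nat -> R[i]) x :
  lap (fun y => f `|y|%N) x =
  if x == 0 then 2%:R * f 1%N - 2%:R * f 0%N
  else f `|x|.+1 + f `|x|.-1 - 2%:R * f `|x|%N.
Proof.
rewrite /lap; case: eqP => [->|/eqP x0]; first by rewrite add0r sub0r absz0 /=; ring.
have [p|p] := ltrP 0 x.
  by rewrite (_ : absz (x + 1) = (absz x).+1) 1?(_ : absz (x - 1) = (absz x).-1) //; lia.
rewrite (_ : absz (x + 1) = (absz x).-1) 1?(_ : absz (x - 1) = (absz x).+1); [|lia|lia].
by rewrite [f (absz x).-1 + _]addrC.
Qed.

Lemma lap_hker w zeta : zeta != 0 -> zeta^-1 - zeta != 0 -> 2%:R - zeta - zeta^-1 = w ->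
  lap (hker zeta) = - w *: hker zeta - delta 0.
Proof.
move=> z0 d0 E; apply/funext => x.
rewrite (lap_abs (fun k => zeta ^+ k / (zeta^-1 - zeta))).
rewrite [RHS](_ : _ = - w * hker zeta x - delta 0 x) // /hker /delta -E.
have q0 : 1 - zeta * zeta != 0.
  by apply: contra d0 => /eqP H; rewrite -(mulrI_eq0 _ (lregP z0)) mulrBr divff // H.
case: eqP => [->|/eqP x0]; first by rewrite absz0 expr0 expr1; field; rewrite mulNr q0 z0.
have [k ->] : exists k, `|x|%N = k.+1 by exists `|x|.-1; lia.
by rewrite /= !exprS; field; rewrite mulNr q0 z0.
Qed.

Lemma lapD (phi psi : seqZ R) : lap (phi + psi) = lap phi + lap psi.
Proof.
apply/funext => n; rewrite /lap -[RHS]/(_ + _ - _ + (_ + _ - _)).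
by rewrite -![(phi + psi) _]/(_ + _); ring.
Qed.

Lemma lapZ (c : R[i]) (phi : seqZ R) : lap (c *: phi) = c *: lap phi.
Proof.
apply/funext => n; rewrite /lap -[RHS]/(c * (_ + _ - _)).
by rewrite -![(c *: phi) _]/(_ * _); ring.
Qed.

Lemma lapB (phi psi : seqZ R) : lap (phi - psi) = lap phi - lap psi.
Proof. by rewrite -scaleN1r lapD lapZ scaleN1r. Qed.

Lemma bilap_fker w zeta1 zeta2 : w != 0 -> zeta1 != 0 -> zeta2 != 0 ->
  zeta1^-1 - zeta1 != 0 -> zeta2^-1 - zeta2 != 0 ->
  2%:R - zeta1 - zeta1^-1 = w -> 2%:R - zeta2 - zeta2^-1 = - w ->
  bilap (fker w zeta1 zeta2) = w ^+ 2 *: fker w zeta1 zeta2 + delta 0.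
Proof.
move=> w0 a0 b0 a1 b1 E1 E2.
have F : fker w zeta1 zeta2 = (2%:R * w)^-1 *: (hker zeta1 - hker zeta2) by apply/funext.

rewrite F /bilap /= [lap (_ *: (hker zeta1 - _))]lapZ [lap (hker zeta1 - _)]lapB.
rewrite (lap_hker a0 a1 E1) (lap_hker b0 b1 E2) opprK [lap (_ *: (_ - _))]lapZ.
rewrite [lap (_ - (w *: _ - _))]lapB [lap (- w *: _ - _)]lapB [lap (w *: _ - _)]lapB.
rewrite [lap (- w *: _)]lapZ [lap (w *: _)]lapZ (lap_hker a0 a1 E1) (lap_hker b0 b1 E2) opprK.
move: (hker zeta1) (hker zeta2) (delta 0) (lap (delta 0)) => f g h k.
apply/funext => x.
rewrite -[LHS]/((2%:R * w)^-1 * ((- w * (- w * f x - h x) - k x) - (w * (w * g x - h x) - k x))).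
rewrite -[RHS]/(w ^+ 2 * ((2%:R * w)^-1 * (f x - g x)) + h x).
by field.
Qed.

Lemma hker_sumle zeta : nc zeta < 1 -> exists B, sumle (hker zeta) B.
Proof.
move=> z1; have r01 : 0 <= nc zeta < 1 by rewrite nc_ge0.
have H : sumle (fun x : int => zeta ^+ `|x|%N) ((1 - nc zeta)^-1 + (1 - nc zeta)^-1).
  by move=> s us; under eq_bigr do rewrite ncX; exact: geom_int_sum.
exists (nc (zeta^-1 - zeta)^-1 * ((1 - nc zeta)^-1 + (1 - nc zeta)^-1)).
have -> : hker zeta = (fun x => (zeta^-1 - zeta)^-1 * zeta ^+ `|x|%N).
  by apply/funext => x; rewrite /hker mulrC.
exact: sumleZ H.
Qed.

Lemma fker_sumle w zeta1 zeta2 : nc zeta1 < 1 -> nc zeta2 < 1 ->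
  exists B, sumle (fker w zeta1 zeta2) B.
Proof.
move=> /hker_sumle[B1 H1] /hker_sumle[B2 H2]; eexists.
apply: (@sumle_dom _ _ (fun x => (2%:R * w)^-1 * (hker zeta1 x + -1 * hker zeta2 x))).
  by move=> x; rewrite /fker mulN1r lexx.
exact: sumleZ (sumleD H1 (sumleZ _ H2)).
Qed.

Lemma convol_delta (phi : seqZ R) : convol (delta 0) phi = phi.
Proof.
apply/funext => n; rewrite /convol /kop (@csum_fin _ _ [:: n]) //.
  by rewrite big_seq1 /delta subrr eqxx mul1r.
by move=> m; rewrite inE /delta subr_eq0 eq_sym => /negbTE ->; rewrite mul0r.
Qed.

Lemma lap_sumle (G : seqZ R) B : sumle G B -> exists B', sumle (lap G) B'.
Proof.
move=> H; have K k : sumle (fun x => G (x + k)) B.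
  have K1 : cancel (fun m : int => m + k) (fun m => m - k) by move=> m; rewrite addrK.
  have K2 : cancel (fun m : int => m - k) (fun m => m + k) by move=> m; rewrite subrK.
  exact: (csum_reindex K1 K2 H).1.
eexists; apply: (@sumle_dom _ _ (fun x => (G (x + 1) + G (x - 1)) + (- 2%:R) * G x)).
  by move=> x; rewrite /lap mulNr lexx.
exact: sumleD (sumleD (K 1) (K (-1))) (sumleZ _ H).
Qed.

Lemma wnormZ t (z : R[i]) (phi : seqZ R) c : 0 <= c -> (wnorm t phi <= c%:E)%E ->
  (wnorm t (z *: phi) <= (nc z * c)%:E)%E.
Proof.
move=> c0; rewrite (wnorm_jmul t phi) (wnorm_jmul t (z *: phi)) => /(wnormP _ c0) H.
have E : jmul t (z *: phi) = z *: jmul t phi.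
  apply/funext => n; rewrite -[RHS]/(z * ((jap n `^ t)%:C * phi n)) /jmul.
  by rewrite -[(z *: phi) n]/(z * phi n) mulrCA.
by rewrite E; apply/wnormP; [rewrite mulr_ge0 ?nc_ge0|exact: l2leZ].
Qed.

Lemma opnorm_app t t' (A : opZ R) C (phi : seqZ R) c : linear_on (l2w t) A -> 0 <= C ->
  (opnorm t t' A <= C%:E)%E -> 0 < c -> (wnorm t phi <= c%:E)%E ->
  (wnorm t' (A phi) <= (C * c)%:E)%E.
Proof.
move=> lin C0 HC c0 H.
have V0 : 0 <= c^-1 by rewrite invr_ge0 ltW.
have H1 : (wnorm t (c^-1%:C *: phi) <= 1)%E.
  by have := wnormZ c^-1%:C (ltW c0) H; rewrite ncC ger0_norm // mulVf ?gt_eqF.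
have L1 : l2w t (c^-1%:C *: phi) by apply: le_lt_trans H1 _; rewrite ltry.
have L : l2w t phi by apply: le_lt_trans H _; rewrite ltry.
have L0 : l2w t 0.
  by have := wnormZ 0 (ltW c0) H; rewrite scale0r nc0 mul0r => /le_lt_trans; apply; rewrite ltry.
have A0 : A 0 = 0.
  have := lin 1 0 0 L0 L0; rewrite scale1r addr0 scale1r => E.
  by apply: (addrI (A 0)); rewrite addr0 -E.
have HA : (wnorm t' (A (c^-1%:C *: phi)) <= C%:E)%E.
  by apply: le_trans HC; apply: ereal_sup_ubound; exists (c^-1%:C *: phi).
have := wnormZ c%:C C0 HA; rewrite ncC (ger0_norm (ltW c0)) mulrC.
have := lin c%:C _ 0 L1 L0; rewrite addr0 A0 addr0 scalerA -rmorphM divff ?gt_eqF // scale1r.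
by move=> ->.
Qed.

Lemma Bop_bounded (A : opZ R) : Bop 0 0 A -> bounded_op A.
Proof.
move=> [lin fin]; split=> //.
have [C [C0 HC]] : exists C, 0 <= C /\ (opnorm 0 0 A <= C%:E)%E.
  case: (opnorm 0 0 A) fin => [r _|//|_]; last by exists 0; rewrite leNye.
  by exists `|r|; rewrite lee_fin ler_norm.
exists C => // phi c H; have c0 := H.1.
apply: l2le_eps; first exact: mulr_ge0.
move=> e e0; have C1 : 0 < C + 1 by rewrite ltr_wpDl.
have ce : 0 < c + e / (C + 1) by rewrite ltr_wpDl // divr_gt0.
have W := opnorm_app lin C0 HC ce (_ : (wnorm 0 phi <= _)%E).
have {}W : l2le (A phi) (C * (c + e / (C + 1))).
  apply/wnormP; first by rewrite mulr_ge0 // ltW.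
  apply: W; apply/wnormP; first exact: ltW.
  by apply: l2le_le H; rewrite lerDl divr_ge0 // ltW.
apply: l2le_le W; rewrite mulrDr lerD2l mulrCA ler_piMr ?(ltW e0) //.
by rewrite ler_pdivrMr // mul1r lerDl.
Qed.

Lemma Bop00 (A : opZ R) C : 0 <= C -> linear_on (l2w 0) A ->
  (forall phi c, l2le phi c -> l2le (A phi) (C * c)) -> Bop 0 0 A.
Proof.
move=> C0 Al HC; split=> //; apply: le_lt_trans (_ : _ <= C%:E)%E _; last by rewrite ltry.
apply: ge_ereal_sup => _ [phi /= p1 <-].
by apply/wnormP => //; rewrite -[C]mulr1; apply: HC; apply/wnormP.
Qed.

Lemma resolvent_inverse w zeta1 zeta2 : w != 0 -> zeta1 != 0 -> zeta2 != 0 ->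
  nc zeta1 < 1 -> nc zeta2 < 1 ->
  zeta1^-1 - zeta1 != 0 -> zeta2^-1 - zeta2 != 0 ->
  2%:R - zeta1 - zeta1^-1 = w -> 2%:R - zeta2 - zeta2^-1 = - w ->
  op_inverse (fun phi => bilap phi - w ^+ 2 *: phi) (convol (fker w zeta1 zeta2)).
Proof.
move=> w0 a0 b0 a2 b2 a1 b1 E1 E2; set G := fker w zeta1 zeta2.
have BG := bilap_fker w0 a0 b0 a1 b1 E1 E2; rewrite -/G in BG.
have [B HB] := fker_sumle w a2 b2; rewrite -/G in HB.
have B0 := sumle_ge0 HB; have [B' HB'] := lap_sumle HB.
have convD phi c : l2le phi c -> convol (w ^+ 2 *: G + delta 0) phi = w ^+ 2 *: convol G phi + phi.
  move=> H; transitivity (w ^+ 2 *: convol G phi + convol (delta 0) phi); last first.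
    by rewrite convol_delta.
  apply/funext => n.
  rewrite -[RHS]/(w ^+ 2 * convol G phi n + convol (delta 0) phi n) /convol /kop.
  have S0 : sumle (fun m => delta 0 (n - m) * phi m) c.
    move=> s us; case: (boolP (n \in s)) => ns.
      rewrite (bigD1_seq n) //= big1; last first.
        move=> m; rewrite /delta subr_eq0 eq_sym => /negbTE ->; rewrite mul0r; exact: nc0.
      by rewrite addr0 /delta subrr eqxx mul1r; exact: l2le_coord.
    rewrite big_seq big1; first by case: H.
    move=> m ms; rewrite /delta subr_eq0; case: eqP => [e|_]; last by rewrite mul0r nc0.
    by move: ns; rewrite e ms.
  rewrite -(csumZ _ (convol_sumle n HB H)) -(csumD (sumleZ _ (convol_sumle n HB H)) S0).
  apply: eq_csum => m; rewrite -[(w ^+ 2 *: G + delta 0) _]/(w ^+ 2 * G (n - m) + delta 0 (n - m)); ring.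
have cs phi c : l2le phi c -> forall n, exists c', sumle (fun m => G (n - m) * phi m) c'.
  by move=> H n; eexists; exact: convol_sumle HB H.
have cs' phi c : l2le phi c -> forall n, exists c', sumle (fun m => lap G (n - m) * phi m) c'.
  by move=> H n; eexists; exact: convol_sumle HB' H.
split.
- apply: (@Bop00 _ (16 + nc (w ^+ 2))).
  + by rewrite addr_ge0 ?nc_ge0.
  + move=> c phi psi _ _; rewrite /bilap /= (lapD (c *: phi)) lapZ (lapD (c *: lap phi)) lapZ.
    have L (x y u v : seqZ R) :
        c *: x + y - w ^+ 2 *: (c *: u + v) = c *: (x - w ^+ 2 *: u) + (y - w ^+ 2 *: v).
      apply/funext => n; rewrite -[LHS]/(c * x n + y n - w ^+ 2 * (c * u n + v n)).
      by rewrite -[RHS]/(c * (x n - w ^+ 2 * u n) + (y n - w ^+ 2 * v n)); ring.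
    exact: L.
  + move=> phi c H; rewrite mulrDl; apply: l2leD; last by apply: l2leN; exact: l2leZ.
    by rewrite (_ : 16 * c = 4 * (4 * c)); [do 2 apply: lap_bound|ring].
- apply: (Bop00 B0); first exact: convol_linear HB.
  by move=> phi c; exact: convol_bound.
- move=> phi /l2P[c Hc]; split.
  + rewrite /bilap /= (lap_convol (cs _ _ Hc)) (lap_convol (cs' _ _ Hc)) -[lap (lap G)]/(bilap G) BG.
    by rewrite (convD _ _ Hc) addrAC subrr add0r.
  + have L1 := lap_bound Hc; have L2 := lap_bound L1.
    have lin := convol_linear HB; rewrite addrC -scaleNr.
    rewrite lin; [|exact: l2le_l2 Hc|exact: l2le_l2 L2].
    rewrite (convol_lap HB L1) (convol_lap HB' Hc) -[lap (lap G)]/(bilap G) BG (convD _ _ Hc).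
    by rewrite scaleNr addKr.
Qed.

Lemma resolventE z B : op_inverse (fun phi : seqZ R => bilap phi - z *: phi) B ->
  forall phi, l2w 0 phi -> resolvent bilap z phi = B phi.
Proof.
move=> HB phi Hp.
have ex : exists B, op_inverse (fun phi : seqZ R => bilap phi - z *: phi) B by exists B.
have [_ rb ri] := xgetPex (0 : opZ R) ex; rewrite -/(resolvent bilap z) in rb ri.
have [_ bb bi] := HB.
have L : l2w 0 (resolvent bilap z phi).
  have [_ [C C0 HC]] := Bop_bounded rb; have [c Hc] := (l2P phi).1 Hp.
  exact: l2le_l2 (HC _ _ Hc).
have [_ b2] := bi _ L; have [r1 _] := ri _ Hp.
by rewrite -b2 r1.
Qed.

End FreeResolvent.

Section Roots.
Context {R : realType}.
Implicit Types (w zeta a b : R[i]) (t e d C : R).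

Lemma csqrt_exists w : exists v : R[i], v ^+ 2 = w.
Proof. by exists (sqrtC w); exact: sqrtCK. Qed.

Lemma root_in_disc w : complex.Im w != 0 -> exists zeta,
  [/\ zeta != 0, nc zeta < 1, 2%:R - zeta - zeta^-1 = w & 0 < complex.Im w * complex.Im zeta].
Proof.
move=> w0; have [v Hv] := csqrt_exists (w ^+ 2 - 4%:R * w).
pose r1 := (2%:R - w + v) / 2%:R; pose r2 := (2%:R - w - v) / 2%:R.
have P : r1 * r2 = 1.
  have -> : r1 * r2 = ((2%:R - w) ^+ 2 - v ^+ 2) / 4%:R by rewrite /r1 /r2; field.
  by rewrite Hv; field.
have Sm : r1 + r2 = 2%:R - w by rewrite /r1 /r2; field.
have [zeta [eta [zle P' S']]] : exists zeta eta : R[i],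
    [/\ nc zeta <= 1, zeta * eta = 1 & zeta + eta = 2%:R - w].
  have [h|h] := lerP (nc r1) 1; first by exists r1, r2.
  exists r2, r1; split; [|by rewrite mulrC|by rewrite addrC].
  have := congr1 (fun z : R[i] => nc z) P; rewrite ncM nc1 => h2.
  have n2 := nc_ge0 r2; have := ler_wpM2r n2 (ltW h); rewrite h2 mul1r //.
have z0 : zeta != 0.
  by apply/eqP => h; move: P'; rewrite h mul0r => /eqP; rewrite eq_sym oner_eq0.
have eE : eta = zeta^-1 by apply: (mulfI z0); rewrite P' divff.
have E : 2%:R - zeta - zeta^-1 = w.
  by rewrite -eE -addrA -opprD S' opprB addrC subrK.
have Q : zeta + zeta - zeta * zeta - 1 = w * zeta.
  by rewrite -[in RHS]E; field.
move: zle z0 Q w0 E {eE P' S'}; case: w {Hv r1 r2 P Sm v} => wr wi; case: zeta => p q.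
move=> zle z0 Q; rewrite [complex.Im _]/= => w0 E.
have Q1 : p + p - (p * p - q * q) - 1 = wr * p - wi * q := congr1 (@complex.Re R) Q.
have Q2 : q + q - (p * q + q * p) - 0 = wr * q + wi * p := congr1 (@complex.Im R) Q.
have K : wi * (p ^+ 2 + q ^+ 2) = q * (1 - (p ^+ 2 + q ^+ 2)).
  have := congr1 ( *%R p) Q2; have := congr1 ( *%R q) Q1; lra.
have N0 : 0 < p ^+ 2 + q ^+ 2.
  rewrite lt_neqAle addr_ge0 ?sqr_ge0 // andbT eq_sym paddr_eq0 ?sqr_ge0 // !expf_eq0 /=.
  by move: z0; rewrite eq_complex.
have N1 : p ^+ 2 + q ^+ 2 < 1.
  rewrite lt_neqAle; apply/andP; split.
    apply/eqP => h; move: K; rewrite h subrr mulr0 mulr1 => /eqP.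
    by rewrite (negbTE w0).
  by have := exprn_ile1 2 (sqrtr_ge0 _) zle; rewrite sqr_sqrtr ?addr_ge0 ?sqr_ge0.
exists (Complex p q); split=> //.
  by rewrite /= -[ltRHS]sqrtr1 ltr_sqrt.
rewrite [complex.Im _]/=.
have q0 : q != 0.
  by apply/eqP => h; move: K; rewrite {2}h mul0r => /eqP; rewrite mulf_eq0 (negbTE w0) gt_eqF.
have : 0 < wi * q * (p ^+ 2 + q ^+ 2).
  rewrite mulrAC K [q * _]mulrC -mulrA -expr2 mulr_gt0 ?subr_gt0 //.
  by rewrite lt_neqAle sqr_ge0 andbT eq_sym expf_eq0.
by rewrite pmulr_lgt0.
Qed.

Lemma root_diff w w0 zeta a : zeta != 0 -> a != 0 ->
  2%:R - zeta - zeta^-1 = w -> 2%:R - a - a^-1 = w0 ->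
  (zeta - a) * (zeta - a^-1) = (w0 - w) * zeta.
Proof. by move=> z0 a0 <- <-; field; rewrite z0 a0. Qed.

Lemma csqrt_near (m tau : R) : 0 < m -> tau != 0 -> exists v : R[i],
  [/\ v ^+ 2 = Complex (m ^+ 2) tau, v != 0, 0 < tau * complex.Im v
    & nc (v - m%:C) <= `|tau| / m].
Proof.
move=> m0 t0; have [v Hv] : exists v : R[i], v ^+ 2 = Complex (m ^+ 2) tau /\ 0 <= complex.Re v.
  have [v Hv] := csqrt_exists (Complex (m ^+ 2) tau).
  have [h|h] := lerP 0 (complex.Re v); first by exists v.
  by exists (- v); rewrite sqrrN; split=> //; case: v h {Hv} => p q /=; rewrite oppr_ge0 => /ltW.
case: Hv => Hv; case: v Hv => p q Hv; rewrite [complex.Re _]/= => p0.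
have Q1 : p * p - q * q = m ^+ 2 := congr1 (@complex.Re R) Hv.
have Q2 : p * q + q * p = tau := congr1 (@complex.Im R) Hv.
have q0 : q != 0 by apply: contra t0 => /eqP h; rewrite -Q2 h mulr0 mul0r addr0.
have q2 : 0 < q ^+ 2 by rewrite lt_neqAle sqr_ge0 andbT eq_sym expf_eq0.
have pm : m <= p.
  rewrite -(ler_pXn2r (n := 2)) ?nnegrE ?(ltW m0) // -Q1; rewrite -!expr2; lra.
have p1 : 0 < p by apply: lt_le_trans pm.
have v0 : Complex p q != 0 by rewrite eq_complex /= negb_and q0 orbT.
exists (Complex p q); split=> //.
  rewrite [complex.Im _]/= -Q2.
  have -> : (p * q + q * p) * q = 2 * p * q ^+ 2 by ring.
  by rewrite mulr_gt0 // mulr_gt0.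
rewrite ler_pdivlMr //.
have N : nc (Complex p q - m%:C) * nc (Complex p q + m%:C) = `|tau|.
  rewrite -ncM -subr_sqr Hv.
  have -> : Complex (m ^+ 2) tau - m%:C ^+ 2 = 'i%C * tau%:C.
    rewrite -rmorphXn; apply/eqP; rewrite eq_complex /=.
    by rewrite !(mul0r, mul1r, subrr, addr0, add0r, subr0, oppr0, mulr0) !eqxx.
  by rewrite ncM ncC /= expr0n expr1n add0r sqrtr1 mul1r.
rewrite -N; apply: ler_wpM2l; first exact: nc_ge0.
apply: le_trans (nc_Re _); rewrite /= ger0_norm ?addr_ge0 ?(ltW m0) //.
by rewrite lerDr.
Qed.

End Roots.

Section Rates.
Context {R : realType}.
Implicit Types (f g : R -> R[i]) (l m : R[i]) (e d C : R).

Definition rate f l := exists C d, [/\ 0 <= C, 0 < d &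
  forall e, 0 < e < d -> nc (f e - l) <= C * e].

Lemma rate_const l : rate (fun _ => l) l.
Proof. by exists 0, 1; split=> // e _; rewrite subrr nc0 mul0r. Qed.

Lemma rate_bounded f l : rate f l -> exists C d, [/\ 0 <= C, 0 < d &
  forall e, 0 < e < d -> nc (f e) <= C].
Proof.
move=> [C [d [C0 d0 H]]]; exists (C * d + nc l), d; split=> //.
  by rewrite addr_ge0 ?nc_ge0 // mulr_ge0 // ltW.
move=> e ed; rewrite -[f e](subrK l); apply: le_trans (ncD _ _) _; apply: lerD => //.
apply: le_trans (H e ed) _; apply: ler_wpM2l => //.
by case/andP: ed => _ /ltW.
Qed.

Lemma rateB f g l m : rate f l -> rate g m -> rate (fun e => f e - g e) (l - m).
Proof.
move=> [C [d [C0 d0 H]]] [C' [d' [C0' d0' H']]].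
exists (C + C'), (Num.min d d'); split; rewrite ?addr_ge0 ?lt_min ?d0 // => e.
rewrite lt_min => /andP[e0 /andP[ed ed']].
have -> : f e - g e - (l - m) = (f e - l) - (g e - m) by ring.
apply: le_trans (ncB _ _) _; rewrite mulrDl.
by apply: lerD; [apply: H|apply: H']; rewrite e0.
Qed.

Lemma rateM f g l m : rate f l -> rate g m -> rate (fun e => f e * g e) (l * m).
Proof.
move=> Hf [C' [d' [C0' d0' H']]]; have [B [d1 [B0 d10 HB]]] := rate_bounded Hf.
have [C [d [C0 d0 H]]] := Hf.
exists (B * C' + C * nc m), (Num.min (Num.min d d1) d'); split.
- by rewrite addr_ge0 ?mulr_ge0 ?nc_ge0.
- by rewrite !lt_min d0 d10.
move=> e; rewrite !lt_min => /andP[e0 /andP[/andP[ed ed1] ed']].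
have -> : f e * g e - l * m = f e * (g e - m) + (f e - l) * m by ring.
apply: le_trans (ncD _ _) _; rewrite !ncM mulrDl; apply: lerD.
  by rewrite -mulrA; apply: ler_pM; rewrite ?nc_ge0 // ?HB ?H' ?e0.
by rewrite mulrAC; apply: ler_wpM2r; [exact: nc_ge0|apply: H; rewrite e0].
Qed.

Lemma rateV f l : l != 0 -> rate f l -> rate (fun e => (f e)^-1) l^-1.
Proof.
move=> l0 [C [d [C0 d0 H]]].
have n0 : 0 < nc l by rewrite lt_neqAle eq_sym nc_eq0 l0 nc_ge0.
pose d1 := nc l / 2 / (C + 1).
have C1 : 0 < C + 1 by rewrite ltr_wpDl.
have d10 : 0 < d1 by rewrite !divr_gt0.
exists (C * (2 / (nc l * nc l))), (Num.min d d1); split.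
- by rewrite mulr_ge0 // divr_ge0 // mulr_ge0 ?nc_ge0.
- by rewrite lt_min d0.
move=> e; rewrite lt_min => /andP[e0 /andP[ed ed1]].
have He : nc (f e - l) <= C * e by apply: H; rewrite e0.
have fl : nc l / 2 <= nc (f e).
  have h1 : nc l <= nc (f e) + nc (f e - l).
    by rewrite -{1}[l](subKr (f e)); exact: ncB.
  have h2 : C * e <= nc l / 2.
    apply: (@le_trans _ _ ((C + 1) * d1)).
      by apply: ler_pM => //; [exact: ltW|rewrite lerDl|exact: ltW].
    by rewrite /d1 mulrC divfK ?gt_eqF.
  have s2 := splitr (nc l); lra.
have f0 : 0 < nc (f e) by apply: lt_le_trans fl; rewrite divr_gt0.
have fn0 : f e != 0 by rewrite -nc_eq0 gt_eqF.
have -> : (f e)^-1 - l^-1 = - (f e - l) * ((f e)^-1 * l^-1) by field; rewrite fn0 l0.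
rewrite !ncM ncN !Normc.normcV mulrAC.
apply: ler_pM; rewrite ?mulr_ge0 ?invr_ge0 ?nc_ge0 //.
have -> : 2 / (nc l * nc l) = (nc l / 2)^-1 * (nc l)^-1 by field; rewrite gt_eqF.
apply: ler_wpM2r; first by rewrite invr_ge0 nc_ge0.
by rewrite lef_pV2 ?posrE ?divr_gt0.
Qed.

Lemma nc_powB (a b : R[i]) k : nc a <= 1 -> nc b <= 1 ->
  nc (a ^+ k - b ^+ k) <= k%:R * nc (a - b).
Proof.
move=> a1 b1; elim: k => [|k IH]; first by rewrite !expr0 subrr nc0 mul0r.
have -> : a ^+ k.+1 - b ^+ k.+1 = a * (a ^+ k - b ^+ k) + (a - b) * b ^+ k.
  by rewrite !exprS; ring.
apply: le_trans (ncD _ _) _; rewrite !ncM -natr1 mulrDl mul1r; apply: lerD.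
  by apply: le_trans IH; rewrite ler_piMl ?nc_ge0.
by rewrite ler_piMr ?nc_ge0 // ncX exprn_ile1 ?nc_ge0.
Qed.

Lemma nc_powB_gamma (a b : R[i]) k (g d : R) : nc a <= 1 -> nc b <= 1 ->
  0 < g <= 1 -> nc (a - b) <= d -> nc (a ^+ k - b ^+ k) <= 2 * (k%:R * d) `^ g.
Proof.
move=> a1 b1 /andP[g0 g1] H.
have d0 : 0 <= d by apply: le_trans H; exact: nc_ge0.
have y0 : 0 <= k%:R * d by rewrite mulr_ge0.
have L1 : nc (a ^+ k - b ^+ k) <= k%:R * d.
  by apply: le_trans (nc_powB k a1 b1) _; apply: ler_wpM2l.
have L2 : nc (a ^+ k - b ^+ k) <= 2.
  apply: le_trans (ncB _ _) _; rewrite !ncX -[2]/(1 + 1); apply: lerD; exact: exprn_ile1 (nc_ge0 _) _.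
have P0 : 0 <= (k%:R * d) `^ g by exact: powR_ge0.
have [h|h] := lerP (k%:R * d) 1.
  have [E|n0] := eqVneq (k%:R * d) 0; first by rewrite E in L1 *; apply: le_trans L1 _; rewrite mulr_ge0 // powR_ge0.
  apply: le_trans L1 _; apply: (@le_trans _ _ ((k%:R * d) `^ g)).
    by apply: ger1_powR; rewrite // lt_neqAle eq_sym n0 y0.
  by rewrite ler_peMl // ler1n.
apply: le_trans L2 _; rewrite ler_peMr //.
rewrite -[leLHS](powRr0 (k%:R * d)); apply: ler_powR; [exact: ltW|exact: ltW].
Qed.

End Rates.

Section WeightedConvolution.
Context {R : realType}.
Implicit Types (K phi : seqZ R) (t g B c : R).

Lemma jap_powD (n : int) (p q : R) : jap n `^ (p + q) = jap n `^ p * jap n `^ q.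
Proof. by rewrite powRD // (gt_eqF (jap_gt0 n)) implybT. Qed.

Lemma jap_sub_powR g (n m : int) : 0 <= g ->
  jap (n - m) `^ g <= 2 `^ g * (jap n `^ g * jap m `^ g) :> R.
Proof.
move=> g0; rewrite -!powRM ?mulr_ge0 ?jap_ge0 //.
by apply: ge0_ler_powR; rewrite ?nnegrE ?mulr_ge0 ?jap_ge0 // jap_sub.
Qed.

Lemma convol_weighted t g : 0 <= g -> 1 / 2 < t - g ->
  exists2 M, 0 <= M & forall K B, 0 <= B -> (forall x, nc (K x) <= B * jap x `^ g) ->
    linear_on (l2w t) (convol K) /\
    forall phi c, 0 <= c -> (wnorm t phi <= c%:E)%E -> (wnorm (- t) (convol K phi) <= (B * M * c)%:E)%E.
Proof.
move=> g0 tg; have [S HS] := jap_l2 tg; have S0 := HS.1.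
pose a : seqZ R := fun n => (jap n `^ (- (t - g)))%:C.
have jpos (n : int) : 0 < jap n :> R := jap_gt0 n.
exists (2 `^ g * S * S); first by rewrite !mulr_ge0 ?powR_ge0.
move=> K B B0 HK.
pose K' (n m : int) : R[i] := (jap n `^ (- t))%:C * K (n - m) * (jap m `^ (- t))%:C.
have C0 : 0 <= B * 2 `^ g by rewrite mulr_ge0 ?powR_ge0.
have aE (n : int) : nc (a n) = jap n `^ (- t) * jap n `^ g.
  by rewrite /a ncC ger0_norm ?powR_ge0 // opprB addrC jap_powD.
have K'b n m : nc (K' n m) <= B * 2 `^ g * (nc (a n) * nc (a m)).
  rewrite !aE /K' ncM [nc (_%:C * K _)]ncM (ncC (jap n `^ (- t))) (ncC (jap m `^ (- t))).
  rewrite !ger0_norm ?powR_ge0 //.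
  apply: (@le_trans _ _ (jap n `^ (- t) * (B * (2 `^ g * (jap n `^ g * jap m `^ g))) * jap m `^ (- t))).
    apply: ler_wpM2r; first exact: powR_ge0.
    apply: ler_wpM2l; first exact: powR_ge0.
    apply: le_trans (HK _) _; apply: ler_wpM2l => //; exact: jap_sub_powR.
  rewrite le_eqVlt; apply/orP; left; apply/eqP.
  move: (jap n `^ (- t)) (jap n `^ g) (jap m `^ g) (jap m `^ (- t)) (2 `^ g) => u1 u2 u3 u4 u5.
  by ring.
have jj (n : int) : (jap n `^ t)%:C * (jap n `^ (- t))%:C = 1 :> R[i].
  by rewrite -rmorphM /= -jap_powD subrr powRr0.
have termE n m phi : K (n - m) * phi m = (jap n `^ t)%:C * (K' n m * jmul t phi m).
  rewrite /K' /jmul; have := jj n; have := jj m.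
  move: (jap n `^ t)%:C (jap n `^ (- t))%:C (jap m `^ t)%:C (jap m `^ (- t))%:C (K (n - m)) (phi m).
  move=> u v x y k f xy uv.
  have -> : u * (v * k * y * (x * f)) = (u * v) * (x * y) * (k * f) by ring.
  by rewrite xy uv !mul1r.
have L2 phi c : 0 <= c -> (wnorm t phi <= c%:E)%E -> l2le (jmul t phi) c.
  by move=> c0; rewrite wnorm_jmul => /(wnormP _ c0).
have sums phi c n : 0 <= c -> (wnorm t phi <= c%:E)%E ->
    exists c', sumle (fun m => K (n - m) * phi m) c'.
  move=> c0 H; eexists; apply: (@sumle_dom _ _ (fun m => (jap n `^ t)%:C * (K' n m * jmul t phi m))).
    by move=> m; rewrite termE.
  exact: sumleZ (kop_sumle C0 HS K'b n (L2 _ _ c0 H)).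
have bnd phi : l2w t phi -> exists2 c, 0 <= c & (wnorm t phi <= c%:E)%E.
  move=> H; have F : wnorm t phi \is a fin_num by rewrite ge0_fin_numE ?wnorm_ge0.
  by exists (fine (wnorm t phi)); rewrite ?fine_ge0 ?wnorm_ge0 ?fineK.
split.
  move=> z phi psi /bnd[c c0 Hc] /bnd[d d0 Hd]; apply/funext => n.
  have [c1 H1] := sums _ _ n c0 Hc; have [c2 H2] := sums _ _ n d0 Hd.
  rewrite -[RHS]/(z * convol K phi n + convol K psi n) /convol /kop.
  rewrite -(csumZ z H1) -(csumD (sumleZ z H1) H2); apply: eq_csum => m.
  by rewrite -[(z *: phi + psi) m]/(z * phi m + psi m); ring.
move=> phi c c0 H; rewrite wnorm_jmul; apply/wnormP; first by rewrite !mulr_ge0 ?powR_ge0.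
have -> : jmul (- t) (convol K phi) = kop K' (jmul t phi).
  apply/funext => n; rewrite /jmul /convol /kop.
  rewrite (eq_csum (fun m => termE n m phi)) (csumZ _ (kop_sumle C0 HS K'b n (L2 _ _ c0 H))).
  by move: (csum _) => u; rewrite mulrA [X in X * u]mulrC jj mul1r.
rewrite (_ : B * _ * c = B * 2 `^ g * S * S * c); last by ring.
exact: kop_bound C0 HS K'b _ _ (L2 _ _ c0 H).
Qed.

Lemma l2w_sub t phi : 0 <= t -> l2w t phi -> l2w 0 phi.
Proof.
move=> t0 H; have F : wnorm t phi \is a fin_num by rewrite ge0_fin_numE ?wnorm_ge0.
have c0 : 0 <= fine (wnorm t phi) by rewrite fine_ge0 ?wnorm_ge0.
have : (wnorm t phi <= (fine (wnorm t phi))%:E)%E by rewrite fineK.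
rewrite {1}wnorm_jmul => /(wnormP _ c0) L; apply/l2P; exists (fine (wnorm t phi)).
apply: l2le_dom L => n; rewrite /jmul ncM ncC ger0_norm ?powR_ge0 // ler_peMl ?nc_ge0 //.
rewrite -[leLHS](powRr0 (jap n)); exact: ler_powR (jap_ge1 n) _ _ t0.
Qed.

Lemma wnormD t phi psi c d : 0 <= c -> 0 <= d -> (wnorm t phi <= c%:E)%E -> (wnorm t psi <= d%:E)%E ->
  (wnorm t (phi + psi)%R <= (c + d)%:E)%E.
Proof.
move=> c0 d0; rewrite (wnorm_jmul t phi) (wnorm_jmul t psi) (wnorm_jmul t (_ + _)).
move=> /(wnormP _ c0) H1 /(wnormP _ d0) H2; apply/wnormP; first exact: addr_ge0.
have -> : jmul t (phi + psi) = jmul t phi + jmul t psi.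
  apply/funext => n; rewrite -[RHS]/((jap n `^ t)%:C * phi n + (jap n `^ t)%:C * psi n).
  by rewrite -mulrDr.
exact: l2leD.
Qed.

Lemma wnorm_eq0 t phi : (wnorm t phi <= 0)%E -> phi = 0.
Proof.
rewrite wnorm_jmul => /(wnormP _ (lexx 0)) H; apply/funext => n.
have := l2le_coord n H; rewrite /jmul ncM ncC ger0_norm ?powR_ge0 // => h.
have p : 0 < jap n `^ t :> R by rewrite powR_gt0 ?jap_gt0.
apply/eqP; rewrite -nc_eq0 eq_le nc_ge0 andbT.
by move: h; rewrite pmulr_rle0.
Qed.

End WeightedConvolution.

Lemma inv_sub_neq0 {R : realType} (z : R[i]) : z != 0 -> nc z < 1 -> z^-1 - z != 0.
Proof.
move=> z0 z1; apply/eqP => h; have h' : z * z = 1.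
  have := congr1 (fun x => z * x) h; rewrite mulrBr divff // mulr0 => /eqP.
  by rewrite subr_eq0 => /eqP.
have h9 : nc z * nc z = 1 by rewrite -ncM h' nc1.
by have := mulr_ilt1 (nc_ge0 z) (nc_ge0 z) z1 z1; rewrite h9 ltxx.
Qed.

Section LimitingAbsorption.
Context {R : realType}.
Variables (pm : bool) (m : R) (a b : R[i]).
Hypotheses (m0 : 0 < m) (a1 : nc a = 1) (aE : 2%:R - a - a^-1 = m%:C)
  (aI : 0 < pmsign pm * complex.Im a) (b0 : b != 0) (b1 : nc b < 1)
  (bE : 2%:R - b - b^-1 = - m%:C).

Let a0 : a != 0. Proof. by rewrite -nc_eq0 a1 oner_eq0. Qed.

Let pm1 : pmsign pm * pmsign pm = 1 :> R.
Proof. by rewrite /pmsign; case: pm; rewrite ?mulr1 ?mulrNN ?mulr1. Qed.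

Let pmn : `|pmsign pm| = 1 :> R.
Proof. by rewrite /pmsign; case: pm; rewrite ?normrN normr1. Qed.

Let aV : complex.Im a^-1 = - complex.Im a.
Proof.
have := a1; case: (a) => p q /= h.
have : p ^+ 2 + q ^+ 2 = 1.
  by have := congr1 (fun x => x ^+ 2) h; rewrite sqr_sqrtr ?addr_ge0 ?sqr_ge0 // expr1n.
by move=> ->; rewrite divr1.
Qed.

Let aVa : a^-1 - a != 0.
Proof.
apply/eqP => h; have := congr1 (@complex.Im R) h.
rewrite (_ : complex.Im (a^-1 - a) = complex.Im a^-1 - complex.Im a); last by case: (a^-1) => ? ?; case: (a).
rewrite aV /= => h2; have i0 : complex.Im a = 0 by lra.
by move: aI; rewrite i0 mulr0 ltxx.
Qed.

Let bVb : b^-1 - b != 0.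
Proof.
exact: inv_sub_neq0.
Qed.

Let ex e : exists p : R[i] * (R[i] * R[i]), 0 < e -> 
  let w := p.1 in let z1 := p.2.1 in let z2 := p.2.2 in
  [/\ w ^+ 2 = Complex (m ^+ 2) (pmsign pm * e), w != 0, nc (w - m%:C) <= e / m &
   [/\ z1 != 0, z2 != 0, nc z1 < 1, nc z2 < 1 &
    [/\ 2%:R - z1 - z1^-1 = w, 2%:R - z2 - z2^-1 = - w & 0 < pmsign pm * complex.Im z1]]].
Proof.
have [e0|] := pselect (0 < e); last by move=> ne; exists (0, (0, 0)).
have pe : pmsign pm * e != 0.
  by rewrite -normr_eq0 normrM pmn mul1r normr_eq0 gt_eqF.
have [w [Hw w0 wI wm]] := csqrt_near m0 pe.
have wI0 : complex.Im w != 0 by apply/eqP => h; move: wI; rewrite h mulr0 ltxx.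
have wIN : complex.Im (- w) != 0 by case: (w) wI0 => p q /=; rewrite oppr_eq0.
have [z1 [z10 z11 z1E z1I]] := root_in_disc wI0.
have [z2 [z20 z21 z2E _]] := root_in_disc wIN.
exists (w, (z1, z2)) => _ /=; split=> //.
  by move: wm; rewrite normrM pmn mul1r (gtr0_norm e0).
split=> //; split=> //.
have : 0 < (pmsign pm * e * complex.Im w) * (complex.Im w * complex.Im z1) by rewrite mulr_gt0.
have -> : (pmsign pm * e * complex.Im w) * (complex.Im w * complex.Im z1)
   = (pmsign pm * complex.Im z1) * (e * complex.Im w ^+ 2) by ring.
rewrite pmulr_lgt0 // mulr_gt0 //.
by rewrite lt_neqAle sqr_ge0 andbT eq_sym expf_eq0.
Qed.

Let W e := (projT1 (cid (ex e))).1.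
Let Z1 e := (projT1 (cid (ex e))).2.1.
Let Z2 e := (projT1 (cid (ex e))).2.2.

Let rW : rate W m%:C.
Proof.
exists m^-1, 1; split=> //; first by rewrite invr_ge0 ltW.
move=> e /andP[e0 _]; have [_ _ h _] := projT2 (cid (ex e)) e0.
by rewrite mulrC.
Qed.

Let rate_root (Z : R -> R[i]) (u : R -> R[i]) u0 z c : 0 < c -> rate u u0 ->
  z != 0 -> 2%:R - z - z^-1 = u0 ->
  (forall e, 0 < e -> [/\ Z e != 0, nc (Z e) < 1, 2%:R - Z e - (Z e)^-1 = u e &
      c <= nc (Z e - z^-1)]) -> rate Z z.
Proof.
move=> c0 [C [d [C0 d0 H]]] z0 zE HZ.
exists (C / c), d; split=> //; first by rewrite divr_ge0 // ltW.
move=> e ed; have e0 : 0 < e by case/andP: ed.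
have [h1 h2 h3 h4] := HZ e e0.
have D := root_diff h1 z0 h3 zE.
have ND : nc (Z e - z) * nc (Z e - z^-1) <= C * e.
  rewrite -ncM D ncM -ncN opprB; apply: le_trans (H e ed).
  by rewrite ler_piMr ?nc_ge0 // ltW.
rewrite mulrAC ler_pdivlMr //; apply: le_trans ND; apply: ler_wpM2l => //; exact: nc_ge0.
Qed.

Let rZ1 : rate Z1 a.
Proof.
apply: (rate_root aI rW a0 aE) => e e0.
have [_ _ _ [h1 h2 h3 h4 [h5 h6 h7]]] := projT2 (cid (ex e)) e0.
split=> //; apply: le_trans (nc_Im _).
rewrite (_ : complex.Im (Z1 e - a^-1) = complex.Im (Z1 e) - complex.Im a^-1); last first.
  by case: (Z1 e) => ? ?; case: (a^-1).
rewrite aV opprK -[leRHS]mul1r -pmn -normrM mulrDr ger0_norm.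
  by rewrite lerDr ltW.
by rewrite addr_ge0 // ltW.
Qed.

Let rZ2 : rate Z2 b.
Proof.
have rWN : rate (fun e => - W e) (- m%:C).
  have [C [d [C0 d0 H]]] := rW; exists C, d; split=> // e /H.
  by rewrite -opprD ncN.
have nb : 0 < nc b by rewrite lt_neqAle eq_sym nc_eq0 b0 nc_ge0.
have c0 : 0 < (nc b)^-1 - 1 by rewrite subr_gt0 invf_gt1.
apply: (rate_root c0 rWN b0 bE) => e e0.
have [_ _ _ [h1 h2 h3 h4 [h5 h6 h7]]] := projT2 (cid (ex e)) e0.
split=> //; rewrite -[nc (Z2 e - _)]ncN opprB.
have := nc_dist b^-1 (Z2 e); rewrite Normc.normcV => h.
apply: le_trans (_ : _ <= (nc b)^-1 - nc (Z2 e)) _; first by rewrite lerD2l lerN2 ltW.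
exact: le_trans (ler_norm _) h.
Qed.

Let F e := fker (W e) (Z1 e) (Z2 e).
Let F0 := fker m%:C a b.
Let m2 : 2%:R * m%:C != 0 :> R[i].
Proof. by rewrite mulf_neq0 ?pnatr_eq0 // eq_complex /= negb_and gt_eqF. Qed.

Let coef u z : R[i] := (2%:R * u)^-1 * (z^-1 - z)^-1.

Let fkerE u z1 z2 x : fker u z1 z2 x = coef u z1 * z1 ^+ `|x|%N - coef u z2 * z2 ^+ `|x|%N.
Proof. by rewrite /fker /hker /coef; ring. Qed.

Let rcoef Z z : rate Z z -> z != 0 -> z^-1 - z != 0 -> rate (fun e => coef (W e) (Z e)) (coef m%:C z).
Proof.
move=> rZ z0 zz; apply: rateM; apply: rateV => //.
  by apply: rateM rW; exact: rate_const.
by apply: rateB => //; exact: rateV.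
Qed.

Let term_diff Z z g : rate Z z -> z != 0 -> z^-1 - z != 0 -> nc z <= 1 -> 0 < g <= 1 ->
  (forall e, 0 < e -> nc (Z e) <= 1) ->
  exists C d, [/\ 0 <= C, 0 < d & forall e (x : int), 0 < e < d ->
   nc (coef (W e) (Z e) * Z e ^+ `|x|%N - coef m%:C z * z ^+ `|x|%N) <= C * e `^ g * jap x `^ g].
Proof.
move=> rZ z0 zz z1 g01 Z1'; have [C [d [C0 d0 H]]] := rcoef rZ z0 zz.
have [C' [d' [C0' d0' H']]] := rZ.
pose A := nc (coef m%:C z); have A0 : 0 <= A := nc_ge0 _.
have g0 : 0 < g by case/andP: g01.
exists (C + A * (2 * C' `^ g)), (Num.min 1 (Num.min d d')); split.
- by rewrite addr_ge0 // !mulr_ge0 ?powR_ge0.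
- by rewrite !lt_min ltr01 d0.
move=> e x; rewrite !lt_min => /andP[e0 /andP[e1 /andP[ed ed']]].
have eg : e <= e `^ g by apply: ger1_powR; [rewrite e0 ltW|case/andP: g01].
have jg : 1 <= jap x `^ g :> R.
  rewrite -[leLHS](powRr0 (jap x)); apply: ler_powR; [exact: jap_ge1|exact: ltW].
have -> : coef (W e) (Z e) * Z e ^+ `|x|%N - coef m%:C z * z ^+ `|x|%N =
  (coef (W e) (Z e) - coef m%:C z) * Z e ^+ `|x|%N + coef m%:C z * (Z e ^+ `|x|%N - z ^+ `|x|%N) by ring.
apply: le_trans (ncD _ _) _; rewrite ncM [X in _ + X]ncM -[leRHS]mulrA [leRHS]mulrDl -/A; apply: lerD.
  apply: (@le_trans _ _ (C * e)).
    apply: le_trans (H e _); last by rewrite e0.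
    by rewrite ler_piMr ?nc_ge0 // ncX exprn_ile1 ?nc_ge0 ?Z1'.
  apply: ler_wpM2l => //; rewrite -[leLHS]mulr1.
  by apply: ler_pM => //; exact: ltW.
rewrite -[leRHS]mulrA; apply: ler_wpM2l => //.
have HZ : nc (Z e - z) <= C' * e by apply: H'; rewrite e0.
apply: le_trans (nc_powB_gamma `|x| (Z1' e e0) z1 g01 HZ) _.
rewrite -[leRHS]mulrA; apply: ler_wpM2l => //.
rewrite !powRM ?mulr_ge0 ?(ltW e0) // [leLHS]mulrC -[leLHS]mulrA.
apply: ler_wpM2l; first exact: powR_ge0.
apply: ler_wpM2l; first exact: powR_ge0.
by apply: ge0_ler_powR; rewrite ?nnegrE ?jap_ge0 ?(ltW g0) // jap_abs_le.
Qed.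

Let F_diff g : 0 < g <= 1 -> exists C d, [/\ 0 <= C, 0 < d & forall e (x : int), 0 < e < d ->
   nc (F e x - F0 x) <= C * e `^ g * jap x `^ g].
Proof.
move=> g01.
have L1 e : 0 < e -> nc (Z1 e) <= 1.
  by move=> e0; have [_ _ _ [_ _ h _ _]] := projT2 (cid (ex e)) e0; exact: ltW.
have L2 e : 0 < e -> nc (Z2 e) <= 1.
  by move=> e0; have [_ _ _ [_ _ _ h _]] := projT2 (cid (ex e)) e0; exact: ltW.
have a1' : nc a <= 1 by rewrite a1.
have [C [d [C0 d0 H]]] := term_diff rZ1 a0 aVa a1' g01 L1.
have [C' [d' [C0' d0' H']]] := term_diff rZ2 b0 bVb (ltW b1) g01 L2.
exists (C + C'), (Num.min d d'); split; rewrite ?addr_ge0 ?lt_min ?d0 // => e x.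
rewrite lt_min => /andP[e0 /andP[ed ed']].
have -> : F e x - F0 x =
  (coef (W e) (Z1 e) * Z1 e ^+ `|x|%N - coef m%:C a * a ^+ `|x|%N)
  - (coef (W e) (Z2 e) * Z2 e ^+ `|x|%N - coef m%:C b * b ^+ `|x|%N).
  by rewrite /F /F0 !fkerE; ring.
apply: le_trans (ncB _ _) _; rewrite !mulrDl.
by apply: lerD; [apply: H|apply: H']; rewrite e0.
Qed.

Let F0_bound x : nc (F0 x) <= nc (coef m%:C a) + nc (coef m%:C b).
Proof.
rewrite /F0 fkerE; apply: le_trans (ncB _ _) _; rewrite ncM [X in _ + X]ncM !ncX a1 expr1n mulr1.
by apply: lerD => //; rewrite ler_piMr ?nc_ge0 // exprn_ile1 ?nc_ge0 // ltW.
Qed.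

Lemma F0_sumle s (phi : seqZ R) n : 1 / 2 < s -> l2w s phi ->
  exists c, sumle (fun k => F0 (n - k) * phi k) c.
Proof.
move=> s2 L.
have [S HS] := jap_l2 (s2 : 1 / 2 < s).
have Fn : wnorm s phi \is a fin_num by rewrite ge0_fin_numE ?wnorm_ge0.
have f0 : 0 <= fine (wnorm s phi) by rewrite fine_ge0 ?wnorm_ge0.
have : (wnorm s phi <= (fine (wnorm s phi))%:E)%E by rewrite fineK.
rewrite {1}wnorm_jmul => /(wnormP _ f0) Hj.
exists (nc (nc (coef m%:C a) + nc (coef m%:C b))%:C * (S * fine (wnorm s phi))).
apply: sumle_dom (sumleZ _ (sumle_CS HS Hj)) => k.
have -> : (jap k `^ (- s))%:C * jmul s phi k = phi k := congr1 (fun f => f k) (jmulK s phi).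
rewrite ncM [leRHS]ncM; apply: ler_wpM2r; first exact: nc_ge0.
by rewrite ncC ger0_norm ?addr_ge0 ?nc_ge0 // F0_bound.
Qed.

Let T0 : opZ R := convol F0.

Let gam_ex (s : R) : 1 / 2 < s -> exists2 g, 0 < g <= 1 & 1 / 2 < s - g.
Proof.
move=> s2; exists (Num.min 1 ((s - 1 / 2) / 2)).
  by rewrite lt_min ltr01 /= ge_min lexx /= andbT divr_gt0 // subr_gt0.
have : Num.min 1 ((s - 1 / 2) / 2) <= (s - 1 / 2) / 2 by rewrite ge_min lexx orbT.
have : (s - 1 / 2) / 2 + (s - 1 / 2) / 2 = s - 1 / 2 by rewrite -splitr.
lra.
Qed.

Let res e := resolvent bilap (Complex (m ^+ 2) (pmsign pm * e)) : opZ R.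

Let resE e (phi : seqZ R) : 0 < e -> l2w 0 phi -> res e phi = convol (F e) phi.
Proof.
move=> e0 Hp; have [Hw w0 _ [h1 h2 h3 h4 [h5 h6 _]]] := projT2 (cid (ex e)) e0.
have nz := @inv_sub_neq0 R.
apply: resolventE => //; rewrite -Hw.
exact: resolvent_inverse w0 h1 h2 h3 h4 (nz _ h1 h3) (nz _ h2 h4) h5 h6.
Qed.

Let res_lin e : 0 < e -> linear_on (l2w 0) (res e).
Proof.
move=> e0 z phi psi h1 h2; have [_ _ _ [_ _ h3 h4 _]] := projT2 (cid (ex e)) e0.
have [B HB] := fker_sumle (W e) h3 h4.
by rewrite !resE //; [exact: convol_linear HB _ _ _ h1 h2|exact: l2_lin].
Qed.

Let is_R0 (T : opZ R) := forall s : R, 1 / 2 < s -> Bop s (- s) T /\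
    opnorm s (- s) (res e - T) @[e --> (0 : R)^'+] --> 0%E.

Let T0_is_R0 : is_R0 T0.
Proof.
move=> s s2; split.
  have [|M M0 HM] := @convol_weighted R s 0 (lexx 0); first by rewrite subr0.
  have B0 : 0 <= nc (coef m%:C a) + nc (coef m%:C b) by rewrite addr_ge0 ?nc_ge0.
  have [x|h1 h2] := HM F0 _ B0; first by rewrite powRr0 mulr1.
  split=> //; apply: le_lt_trans (_ : _ <= ((nc (coef m%:C a) + nc (coef m%:C b)) * M * 1)%:E)%E _; last by rewrite ltry.
  by apply: ge_ereal_sup => _ [phi /= p1 <-]; apply: h2.
have [g g01 sg] := gam_ex s2; have g0 : 0 < g by case/andP: g01.
have [M M0 HM] := convol_weighted (ltW g0) sg.
have [C [d [C0 d0 HC]]] := F_diff g01.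
have s0 : 0 <= s by apply: ltW; apply: lt_trans s2; rewrite divr_gt0.
apply: (@squeeze_cvge _ _ _ _ (fun=> 0%E) _ (fun e => (C * M * e `^ g)%:E)); last first.
- apply: cvg_EFin; first by near=> e.
  rewrite -[X in _ --> X](mulr0 (C * M)); apply: cvgMr; exact: powR_cvg0.
- exact: cvg_cst.
near=> e.
have ed : 0 < e < d by apply/andP; split; near: e; [exact: nbhs_right_gt|exact: nbhs_right_lt].
have e0 : 0 < e by case/andP: ed.
have B0 : 0 <= C * e `^ g by rewrite mulr_ge0 ?powR_ge0.
have [h1 h2] := HM (fun x => F e x - F0 x) _ B0 (fun x => HC e x ed).
have E (phi : seqZ R) : l2w s phi -> (res e - T0) phi = convol (fun x => F e x - F0 x) phi.
  move=> L; have L0 := l2w_sub s0 L.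
  rewrite -[LHS]/(res e phi - T0 phi) resE //; apply/funext => n.
  rewrite -[LHS]/(convol (F e) phi n - convol F0 phi n) /convol /kop.
  have [c Hc] := (l2P phi).1 L0.
  have [_ _ _ [_ _ z1 z2 _]] := projT2 (cid (ex e)) e0.
  have [B HB] := fker_sumle (W e) z1 z2.
  have S1 : sumle (fun m => F e (n - m) * phi m) (B * c) := convol_sumle n HB Hc.
  have [c' S2] := F0_sumle n s2 L.
  rewrite -[- csum _]mulN1r -(csumZ _ S2) -(csumD S1 (sumleZ _ S2)).
  by apply: eq_csum => k; ring.
apply/andP; split.
  apply: le_ereal_sup_tmp; exists (wnorm (- s) ((res e - T0) 0)); last exact: wnorm_ge0.
  exists 0 => //=; rewrite wnorm_jmul; apply/wnormP => //; apply: l2le_le ler01 _.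
  rewrite (_ : jmul s 0 = 0); first exact: l2le0.
  by apply/funext => n; rewrite /jmul mulr0.
apply: ge_ereal_sup => _ [phi /= p1 <-].
have L : l2w s phi by apply: le_lt_trans p1 _; rewrite ltry.
rewrite E //; have := h2 phi 1 ler01 p1; rewrite mulr1 mulrAC.
by [].
Unshelve. all: by end_near.
Qed.

Lemma R0E s (phi : seqZ R) : 1 / 2 < s -> l2w s phi -> R0 pm (m ^+ 2) phi = convol F0 phi.
Proof.
move=> s2 L; have s0 : 0 <= s by apply: ltW; apply: lt_trans s2; rewrite divr_gt0.
have T1 : is_R0 (R0 pm (m ^+ 2)) := xgetPex (0 : opZ R) (ex_intro is_R0 T0 T0_is_R0).
have [[lin1 _] c1] := T1 s s2; have [[lin0 _] c0] := T0_is_R0 s2.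
apply/eqP; rewrite -subr_eq0; apply/eqP.
have Fn : wnorm s phi \is a fin_num by rewrite ge0_fin_numE ?wnorm_ge0.
pose c := fine (wnorm s phi) + 1.
have c_gt0 : 0 < c by rewrite ltr_wpDl // fine_ge0 ?wnorm_ge0.
have Hc : (wnorm s phi <= c%:E)%E by rewrite -(fineK Fn) lee_fin lerDl.
apply: (@wnorm_eq0 _ (- s)); apply/lee_addgt0Pr => eta eta0; rewrite add0e.
pose h := eta / (2 * c); have h0 : 0 < h by rewrite divr_gt0 // mulr_gt0.
have nb : nbhs (0%E : \bar R) [set u | (u < h%:E)%E].
  by apply: open_ereal_lt'; rewrite lte_fin.
have N1 : \forall e \near (0 : R)^'+, (opnorm s (- s)%R (res e - R0 pm (m ^+ 2))%R < h%:E)%E.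
  exact: c1 nb.
have N0 : \forall e \near (0 : R)^'+, (opnorm s (- s)%R (res e - T0)%R < h%:E)%E.
  exact: c0 nb.
have [e [[e0 o1] o0]] := filter_ex (filterI (filterI (nbhs_right_gt (0 : R)) N1) N0).
have lin (T : opZ R) : linear_on (l2w s) T -> linear_on (l2w s) (res e - T).
  move=> lT z f g Lf Lg; have Lf0 := l2w_sub s0 Lf; have Lg0 := l2w_sub s0 Lg.
  rewrite -[LHS]/(res e (z *: f + g) - T (z *: f + g)) (res_lin e0) // lT //.
  apply/funext => n; rewrite -[LHS]/((z * res e f n + res e g n) - (z * T f n + T g n)).
  by rewrite -[RHS]/(z * (res e f n - T f n) + (res e g n - T g n)); ring.
have B1 := opnorm_app (lin _ lin1) (ltW h0) (ltW o1) c_gt0 Hc.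
have B0 := opnorm_app (lin _ lin0) (ltW h0) (ltW o0) c_gt0 Hc.
have hc0 : 0 <= h * c by rewrite mulr_ge0 // ltW.
have B1' : (wnorm (- s)%R (- ((res e - R0 pm (m ^+ 2)) phi))%R <= (h * c)%:E)%E.
  by have := wnormZ (-1) hc0 B1; rewrite scaleN1r ncN nc1 mul1r.
have := wnormD hc0 hc0 B0 B1'.
rewrite (_ : h * c + h * c = eta); last by rewrite /h; field; rewrite gt_eqF.
congr (_ <= _)%E; congr wnorm; apply/funext => n.
rewrite -[LHS]/((res e phi n - T0 phi n) + - (res e phi n - R0 pm (m ^+ 2) phi n)).
by rewrite -[RHS]/(R0 pm (m ^+ 2) phi n - convol F0 phi n) /T0; ring.
Qed.

End LimitingAbsorption.

Section Beta.
Context {R : realType}.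
Variables (sg : R[i]) (s : R).
Hypotheses (sg2 : sg ^+ 2 = s%:C) (s2 : s ^+ 2 = 1).

Definition uu (t : R) : R := Num.sqrt (4 + s * t ^+ 2).
Definition beta (t : R) : R[i] := ((uu t)%:C - sg * t%:C) / 2%:R.
Definition qq (t : R) : R[i] := (uu t)%:C^-1.
Definition rr (t : R) : R[i] := (2%:R + (uu t)%:C)^-1.
Definition rho (t : R) : R[i] := (s%:C * t%:C * rr t - sg) / 2%:R.

Let sabs : `|s| = 1.
Proof. by apply/eqP; rewrite -(eqrXn2 (n := 2)) // expr1n real_normK ?num_real // s2. Qed.

Let arg_pos t : `|t| < 2 -> 0 < 4 + s * t ^+ 2.
Proof.
move=> tl; have : t ^+ 2 < 4.
  rewrite -(real_normK (num_real t)) (_ : 4 = 2 ^+ 2); last by ring.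
  by rewrite ltrXn2r.
have /ler_normlP[h1 h2] : `|s| <= 1 by rewrite sabs.
have t2 := sqr_ge0 t; nra.
Qed.

Lemma uu_gt0 t : `|t| < 2 -> 0 < uu t.
Proof. by move/arg_pos => h; rewrite sqrtr_gt0. Qed.

Lemma uu_sq t : `|t| < 2 -> uu t ^+ 2 = 4 + s * t ^+ 2.
Proof. by move/arg_pos => h; rewrite sqr_sqrtr // ltW. Qed.

Lemma uuC_sq t : `|t| < 2 -> (uu t)%:C ^+ 2 = 4%:R + s%:C * t%:C ^+ 2 :> R[i].
Proof.
move=> h; have := congr1 (real_complex R) (uu_sq h).
by rewrite rmorphXn => ->; rewrite rmorphD rmorphM rmorphXn (rmorph_nat (real_complex R)).
Qed.

Lemma uuC_neq0 t : `|t| < 2 -> (uu t)%:C != 0 :> R[i].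
Proof. by move/uu_gt0 => h; rewrite eq_complex /= negb_and gt_eqF. Qed.

Lemma beta_inv t : `|t| < 2 -> beta t * (beta t + sg * t%:C) = 1.
Proof.
move=> h; have U := uuC_sq h.
have -> : beta t * (beta t + sg * t%:C) = ((uu t)%:C ^+ 2 - sg ^+ 2 * t%:C ^+ 2) / 4%:R.
  by rewrite /beta; field.
by rewrite U sg2 addrK divff // pnatr_eq0.
Qed.

Lemma beta_neq0 t : `|t| < 2 -> beta t != 0.
Proof.
by move=> h; apply/eqP => b0; have := beta_inv h; rewrite b0 mul0r => /eqP; rewrite eq_sym oner_eq0.
Qed.

Lemma betaV t : `|t| < 2 -> (beta t)^-1 = beta t + sg * t%:C.
Proof.
by move=> h; apply: (mulfI (beta_neq0 h)); rewrite beta_inv // divff ?beta_neq0.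
Qed.

Lemma beta_rho t : `|t| < 2 -> beta t = 1 + t%:C * rho t.
Proof.
move=> h; have U := uuC_sq h; have u0 := uu_gt0 h.
have n0 : 2%:R + (uu t)%:C != 0 :> R[i].
  by rewrite -(rmorph_nat (real_complex R) 2) -rmorphD eq_complex /= negb_and gt_eqF // addr_gt0.
have E : (uu t)%:C = 2%:R + s%:C * t%:C ^+ 2 * rr t.
  apply: (mulIf n0); rewrite [RHS]mulrDl -[_ * rr t * _]mulrA /rr mulVf // mulr1.
  have -> : s%:C * t%:C ^+ 2 = (uu t)%:C ^+ 2 - 4%:R :> R[i] by rewrite U; ring.
  ring.
by rewrite /beta {1}E /rho; field.
Qed.

Let tin (t : R) : 0 < t < 1 -> `|t| < 2.
Proof. by move=> /andP[t0 t1]; rewrite gtr0_norm // (lt_trans t1) // ltr1n. Qed.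

Let arg_low (t : R) : 0 < t < 1 -> 3 <= 4 + s * t ^+ 2 <= 5.
Proof.
move=> /andP[t0 t1]; have : t ^+ 2 <= 1 by rewrite exprn_ile1 ?ltW.
have /ler_normlP[h1 h2] : `|s| <= 1 by rewrite sabs.
by have t2 := sqr_ge0 t => h; apply/andP; split; nra.
Qed.

Lemma uu_low t : 0 < t < 1 -> 1 <= uu t.
Proof.
move=> /arg_low /andP[h _]; rewrite -[leLHS]sqrtr1 ler_wsqrtr //.
by apply: le_trans h; rewrite ler1n.
Qed.

Lemma uu_sE0 : sE 0 1 (fun t => (uu t)%:C).
Proof.
apply: (@sE_sqrt0 _ 1 (fun t => 4 + s * t ^+ 2) 3 5 (fun t => 2 * s * t)) => //; last first.
  by rewrite ler01 lexx.
move=> t td; have /andP[l1 l2] := arg_low td; have /andP[t0 t1] := td; split=> //.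
  rewrite !normrM sabs mulr1 (gtr0_norm t0) ger0_norm //.
  by apply: (@le_trans _ _ (2 * 1)); [apply: ler_wpM2l => //; exact: ltW|rewrite mulr1 ler_nat].
exists 1, 1; split=> // h _.
have -> : (4 + s * (t + h) ^+ 2)%:C - (4 + s * t ^+ 2)%:C - h%:C * (2 * s * t)%:C = (s * h ^+ 2)%:C.
  by rewrite -rmorphM -!rmorphB; congr (_%:C); ring.
by rewrite ncC normrM sabs normrX.
Qed.

Lemma rr_eq t : 0 < t < 1 -> rr t = 4%:R^-1 + t%:C * (- (s%:C / 4%:R) * t%:C * (rr t) ^+ 2).
Proof.
move=> td; have h := tin td; have U := uuC_sq h; have u0 := uu_gt0 h.
have n0 : 2%:R + (uu t)%:C != 0 :> R[i].
  by rewrite -(rmorph_nat (real_complex R) 2) -rmorphD eq_complex /= negb_and gt_eqF // addr_gt0.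
rewrite /rr.
have -> : t%:C * (- (s%:C / 4%:R) * t%:C * (2%:R + (uu t)%:C)^-1 ^+ 2)
   = - (s%:C * t%:C ^+ 2) / 4%:R * (2%:R + (uu t)%:C)^-1 ^+ 2 by ring.
have -> : s%:C * t%:C ^+ 2 = (uu t)%:C ^+ 2 - 4%:R :> R[i] by rewrite U; ring.
by field.
Qed.

Lemma rr_sE k : sE k 1 rr.
Proof.
have b0 : sE 0 1 rr.
  apply: (@sE_inv0 _ 1 _ 1) => //.
    by apply: sE_D uu_sE0; exact: sE_const.
  move=> t td; rewrite -(rmorph_nat (real_complex R) 2) -rmorphD ncC.
  have := uu_low td => h; rewrite ger0_norm ?addr_ge0 ?(le_trans ler01 h) //.
  by rewrite (le_trans h) // lerDr.
apply: (sE_fix b0 _ rr_eq) => {}k hk.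
by apply: sE_M (sE_X 2 hk); apply: sE_Z; exact: sE_t.
Qed.

Lemma qq_eq t : 0 < t < 1 -> qq t = 2%:R^-1 + t%:C * (- (s%:C / 2%:R) * t%:C * (rr t * qq t)).
Proof.
move=> td; have h := tin td; have U := uuC_sq h; have u0 := uu_gt0 h.
have n0 : 2%:R + (uu t)%:C != 0 :> R[i].
  by rewrite -(rmorph_nat (real_complex R) 2) -rmorphD eq_complex /= negb_and gt_eqF // addr_gt0.
have n1 := uuC_neq0 h; rewrite /rr /qq.
have -> : t%:C * (- (s%:C / 2%:R) * t%:C * ((2%:R + (uu t)%:C)^-1 * (uu t)%:C^-1))
   = - (s%:C * t%:C ^+ 2) / 2%:R * ((2%:R + (uu t)%:C)^-1 * (uu t)%:C^-1) by ring.
have -> : s%:C * t%:C ^+ 2 = (uu t)%:C ^+ 2 - 4%:R :> R[i] by rewrite U; ring.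
by field; rewrite n1.
Qed.

Lemma qq_sE k : sE k 1 qq.
Proof.
have b0 : sE 0 1 qq.
  apply: (@sE_inv0 _ 1 _ 1) => //; first exact: uu_sE0.
  by move=> t td; rewrite ncC ger0_norm ?uu_low // (le_trans ler01 (uu_low td)).
apply: (sE_fix b0 _ qq_eq) => {}k hk.
by apply: sE_M (sE_M (rr_sE k) hk); apply: sE_Z; exact: sE_t.
Qed.

Lemma rho_sE k : sE k 1 rho.
Proof.
apply: (@sE_eq _ _ _ (fun t => 2%:R^-1 * (s%:C * (t%:C * rr t) + - sg))).
  by move=> t _; rewrite /rho mulrA mulrC.
apply: sE_Z; apply: sE_D; last exact: sE_const.
by apply: sE_Z; apply: sE_M (rr_sE k); exact: sE_t.
Qed.

Lemma nc_sg : nc sg = 1.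
Proof.
apply/eqP; rewrite -(eqrXn2 (n := 2)) ?nc_ge0 // -ncX sg2 ncC sabs expr1n //.
Qed.

Lemma rho_low t : 0 < t < 1 -> 1 / 4 <= nc (rho t).
Proof.
move=> td; have /andP[t0 t1] := td.
have L := uu_low td.
have rb : nc (rr t) <= 1 / 2.
  rewrite /rr Normc.normcV -(rmorph_nat (real_complex R) 2) -rmorphD ncC.
  have p : 0 <= 2 + uu t by rewrite addr_ge0 // (le_trans ler01 L).
  rewrite ger0_norm // mul1r lef_pV2 ?posrE //; last by rewrite ltr_wpDr // (le_trans ler01 L).
  by rewrite lerDl (le_trans ler01 L).
rewrite /rho ncM Normc.normcV -(rmorph_nat (real_complex R) 2) ncC normr_nat.
have : nc sg - nc (s%:C * t%:C * rr t) <= nc (s%:C * t%:C * rr t - sg).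
  rewrite -[nc (_ - sg)]ncN opprB lerBlDr; apply: le_trans (ncD _ _); rewrite subrK //.
rewrite nc_sg !ncM !ncC sabs mul1r (gtr0_norm t0) => h.
have h2 : t * nc (rr t) <= 1 / 2.
  by apply: le_trans (ler_piMl (nc_ge0 _) (ltW t1)) rb.
have h3 : 1 / 2 <= nc (s%:C * t%:C * rr t - sg) by lra.
have V2 : 0 <= 2^-1 :> R by rewrite invr_ge0.
have -> : 4^-1 = 1 / 2 * 2^-1 :> R by field.
exact: ler_wpM2r.
Qed.

End Beta.

Section Pointwise.
Context {R : realType}.
Implicit Types (f g : seqZ R) (n : int).
Lemma addsE f g n : (f + g) n = f n + g n. Proof. by []. Qed.
Lemma oppsE f n : (- f) n = - f n. Proof. by []. Qed.
Lemma scalesE z f n : (z *: f) n = z * f n. Proof. by []. Qed.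
End Pointwise.

(* Reduces an identity between linear combinations of operators to one in the scalars. *)
Ltac pointwise :=
  apply: bop_eq => ? ?; rewrite !(boD, boZ, boN) //; apply/funext => ?;
  rewrite !(addsE, oppsE, scalesE).

Section BetaPowers.
Context {R : realType}.
Variables (sg : R[i]) (s : R).
Hypotheses (sg2 : sg ^+ 2 = s%:C) (s2 : s ^+ 2 = 1).
Hypothesis beta_le : forall t, 0 < t < 1 -> nc (beta sg s t) <= 1.
Variables (w : int -> R) (p : nat) (S : R) (e : int -> R[i]) (c : nat).
Hypotheses (w0 : forall n, 0 <= w n) (wS : l2le (wgt w p) S)
  (e1 : forall x, nc (e x) <= 1).

Let z (t : R) : R[i] := if 0 < t < 1 then beta sg s t else 1.
Let z1 t : nc (z t) <= 1.
Proof. by rewrite /z; case: ifP => h; [exact: beta_le|rewrite nc1]. Qed.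
Let n1 : nc (1 : R[i]) <= 1. Proof. by rewrite nc1. Qed.
Let zE t : 0 < t < 1 -> z t = 1 + t%:C * rho sg s t.
Proof.
move=> td; rewrite /z td; apply: beta_rho => //.
by have /andP[t0 t1] := td; rewrite gtr0_norm // (lt_trans t1) // ltr1n.
Qed.

Definition betapow (t : R) : bop R := Op w (fun x => e x * beta sg s t ^+ (c * `|x|)).
Definition taylor (m : nat) : bop R := Op w (fun x => e x * Sp 1 m (c * `|x|) 1).

Let O m := Opow w e c 1 z m.

Let betapowE t : 0 < t < 1 -> betapow t = O 0 t.
Proof. by move=> td; apply: Op_eq => x; rewrite /spk Sp0 /z td. Qed.

Let step m t : (m.+1 <= p)%N -> 0 < t < 1 ->
  O m t = taylor m + t%:C *: (rho sg s t *: O m.+1 t).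
Proof. by move=> mp td; exact: (Opow_taylor w0 wS c e1 n1 z1 zE mp td). Qed.

Let OE k m : (m + k <= p)%N -> (1 < p)%N -> E k 1 (O m).
Proof.
have d4 : 0 < 1 / 4 :> R by rewrite divr_gt0.
move=> mk p2; have yE k' : sE k' 1 (rho sg s) by exact: rho_sE.
exact: (Opow_E w0 wS c e1 n1 z1 zE yE (lexx 1) d4 (rho_low sg2 s2) p2 mk).
Qed.

Local Notation q := (qq s).
Local Notation r := (rr s).
Local Notation y := (rho sg s).

Lemma betapow_exp2 k : (2 + k <= p)%N -> exists2 W, E k 1 W & forall t, 0 < t < 1 ->
  q t *: betapow t = 2%:R^-1 *: taylor 0 + t%:C *: (- (sg / 4%:R) *: taylor 1 + t%:C *: W t).
Proof.
move=> kp; have p2 : (1 < p)%N by apply: leq_trans kp; rewrite leq_addr.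
have p1 := ltnW p2.
pose qa t := - (s%:C / 2%:R) * (r t * q t).
pose ya t := s%:C / 2%:R * r t.
exists (fun t => qa t *: taylor 0 + (2%:R^-1 * ya t + t%:C * (qa t * y t)) *: taylor 1
  + (q t * y t ^+ 2) *: O 2 t).
  have hr := rr_sE s2 k; have hq := qq_sE s2 k; have hy := rho_sE sg s2 k.
  have hqa : sE k 1 qa by apply: sE_Z; exact: sE_M.
  have hya : sE k 1 ya by exact: sE_Z.
  apply: E_D; last by apply: sE_scale; [apply: sE_M => //; exact: sE_X|exact: OE].
  apply: E_D; apply: sE_scale; rewrite //; try exact: E_const.
  by apply: sE_D; [exact: sE_Z|apply: sE_M; [exact: sE_t|exact: sE_M]].
move=> t td; rewrite betapowE // (step p1 td) (step p2 td).
have Eq : q t = 2%:R^-1 + t%:C ^+ 2 * qa t.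
  by rewrite {1}(qq_eq s2 td) /qa; ring.
have Ey : y t = - (sg / 2%:R) + t%:C * ya t.
  by rewrite /rho /ya; field.
rewrite {}Eq {}Ey; move: (taylor 0) (taylor 1) (O 2 t) (qa t) (ya t) => x0 x1 x2 a b.
by pointwise; field.
Qed.

Lemma betapow_exp4 k : (4 + k <= p)%N -> exists2 W, E k 1 W & forall t, 0 < t < 1 ->
  let A := - (sg / 2%:R) in let B := s%:C / 8%:R in let D := - (s%:C / 16%:R) in
  q t *: betapow t = 2%:R^-1 *: taylor 0 + t%:C *: ((A / 2%:R) *: taylor 1
    + t%:C *: (D *: taylor 0 + (B / 2%:R) *: taylor 1 + (A ^+ 2 / 2%:R) *: taylor 2
    + t%:C *: ((D * A) *: taylor 1 + (A * B) *: taylor 2 + (A ^+ 3 / 2%:R) *: taylor 3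
    + t%:C *: W t))).
Proof.
move=> kp; have p4 : (3 < p)%N by apply: leq_trans kp; rewrite leq_addr.
have p3 := ltnW p4; have p2 := ltnW p3; have p1 := ltnW p2.
pose A : R[i] := - (sg / 2%:R); pose B : R[i] := s%:C / 8%:R; pose D : R[i] := - (s%:C / 16%:R).
pose r2 t := - (s%:C / 4%:R) * r t ^+ 2.
pose ra t := s%:C / 2%:R * r2 t.
pose qa t := 16%:R^-1 * (r t * q t) + - (s%:C / 2%:R) * (r2 t * q t).
pose ww t := B + t%:C * (t%:C * ra t).
pose Dq t := D + t%:C * (t%:C * qa t).
pose Y2 t := B ^+ 2 + (2%:R * A) * (t%:C * ra t) + (2%:R * B) * (t%:C * (t%:C * ra t))
  + (t%:C * (t%:C * ra t)) ^+ 2.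
pose f1 t := 2%:R^-1 * ra t + D * B + D * (t%:C * (t%:C * ra t)) + t%:C * (qa t * y t).
pose f2 t := 2%:R^-1 * Y2 t + Dq t * y t ^+ 2.
pose f3 t := 2%:R^-1 * ((3%:R * A ^+ 2) * ww t + (3%:R * A) * (t%:C * ww t ^+ 2)
    + t%:C * (t%:C * ww t ^+ 3)) + t%:C * (Dq t * y t ^+ 3).
exists (fun t => qa t *: taylor 0 + f1 t *: taylor 1 + f2 t *: taylor 2 + f3 t *: taylor 3
  + (q t * y t ^+ 4) *: O 4 t).
  have hr := rr_sE s2 k; have hq := qq_sE s2 k; have hy := rho_sE sg s2 k.
  have tS f : sE k 1 f -> sE k 1 (fun t => t%:C * f t) by apply: sE_M; exact: sE_t.
  have cS (u : R[i]) : sE k 1 (fun=> u) by exact: sE_const.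
  have hr2 : sE k 1 r2 by apply: sE_Z; exact: sE_X.
  have hra : sE k 1 ra by exact: sE_Z.
  have hqa : sE k 1 qa by apply: sE_D; apply: sE_Z; apply: sE_M.
  have hw : sE k 1 ww by apply: sE_D => //; do 2 apply/tS.
  have hD : sE k 1 Dq by apply: sE_D => //; do 2 apply/tS.
  have hY2 : sE k 1 Y2.
    apply: sE_D; last by apply: sE_X; do 2 apply/tS.
    apply: sE_D; last by apply: sE_Z; do 2 apply/tS.
    by apply: sE_D => //; apply: sE_Z; apply/tS.
  have hf1 : sE k 1 f1.
    apply: sE_D; last by apply/tS; exact: sE_M.
    apply: sE_D; last by apply: sE_Z; do 2 apply/tS.
    by apply: sE_D => //; apply: sE_Z.
  have hf2 : sE k 1 f2.
    by apply: sE_D; [exact: sE_Z|apply: sE_M => //; exact: sE_X].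
  have hf3 : sE k 1 f3.
    apply: sE_D; last by apply/tS; apply: sE_M => //; exact: sE_X.
    apply: sE_Z; apply: sE_D; last by do 2 apply/tS; exact: sE_X.
    by apply: sE_D; apply: sE_Z => //; apply/tS; exact: sE_X.
  apply: E_D; last by apply: sE_scale; [apply: sE_M => //; exact: sE_X|exact: OE].
  by do 3 (apply: E_D; last by apply: sE_scale => //; exact: E_const); apply: sE_scale => //; exact: E_const.
move=> t td /=; rewrite -/A -/B -/D betapowE // (step p1 td) (step p2 td) (step p3 td) (step p4 td).
have ss : s%:C ^+ 2 = 1 :> R[i] by rewrite -rmorphXn s2.
have Er : r t = 4%:R^-1 + t%:C ^+ 2 * r2 t by rewrite {1}(rr_eq s2 td) /r2; ring.
have Eq : q t = 2%:R^-1 + t%:C ^+ 2 * D + t%:C ^+ 4 * qa t.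
  have Q := qq_eq s2 td.
  rewrite {1}Q {1}Er /qa mulrDl {1}Q /D; move: ss; move: (s%:C) (t%:C) (r2 t) (q t) (r t) => s' t' a b c' ss.
  transitivity (2%:R^-1 + t' ^+ 2 * - (s' / 16%:R) + t' ^+ 4 * (s' ^+ 2 / 16%:R * (c' * b) + - (s' / 2%:R) * (a * b))).
    by field.
  by rewrite ss mul1r.
have Ey : y t = A + t%:C * B + t%:C ^+ 3 * ra t.
  by rewrite /rho Er /A /B /ra; field.
rewrite /f1 /f2 /f3 /Y2 /Dq /ww {}Eq {}Ey.
move: (taylor 0) (taylor 1) (taylor 2) (taylor 3) (O 4 t) (qa t) (ra t) => x0 x1 x2 x3 x4 a b; move: (A) (B) (D) => A' B' D'.
by pointwise; field.
Qed.

End BetaPowers.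

Section InverseExpansion.
Context {R : realType}.
Implicit Types (t d : R).

Lemma sandwich_inverse (M N D1 D2 C1 C2 Y : bop R) : N = D1 * M * D2 ->
  C1 * D1 = 1 -> D1 * C1 = 1 -> C2 * D2 = 1 -> D2 * C2 = 1 -> N * Y = 1 -> Y * N = 1 ->
  M * (D2 * Y * D1) = 1 /\ (D2 * Y * D1) * M = 1.
Proof.
move=> NE c1 d1 c2 d2 NY YN.
have ME : M = C1 * N * C2 by rewrite NE !mulrA c1 mul1r -mulrA d2 mulr1.
split.
  rewrite ME -!mulrA (mulrA C2) c2 mul1r (mulrA N) NY mul1r //.
by rewrite ME !mulrA -(mulrA (D2 * Y)) d1 mulr1 -(mulrA D2) YN mulr1.
Qed.

Lemma corner_inverse (N N' X X' S : bop R) : N * X = 1 -> X' * N' = 1 -> N * S = N' * S ->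
  X * S = S * X * S -> X' * S = X * S.
Proof.
move=> NX XN' NS XS; rewrite -[X' * S]mulr1.
transitivity (X' * (N * (X * S))); first by rewrite (mulrA N) NX mul1r mulr1.
by rewrite XS !mulrA -(mulrA X') NS mulrA XN' mul1r.
Qed.

Lemma diag_inverse (P Q : bop R) (s : R[i]) : P * P = P -> P * Q = 0 -> Q * P = 0 -> Q * Q = Q ->
  P + Q = 1 -> s != 0 ->
  (s^-1 *: P + Q) * (s *: P + Q) = 1 /\ (s *: P + Q) * (s^-1 *: P + Q) = 1.
Proof.
move=> PP PQ QP QQ PQ1 s0.
rewrite !(mulrDl, mulrDr) -!scalerAl -!scalerAr PP PQ QP QQ !scaler0 !addr0 !add0r.
by rewrite !scalerA mulVf // divff // scale1r.
Qed.

Section OneProjection.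
Variables (P U K0 : bop R) (a : R[i]) (X0 : bop R).
Let Q := 1 - P.
Hypotheses (PP : P * P = P) (a0 : a != 0).
Let N0 := a *: P + Q * (U + K0).
Hypotheses (NX : N0 * X0 = 1) (XN : X0 * N0 = 1).

Let PQ : P * Q = 0. Proof. by rewrite mulrBr mulr1 PP subrr. Qed.
Let QP : Q * P = 0. Proof. by rewrite mulrBl mul1r PP subrr. Qed.
Let QQ : Q * Q = Q. Proof. by rewrite {1}/Q mulrBl mul1r PQ subr0. Qed.

Let PQ1 : P + Q = 1. Proof. by rewrite addrC subrK. Qed.

Lemma corner_one : X0 * Q = Q * X0 * Q.
Proof.
have PN : P * N0 = a *: P by rewrite mulrDr -scalerAr PP mulrA PQ mul0r addr0.
have PX : P = a *: (P * X0) by rewrite scalerAl -PN -mulrA NX mulr1.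
have PX0 : P * X0 * Q = 0.
  apply: (scalerI a0); rewrite scaler0 scalerAl -PX; exact: PQ.
by rewrite {2}/Q mulrBl mul1r mulrBl PX0 subr0.
Qed.

Lemma corner_one_N : N0 * Q = Q * (U + K0) * Q.
Proof. by rewrite mulrDl -scalerAl PQ scaler0 add0r. Qed.

Lemma inverse_one (W M : R -> bop R) : E 1 1 W ->
  (forall t, 0 < t < 1 -> M t = U + t%:C^-1 *: (a *: P + t%:C *: (K0 + t%:C *: W t))) ->
  exists d (B11 : bop R) (G : R -> bop R), [/\ 0 < d <= 1, bG d G & forall t, 0 < t < d ->
    let X := Q * X0 * Q + t%:C *: B11 + (t ^+ 2)%:C *: G t in M t * X = 1 /\ X * M t = 1].
Proof.
move=> WE ME; pose D (t : R) : bop R := t%:C *: P + Q.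
pose N' t := P * (U + K0) + D t * W t.
have N'E : E 1 1 N'.
  apply: E_D; first exact: E_const.
  by apply: E_M WE; apply: E_D; [apply: E_t; exact: E_const|exact: E_const].
have [d [Y [/andP[d0 dle] Yinv [Y' [X1 [G [GE Y'E]]] YE]]]] := E_inv ltr01 XN NX N'E.
exists d, (X0 * P + X1 * Q), (fun t => X1 * P + G t * Q + t%:C *: (G t * P)); split.
- by rewrite d0.
- by apply: bGD; [apply: bGD; [exact: bG_const|exact: (E_Mc (k := 0))]|apply: bG_tM; exact: (E_Mc (k := 0))].
move=> t /= td; have [t0 tlt] := andP td.
have tn : t%:C != 0 :> R[i] by rewrite eq_complex /= negb_and gt_eqF.
have NE : N0 + t%:C *: N' t = D t * M t * 1.
  rewrite mulr1 ME ?t0 ?(lt_le_trans tlt) //.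
  have DP : D t * P = t%:C *: P by rewrite mulrDl QP addr0 -scalerAl PP.
  have -> : U + t%:C^-1 *: (a *: P + t%:C *: (K0 + t%:C *: W t))
      = U + K0 + t%:C *: W t + t%:C^-1 *: (a *: P).
    by rewrite scalerDr (scalerA t%:C^-1 t%:C) mulVf // scale1r; abel.
  have -> : D t * (U + K0 + t%:C *: W t + t%:C^-1 *: (a *: P))
      = t%:C *: (P * (U + K0)) + Q * (U + K0) + t%:C *: (D t * W t) + a *: P.
    rewrite mulrDr -2!scalerAr DP !scalerA; congr (_ + _); last by congr (_ *: _); field.
    by rewrite mulrDr -scalerAr; congr (_ + _); rewrite mulrDl -scalerAl.
  by rewrite /N0 /N' scalerDr; abel.
have DC := diag_inverse PP PQ QP QQ PQ1 tn.
have [NY YN] := Yinv t td.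
have := sandwich_inverse NE DC.1 DC.2 (mulr1 1) (mulr1 1) NY YN.
rewrite mul1r YE // Y'E // => h12.
suff -> : Q * X0 * Q + t%:C *: (X0 * P + X1 * Q) + (t ^+ 2)%:C *: (X1 * P + G t * Q + t%:C *: (G t * P)) =
  (X0 + t%:C *: (X1 + t%:C *: G t)) * D t by [].
rewrite -corner_one expr2 rmorphM -scalerA /D; move: (G t) => g.
by nring.
Qed.

End OneProjection.

Lemma triple_product (P1 P2 Q S X0 X1 X2 X3 G : bop R) (s : R[i]) :
  (s *: P1 + Q) * (X0 + s *: (X1 + s *: (X2 + s *: (X3 + s *: G)))) * (s *: (s *: P1) + s *: P2 + S) =
  Q * X0 * S
  + s *: (P1 * X0 * S + Q * X0 * P2 + Q * X1 * S
  + s *: (P1 * X0 * P2 + P1 * X1 * S + Q * X0 * P1 + Q * X1 * P2 + Q * X2 * S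
  + s *: (P1 * X0 * P1 + P1 * X1 * P2 + P1 * X2 * S + Q * X1 * P1 + Q * X2 * P2 + Q * X3 * S
  + s *: (P1 * X1 * P1 + P1 * X2 * P2 + P1 * X3 * S + Q * X2 * P1 + Q * X3 * P2 + Q * G * S
  + s *: (P1 * X2 * P1 + P1 * X3 * P2 + P1 * G * S + Q * X3 * P1 + Q * G * P2
  + s *: (P1 * X3 * P1 + P1 * G * P2 + Q * G * P1 + s *: (P1 * G * P1))))))).
Proof.
have -> : (s *: P1 + Q) * (X0 + s *: (X1 + s *: (X2 + s *: (X3 + s *: G)))) =
    Q * X0 + s *: (P1 * X0 + Q * X1 + s *: (P1 * X1 + Q * X2 + s *: (P1 * X2 + Q * X3
    + s *: (P1 * X3 + Q * G + s *: (P1 * G))))).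
  by rewrite mulrDl -scalerAl ?(mulrDr, =^~ scalerAr); pointwise; ring.
have HR X Y : (X + s *: Y) * (s *: (s *: P1) + s *: P2 + S) =
    X * S + s *: (X * P2 + s *: (X * P1) + Y * (s *: (s *: P1) + s *: P2 + S)).
  by nring.
rewrite 5!HR; rewrite mulrDr mulrDr -!scalerAr !mulrDl.
set x := (P1 * X0 * S); set x1 := (Q * X0 * P2).
by pointwise; ring.
Qed.

Section TwoProjections.
Variables (P1 P2 U K0 K2 : bop R) (a b : R[i]) (X0 : bop R).
Let Q := 1 - P1.
Let S := 1 - P1 - P2.
Hypotheses (P11 : P1 * P1 = P1) (P22 : P2 * P2 = P2) (P12 : P1 * P2 = 0) (P21 : P2 * P1 = 0)
  (a0 : a != 0) (b0 : b != 0) (SKQ : S * K2 * Q = 0) (PKQ : P2 * K2 * Q = b *: P2).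
Let N0 := a *: P1 + b *: P2 + S * K2 * P1 + S * (U + K0) * Q.
Hypotheses (NX : N0 * X0 = 1) (XN : X0 * N0 = 1).

Let P1Q : P1 * Q = 0. Proof. by rewrite mulrBr mulr1 P11 subrr. Qed.
Let QP1 : Q * P1 = 0. Proof. by rewrite mulrBl mul1r P11 subrr. Qed.
Let P2Q : P2 * Q = P2. Proof. by rewrite mulrBr mulr1 P21 subr0. Qed.
Let QP2 : Q * P2 = P2. Proof. by rewrite mulrBl mul1r P12 subr0. Qed.
Let QQ : Q * Q = Q. Proof. by rewrite {1}/Q mulrBl mul1r P1Q subr0. Qed.
Let SQ : S = Q - P2. Proof. by []. Qed.
Let P1S : P1 * S = 0. Proof. by rewrite SQ mulrBr P1Q P12 subr0. Qed.
Let SP1 : S * P1 = 0. Proof. by rewrite SQ mulrBl QP1 P21 subr0. Qed.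
Let P2S : P2 * S = 0. Proof. by rewrite SQ mulrBr P2Q P22 subrr. Qed.
Let SP2 : S * P2 = 0. Proof. by rewrite SQ mulrBl QP2 P22 subrr. Qed.
Let SS : S * S = S. Proof. by rewrite {1}SQ mulrBl P2S subr0 /Q mulrBl mul1r P1S subr0. Qed.
Let QS : Q * S = S. Proof. by rewrite /Q mulrBl mul1r P1S subr0. Qed.
Let SQS : S * Q = S. Proof. by rewrite /Q mulrBr mulr1 SP1 subr0. Qed.
Let PQ1 : P1 + Q = 1. Proof. by rewrite addrC subrK. Qed.

Let PX1 : P1 * X0 = a^-1 *: P1.
Proof.
have PN : P1 * N0 = a *: P1.
  by rewrite /N0 3!mulrDr -!scalerAr !mulrA P11 P12 P1S !mul0r scaler0 !addr0.
by rewrite -[P1 in RHS]mulr1 -NX mulrA PN scalerAl scalerA mulVf // scale1r.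
Qed.

Let PX2 : P2 * X0 = b^-1 *: P2.
Proof.
have PN : P2 * N0 = b *: P2.
  by rewrite /N0 3!mulrDr -!scalerAr !mulrA P22 P21 P2S !mul0r scaler0 !addr0 add0r.
by rewrite -[P2 in RHS]mulr1 -NX mulrA PN scalerAl scalerA mulVf // scale1r.
Qed.

Let Pzero (A B : bop R) (c : R[i]) : A * X0 = c *: A -> A * B = 0 -> A * X0 * B = 0.
Proof. by move=> -> AB; rewrite -scalerAl AB scaler0. Qed.

Lemma corner_two : X0 * S = S * X0 * S.
Proof.
rewrite {2}/S !mulrBl mul1r (Pzero PX1 P1S) (Pzero PX2 P2S) !subr0 //.
Qed.

Lemma corner_two_N : N0 * S = S * (U + K0) * S.
Proof.
by rewrite /N0 3!mulrDl -!scalerAl -!mulrA P1S P2S QS !mulr0 !scaler0 !add0r.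
Qed.

Lemma inverse_two (W M : R -> bop R) : E 3 1 W ->
  (forall t, 0 < t < 1 -> M t = U + (t%:C^-1 ^+ 3) *: (a *: P1 + t%:C ^+ 2 *: K2
     + t%:C ^+ 3 *: K0 + t%:C ^+ 4 *: W t)) ->
  exists d (A11 A21 A22 A23 A31 : bop R) (G : R -> bop R), [/\ 0 < d <= 1, bG d G & forall t, 0 < t < d ->
    let X := S * X0 * S + t%:C *: (Q * A11 * Q) + (t ^+ 2)%:C *: (Q * A21 * Q + S * A22 + A23 * S)
       + (t ^+ 3)%:C *: A31 + (t ^+ 4)%:C *: G t in M t * X = 1 /\ X * M t = 1].
Proof.
move=> WE ME.
pose D1 (t : R) : bop R := t%:C *: (t%:C *: P1) + t%:C *: P2 + S.
pose D2 (t : R) : bop R := t%:C *: P1 + Q.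
pose N' t := P1 * K2 * Q + P2 * K2 * P1 + t%:C *: (P1 * K2 * P1)
  + S * (U + K0) * P1 + (P2 + t%:C *: P1) * (U + K0) * D2 t + D1 t * W t * D2 t.
have cE (X : bop R) : E 3 1 (fun=> X) by exact: E_const.
have tE (X : bop R) : E 3 1 (fun t => t%:C *: X) by apply: E_t; exact: E_const.
have D2E : E 3 1 D2 by exact: E_D.
have D1E : E 3 1 D1 by apply: E_D => //; apply: E_D => //; apply: E_t.
have N'E : E 3 1 N'.
  apply: E_D; last by apply: E_M => //; exact: E_M.
  apply: E_D; last by apply: E_M => //; apply: E_Mc; exact: E_D.
  by apply: E_D => //; apply: E_D.
have [d [Y [/andP[d0 dle] Yinv [Y' [X1 [Y1 [[X2 [Y2 [[X3 [G [GE Y2E]]] Y1E]]] Y'E]]] YE]]]] := E_inv ltr01 XN NX N'E.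
exists d, (X0 * P2 + X1 * S), (X1 * P2 + X2 * S), (X0 * P1), (P1 * X1),
  (P1 * X0 * P1 + P1 * X1 * P2 + P1 * X2 * S + Q * X1 * P1 + Q * X2 * P2 + Q * X3 * S).
exists (fun t => P1 * X1 * P1 + P1 * X2 * P2 + P1 * X3 * S + Q * X2 * P1 + Q * X3 * P2 + Q * G t * S
  + t%:C *: (P1 * X2 * P1 + P1 * X3 * P2 + P1 * G t * S + Q * X3 * P1 + Q * G t * P2
  + t%:C *: (P1 * X3 * P1 + P1 * G t * P2 + Q * G t * P1 + t%:C *: (P1 * G t * P1)))).
split; first by rewrite d0.
  have G2 (A B : bop R) : bG d (fun t => A * G t * B) by apply: (E_Mc (k := 0)); exact: (E_cM (k := 0)).
  apply: bGD; first by apply: bGD => //; exact: bG_const.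
  apply: bG_tM; apply: bGD.
    by apply: bGD => //; apply: bGD; [apply: bGD => //|]; exact: bG_const.
  apply: bG_tM; apply: bGD; last exact: bG_tM.
  by apply: bGD => //; apply: bGD => //; exact: bG_const.
move=> t /= td; have [t0 tlt] := andP td.
have tn : t%:C != 0 :> R[i] by rewrite eq_complex /= negb_and gt_eqF.
have D2C := diag_inverse P11 P1Q QP1 QQ PQ1 tn.
have D1C : exists C1, C1 * D1 t = 1 /\ D1 t * C1 = 1.
  have D1E' : D1 t = D2 t * (t%:C *: (P1 + P2) + S).
    rewrite /D2 mulrDl -scalerAl [P1 * _]mulrDr [Q * _]mulrDr -!scalerAr P1S QS addr0 addrA.
    by rewrite ![_ * (P1 + P2)]mulrDr P11 P12 QP1 QP2 addr0 add0r.
  have h1 : (P1 + P2) * (P1 + P2) = P1 + P2.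
    by rewrite mulrDl ![_ * (P1 + P2)]mulrDr P11 P12 P21 P22 addr0 add0r.
  have h2 : (P1 + P2) * S = 0 by rewrite mulrDl P1S P2S addr0.
  have h3 : S * (P1 + P2) = 0 by rewrite mulrDr SP1 SP2 addr0.
  have h4 : P1 + P2 + S = 1 by rewrite addrC /S -[1 - P1 - P2]addrA -opprD subrK.
  have [e1 e2] := diag_inverse h1 h2 h3 SS h4 tn.
  exists ((t%:C^-1 *: (P1 + P2) + S) * (t%:C^-1 *: P1 + Q)); rewrite D1E'; split.
    by rewrite !mulrA -(mulrA _ (t%:C^-1 *: P1 + Q)) D2C.1 mulr1.
  by rewrite !mulrA -(mulrA (D2 t)) e2 mulr1 D2C.2.
have NE : N0 + t%:C *: N' t = D1 t * M t * D2 t.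
  have hP : D1 t * P1 * D2 t = t%:C ^+ 3 *: P1.
    have -> : D1 t * P1 = t%:C *: (t%:C *: P1).
      by rewrite /D1 2!mulrDl -!scalerAl P11 P21 SP1 !scaler0 !addr0.
    by rewrite /D2 mulrDr -!scalerAl -!scalerAr P1Q !scaler0 addr0 P11 !scalerA; congr (_ *: _); ring.
  have hK : D1 t * K2 * D2 t = t%:C *: (b *: P2 + S * K2 * P1
      + t%:C *: (P1 * K2 * Q + P2 * K2 * P1 + t%:C *: (P1 * K2 * P1))).
    rewrite /D1 /D2 mulrDr -scalerAr 6!mulrDl -!scalerAl SKQ PKQ.
    move: (P1 * K2 * P1) (P2 * K2 * P1) (S * K2 * P1) (P1 * K2 * Q) => x1 x2 x3 x4.
    by pointwise; ring.
  have hU (X : bop R) : D1 t * X * D2 t = S * X * Q + t%:C *: (S * X * P1 + (P2 + t%:C *: P1) * X * D2 t).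
    have -> : D1 t = S + t%:C *: (P2 + t%:C *: P1) by rewrite scalerDr /D1 addrC [_ + t%:C *: P2]addrC.
    have e : S * X * D2 t = S * X * Q + t%:C *: (S * X * P1) by rewrite /D2 mulrDr -scalerAr addrC.
    by rewrite 2!mulrDl -!scalerAl e scalerDr addrA.
  have -> : D1 t * M t * D2 t = D1 t * (U + K0) * D2 t + t%:C^-1 ^+ 3 *: (a *: (D1 t * P1 * D2 t))
     + t%:C^-1 *: (D1 t * K2 * D2 t) + t%:C *: (D1 t * W t * D2 t).
    rewrite ME ?t0 ?(lt_le_trans tlt) //.
    have -> : U + (t%:C^-1 ^+ 3) *: (a *: P1 + t%:C ^+ 2 *: K2 + t%:C ^+ 3 *: K0 + t%:C ^+ 4 *: W t)
      = U + K0 + t%:C^-1 ^+ 3 *: (a *: P1) + t%:C^-1 *: K2 + t%:C *: W t.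
      by move: (W t) => w; pointwise; field.
    by move: (D1 t) (D2 t) (W t) => A B w; rewrite 3!mulrDr 3!mulrDl -!scalerAr -!scalerAl.
  rewrite hP hK hU /N0 /N'; move: (P1 * K2 * P1) (P2 * K2 * P1) (S * K2 * P1) (P1 * K2 * Q) => x1 x2 x3 x4.
  move: (S * (U + K0) * Q) (S * (U + K0) * P1) (_ * (U + K0) * D2 t) (D1 t * W t * D2 t) => x5 x6 x7 x8.
  by pointwise; field.
have [NY YN] := Yinv t td.
have [C1 [c1 c2]] := D1C.
have := sandwich_inverse NE c1 c2 D2C.1 D2C.2 NY YN.
rewrite YE // Y'E // Y1E // Y2E // => h12.
rewrite /D1 /D2 triple_product in h12.
have f0 : Q * X0 * S = S * X0 * S by rewrite [Q * _]mulrBl mul1r mulrBl (Pzero PX1 P1S) subr0 corner_two.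
have f1 : P1 * X0 * S = 0 by exact: Pzero PX1 P1S.
have f2 : P1 * X0 * P2 = 0 by exact: Pzero PX1 P12.
have f3 : S * (X0 * P1) = Q * X0 * P1 by rewrite SQ mulrBl !mulrA (Pzero PX2 P21) subr0.
have f4 (X X' : bop R) : Q * (X * P2 + X' * S) * Q = Q * X * P2 + Q * X' * S.
  by rewrite -mulrA [(X * P2 + _) * Q]mulrDl -!mulrA P2Q SQS [Q * (_ + _)]mulrDr.
rewrite f0 f1 f2 in h12; rewrite !f4 f3 !rmorphXn /=.
suff E : forall x y : bop R, y = x -> M t * x = 1 /\ x * M t = 1 -> M t * y = 1 /\ y * M t = 1.
  apply: E h12; rewrite {c1 c2 C1 NY YN NE}.
move: (S * X0 * S) (Q * X0 * P2) (Q * X1 * S) (Q * X1 * P2) (Q * X2 * S) (P1 * X1 * S) (Q * X0 * P1).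
move: (P1 * X0 * P1 + P1 * X1 * P2 + P1 * X2 * S + Q * X1 * P1 + Q * X2 * P2 + Q * X3 * S).
set z := (P1 * X1 * P1 + _ + _ + _ + _ + _ + t%:C *: _).
move: z => z y x0 x1 x2 x3 x4 x5 x6.
  by pointwise; ring.
by move=> x y ->.
Qed.

End TwoProjections.
End InverseExpansion.

Section InnerProduct.
Context {R : realType}.
Implicit Types (phi psi e f g : seqZ R) (z : R[i]).

Lemma inner_sumle phi psi c d : l2le phi c -> l2le psi d ->
  sumle (fun n => phi n * (psi n)^*) (c * d).
Proof.
move=> Hc Hd; apply: sumle_CS => //; apply: l2le_dom Hd => n.
by rewrite nc_conj.
Qed.

Lemma inner_lin z phi phi' psi : l2w 0 phi -> l2w 0 phi' -> l2w 0 psi ->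
  inner (z *: phi + phi') psi = z * inner phi psi + inner phi' psi.
Proof.
move=> /l2P[c Hc] /l2P[c' Hc'] /l2P[d Hd]; rewrite /inner.
have h := inner_sumle Hc Hd; rewrite -(csumZ z h) -(csumD (sumleZ z h) (inner_sumle Hc' Hd)).
by apply: eq_csum => n; rewrite addsE scalesE mulrDl mulrA.
Qed.

Lemma inner_conj phi psi : l2w 0 phi -> l2w 0 psi -> inner psi phi = (inner phi psi)^*.
Proof.
move=> /l2P[c Hc] /l2P[d Hd]; have h := inner_sumle Hc Hd.
apply: (csum_unique (inner_sumle Hd Hc)) => e /(csum_lim h) [s us Hs].
exists s => // s' us' sub; have := Hs s' us' sub; rewrite -nc_conj; apply: le_trans.
rewrite le_eqVlt; apply/orP; left; apply/eqP; congr nc.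
rewrite rmorphB rmorph_sum; congr (_ - _); apply: eq_bigr => n _.
by rewrite rmorphM /= conjCK mulrC.
Qed.

Lemma inner0l psi : inner 0 psi = 0.
Proof.
rewrite /inner (@csum_fin _ _ [::]) ?big_nil // => n _; exact: mul0r.
Qed.

Lemma innerZl z phi psi : l2w 0 phi -> l2w 0 psi -> inner (z *: phi) psi = z * inner phi psi.
Proof.
by move=> h1 h2; rewrite -[z *: phi]addr0 inner_lin ?inner0l ?addr0 //; exact: l2_0.
Qed.

Lemma innerDl phi phi' psi : l2w 0 phi -> l2w 0 phi' -> l2w 0 psi ->
  inner (phi + phi') psi = inner phi psi + inner phi' psi.
Proof. by move=> h1 h2 h3; rewrite -[phi in LHS]scale1r inner_lin // mul1r. Qed.

Lemma innerBl phi phi' psi : l2w 0 phi -> l2w 0 phi' -> l2w 0 psi ->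
  inner (phi - phi') psi = inner phi psi - inner phi' psi.
Proof. by move=> h1 h2 h3; rewrite addrC -scaleN1r inner_lin // mulN1r addrC. Qed.

Lemma inner_linr z phi psi psi' : l2w 0 phi -> l2w 0 psi -> l2w 0 psi' ->
  inner phi (z *: psi + psi') = z^* * inner phi psi + inner phi psi'.
Proof.
move=> h1 h2 h3; rewrite inner_conj //; last exact: l2_lin.
by rewrite inner_lin // rmorphD rmorphM /= -(inner_conj h2 h1) -(inner_conj h3 h1).
Qed.

Lemma inner_eq0 phi : l2w 0 phi -> inner phi phi = 0 -> phi = 0.
Proof.
move=> /l2P[c Hc] i0; apply/funext => m; apply/eqP; rewrite -nc_eq0 -sqrf_eq0.
rewrite eq_le sqr_ge0 andbT; apply/ler_addgt0Pr => e e0.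
have [s us Hs] := csum_lim (inner_sumle Hc Hc) e0.
have sub : {subset s <= undup (m :: s)} by move=> x xs; rewrite mem_undup inE xs orbT.
have := Hs _ (undup_uniq _) sub; rewrite -/(inner phi phi) i0 subr0 add0r; apply: le_trans.
have -> : \sum_(n <- undup (m :: s)) phi n * (phi n)^* = (\sum_(n <- undup (m :: s)) nc (phi n) ^+ 2)%:C.
  rewrite rmorph_sum; apply: eq_bigr => n _; by rewrite rmorphXn /= -normcE_nc normCK.
rewrite ncC ger0_norm ?sumr_ge0 //; last by move=> n _; exact: sqr_ge0.
rewrite (bigD1_seq m) ?undup_uniq ?mem_undup ?mem_head //= lerDl sumr_ge0 // => n _.
exact: sqr_ge0.
Qed.

Definition rk f g : bop R := mkB (fun phi => inner phi g *: f).

Lemma rkE f g phi : l2w 0 f -> l2w 0 g -> l2w 0 phi -> rk f g phi = inner phi g *: f.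
Proof.
move=> Hf Hg Hp; rewrite mkBE //; split.
  by move=> z h1 h2 H1 H2; rewrite inner_lin // scalerDl scalerA.
move: Hf Hg => /l2P[c Hc] /l2P[d Hd].
exists (c * d); first by rewrite mulr_ge0 ?Hc.1 ?Hd.1.
move=> psi b Hb; apply: l2le_le (l2leZ _ Hc).
have := csum_norm (inner_sumle Hb Hd); rewrite -/(inner psi g) => h.
by apply: le_trans (ler_wpM2r Hc.1 h) _; rewrite le_eqVlt; apply/orP; left; apply/eqP; ring.
Qed.

Lemma mul_rk (A : bop R) f g : l2w 0 f -> l2w 0 g -> A * rk f g = rk (A f) g.
Proof.
move=> hf hg; apply: bop_eq => phi hp.
by rewrite boM // rkE // bopZ // rkE //; exact: bopl2.
Qed.

Lemma rk_rk f g f' g' : l2w 0 f -> l2w 0 g -> l2w 0 f' -> l2w 0 g' ->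
  rk f g * rk f' g' = inner f' g *: rk f g'.
Proof.
move=> h1 h2 h3 h4; apply: bop_eq => phi hp.
by rewrite boM // boZ // !rkE //; [rewrite innerZl // !scalerA mulrC|exact: l2Z].
Qed.

Definition proj1 e : bop R := (inner e e)^-1 *: rk e e.

Lemma proj1E e phi : l2w 0 e -> l2w 0 phi -> proj1 e phi = (inner phi e / inner e e) *: e.
Proof. by move=> h1 h2; rewrite boZ // rkE // scalerA mulrC. Qed.

Lemma proj1_idem e : l2w 0 e -> e <> 0 -> proj1 e * proj1 e = proj1 e.
Proof.
move=> he e0; have i0 : inner e e != 0 by apply/eqP => /(inner_eq0 he).
by rewrite -scalerAl -scalerAr rk_rk // !scalerA mulfVK.
Qed.

Lemma proj1_orth e f : l2w 0 e -> l2w 0 f -> inner f e = 0 -> proj1 e * proj1 f = 0.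
Proof. by move=> h1 h2 ef; rewrite -scalerAl -scalerAr rk_rk // ef scale0r !scaler0. Qed.

Lemma rk_proj1 e f : l2w 0 e -> l2w 0 f -> e <> 0 -> rk f e * proj1 e = rk f e.
Proof.
move=> he hf e0; have i0 : inner e e != 0 by apply/eqP => /(inner_eq0 he).
by rewrite -scalerAr rk_rk // scalerA mulVf // scale1r.
Qed.

Lemma rk_proj1_orth e f g : l2w 0 e -> l2w 0 f -> l2w 0 g -> inner e g = 0 -> rk f g * proj1 e = 0.
Proof. by move=> h1 h2 h3 eg; rewrite -scalerAr rk_rk // eg scale0r scaler0. Qed.

Lemma rk_linr z f g g' : l2w 0 f -> l2w 0 g -> l2w 0 g' ->
  rk f (z *: g + g') = z^* *: rk f g + rk f g'.
Proof.
move=> h1 h2 h3; apply: bop_eq => phi hp; have h4 := l2_lin z h2 h3.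
by rewrite boD // boZ // !rkE // inner_linr // scalerDl scalerA.
Qed.

Lemma rk0l g : l2w 0 g -> rk 0 g = 0.
Proof. by move=> h; apply: bop_eq => phi hp; rewrite rkE ?scaler0 ?bo0 //; exact: l2_0. Qed.

Lemma oprojE (E : set (seqZ R)) (A : opZ R) : (forall phi, E phi -> l2w 0 phi) ->
  (forall phi psi, E phi -> E psi -> E (phi - psi)) ->
  (forall phi, l2w 0 phi -> E (A phi) /\ forall psi, E psi -> inner (phi - A phi) psi = 0) ->
  forall phi, l2w 0 phi -> oproj E phi = A phi.
Proof.
move=> El2 Esub HA phi hp; rewrite /oproj.
have ex : exists P : opZ R, [set P | forall phi, l2w 0 phi ->
    E (P phi) /\ forall psi, E psi -> inner (phi - P phi) psi = 0] P by exists A.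
have [P1 P2] := xgetPex (0 : opZ R) ex phi hp.
have [A1 A2] := HA _ hp.
set P := xget _ _ in P1 P2 *.
have d := Esub _ _ P1 A1.
apply/eqP; rewrite -subr_eq0; apply/eqP; apply: inner_eq0; first exact: El2.
have dE : phi - A phi - (phi - P phi) = P phi - A phi by rewrite opprB [LHS]addrC subrKA.
have h1 : l2w 0 (phi - A phi) by apply: l2B => //; exact: El2.
have h2 : l2w 0 (phi - P phi) by apply: l2B => //; exact: El2.
by rewrite -[X in inner X _]dE innerBl ?(A2 _ d) ?(P2 _ d) ?subrr //; exact: El2.
Qed.

End InnerProduct.

Section Potential.
Context {R : realType}.
Variables (V : int -> R) (p : nat) (S : R).
Let w := vpot V.
Hypothesis wS : l2le (wgt w p) S.

Lemma vpot_ge0 n : 0 <= w n. Proof. exact: sqrtr_ge0. Qed.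

Lemma Upot_norm n : nc (Upot V n)%:C = 1.
Proof. by rewrite ncC /Upot; case: ifP; rewrite ?normrN normr1. Qed.

Lemma Upot_sq n : Upot V n * Upot V n = 1.
Proof. by rewrite /Upot; case: ifP; rewrite ?mulrNN mulr1. Qed.

Lemma potE n : V n = w n * Upot V n * w n.
Proof.
rewrite mulrAC -expr2 sqr_sqrtr // /Upot; case: ifPn => h; first by rewrite mulr1 ger0_norm.
by rewrite mulrN1 ltr0_norm ?opprK // ltNge.
Qed.

Definition Uop : bop R := mkB (mulop (Upot V)).

Lemma UopE phi : l2w 0 phi -> Uop phi = mulop (Upot V) phi.
Proof.
move=> h; rewrite mkBE //; split.
  move=> z h1 h2 _ _; apply/funext => n; rewrite addsE scalesE /mulop addsE scalesE.
  by ring.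
exists 1 => // f c Hc; rewrite mul1r; apply: l2le_dom Hc => n.
by rewrite /mulop ncM Upot_norm mul1r.
Qed.

Lemma Uop_sq : Uop * Uop = 1.
Proof.
apply: bop_eq => phi h; have h2 := bopl2 Uop h.
rewrite boM // bo1 // UopE // UopE //; apply/funext => n.
by rewrite /mulop mulrA -rmorphM Upot_sq mul1r.
Qed.

Lemma Uop_offop s : offop s * Uop = Uop * offop s.
Proof.
apply: bop_eq => phi h; have h2 := bopl2 Uop h; have h3 := bopl2 (offop s) h.
rewrite !boM // offopE // UopE // UopE // offopE //; apply/funext => n.
by rewrite /mulop /offseq; case: ifP; rewrite ?mulr0.
Qed.

Definition vmul (a : seqZ R) : seqZ R := fun n => (w n)%:C * a n.

Lemma vmul_l2 (a : seqZ R) C : 0 <= C -> (forall n, nc (a n) <= C * jap n ^+ p) -> l2w 0 (vmul a).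
Proof.
move=> C0 H; apply: (@l2le_l2 _ _ (nc C%:C * S)).
apply: l2le_dom (l2leZ C%:C wS) => n; rewrite scalesE /wgt !ncM !ncC (ger0_norm C0).
rewrite ger0_norm ?vpot_ge0 // ger0_norm ?mulr_ge0 ?exprn_ge0 ?jap_ge0 ?vpot_ge0 //.
by rewrite mulrA mulrC; apply: ler_wpM2r; [exact: vpot_ge0|].
Qed.

Lemma Op_separable C g (a b : seqZ R) : growth p C g -> (forall n m, g (n - m) = a n * (b m)^*) ->
  l2w 0 (vmul a) -> l2w 0 (vmul b) -> Op w g = rk (vmul a) (vmul b).
Proof.
move=> hg gE ha hb; apply: bop_eq => phi h; apply/funext => n.
rewrite (OpE vpot_ge0 wS n hg h) rkE // scalesE mulrC /inner.
move: h hb => /l2P[c Hc] /l2P[d Hd]; rewrite -(csumZ _ (inner_sumle Hc Hd)).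
apply: eq_csum => m; rewrite /cker gE /vmul rmorphM /= .
have -> : (w m)%:C^* = (w m)%:C by apply/conj_Creal; rewrite complex_real.
by ring.
Qed.

Lemma vmul_l2w1 phi : (1 <= p)%N -> l2w 0 phi -> l2w 1 (vmul phi).
Proof.
move=> p1 /l2P[c Hc]; rewrite /l2w /= wnorm_jmul; apply: (@l2le_l2 _ _ (nc S%:C * c)).
apply: l2le_dom (l2leZ S%:C Hc) => n; rewrite scalesE /jmul /vmul !ncM mulrA.
apply: ler_wpM2r; first exact: nc_ge0.
rewrite powRr1 ?jap_ge0 // !ncC -normrM.
have := l2le_coord n wS; rewrite /wgt ncC => h; apply: le_trans (_ : _ <= S) _; last exact: ler_norm.
apply: le_trans h; rewrite !ger0_norm ?mulr_ge0 ?exprn_ge0 ?jap_ge0 ?vpot_ge0 //.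
apply: ler_wpM2r; first exact: vpot_ge0.
by rewrite -[leLHS]expr1; apply: ler_weXn2l => //; exact: jap_ge1.
Qed.

Lemma fker_growth m (a b : R[i]) : nc a <= 1 -> nc b <= 1 -> exists C, growth p C (fker m a b).
Proof.
move=> a1 b1.
have hb (z : R[i]) : nc z <= 1 -> growth p (nc (z^-1 - z)^-1) (hker z).
  move=> z1 x; rewrite /hker ncM mulrC; apply: ler_pM; rewrite ?nc_ge0 //.
  rewrite ncX; apply: (@le_trans _ _ 1); first by rewrite exprn_ile1 ?nc_ge0.
  by rewrite exprn_ege1 ?jap_ge1.
have h := growthZ (2%:R * m)^-1 (growthB (hb _ a1) (hb _ b1)).
by eexists; exact: h.
Qed.

Lemma MopE pm (mu : R) (a b : R[i]) phi : (1 <= p)%N -> 0 < mu -> nc a = 1 ->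
  2%:R - a - a^-1 = (mu ^+ 2)%:C -> 0 < pmsign pm * complex.Im a -> b != 0 -> nc b < 1 ->
  2%:R - b - b^-1 = - (mu ^+ 2)%:C -> l2w 0 phi ->
  Mop V pm mu phi = (Uop + Op w (fker (mu ^+ 2)%:C a b)) phi.
Proof.
move=> p1 mu0 a1 aE aI b0 b1 bE hp.
have m0 : 0 < mu ^+ 2 by rewrite exprn_gt0.
have s1 : 1 / 2 < 1 :> R by rewrite mul1r invf_lt1 // ltr1n.
have hv := vmul_l2w1 p1 hp.
rewrite boD // UopE //; apply/funext => n.
rewrite /Mop [LHS](_ : _ = mulop (Upot V) phi n + (w n)%:C * R0 pm (mu ^+ 4) (vmul phi) n) //.
rewrite addsE; congr (_ + _).
have -> : mu ^+ 4 = (mu ^+ 2) ^+ 2 by rewrite -exprM.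
rewrite (R0E m0 a1 aE aI b0 b1 bE s1 hv).
have a1le : nc a <= 1 by rewrite a1.
have [C hg] := fker_growth (mu ^+ 2)%:C a1le (ltW b1).
rewrite (OpE vpot_ge0 wS n hg hp).
have [c hc] := F0_sumle (mu ^+ 2) a1 b1 n s1 hv.
rewrite /convol /kop -(csumZ _ hc); apply: eq_csum => k.
by rewrite /cker /vmul; ring.
Qed.

End Potential.

Section SpAtOne.
Context {R : realType}.

Lemma Sp1 N : Sp (1 : R[i]) 1 N 1 = N%:R.
Proof.
by elim: N => [|N IH] //=; rewrite IH Sp0 expr1n mul1r natr1.
Qed.

Lemma Sp2 N : Sp (1 : R[i]) 2 N 1 = N%:R * (N%:R - 1) / 2%:R.
Proof.
elim: N => [|N IH]; first by rewrite /= !mul0r.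
by rewrite [LHS](_ : _ = 1 * Sp 1 2 N 1 + Sp 1 1 N 1) // IH Sp1 -[N.+1%:R]natr1; field.
Qed.

Lemma Sp3 N : Sp (1 : R[i]) 3 N 1 = N%:R * (N%:R - 1) * (N%:R - 2%:R) / 6%:R.
Proof.
elim: N => [|N IH]; first by rewrite /= !mul0r.
by rewrite [LHS](_ : _ = 1 * Sp 1 3 N 1 + Sp 1 2 N 1) // IH Sp2 -[N.+1%:R]natr1; field.
Qed.

Lemma sqr_absz (x : int) : x%:~R ^+ 2 = `|x|%N%:R ^+ 2 :> R[i].
Proof. by case: x => k; rewrite ?NegzE ?abszN ?mulrNz ?sqrrN. Qed.

End SpAtOne.

Section BetaValues.
Context {R : realType}.
Implicit Types (t : R) (pm : bool).

Definition sgn pm : R[i] := Complex 0 (pmsign pm).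

Lemma pmsign_sq pm : pmsign pm * pmsign pm = 1 :> R.
Proof. by rewrite /pmsign; case: pm; rewrite ?mulrNN mulr1. Qed.

Lemma sgn_sq pm : sgn pm ^+ 2 = (-1)%:C.
Proof.
by apply/eqP; rewrite eq_complex /= !mul0r !mulr0 pmsign_sq sub0r addr0 !eqxx.
Qed.

Lemma sgnN pm : - sgn pm = sgn (~~ pm).
Proof. by apply/eqP; rewrite eq_complex /= oppr0 eqxx /pmsign; case: pm => /=; rewrite ?opprK eqxx. Qed.

Lemma sgnV pm : (sgn pm)^-1 = - sgn pm.
Proof.
have s0 : sgn pm != 0 by rewrite eq_complex /= /pmsign eqxx; case: pm; rewrite ?oppr_eq0 oner_eq0.
apply: (mulfI s0); rewrite divff // mulrN -expr2 sgn_sq.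
by rewrite rmorphN opprK.
Qed.

Lemma beta_complex (pm : bool) t : beta (sgn pm) (-1) t = Complex (uu (-1) t / 2) (- pmsign pm * t / 2).
Proof.
rewrite /beta -(rmorph_nat (real_complex R) 2) -fmorphV; apply/eqP; rewrite eq_complex /=.
by rewrite !(mulr0, mul0r, subr0, addr0, sub0r, oppr0, add0r) -mulNr !eqxx.
Qed.

Lemma nc_beta pm t : `|t| < 2 -> nc (beta (sgn pm) (-1) t) = 1.
Proof.
move=> t2; rewrite beta_complex /=; rewrite -[RHS]sqrtr1; congr Num.sqrt.
have sm2 : (-1) ^+ 2 = 1 :> R by rewrite sqrrN expr1n.
have -> : (uu (-1) t / 2) ^+ 2 = (uu (-1) t) ^+ 2 / 4 by field.
rewrite (uu_sq sm2 t2).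
have -> : (- pmsign pm * t / 2) ^+ 2 = (pmsign pm * pmsign pm) * t ^+ 2 / 4 by field.
by rewrite pmsign_sq; field.
Qed.

Lemma beta_pow_inv (sg : R[i]) (s : R) t : sg ^+ 2 = s%:C -> s ^+ 2 = 1 -> `|t| < 2 ->
  let x := beta sg s t ^+ 2 in
  x^-1 - x = sg * t%:C * (uu s t)%:C /\ 2%:R - x - x^-1 = - (s * t ^+ 2)%:C.
Proof.
move=> sg2 s2 tl x.
have bV := betaV sg2 s2 tl.
have xV : x^-1 = (beta sg s t + sg * t%:C) ^+ 2 by rewrite /x -exprVn bV.
have uE : (uu s t)%:C = 2%:R * beta sg s t + sg * t%:C by rewrite /beta; field.
split; first by rewrite xV uE /x; ring.
have b1 := beta_inv sg2 s2 tl.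
rewrite rmorphM rmorphXn /= -sg2 xV /x.
transitivity (2%:R - 2%:R * (beta sg s t * (beta sg s t + sg * t%:C)) - sg ^+ 2 * t%:C ^+ 2); first by ring.
by rewrite b1 mulr1 subrr sub0r.
Qed.

Lemma beta1_real t : beta 1 1 t = ((uu 1 t - t) / 2)%:C.
Proof.
by rewrite /beta mul1r rmorphM rmorphB fmorphV (rmorph_nat (real_complex R) 2).
Qed.

Lemma beta1_bounds t : 0 < t < 2 -> 0 < (uu 1 t - t) / 2 < 1.
Proof.
move=> /andP[t0 t2]; have tl : `|t| < 2 by rewrite gtr0_norm.
have u0 : 0 < uu 1 t by apply: uu_gt0; rewrite ?expr1n.
have u2 : uu 1 t ^+ 2 = 4 + 1 * t ^+ 2 by apply: uu_sq; rewrite ?expr1n.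
have h1 : t < uu 1 t by rewrite -(ltr_pXn2r (n := 2)) ?nnegrE ?ltW // u2; nra.
have h2 : uu 1 t < 2 + t by rewrite -(ltr_pXn2r (n := 2)) ?nnegrE ?ltW ?addr_gt0 // u2; nra.
by rewrite divr_gt0 ?subr_gt0 //= ltr_pdivrMr // mul1r ltrBlDr.
Qed.

Lemma nc_beta1 t : 0 < t < 2 -> beta 1 1 t != 0 /\ nc (beta 1 1 t) < 1.
Proof.
move=> /beta1_bounds /andP[h0 h1]; rewrite beta1_real ncC gtr0_norm //; split=> //.
by rewrite -nc_eq0 ncC gtr0_norm // gt_eqF.
Qed.

End BetaValues.

Section ExpansionAtZero.
Context {R : realType}.
Variables (w : int -> R) (p : nat) (S : R) (pm : bool).
Hypotheses (w0 : forall n, 0 <= w n) (wS : l2le (wgt w p) S) (p7 : (7 <= p)%N).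

Let sg : R[i] := sgn (~~ pm).
Let aa (t : R) : R[i] := beta sg (-1) t ^+ 2.
Let bb (t : R) : R[i] := beta 1 1 t ^+ 2.

Let sg2 : sg ^+ 2 = (-1)%:C. Proof. exact: sgn_sq. Qed.
Let sm2 : (-1) ^+ 2 = 1 :> R. Proof. by rewrite sqrrN expr1n. Qed.
Let s12 : 1 ^+ 2 = 1 :> R. Proof. by rewrite expr1n. Qed.
Let s12C : (1 : R[i]) ^+ 2 = (1 : R)%:C. Proof. by rewrite expr1n. Qed.

Lemma zero_roots (t : R) : 0 < t < 1 -> [/\ nc (aa t) = 1, 2%:R - aa t - (aa t)^-1 = (t ^+ 2)%:C,
  0 < pmsign pm * complex.Im (aa t), bb t != 0 & nc (bb t) < 1 /\ 2%:R - bb t - (bb t)^-1 = - (t ^+ 2)%:C].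
Proof.
move=> /andP[t0 t1]; have t2 : t < 2 by rewrite (lt_trans t1) // ltr1n.
have tl : `|t| < 2 by rewrite gtr0_norm.
have [_ aE] := beta_pow_inv sg2 sm2 tl.
have [_ bE] := beta_pow_inv s12C s12 tl.
have [b0 b1] : beta 1 1 t != 0 /\ nc (beta 1 1 t) < 1 by apply: nc_beta1; rewrite t0.
split=> //.
- by rewrite ncX nc_beta ?expr1n.
- by rewrite aE mulN1r rmorphN opprK.
- rewrite /aa beta_complex /= .
  have -> : pmsign pm * (uu (-1) t / 2 * (- pmsign (~~ pm) * t / 2) + - pmsign (~~ pm) * t / 2 * (uu (-1) t / 2))
    = (pmsign pm * pmsign pm) * (uu (-1) t * t / 2).
    have -> : pmsign (~~ pm) = - pmsign pm :> R by rewrite /pmsign; case: (pm); rewrite ?opprK.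
    by field.
  by rewrite pmsign_sq mul1r divr_gt0 // mulr_gt0 // uu_gt0.
- by rewrite expf_neq0.
- split; first by rewrite ncX expr_lt1 ?nc_ge0.
  by rewrite bE mul1r.
Qed.

Definition ker2 (x : int) : R[i] := 4%:R * x%:~R ^+ 2 - 1.
Definition ker3 (x : int) : R[i] := (`|x|%N%:R ^+ 3 - `|x|%N%:R) / 12%:R.

Let one (x : int) : R[i] := 1.
Let one1 x : nc (one x) <= 1. Proof. by rewrite nc1. Qed.
Let z1 : nc (1 : R[i]) <= 1. Proof. by rewrite nc1. Qed.

Let T m := taylor w one 2 m.
Let Tg m : (m <= p)%N -> exists C, growth p C (fun x => one x * Sp 1 m (2 * `|x|) 1).
Proof. by move=> mp; eexists; exact: (spk_growth 2 one1 z1 mp z1). Qed.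

Let T2E : T 0 - T 1 - 2%:R *: T 2 = - Op w ker2.
Proof.
have [C0 g0] := Tg (leq_trans (isT : 0 <= 7)%N p7).
have [C1 g1] := Tg (leq_trans (isT : 1 <= 7)%N p7).
have [C2 g2] := Tg (leq_trans (isT : 2 <= 7)%N p7).
have g3 := growthB (growthB g0 g1) (growthZ 2%:R g2).
rewrite /T /taylor -(OpZ w0 wS _ g2) -(OpB w0 wS g0 g1) -(OpB w0 wS (growthB g0 g1) (growthZ _ g2)).
have E : Op w ker2 = Op w (fun x => -1 * (one x * Sp 1 0 (2 * `|x|) 1 - one x * Sp 1 1 (2 * `|x|) 1 - 2%:R * (one x * Sp 1 2 (2 * `|x|) 1))).
  apply: Op_eq => x; rewrite Sp0 Sp1 Sp2 expr1n natrM /ker2 /one.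
  have -> : x%:~R ^+ 2 = (`|x|%N%:R : R[i]) ^+ 2.
    exact: sqr_absz.
  by field.
by rewrite E (OpZ w0 wS _ g3) scaleN1r opprK.
Qed.

Let T3E : - T 1 + 2%:R *: T 2 + 2%:R *: T 3 = 32%:R *: Op w ker3.
Proof.
have [C1 g1] := Tg (leq_trans (isT : 1 <= 7)%N p7).
have [C2 g2] := Tg (leq_trans (isT : 2 <= 7)%N p7).
have [C3 g3] := Tg (leq_trans (isT : 3 <= 7)%N p7).
have g12 := growthD (growthZ (-1) g1) (growthZ 2%:R g2).
have g := growthD g12 (growthZ 2%:R g3).
have E : Op w ker3 = Op w (fun x => 32%:R^-1 * (-1 * (one x * Sp 1 1 (2 * `|x|) 1) + 2%:R * (one x * Sp 1 2 (2 * `|x|) 1) + 2%:R * (one x * Sp 1 3 (2 * `|x|) 1))).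
  by apply: Op_eq => x; rewrite Sp1 Sp2 Sp3 natrM /ker3 /one; field.
rewrite E (OpZ w0 wS _ g) (OpD w0 wS g12 (growthZ _ g3)) (OpD w0 wS (growthZ (-1) g1) (growthZ _ g2)).
rewrite (OpZ w0 wS _ g1) (OpZ w0 wS _ g2) (OpZ w0 wS _ g3) -/(T 1) -/(T 2) -/(T 3).
by rewrite scalerA divff ?pnatr_eq0 // scale1r scaleN1r.
Qed.

Lemma expansion_at_zero : exists2 W, E 3 1 W & forall t : R, 0 < t < 1 ->
  Op w (fker (t ^+ 2)%:C (aa t) (bb t)) = (t%:C^-1 ^+ 3) *: (- ((sg + 1) / 4%:R) *: Op w one
     + t%:C ^+ 2 *: (((sg - 1) / 32%:R) *: Op w ker2) + t%:C ^+ 3 *: Op w ker3 + t%:C ^+ 4 *: W t).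
Proof.
have le1 (t : R) : 0 < t < 1 -> nc (beta sg (-1) t) <= 1.
  by move=> /andP[t0 t1]; rewrite nc_beta // gtr0_norm // (lt_trans t1) // ltr1n.
have le2 (t : R) : 0 < t < 1 -> nc (beta 1 1 t) <= 1.
  move=> /andP[t0 t1]; have [_ h] : beta 1 1 t != 0 /\ nc (beta 1 1 t) < 1.
    by apply: nc_beta1; rewrite t0 (lt_trans t1) // ltr1n.
  exact: ltW.
have [W1 E1 H1] := betapow_exp4 sg2 sm2 le1 2 w0 wS one1 (k := 3) p7.
have [W2 E2 H2] := betapow_exp4 s12C s12 le2 2 w0 wS one1 (k := 3) p7.
exists (fun t => (- sg / 2%:R) *: W1 t - 2%:R^-1 *: W2 t).
  by apply: E_B; apply: E_Z.
move=> t td; have {}H1 := H1 t td; have {}H2 := H2 t td.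
have /andP[t0 t1] := td; have tl : `|t| < 2 by rewrite gtr0_norm // (lt_trans t1) // ltr1n.
have tn : t%:C != 0 :> R[i] by rewrite eq_complex /= negb_and gt_eqF.
have -> : Op w (fker (t ^+ 2)%:C (aa t) (bb t)) = (t%:C^-1 ^+ 3) *: ((- sg / 2%:R) *: (qq (-1) t *: betapow sg (-1) w one 2 t)
    - 2%:R^-1 *: (qq 1 t *: betapow 1 1 w one 2 t)).
  have be z : nc z <= 1 -> growth p 1 (fun x : int => one x * z ^+ (2 * `|x|)).
    move=> zle x; rewrite /one mul1r ncX mul1r; apply: (@le_trans _ _ 1).
      by rewrite exprn_ile1 ?nc_ge0.
    by rewrite exprn_ege1 ?jap_ge1.
  have g1 := be _ (le1 t td); have g2 := be _ (le2 t td).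
  rewrite 2!scalerA -[in RHS](OpZ w0 wS _ g1) -[in RHS](OpZ w0 wS _ g2).
  rewrite -(OpB w0 wS (growthZ _ g1) (growthZ _ g2)) -(OpZ w0 wS _ (growthB (growthZ _ g1) (growthZ _ g2))).
  apply: Op_eq => x; rewrite /fker /hker /one /qq /aa /bb.
  have [-> _] := beta_pow_inv sg2 sm2 tl; have [-> _] := beta_pow_inv s12C s12 tl.
  have u1 := uuC_neq0 sm2 tl; have u2 := uuC_neq0 s12 tl; rewrite -!exprM !mul1r rmorphXn /=.
  have -> : - sg = sg^-1 by rewrite /sg sgnV.
  have s0 : sg != 0 by apply/eqP => e; have := sg2; rewrite e expr0n /= rmorphN rmorph1 => /eqP; rewrite eq_sym oppr_eq0 oner_eq0.
  move: (beta _ _ _ ^+ _) (beta _ _ _ ^+ _) => y1 y2.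
  by field; rewrite s0 u1 u2 tn.
rewrite H1 H2 /=.
have -> : Op w ker2 = - (T 0 - T 1 - 2%:R *: T 2) by rewrite T2E opprK.
have -> : Op w ker3 = 32%:R^-1 *: (- T 1 + 2%:R *: T 2 + 2%:R *: T 3).
  by rewrite T3E scalerA mulVf ?scale1r // pnatr_eq0.
rewrite /T -[Op w one]/(Op w one); have -> : Op w one = T 0.
  by apply: Op_eq => x; rewrite Sp0 expr1n mulr1.
rewrite /T; congr (_ *: _).
move: (taylor w one 2 0) (taylor w one 2 1) (taylor w one 2 2) (taylor w one 2 3) (W1 t) (W2 t) => x0 x1 x2 x3 y1 y2.
have S2 := sg2; rewrite rmorphN rmorph1 in S2.
rewrite !rmorphN !rmorph1; move: S2; move: (sg) (t%:C) => s' t' S2.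
by pointwise; field: S2.
Qed.

End ExpansionAtZero.

Section ExpansionAtSixteen.
Context {R : realType}.
Variables (w : int -> R) (p : nat) (S : R) (pm : bool).
Hypotheses (w0 : forall n, 0 <= w n) (wS : l2le (wgt w p) S) (p3 : (3 <= p)%N).

Let sg : R[i] := sgn pm.
Let tau (t : R) : R := 2 - t ^+ 2.
Let aa (t : R) : R[i] := - (beta sg (-1) t ^+ 4).
Let bb (t : R) : R[i] := beta 1 1 (tau t) ^+ 2.

Let sg2 : sg ^+ 2 = (-1)%:C. Proof. exact: sgn_sq. Qed.
Let sm2 : (-1) ^+ 2 = 1 :> R. Proof. by rewrite sqrrN expr1n. Qed.
Let s12 : 1 ^+ 2 = 1 :> R. Proof. by rewrite expr1n. Qed.
Let s12C : (1 : R[i]) ^+ 2 = (1 : R)%:C. Proof. by rewrite expr1n. Qed.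

Lemma tau_bounds (t : R) : 0 < t < 1 -> 1 < tau t < 2.
Proof.
move=> /andP[t0 t1]; have h : t ^+ 2 < 1 by rewrite expr_lt1 // ltW.
have h0 : 0 < t ^+ 2 by rewrite exprn_gt0.
by rewrite /tau; apply/andP; split; lra.
Qed.

Let tauC (t : R) : (tau t)%:C = 2%:R - t%:C ^+ 2.
Proof. by rewrite rmorphB rmorphXn (rmorph_nat (real_complex R) 2). Qed.

Let tl (t : R) : 0 < t < 1 -> `|t| < 2.
Proof. by move=> /andP[t0 t1]; rewrite gtr0_norm // (lt_trans t1) // ltr1n. Qed.

Let taul (t : R) : 0 < t < 1 -> `|tau t| < 2.
Proof. by move=> /tau_bounds /andP[h1 h2]; rewrite gtr0_norm // (lt_trans _ h1). Qed.

Let tau02 (t : R) : 0 < t < 1 -> 0 < tau t < 2.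
Proof. by move=> /tau_bounds /andP[h1 ->]; rewrite (lt_trans _ h1). Qed.

Let aa_inv (t : R) : 0 < t < 1 ->
  (aa t)^-1 - aa t = - (sg * t%:C * (uu (-1) t)%:C * (tau t)%:C) /\
  2%:R - aa t - (aa t)^-1 = (tau t)%:C ^+ 2.
Proof.
move=> td; have [h1 h2] := beta_pow_inv sg2 sm2 (tl td).
have E : (tau t)%:C = beta sg (-1) t ^+ 2 + (beta sg (-1) t ^+ 2)^-1.
  rewrite tauC; apply/eqP; rewrite -subr_eq0; apply/eqP.
  transitivity (2%:R - beta sg (-1) t ^+ 2 - (beta sg (-1) t ^+ 2)^-1 - t%:C ^+ 2); first by ring.
  by rewrite h2 mulN1r rmorphN opprK rmorphXn subrr.
have b0 : beta sg (-1) t ^+ 2 != 0 by rewrite expf_neq0 // (beta_neq0 sg2 sm2 (tl td)).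
have aE : aa t = - ((beta sg (-1) t ^+ 2) ^+ 2) by rewrite -exprM.
rewrite E -h1 aE; move: (beta sg (-1) t ^+ 2) b0 => x x0; split; by field.
Qed.

Lemma sixteen_roots (t : R) : 0 < t < 1 -> [/\ nc (aa t) = 1, 2%:R - aa t - (aa t)^-1 = (tau t ^+ 2)%:C,
  0 < pmsign pm * complex.Im (aa t), bb t != 0 & nc (bb t) < 1 /\ 2%:R - bb t - (bb t)^-1 = - (tau t ^+ 2)%:C].
Proof.
move=> td; have /andP[t0 t1] := td.
have [_ aE] := aa_inv td; have [_ bE] := beta_pow_inv s12C s12 (taul td).
have [b0 b1] := nc_beta1 (tau02 td).
split=> //.
- by rewrite ncN ncX nc_beta ?expr1n // tl.
- by rewrite aE rmorphXn.
- have u2 := uu_sq sm2 (tl td); have u0 := uu_gt0 sm2 (tl td).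
  rewrite /aa (_ : beta sg (-1) t ^+ 4 = (beta sg (-1) t ^+ 2) ^+ 2); last by rewrite -exprM.
  rewrite beta_complex /=; set u := uu (-1) t in u0 u2 *.
  have -> : pmsign pm * - ((u / 2 * (u / 2) - - pmsign pm * t / 2 * (- pmsign pm * t / 2)) *
    (u / 2 * (- pmsign pm * t / 2) + - pmsign pm * t / 2 * (u / 2)) +
    (u / 2 * (- pmsign pm * t / 2) + - pmsign pm * t / 2 * (u / 2)) *
    (u / 2 * (u / 2) - - pmsign pm * t / 2 * (- pmsign pm * t / 2)))
    = (pmsign pm * pmsign pm) * (u * t) * (u ^+ 2 - (pmsign pm * pmsign pm) * t ^+ 2) / 4 by field.
  have /andP[h1 _] := tau_bounds td; rewrite /tau in h1.
  by rewrite pmsign_sq u2 !mul1r divr_gt0 // !mulr_gt0 //; nra.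
- by rewrite expf_neq0.
- split; first by rewrite ncX expr_lt1 ?nc_ge0.
  by rewrite bE mul1r.
Qed.

Let one (x : int) : R[i] := 1.
Let one1 x : nc (one x) <= 1. Proof. by rewrite nc1. Qed.
Let ee (x : int) : R[i] := (-1) ^+ `|x|.
Let ee1 x : nc (ee x) <= 1. Proof. by rewrite ncX ncN nc1 expr1n. Qed.

Let y (t : R) : R[i] := (uu 1 (tau t))%:C.
Let y0 : R[i] := (Num.sqrt (8 : R))%:C.
Definition gam0 : R[i] := (y0 - 2%:R) / 2%:R.
Let Q (t : R) : R[i] := (y t)^-1.
Let pp (t : R) : R[i] := (y t + y0)^-1.
Let rr1 (t : R) : R[i] := (tau t)%:C^-1.

Let y_low (t : R) : 0 < t < 1 -> 2 <= uu 1 (tau t).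
Proof.
move=> td; rewrite -[leLHS]ger0_norm // -sqrtr_sqr ler_wsqrtr //.
by have := sqr_ge0 (tau t); lra.
Qed.

Let y_sE0 : sE 0 1 y.
Proof.
apply: (@sE_sqrt0 _ 1 (fun t => 4 + 1 * tau t ^+ 2) 4 8 (fun t => 2 * tau t * - (2 * t))) => //; last by rewrite ler01 lexx.
move=> t td; have /andP[h1 h2] := tau_bounds td; have /andP[t0 t1] := td; split.
- by have := sqr_ge0 (tau t); lra.
- by nra.
- rewrite !normrM normrN normrM !ger0_norm ?ltW ?(lt_trans _ h1) //.
  by nra.
have ler02 : 0 <= 2 :> R by [].
pose P (h : R) := - (2 * tau t) + (2 * t + h) ^+ 2.
exists (2 * 2 + 9), 1; split=> // h h1'.
have -> : (4 + 1 * tau (t + h) ^+ 2)%:C - (4 + 1 * tau t ^+ 2)%:C - h%:C * (2 * tau t * - (2 * t))%:C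
  = (h ^+ 2 * P h)%:C.
  by rewrite -rmorphM -!rmorphB; congr (_%:C); rewrite /P /tau; ring.
rewrite ncC normrM normrX mulrC; apply: ler_wpM2r; first exact: sqr_ge0.
apply: le_trans (ler_normD _ _) _; rewrite normrN normrM normrX (ger0_norm ler02) (gtr0_norm (lt_trans ltr01 h1)).
apply: lerD; first by rewrite ler_pM2l // ltW.
have ->  : 9 = 3 ^+ 2 :> R by ring.
have h3 : `|2 * t + h| <= 3.
  by apply: le_trans (ler_normD _ _) _; rewrite normrM (gtr0_norm t0) ger0_norm //; lra.
by apply: lerXn2r => //; rewrite nnegrE.
Qed.

Let s8 : 0 < Num.sqrt (8 : R). Proof. by rewrite sqrtr_gt0. Qed.

Let y_gt0 (t : R) : 0 < t < 1 -> 0 < uu 1 (tau t).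
Proof. by move=> /y_low; apply: lt_le_trans. Qed.

Let y_neq0 (t : R) : 0 < t < 1 -> y t != 0.
Proof. by move=> /y_gt0 h; rewrite eq_complex /= negb_and gt_eqF. Qed.

Let y0_neq0 : y0 != 0. Proof. by rewrite eq_complex /= negb_and gt_eqF. Qed.

Let yy0_neq0 (t : R) : 0 < t < 1 -> y t + y0 != 0.
Proof. by move=> /y_gt0 h; rewrite -rmorphD eq_complex /= negb_and gt_eqF // addr_gt0. Qed.

Let y0_sq : y0 ^+ 2 = 8%:R.
Proof. by rewrite -rmorphXn sqr_sqrtr // (rmorph_nat (real_complex R) 8). Qed.

Let y_sq (t : R) : 0 < t < 1 -> y t ^+ 2 = y0 ^+ 2 + t%:C * (t%:C * (t%:C ^+ 2 - 4%:R)).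
Proof.
move=> td; have := uuC_sq s12 (taul td); rewrite -/(y t) => ->.
by rewrite y0_sq mul1r tauC; ring.
Qed.

Let yE (t : R) : 0 < t < 1 -> y t = y0 + t%:C * (t%:C * (t%:C ^+ 2 - 4%:R) * pp t).
Proof.
move=> td; have n := yy0_neq0 td; apply: (mulIf n).
have -> : y t * (y t + y0) = y t ^+ 2 + y t * y0 by ring.
rewrite (y_sq td) /pp; field; exact: n.
Qed.

Let pp_sE k : sE k 1 pp.
Proof.
have b0 : sE 0 1 pp.
  apply: (@sE_inv0 _ 1 _ 2) => //; first by apply: sE_D; [exact: y_sE0|exact: sE_const].
  move=> t td; rewrite -rmorphD ncC ger0_norm; last by rewrite addr_ge0 ?ltW ?y_gt0.
  by rewrite (le_trans (y_low td)) // lerDl ltW.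
apply: (sE_fix (f0 := (2%:R * y0)^-1)
  (Phi := fun t => - (2%:R * y0)^-1 * (t%:C * (t%:C ^+ 2 + - 4%:R)) * (pp t * pp t)) b0).
  move=> k' hk; apply: sE_M; last exact: sE_M.
  apply: sE_Z; apply: sE_M; first exact: sE_t.
  by apply: sE_D; [apply: sE_X; exact: sE_t|exact: sE_const].
move=> t td; have n := yy0_neq0 td; have n0 := y0_neq0; have Y := y_sq td; rewrite /pp.
have -> : t%:C * (- (2%:R * y0)^-1 * (t%:C * (t%:C ^+ 2 + - 4%:R)) * ((y t + y0)^-1 * (y t + y0)^-1))
  = - (2%:R * y0)^-1 * (t%:C * (t%:C * (t%:C ^+ 2 - 4%:R))) * ((y t + y0)^-1 * (y t + y0)^-1) by ring.
have -> : t%:C * (t%:C * (t%:C ^+ 2 - 4%:R)) = y t ^+ 2 - y0 ^+ 2 by rewrite Y; ring.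
by move: (y t) y0 n n0 => u v n n0; field; rewrite n n0.
Qed.

Let tt_sE k : sE k 1 (fun t : R => t%:C * (t%:C ^+ 2 - 4%:R)).
Proof.
apply: sE_M; first exact: sE_t.
by apply: sE_D; [apply: sE_X; exact: sE_t|exact: sE_const].
Qed.

Let QE (t : R) : 0 < t < 1 -> Q t = y0^-1 + t%:C * (- y0^-1 * (t%:C * (t%:C ^+ 2 - 4%:R)) * (pp t * Q t)).
Proof.
move=> td; have n := yy0_neq0 td; have n0 := y0_neq0; have n1 := y_neq0 td; have Y := yE td.
have h : t%:C * (t%:C * (t%:C ^+ 2 - 4%:R) * pp t) = y t - y0 by rewrite [in RHS]Y; ring.
have -> : t%:C * (- y0^-1 * (t%:C * (t%:C ^+ 2 - 4%:R)) * (pp t * Q t))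
  = - y0^-1 * (t%:C * (t%:C * (t%:C ^+ 2 - 4%:R) * pp t)) * Q t by ring.
by rewrite h /Q; move: (y t) y0 n0 n1 => u v n0 n1; field; rewrite n0 n1.
Qed.

Let Q_sE k : sE k 1 Q.
Proof.
have b0 : sE 0 1 Q.
  apply: (@sE_inv0 _ 1 y 2) => //.
  by move=> t td; rewrite ncC ger0_norm ?(y_low td) // ltW // y_gt0.
apply: (sE_fix b0 _ QE) => {}k hk.
apply: sE_M; last by apply: sE_M => //; exact: pp_sE.
by apply: sE_Z; exact: tt_sE.
Qed.

Let rr1E (t : R) : 0 < t < 1 -> rr1 t = 2%:R^-1 + t%:C * (2%:R^-1 * (t%:C * rr1 t)).
Proof.
move=> td; have /andP[h1 _] := tau_bounds td.
have n : (tau t)%:C != 0 :> R[i] by rewrite eq_complex /= negb_and gt_eqF // (lt_trans _ h1).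
rewrite /rr1; apply: (mulIf n).
have -> : (2%:R^-1 + t%:C * (2%:R^-1 * (t%:C / (tau t)%:C))) * (tau t)%:C = 2%:R^-1 * ((tau t)%:C + t%:C ^+ 2) by field.
by rewrite mulVf // tauC subrK mulVf // pnatr_eq0.
Qed.

Let rr1_sE k : sE k 1 rr1.
Proof.
have b0 : sE 0 1 rr1.
  apply: (@sE_inv0 _ 1 _ 1) => //.
    apply: (@sE_eq _ _ _ (fun t => 2%:R + - t%:C ^+ 2)); first by move=> t _; rewrite tauC.
    apply: sE_D; first exact: sE_const.
    by apply: (@sE_eq _ _ _ (fun t => -1 * t%:C ^+ 2)) => [t _|]; [rewrite mulN1r|apply: sE_Z; apply: sE_X; exact: sE_t].
  by move=> t /tau_bounds /andP[h _]; rewrite ncC ger0_norm ?ltW // (lt_trans _ h).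
apply: (sE_fix b0 _ rr1E) => {}k hk.
by apply: sE_Z; apply: sE_M hk; exact: sE_t.
Qed.

Lemma gam0_real : gam0 = ((Num.sqrt 8 - 2) / 2)%:C.
Proof. by rewrite /gam0 rmorphM rmorphB fmorphV (rmorph_nat (real_complex R) 2). Qed.

Lemma gam0_bounds : 0 < (Num.sqrt (8 : R) - 2) / 2 < 1.
Proof.
have s2 : Num.sqrt (8 : R) ^+ 2 = 8 by rewrite sqr_sqrtr.
have h1 : 2 < Num.sqrt (8 : R) by rewrite -(ltr_pXn2r (n := 2)) ?nnegrE ?sqrtr_ge0 // s2 (_ : 2 ^+ 2 = 4) ?ltr_nat //; ring.
have h2 : Num.sqrt (8 : R) < 4 by rewrite -(ltr_pXn2r (n := 2)) ?nnegrE ?sqrtr_ge0 // s2 (_ : 4 ^+ 2 = 16) ?ltr_nat //; ring.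
by apply/andP; split; lra.
Qed.

Let gam01 : nc gam0 <= 1.
Proof. by have /andP[h0 h1] := gam0_bounds; rewrite gam0_real ncC gtr0_norm // ltW. Qed.

Let zz (t : R) : R[i] := if 0 < t < 1 then beta 1 1 (tau t) else gam0.
Let rho2 (t : R) : R[i] := 2%:R^-1 * ((t%:C ^+ 2 - 4%:R) * pp t + 1).
Let rho1 (t : R) : R[i] := t%:C * rho2 t.

Let zz1 (t : R) : nc (zz t) <= 1.
Proof. by rewrite /zz; case: ifP => // td; have [_ /ltW] := nc_beta1 (tau02 td). Qed.

Let rho2_sE k : sE k 1 rho2.
Proof.
apply: sE_Z; apply: sE_D; last exact: sE_const.
apply: sE_M; last exact: pp_sE.
by apply: sE_D; [apply: sE_X; exact: sE_t|exact: sE_const].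
Qed.

Let rho1_sE k : sE k 1 rho1. Proof. by apply: sE_M; [exact: sE_t|exact: rho2_sE]. Qed.

Let zzE (t : R) : 0 < t < 1 -> zz t = gam0 + t%:C * rho1 t.
Proof.
move=> td; rewrite /zz td /beta -/(y t) (yE td) tauC mul1r /gam0 /rho1 /rho2.
by move: (pp t) (t%:C) y0 => a b c; field.
Qed.

Let powE (t : R) : 0 < t < 1 -> Op w (fun x => one x * beta 1 1 (tau t) ^+ (2 * `|x|)) =
  Op w (fun x => one x * gam0 ^+ (2 * `|x|)) + t%:C *: (t%:C *: (rho2 t *: Opow w one 2 gam0 zz 1 t)).
Proof.
move=> td; have p1 : (1 <= p)%N by apply: leq_trans p3.
have := Opow_taylor w0 wS 2 one1 gam01 zz1 zzE (m := 0) p1 td.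
rewrite [rho1 t *: _](_ : _ = t%:C *: (rho2 t *: Opow w one 2 gam0 zz 1 t)); last by rewrite scalerA.
have -> : Opow w one 2 gam0 zz 0 t = Op w (fun x => one x * beta 1 1 (tau t) ^+ (2 * `|x|)).
  by apply: Op_eq => x; rewrite /spk Sp0 /zz td.
have -> : Op w (spk one 2 gam0 0 gam0) = Op w (fun x => one x * gam0 ^+ (2 * `|x|)).
  by apply: Op_eq => x; rewrite /spk Sp0.
by [].
Qed.

Definition ker16 (x : int) : R[i] :=
  (-1) ^+ `|x| * `|x|%:R / 16%:R - (Num.sqrt (8 : R))%:C^-1 / 16%:R * gam0 ^+ (2 * `|x|).

Lemma expansion_at_sixteen : exists2 W, E 1 1 W & forall t : R, 0 < t < 1 ->
  Op w (fker (tau t ^+ 2)%:C (aa t) (bb t)) =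
  t%:C^-1 *: ((sg / 32%:R) *: Op w ee + t%:C *: (Op w ker16 + t%:C *: W t)).
Proof.
have le1 (t : R) : 0 < t < 1 -> nc (beta sg (-1) t) <= 1 by move=> td; rewrite nc_beta // tl.
have [W1 E1 H1] := betapow_exp2 sg2 sm2 le1 4 w0 wS ee1 (k := 1) p3.
pose h (t : R) := 2%:R^-1 * rr1 t.
pose A (t : R) := 3%:R / 4%:R * h t + 3%:R / 2%:R * (t%:C * (t%:C * h t ^+ 2)) + t%:C * (t%:C * (t%:C * (t%:C * h t ^+ 3))).
pose Q1 (t : R) := - y0^-1 * (t%:C * (t%:C ^+ 2 - 4%:R)) * (pp t * Q t).
pose G0 := Op w (fun x => one x * gam0 ^+ (2 * `|x|)).
pose G1 (t : R) := t%:C *: (rho2 t *: Opow w one 2 gam0 zz 1 t).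
pose T := taylor w ee 4.
have tS (f : R -> R[i]) : sE 1 1 f -> sE 1 1 (fun t => t%:C * f t) by apply: sE_M; exact: sE_t.
have hh : sE 1 1 h by apply: sE_Z; exact: rr1_sE.
have hA : sE 1 1 A.
  apply: sE_D; last by do 4 apply/tS; exact: sE_X.
  by apply: sE_D; apply: sE_Z => //; do 2 apply/tS; exact: sE_X.
have hQ := Q_sE 1.
have hQ1 : sE 1 1 Q1.
  by apply: sE_M; [apply: sE_Z; exact: tt_sE|apply: sE_M => //; exact: pp_sE].
have hG1 : E 1 1 G1.
  apply: E_tS; apply: (sE_scale (k := 0)); first exact: rho2_sE.
  by apply: (Opow_bG_low w0 wS 2 one1 gam01 zz1 zzE rho1_sE (m := 1)).
exists (fun t => (A t * (sg / 4%:R)) *: T 0 + t%:C *: ((A t * 8%:R^-1) *: T 1)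
  + (rr1 t ^+ 3 * (2%:R^-1 * sg)) *: W1 t - (2%:R^-1 * (8%:R^-1 * Q1 t + t%:C * (A t * Q t))) *: G0
  - (2%:R^-1 * (rr1 t ^+ 3 * Q t)) *: G1 t).
  have hr : sE 1 1 (fun t => rr1 t ^+ 3) by apply: sE_X; exact: rr1_sE.
  have cE (X : bop R) : E 1 1 (fun=> X) by exact: E_const.
  apply: E_B; last by apply: sE_scale => //; apply: sE_Z; apply: sE_M.
  apply: E_B; last first.
    by apply: sE_scale => //; apply: sE_Z; apply: sE_D; [apply: sE_Z|apply: tS; apply: sE_M].
  apply: E_D; last by apply: sE_scale => //; apply: sE_M => //; exact: sE_const.
  apply: E_D; last by apply: E_t; apply: sE_scale => //; apply: sE_M => //; exact: sE_const.
  by apply: sE_scale => //; apply: sE_M => //; exact: sE_const.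
move=> t td; have /andP[t0 t1] := td.
have tn : t%:C != 0 :> R[i] by rewrite eq_complex /= negb_and gt_eqF.
have be (e : int -> R[i]) (z : R[i]) : (forall x, nc (e x) <= 1) -> nc z <= 1 -> forall c, growth p 1 (fun x : int => e x * z ^+ (c * `|x|)).
  move=> e1 zle c x; rewrite ncM mul1r; apply: (@le_trans _ _ 1); last by rewrite exprn_ege1 ?jap_ge1.
  by rewrite -[leRHS]mulr1; apply: ler_pM; rewrite ?nc_ge0 // ncX exprn_ile1 ?nc_ge0.
have [b0 /ltW b1] := nc_beta1 (tau02 td).
have /andP[ta1 ta2] := tau_bounds td.
have taun : (tau t)%:C != 0 :> R[i] by rewrite eq_complex /= negb_and gt_eqF // (lt_trans _ ta1).
have -> : Op w (fker (tau t ^+ 2)%:C (aa t) (bb t)) = t%:C^-1 *: ((2%:R^-1 * rr1 t ^+ 3 * sg) *: (qq (-1) t *: betapow sg (-1) w ee 4 t)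
    - t%:C *: ((2%:R^-1 * rr1 t ^+ 3 * Q t) *: Op w (fun x => one x * beta 1 1 (tau t) ^+ (2 * `|x|)))).
  have g1 := be _ _ ee1 (le1 t td) 4; have g2 := be _ _ one1 b1 2.
  rewrite 2!scalerA -[in RHS](OpZ w0 wS _ g1) -[in RHS](OpZ w0 wS _ g2).
  rewrite -(OpB w0 wS (growthZ _ g1) (growthZ _ g2)) -(OpZ w0 wS _ (growthB (growthZ _ g1) (growthZ _ g2))).
  apply: Op_eq => x; rewrite /fker /hker.
  have [-> _] := aa_inv td; have [-> _] := beta_pow_inv s12C s12 (taul td).
  have u1 := uuC_neq0 sm2 (tl td); have u2 := y_neq0 td.
  have -> : aa t ^+ `|x| = ee x * beta sg (-1) t ^+ (4 * `|x|) by rewrite exprNn -exprM.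
  have -> : bb t ^+ `|x| = beta 1 1 (tau t) ^+ (2 * `|x|) by rewrite -exprM.
  rewrite /Q -/(y t) /rr1 /qq /one !mul1r rmorphXn /=.
  have s0 : sg != 0 by apply/eqP => e; have := sg2; rewrite e expr0n /= rmorphN rmorph1 => /eqP; rewrite eq_sym oppr_eq0 oner_eq0.
  move: (beta _ _ _ ^+ _) (beta _ _ _ ^+ _) (ee x) => y1 y2 y3.
  have sV : - sg^-1 = sg by rewrite /sg sgnV opprK.
  rewrite -[sg in RHS]sV.
  by field; rewrite s0 u1 u2 tn taun.
rewrite (H1 t td) (powE td) -/G0 -/(G1 t).
have r3E : rr1 t ^+ 3 = 8%:R^-1 + t%:C ^+ 2 * A t.
  by rewrite (rr1E td) /A /h; move: (rr1 t) => r; field.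
have QE' : Q t = y0^-1 + t%:C * Q1 t by exact: QE.
have ker : Op w ker16 = 64%:R^-1 *: T 1 - (y0^-1 / 16%:R) *: G0.
  have n1 : nc (1 : R[i]) <= 1 by rewrite nc1.
  have g1 := spk_growth 4 ee1 n1 (leq_trans (isT : 1 <= 3)%N p3) n1.
  have g2 := be _ _ one1 gam01 2.
  have E : Op w ker16 = Op w (fun x => 64%:R^-1 * spk ee 4 1 1 1 x - y0^-1 / 16%:R * (one x * gam0 ^+ (2 * `|x|))).
    apply: Op_eq => x; rewrite /spk Sp1 natrM /ker16 /one mul1r -/y0 -/(ee x).
    by move: (y0^-1) => c; field.
  by rewrite E (OpB w0 wS (growthZ _ g1) (growthZ _ g2)) (OpZ w0 wS _ g1) (OpZ w0 wS _ g2).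
have -> : Op w ee = T 0 by apply: Op_eq => x; rewrite Sp0 expr1n mulr1.
rewrite ker; congr (_ *: _).
move: sg2; rewrite rmorphN rmorph1 => S2.
rewrite -/(T 0) -/(T 1) r3E QE'.
move: S2; move: (T 0) (T 1) (W1 t) (G0) (G1 t) (A t) (Q1 t) (y0^-1) (sg) => x0 x1 x2 x3 x4 a q1 y' s' S2.
by pointwise; field: S2.
Qed.

End ExpansionAtSixteen.

Section ThresholdSolutions.
Context {R : realType}.
Implicit Types (V : int -> R) (psi phi f g : seqZ R) (n m : int).

Lemma decay_wgt V (beta c : R) (p : nat) : 0 < c ->
  (forall n, `|V n| <= c * jap n `^ (- beta)) -> 2 * p%:R + 1 < beta ->
  exists S, l2le (wgt (vpot V) p) S.
Proof.
move=> c0 H pb; have q : 1 / 2 < beta / 2 - p%:R by lra.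
have [S HS] := jap_l2 q; exists (nc (Num.sqrt c)%:C * S).
apply: l2le_dom (l2leZ _ HS) => n; rewrite scalesE ncM !ncC.
rewrite !ger0_norm ?mulr_ge0 ?exprn_ge0 ?jap_ge0 ?sqrtr_ge0 ?powR_ge0 //.
apply: (@le_trans _ _ (jap n ^+ p * (Num.sqrt c * jap n `^ (- (beta / 2))))).
  apply: ler_wpM2l; first by rewrite exprn_ge0 ?jap_ge0.
  have -> : Num.sqrt c * jap n `^ (- (beta / 2)) = Num.sqrt (c * (jap n `^ (- (beta / 2))) ^+ 2).
    by rewrite sqrtrM ?ltW // sqrtr_sqr ger0_norm ?powR_ge0.
  apply: ler_wsqrtr.
  apply: le_trans (H n) _; rewrite powR_sq le_eqVlt; apply/orP; left; apply/eqP.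
  by congr (_ * _ `^ _); field.
rewrite le_eqVlt; apply/orP; left; apply/eqP.
rewrite mulrCA; congr (_ * _); rewrite -powR_mulrn ?jap_ge0 // -powRD; last first.
  by rewrite (gt_eqF (jap_gt0 n)) implybT.
by congr (_ `^ _); ring.
Qed.

Lemma Wspace_growth psi (k : nat) (C sigma : R) : (forall n, nc (psi n) <= C * jap n ^+ k) ->
  sigma = k%:R + 1 / 2 -> Wspace sigma psi.
Proof.
move=> H sE s ss; have q : 1 / 2 < s - k%:R by lra.
have [S HS] := jap_l2 q; rewrite /l2w /= wnorm_jmul.
have C0 : 0 <= C.
  have := le_trans (nc_ge0 _) (H 0); rewrite pmulr_lge0 // exprn_gt0 // jap_gt0 //.
apply: (@l2le_l2 _ _ (nc C%:C * S)); apply: l2le_dom (l2leZ _ HS) => n.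
rewrite scalesE /jmul !ncM !ncC (ger0_norm C0) !ger0_norm ?powR_ge0 //.
apply: le_trans (ler_wpM2l (powR_ge0 _ _) (H n)) _.
rewrite mulrCA le_eqVlt; apply/orP; left; apply/eqP; congr (_ * _).
rewrite -powR_mulrn ?jap_ge0 // -powRD; last by rewrite (gt_eqF (jap_gt0 n)) implybT.
by congr (_ `^ _); ring.
Qed.

Lemma small_tails_rk f g : l2w 0 f -> l2w 0 g -> small_tails (rk f g).
Proof.
move=> hf hg; have /l2P[c Hc] := hf; have /l2P[d Hd] := hg => e e0.
have d1 : 0 < d + 1 by rewrite ltr_wpDl ?Hd.1.
have [s us Hs] := l2_tail Hc (divr_gt0 e0 d1); exists s => //.
apply: onrm_le => [|phi b Hb]; first exact: ltW.
have hp := l2le_l2 Hb; rewrite boM // rkE // offopE; last exact: l2Z.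
have -> : offseq s (inner phi g *: f) = inner phi g *: offseq s f.
  by apply/funext => n; rewrite scalesE /offseq; case: ifP; rewrite ?scalesE ?mulr0.
apply: l2le_le (l2leZ _ Hs).
have h := csum_norm (inner_sumle Hb Hd).
apply: le_trans (ler_wpM2r _ h) _; first by rewrite divr_ge0 ?ltW.
rewrite (_ : b * d * _ = e * b * (d / (d + 1))); last by ring.
by rewrite ler_piMr ?mulr_ge0 ?Hb.1 ?(ltW e0) // ler_pdivrMr // mul1r lerDl.
Qed.

Lemma lap_affine (c1 c2 : R[i]) : lap (fun n => c1 + c2 * n%:~R) = 0.
Proof. by apply/funext => n; rewrite /lap !rmorphD /= rmorphN /= rmorph1; ring. Qed.

Lemma lap_ker3 : lap (@ker3 R) = fun x => `|x|%:R / 2%:R.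
Proof.
apply/funext => x; rewrite (lap_abs (fun k => (k%:R ^+ 3 - k%:R) / 12%:R)).
case: eqP => [->|/eqP x0]; first by rewrite expr0n absz0 /=; field.
have : (0 < `|x|)%N by rewrite absz_gt0.
by case: (`|x|%N) => // k _; rewrite /= -[k.+2%:R]natr1 -[k.+1%:R]natr1; field.
Qed.

Lemma bilap_ker3 : lap (fun x : int => `|x|%:R / 2%:R) = delta 0 :> seqZ R.
Proof.
apply/funext => x; rewrite (lap_abs (fun k => k%:R / 2%:R)) /delta.
case: eqP => [_|/eqP x0]; first by rewrite /=; field.
have : (0 < `|x|)%N by rewrite absz_gt0.
by case: (`|x|%N) => // k _; rewrite /= -[k.+2%:R]natr1 -[k.+1%:R]natr1; field.
Qed.

Lemma bilap_ker16 : bilap (@ker16 R) = 16%:R *: @ker16 R + delta 0.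
Proof.
pose A : seqZ R := fun x => (-1) ^+ `|x| * `|x|%:R / 16%:R.
pose b0 : R[i] := gam0 ^+ 2; pose y0 : R[i] := (Num.sqrt (8 : R))%:C.
have y2 : y0 ^+ 2 = 8%:R by rewrite -rmorphXn sqr_sqrtr // (rmorph_nat (real_complex R) 8).
have yn : y0 != 0 by rewrite -sqrf_eq0 y2 pnatr_eq0.
have bE : b0 = 3%:R - y0 by rewrite /b0 /gam0 -/y0; field: y2.
have bb : b0 * (3%:R + y0) = 1 by rewrite bE; ring: y2.
have bn : b0 != 0 by apply/eqP => b; move: bb; rewrite b mul0r => /eqP; rewrite eq_sym oner_eq0.
have bV : b0^-1 = 3%:R + y0 by apply: (mulfI bn); rewrite bb divff.
have lA : lap A = - 4%:R *: A - 8%:R^-1 *: delta 0.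
  apply/funext => x; rewrite (lap_abs (fun k => (-1) ^+ k * k%:R / 16%:R)) addsE oppsE !scalesE /delta /A.
  case: eqP => [->|/eqP x0]; first by rewrite /= expr0; field.
  have : (0 < `|x|)%N by rewrite absz_gt0.
  by case: (`|x|%N) => // k _; rewrite /= -[k.+2%:R]natr1 -[k.+1%:R]natr1 !exprS; field.
have kE : @ker16 R = A - 8%:R^-1 *: hker b0.
  apply/funext => x; rewrite addsE oppsE scalesE /ker16 /A /hker bV bE -/y0.
  have -> : gam0 ^+ (2 * `|x|) = (3%:R - y0) ^+ `|x| :> R[i] by rewrite -bE exprM.
  have -> : 3%:R + y0 - (3%:R - y0) = 2%:R * y0 by ring.
  by field.
have lB : lap (hker b0) = - (- 4%:R) *: hker b0 - delta 0.
  apply: lap_hker => //; first by rewrite bV bE (_ : _ - _ = 2%:R * y0) ?mulf_neq0 ?pnatr_eq0 //; ring.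
  by rewrite bV bE; ring.
have l1 : lap (A - 8%:R^-1 *: hker b0) = - 4%:R *: A - 2%:R^-1 *: hker b0.
  rewrite (lapB A) (lapZ _ (hker b0)) lA lB; apply/funext => x.
  by rewrite !(addsE, oppsE, scalesE); field.
rewrite /bilap /= kE l1 (lapB (- 4%:R *: A)) (lapZ _ A) (lapZ _ (hker b0)) lA lB.
by apply/funext => x; rewrite !(addsE, oppsE, scalesE); field.
Qed.

Lemma cubic_taylor (n m : R) :
  `| `|n - m| ^+ 3 - `|n| ^+ 3 + 3 * (n * `|n| * m)| <= 3 * m ^+ 2 * (`|n| + `|m|).
Proof.
wlog n0 : n m / 0 <= n.
  move=> W; case: (lerP 0 n) => [|/ltW n0]; first exact: W.
  have := W (- n) (- m); rewrite oppr_ge0 => /(_ n0).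
  by rewrite -opprD !normrN sqrrN (_ : - n * `|n| * - m = n * `|n| * m); last ring.
rewrite (ger0_norm n0).
have [h|h] := lerP 0 (n - m).
  rewrite (ger0_norm h).
  rewrite (_ : (n - m) ^+ 3 - n ^+ 3 + 3 * (n * n * m) = m ^+ 2 * (3 * n - m)); last by ring.
  rewrite normrM (ger0_norm (sqr_ge0 m)) (_ : 3 * m ^+ 2 * _ = m ^+ 2 * (3 * (n + `|m|))); last by ring.
  apply: ler_wpM2l; first exact: sqr_ge0.
  apply: le_trans (ler_normB _ _) _; rewrite ger0_norm ?mulr_ge0 // mulrDr lerD2l.
  by rewrite ler_peMl // ler1n.
have [k k0 ->] : exists2 k, 0 <= k & m = n + k.
  by exists (m - n); [rewrite subr_ge0 ltW // -subr_lt0|rewrite addrC subrK].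
have a1 : 0 <= n ^+ 3 by rewrite exprn_ge0.
have a2 : 0 <= n ^+ 2 * k by rewrite mulr_ge0 ?sqr_ge0.
have a3 : 0 <= n * k ^+ 2 by rewrite mulr_ge0 ?sqr_ge0.
have a4 : 0 <= k ^+ 3 by rewrite exprn_ge0.
rewrite (ger0_norm (addr_ge0 n0 k0)) (_ : n - (n + k) = - k); last by ring.
rewrite normrN (ger0_norm k0) (_ : k ^+ 3 - n ^+ 3 + _ = k ^+ 3 + 2 * n ^+ 3 + 3 * (n ^+ 2 * k)); last by ring.
rewrite ger0_norm; last by rewrite !addr_ge0 ?mulr_ge0.
rewrite (_ : 3 * (n + k) ^+ 2 * (n + (n + k)) = 6 * n ^+ 3 + 15 * (n ^+ 2 * k) + 12 * (n * k ^+ 2) + 3 * k ^+ 3); last by ring.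
lra.
Qed.

End ThresholdSolutions.

Section Injectivity.
Context {R : realType}.
Variables (V : int -> R) (p : nat) (S : R).
Let w := vpot V.
Hypothesis wS : l2le (wgt w p) S.
Implicit Types (phi psi G : seqZ R) (n m : int).

Lemma moment_sumle phi c : l2le phi c ->
  sumle (fun m => (jap m ^+ p)%:C * vmul V phi m) (S * c).
Proof.
move=> H; apply: sumle_dom (sumle_CS wS H) => m.
by rewrite /wgt /vmul rmorphM mulrA.
Qed.

Lemma growth_sumle C G phi n : growth p C G -> l2w 0 phi ->
  exists c, sumle (fun m => G (n - m) * vmul V phi m) c.
Proof.
move=> hG /l2P[c Hc]; have C0 := growth_const_ge0 hG.
eexists; apply: sumle_dom (sumleZ (C * 2 ^+ p * jap n ^+ p)%:C (moment_sumle Hc)) => m.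
rewrite [X in _ <= nc X]mulrA [leLHS]ncM [leRHS]ncM -rmorphM.
apply: ler_wpM2r; first exact: nc_ge0.
apply: le_trans (hG _) _; rewrite !ncC !ger0_norm ?mulr_ge0 ?exprn_ge0 ?jap_ge0 //.
rewrite -!mulrA; apply: ler_wpM2l => //; rewrite -!exprMn.
by apply: lerXn2r; rewrite ?nnegrE ?mulr_ge0 ?jap_ge0 //; exact: jap_sub.
Qed.

Lemma convol_corrected C G phi c (h : int -> R[i]) B n : growth p C G -> l2le phi c -> 0 <= B ->
  csum (fun m => (G (n - m) - h m) * vmul V phi m) = 0 -> (forall m, nc (h m) <= B * jap m ^+ p) ->
  nc (convol G (vmul V phi) n) <= B * (S * c).
Proof.
move=> hG Hc B0 c0 hB; have [d Hd] := growth_sumle n hG (l2le_l2 Hc).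
have Hh : sumle (fun m => h m * vmul V phi m) (nc B%:C * (S * c)).
  apply: sumle_dom (sumleZ B%:C (moment_sumle Hc)) => m.
  rewrite [X in _ <= nc X]mulrA [leLHS]ncM [leRHS]ncM -rmorphM.
  apply: ler_wpM2r; first exact: nc_ge0.
  by rewrite ncC ger0_norm ?mulr_ge0 ?exprn_ge0 ?jap_ge0.
rewrite ncC (ger0_norm B0) in Hh.
have E : csum (fun m => (G (n - m) - h m) * vmul V phi m) =
    csum (fun m => G (n - m) * vmul V phi m) + -1 * csum (fun m => h m * vmul V phi m).
  rewrite -(csumZ _ Hh) -(csumD Hd (sumleZ _ Hh)); apply: eq_csum => m; ring.
move: E; rewrite c0 mulN1r => /esym/eqP; rewrite subr_eq0 => /eqP.
by rewrite /convol /kop => ->; exact: csum_norm Hh.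
Qed.

Lemma vmul_sumle (b : seqZ R) phi c : (forall m, nc (b m) <= jap m ^+ p) -> l2le phi c ->
  sumle (fun m => b m * vmul V phi m) (S * c).
Proof.
move=> H Hc; apply: sumle_dom (moment_sumle Hc) => m; rewrite [leLHS]ncM [leRHS]ncM.
by apply: ler_wpM2r; [exact: nc_ge0|rewrite ncC ger0_norm ?exprn_ge0 ?jap_ge0].
Qed.

Lemma inner_vmul phi (b : seqZ R) : (forall m, (b m)^* = b m) ->
  inner phi (vmul V b) = csum (fun m => b m * vmul V phi m).
Proof.
move=> bE; apply: eq_csum => m; rewrite /vmul rmorphM /= bE.
have -> : (w m)%:C^* = (w m)%:C by apply/conj_Creal; rewrite complex_real.
by ring.
Qed.

Lemma Hop_solution phi psi (lam : R[i]) G C : l2w 0 phi -> growth p C G ->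
  bilap (convol G (vmul V phi)) = convol (lam *: G + delta 0) (vmul V phi) ->
  (Uop V + Op w G) phi = vmul V psi -> bilap psi = lam *: psi ->
  Hop V (psi - convol G (vmul V phi)) = lam *: (psi - convol G (vmul V phi)) /\
  (psi - convol G (vmul V phi) = 0 -> phi = 0).
Proof.
move=> hp hG bG E bp; set f := vmul V phi.
have UE n : (Upot V n)%:C * phi n = (w n)%:C * (psi - convol G f) n.
  have := congr1 (fun a => a n) E; rewrite boD // addsE UopE // (OpE (vpot_ge0 V) wS n hG hp).
  have [d Hd] := growth_sumle n hG hp.
  have -> : csum (fun m => cker w G n m * phi m) = (w n)%:C * convol G f n.
    by rewrite /convol /kop -(csumZ _ Hd); apply: eq_csum => m; rewrite /cker /f /vmul; ring.
  by rewrite -[vmul V psi n]/((w n)%:C * psi n) /mulop addsE oppsE mulrBr => <-; rewrite addrK.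
split; last first.
  move=> p0; apply/funext => n; apply/eqP; rewrite -nc_eq0.
  have := congr1 (@nc R) (UE n); rewrite p0 [(0 : seqZ R) n](_ : _ = 0) // mulr0 nc0 ncM Upot_norm mul1r.
  by move=> ->.
have Vpsi : mulop V (psi - convol G f) = f.
  apply/funext => n; rewrite /mulop potE !rmorphM /= -!mulrA -UE mulrA.
  by rewrite -mulrA (mulrA (Upot V n)%:C) -rmorphM Upot_sq mul1r.
rewrite /Hop [LHS](_ : _ = bilap (psi - convol G f) + mulop V (psi - convol G f)) // Vpsi.
rewrite /bilap /= (lapB psi) (lapB (lap psi)) -[lap (lap psi)]/(bilap psi) bp -[lap (lap _)]/(bilap _) bG.
have -> : convol (lam *: G + delta 0) f = lam *: convol G f + f.
  apply/funext => n; have [d Hd] := growth_sumle n hG hp.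
  have cd : convol (delta 0) f n = f n by rewrite convol_delta.
  rewrite addsE scalesE -cd /convol /kop -(csumZ _ Hd).
  have gd : growth p 1 (delta 0 : seqZ R).
    move=> x; rewrite mul1r /delta; case: ifP => _; rewrite ?nc0 ?nc1 ?exprn_ge0 ?jap_ge0 //.
    by rewrite exprn_ege1 ?jap_ge1.
  have [d' Hd'] := growth_sumle n gd hp.
  rewrite -(csumD (sumleZ _ Hd) Hd'); apply: eq_csum => m.
  by rewrite addsE scalesE /f; ring.
by rewrite scalerBr opprD addrA subrK.
Qed.

End Injectivity.

Section ThresholdInjectivity.
Context {R : realType}.
Variables (V : int -> R) (p : nat) (S : R).
Let w := vpot V.
Hypothesis wS : l2le (wgt w p) S.
Implicit Types (phi psi G : seqZ R) (n m : int).

Lemma vC_vmul : vC V = vmul V (fun _ => 1).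
Proof. by apply/funext => n; rewrite /vmul mulr1. Qed.

Lemma v1C_vmul : v1C V = vmul V (fun n => n%:~R).
Proof. by apply/funext => n; rewrite /v1C /vmul rmorphM /= rmorph_int mulrC. Qed.

Lemma signE n : ((-1) ^ n)%:C = (-1) ^+ `|n| :> R[i].
Proof.
case: n => k; first by rewrite -exprnP rmorphXn rmorphN rmorph1.
by rewrite NegzE abszN -exprnN fmorphV rmorphXn rmorphN rmorph1 -exprVn invrN1.
Qed.

Lemma sign_sub n m : (-1) ^+ `|n - m| = (-1) ^+ `|n| * (-1) ^+ `|m| :> R[i].
Proof.
rewrite -!signE -rmorphM; congr (_%:C).
have u : (-1 : R) \is a GRing.unit by rewrite unitrN1.
rewrite exprzDr // ; congr (_ * _).
by case: m => k; rewrite ?NegzE ?opprK -?exprnP -?exprnN -exprVn invrN1.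
Qed.

Lemma vtC_vmul : vtC V = vmul V (fun n => (-1) ^+ `|n|).
Proof. by apply/funext => n; rewrite /vtC /vmul rmorphM /= signE mulrC. Qed.

Definition kr3 (x : R) : R := (`|x| ^+ 3 - `|x|) / 12.

Lemma ker3E n : ker3 n = (kr3 n%:~R)%:C :> R[i].
Proof.
rewrite /ker3 /kr3 rmorphM rmorphB rmorphXn /= fmorphV (rmorph_nat (real_complex R) 12).
have -> : `|n%:~R| = `|n|%N%:R :> R by rewrite natr_absz intr_norm.
by rewrite (rmorph_nat (real_complex R)).
Qed.

Lemma int_le_jap n : `|n%:~R| <= jap n :> R.
Proof.
rewrite -(ler_pXn2r (n := 2)) ?nnegrE ?jap_ge0 // jap_sq real_normK ?num_real //.
by rewrite lerDr.
Qed.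

Lemma growth_ker3 : (3 <= p)%N -> growth p 1 (@ker3 R).
Proof.
move=> p3 x; rewrite mul1r ker3E ncC /kr3.
have j1 := @jap_ge1 R x; have jx := int_le_jap x.
apply: (@le_trans _ _ (jap x ^+ 3)); last exact: ler_weXn2l.
have h3 : `|x%:~R| ^+ 3 <= jap x ^+ 3 :> R by apply: lerXn2r; rewrite ?nnegrE ?jap_ge0.
have h1 : `|x%:~R| <= jap x ^+ 3 :> R by apply: le_trans jx _; rewrite -[leLHS]expr1 ler_weXn2l.
have a0 : 0 <= `|x%:~R| ^+ 3 :> R by rewrite exprn_ge0.
have b0 : 0 <= `|x%:~R| :> R by [].
by apply/ler_normlP; split; lra.
Qed.

Lemma growth_abs : (1 <= p)%N -> growth p 1 (fun x : int => `|x|%:R / 2%:R : R[i]).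
Proof.
move=> p1 x; rewrite mul1r -!(rmorph_nat (real_complex R)) -fmorphV -rmorphM ncC.
rewrite ger0_norm ?divr_ge0 //; apply: (@le_trans _ _ (jap x ^+ 1)); last by apply: ler_weXn2l => //; exact: jap_ge1.
rewrite expr1 natr_absz intr_norm; have := int_le_jap x; have := @jap_ge0 R x; lra.
Qed.

Lemma regular0_solution psi C : regular0 V -> (forall n, nc (psi n) <= C * jap n ^+ 1) ->
  Hop V psi = 0 -> psi = 0.
Proof.
move=> reg H E; apply: contrapT => ne; apply: reg; exists psi; split=> //.
by apply: Wspace_growth H _; field.
Qed.

Lemma regular16_solution psi C : regular16 V -> (forall n, nc (psi n) <= C * jap n ^+ 0) ->
  Hop V psi = (16 : R)%:C *: psi -> psi = 0.
Proof.
move=> reg H E; apply: contrapT => ne; apply: reg; exists psi; split=> //.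
by apply: Wspace_growth H _; rewrite add0r.
Qed.

Lemma injective_at_zero phi (c1 c2 : R[i]) : (3 <= p)%N -> regular0 V -> l2w 0 phi ->
  inner phi (vC V) = 0 -> inner phi (v1C V) = 0 ->
  (Uop V + Op w (@ker3 R)) phi = c1 *: vC V + c2 *: v1C V -> phi = 0.
Proof.
move=> p3 reg hp i0 i1 E; have p1 : (1 <= p)%N by apply: leq_trans p3.
have /l2P[c Hc] := hp.
pose psi : seqZ R := fun n => c1 + c2 * n%:~R.
have g3 := growth_ker3 p3; have g1 := growth_abs p1.
have bG : bilap (convol (@ker3 R) (vmul V phi)) = convol (0 *: @ker3 R + delta 0) (vmul V phi).
  rewrite /bilap /= lap_convol; last by move=> n; exact: (growth_sumle wS n g3 hp).
  rewrite lap_ker3 lap_convol; last by move=> n; exact: (growth_sumle wS n g1 hp).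
  by rewrite bilap_ker3 scale0r add0r.
have Ep : (Uop V + Op w (@ker3 R)) phi = vmul V psi.
  rewrite E vC_vmul v1C_vmul; apply/funext => n.
  by rewrite addsE !scalesE /vmul /psi; ring.
have bp : bilap psi = 0 *: psi.
  rewrite /bilap /= lap_affine scale0r.
  by have := lap_affine (0 : R[i]) 0; rewrite (_ : (fun n => _) = 0) //; apply/funext => n; rewrite mul0r addr0.
have [hH h0] := Hop_solution wS hp g3 bG Ep bp.
apply: h0; apply: (regular0_solution (C := nc c1 + nc c2 + S * c) reg); last by rewrite hH scale0r.
move=> n; rewrite addsE oppsE expr1; have j1 := @jap_ge1 R n.
apply: le_trans (ncB _ _) _; rewrite [leRHS]mulrDl; apply: lerD.
  apply: le_trans (ncD _ _) _; rewrite [leRHS]mulrDl; apply: lerD.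
    by rewrite ler_peMr ?nc_ge0.
  rewrite ncM; apply: ler_wpM2l; first exact: nc_ge0.
  by rewrite -(rmorph_int (real_complex R)) ncC int_le_jap.
pose al : R[i] := (kr3 n%:~R)%:C; pose al' : R[i] := - (3 * (n%:~R * `|n%:~R|) / 12)%:C.
rewrite mulrC.
apply: (convol_corrected wS (h := fun m => ker3 (n - m) - (al + al' * m%:~R)) g3 Hc).
- exact: jap_ge0.
- have s0 : sumle (fun m => 1 * vmul V phi m) (S * c).
    by apply: (vmul_sumle wS) Hc => m; rewrite nc1 exprn_ege1 ?jap_ge1.
  have s1 : sumle (fun m => m%:~R * vmul V phi m) (S * c).
    apply: (vmul_sumle wS) Hc => m; rewrite -(rmorph_int (real_complex R)) ncC.
    apply: le_trans (int_le_jap m) _; rewrite -[leLHS]expr1; apply: ler_weXn2l => //; exact: jap_ge1.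
  transitivity (al * csum (fun m => 1 * vmul V phi m) + al' * csum (fun m => m%:~R * vmul V phi m)).
    rewrite -(csumZ _ s0) -(csumZ _ s1) -(csumD (sumleZ _ s0) (sumleZ _ s1)).
    by apply: eq_csum => m; ring.
  rewrite -inner_vmul; last by move=> m; rewrite rmorph1.
  rewrite -inner_vmul; last by move=> m; rewrite rmorph_int.
  by rewrite -vC_vmul -v1C_vmul i0 i1 !mulr0 addr0.
- move=> m; rewrite ker3E /al /al'.
  have -> : (kr3 (n - m)%:~R)%:C - ((kr3 n%:~R)%:C + - (3 * (n%:~R * `|n%:~R|) / 12)%:C * m%:~R)
    = (kr3 (n%:~R - m%:~R) - kr3 n%:~R + 3 * (n%:~R * `|n%:~R|) / 12 * m%:~R)%:C.
    have e : (n - m)%:~R = n%:~R - m%:~R :> R by rewrite rmorphB.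
    rewrite e -(rmorph_int (real_complex R) m) /=.
    move: (m%:~R : R) (3 * (n%:~R * `|n%:~R|) / 12) (kr3 n%:~R) (kr3 (n%:~R - m%:~R)) => x4 x3 x2 x1.
    by rewrite rmorphD rmorphB rmorphM /=; ring.
  rewrite ncC.
  have jn := int_le_jap n; have jm := int_le_jap m; have m1 := @jap_ge1 R m.
  apply: (@le_trans _ _ (jap n * jap m ^+ 3)); last first.
    by apply: ler_wpM2l; [exact: jap_ge0|exact: ler_weXn2l].
  have T := cubic_taylor (n%:~R : R) m%:~R.
  have D : `| `|n%:~R - m%:~R| - `|n%:~R| | <= `|m%:~R| :> R.
    by apply: le_trans (ler_dist_dist _ _) _; rewrite addrAC subrr add0r normrN.
  move: T D jn jm j1 m1; rewrite /kr3; move: (n%:~R : R) (m%:~R : R) (@jap R n) (@jap R m) => x y a b T D xa yb a1 b1.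
  rewrite (_ : (`|x - y| ^+ 3 - `|x - y|) / 12 - (`|x| ^+ 3 - `|x|) / 12 + 3 * (x * `|x|) / 12 * y
    = 12^-1 * ((`|x - y| ^+ 3 - `|x| ^+ 3 + 3 * (x * `|x| * y)) - (`|x - y| - `|x|))); last by field.
  rewrite normrM ger0_norm //; apply: (@le_trans _ _ (12^-1 * (3 * y ^+ 2 * (`|x| + `|y|) + `|y|))).
    by rewrite ler_pM2l //; apply: le_trans (ler_normB _ _) _; exact: lerD.
  have y0 : 0 <= `|y| by []. have x0 : 0 <= `|x| by [].
  rewrite -(real_normK (num_real y)); move: (`|x|) (`|y|) xa yb x0 y0 => {T D}x' y' xa yb x0 y0.
  have b0 : 0 <= b by apply: le_trans b1.
  have a0 : 0 <= a by apply: le_trans a1.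
  have h1 : y' ^+ 2 <= b ^+ 2 by apply: lerXn2r; rewrite ?nnegrE.
  have h2 : x' + y' <= 2 * (a * b) by nra.
  have h3 : y' ^+ 2 * (x' + y') <= b ^+ 2 * (2 * (a * b)) by apply: ler_pM => //; [exact: sqr_ge0|exact: addr_ge0].
  have h4 : b <= a * b ^+ 3.
    apply: (@le_trans _ _ (1 * b ^+ 3)); last by apply: ler_wpM2r => //; rewrite exprn_ge0.
    by rewrite mul1r -[leLHS]expr1 ler_weXn2l.
  have e : b ^+ 2 * (2 * (a * b)) = 2 * (a * b ^+ 3) by ring.
  have p0 : 0 <= a * b ^+ 3 by rewrite mulr_ge0 ?exprn_ge0.
  rewrite e in h3; lra.
Qed.

Lemma gam0_pow_bound (k : nat) : nc ((Num.sqrt (8 : R))%:C^-1 / 16%:R * gam0 ^+ k : R[i]) <= 1.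
Proof.
have /andP[h0 h1] := @gam0_bounds R.
have s8 : 1 <= Num.sqrt (8 : R) by rewrite -[leLHS]sqrtr1 ler_wsqrtr // ler1n.
rewrite ncM ncX gam0_real ncC (gtr0_norm h0) -[leRHS]mulr1; apply: ler_pM; rewrite ?nc_ge0 ?exprn_ge0 ?(ltW h0) //.
  rewrite -(rmorph_nat (real_complex R) 16) -!fmorphV -rmorphM ncC ger0_norm.
    rewrite -[leRHS]mulr1; apply: ler_pM; rewrite ?invr_ge0 ?sqrtr_ge0 //.
      by rewrite invf_le1 // (lt_le_trans ltr01).
    by rewrite invf_le1 // ler1n.
  by rewrite mulr_ge0 ?invr_ge0 ?sqrtr_ge0.
by rewrite exprn_ile1 // ltW.
Qed.

Lemma growth_ker16 : (1 <= p)%N -> growth p 2 (@ker16 R).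
Proof.
move=> p1 x; rewrite /ker16; have j1 := @jap_ge1 R x.
have jp : jap x <= jap x ^+ p :> R by rewrite -[leLHS]expr1; exact: ler_weXn2l.
apply: le_trans (ncB _ _) _; rewrite [leRHS]mulrDl; apply: lerD; last first.
  by apply: le_trans (gam0_pow_bound _) _; rewrite mul1r exprn_ege1.
rewrite mul1r; apply: le_trans jp; apply: le_trans (int_le_jap x).
rewrite !ncM ncX ncN nc1 expr1n mul1r.
rewrite -(rmorph_nat (real_complex R) 16) -(rmorph_nat (real_complex R) `|x|) -fmorphV !ncC.
rewrite !normr_nat natr_absz intr_norm [X in _ * X]ger0_norm ?invr_ge0 //.
by rewrite ler_piMr // invf_le1 // ler1n.
Qed.

Lemma lap_growth (C : R) G : growth p C G -> exists C', growth p C' (lap G).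
Proof.
move=> hG; have C0 := growth_const_ge0 hG.
exists (2 * (C * (2 ^+ p * jap (1 : int) ^+ p)) + 2 * C) => x; rewrite /lap.
have h k : jap k = jap (1 : int) :> R -> nc (G (x + k)) <= C * (2 ^+ p * jap (1 : int) ^+ p) * jap x ^+ p.
  move=> kE; apply: le_trans (hG _) _; rewrite -mulrA; apply: ler_wpM2l => //.
  rewrite -exprMn -exprMn; apply: lerXn2r; rewrite ?nnegrE ?mulr_ge0 ?jap_ge0 //.
  have := @jap_sub R x (- k); rewrite opprK => h0; apply: le_trans h0 _.
  have -> : jap (- k) = jap k :> R by rewrite /jap mulrNz normrN.
  by rewrite kE mulrA mulrAC.
apply: le_trans (ncB _ _) _; rewrite [leRHS]mulrDl; apply: lerD.
  apply: le_trans (ncD _ _) _; rewrite -[2 * _ * _]mulrA mulr_natl mulr2n; apply: lerD; apply: h => //.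
  by rewrite /jap mulrNz normrN.
rewrite ncM -(rmorph_nat (real_complex R) 2) ncC ger0_norm // -mulrA; apply: ler_wpM2l => //; exact: hG.
Qed.

Lemma bilap_sign : bilap (fun n : int => (-1) ^+ `|n|) = 16%:R *: (fun n => (-1) ^+ `|n|) :> seqZ R.
Proof.
have l : lap (fun n : int => (-1) ^+ `|n|) = - 4%:R *: (fun n => (-1) ^+ `|n|) :> seqZ R.
  apply/funext => n; rewrite /lap scalesE (sign_sub n 1).
  have := sign_sub n (- 1); rewrite opprK => ->; rewrite abszN /= expr1; ring.
by rewrite /bilap /= l (lapZ _ (fun n : int => (-1) ^+ `|n|)) l scalerA; congr (_ *: _); ring.
Qed.

Lemma injective_at_sixteen phi (c1 : R[i]) : (1 <= p)%N -> regular16 V -> l2w 0 phi ->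
  inner phi (vtC V) = 0 -> (Uop V + Op w (@ker16 R)) phi = c1 *: vtC V -> phi = 0.
Proof.
move=> p1 reg hp i0 E; have /l2P[c Hc] := hp.
pose sg : seqZ R := fun n => (-1) ^+ `|n|.
have sg1 n : nc (sg n) = 1 by rewrite ncX ncN nc1 expr1n.
have g := growth_ker16 p1; have [C' g'] := lap_growth g.
have bG : bilap (convol (@ker16 R) (vmul V phi)) = convol (16%:R *: @ker16 R + delta 0) (vmul V phi).
  rewrite /bilap /= lap_convol; last by move=> n; exact: (growth_sumle wS n g hp).
  rewrite lap_convol; last by move=> n; exact: (growth_sumle wS n g' hp).
  by rewrite -[lap (lap _)]/(bilap (@ker16 R)) bilap_ker16.
have Ep : (Uop V + Op w (@ker16 R)) phi = vmul V (c1 *: sg).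
  rewrite E vtC_vmul; apply/funext => n; rewrite !scalesE /vmul scalesE /sg; ring.
have bp : bilap (c1 *: sg) = 16%:R *: (c1 *: sg).
  by rewrite /bilap /= (lapZ c1 sg) (lapZ c1 (lap sg)) -[lap (lap sg)]/(bilap sg) bilap_sign !scalerA mulrC.
have [hH h0] := Hop_solution wS hp g bG Ep bp.
apply: h0; apply: (regular16_solution (C := nc c1 + 2 * (S * c)) reg); last first.
  by rewrite hH (rmorph_nat (real_complex R) 16).
move=> n; rewrite addsE oppsE expr0 mulr1; apply: le_trans (ncB _ _) _; apply: lerD.
  by rewrite scalesE ncM sg1 mulr1.
pose al : R[i] := sg n * `|n|%:R / 16%:R.
apply: (convol_corrected wS (h := fun m => ker16 (n - m) - al * sg m) g Hc) => //.
- have s0 : sumle (fun m => sg m * vmul V phi m) (S * c).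
    by apply: (vmul_sumle wS) Hc => m; rewrite sg1 exprn_ege1 ?jap_ge1.
  transitivity (al * csum (fun m => sg m * vmul V phi m)).
    by rewrite -(csumZ _ s0); apply: eq_csum => m; ring.
  rewrite -inner_vmul; last by move=> m; rewrite /sg rmorphXn rmorphN rmorph1.
  by rewrite -vtC_vmul i0 mulr0.
move=> m; rewrite /ker16 sign_sub -/(sg n) -/(sg m) /al.
set y := _ * gam0 ^+ _.
have -> : sg n * sg m * `|n - m|%:R / 16%:R - y - sg n * `|n|%:R / 16%:R * sg m
  = sg n * sg m * ((`|n - m|%:R - `|n|%:R) / 16%:R) - y by ring.
apply: le_trans (ncB _ _) _; rewrite [leRHS]mulrDl; apply: lerD; last first.
  by apply: le_trans (gam0_pow_bound _) _; rewrite mul1r exprn_ege1 ?jap_ge1.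
rewrite !ncM !sg1 !mul1r; have j1 := @jap_ge1 R m.
apply: (@le_trans _ _ (jap m)); last by rewrite -[leLHS]expr1; exact: ler_weXn2l.
apply: le_trans (int_le_jap m).
rewrite -!(rmorph_nat (real_complex R)) -fmorphV -rmorphB !ncC.
rewrite [X in _ * X]ger0_norm ?invr_ge0 // !natr_absz !intr_norm rmorphB /=.
apply: (@le_trans _ _ (`| `|n%:~R - m%:~R| - `|n%:~R| | * 1)).
  by apply: ler_wpM2l => //; rewrite invf_le1 // ler1n.
by rewrite mulr1; apply: le_trans (ler_dist_dist _ _) _; rewrite addrAC subrr add0r normrN.
Qed.

End ThresholdInjectivity.

Lemma left_corner (R : realType) (P A B S Q X Y : bop R) (a b : R[i]) : P * S = 0 ->
  P * (a *: A + b *: B + S * X * A + S * Y * Q) = a *: (P * A) + b *: (P * B).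
Proof. by move=> PS; rewrite 3!mulrDr -!scalerAr !mulrA PS !mul0r !addr0. Qed.

Lemma corner_apply (R : realType) (A B S X Y : bop R) (a b : R[i]) (phi : seqZ R) : l2w 0 phi ->
  (a *: A + b *: B + S * X * A + S * Y * (1 - A)) phi =
  a *: A phi + b *: B phi + S (X (A phi)) + S (Y (phi - A phi)).
Proof.
move=> hp; have l2b (Z : bop R) f : l2w 0 f -> l2w 0 (Z f) by exact: bopl2.
rewrite boD // boD // boD // boZ // boZ //; congr (_ + _ + _).
  by rewrite boM // boM //; exact: l2b.
have h : l2w 0 (phi - A phi) by apply: l2B => //; exact: l2b.
by rewrite boM // boB // bo1 // boM.
Qed.

Lemma oproj_orth1 (R : realType) (v phi : seqZ R) : l2w 0 v -> v <> 0 -> l2w 0 phi ->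
  oproj (orth (span1 v)) phi = (1 - proj1 v) phi.
Proof.
move=> hv v0 hp; have vv : inner v v != 0 by apply/eqP => /(inner_eq0 hv).
apply: (oprojE (E := orth (span1 v)) (A := 1 - proj1 v)) => //; first by move=> f [].
  move=> f g [hf Hf] [hg Hg]; split; first exact: l2B.
  move=> e He; have [z ze] := He; rewrite innerBl //; last by rewrite ze; exact: l2Z.
  by rewrite Hf // Hg // subrr.
move=> f hf; rewrite boB // bo1 //; split.
  split; first by apply: l2B => //; exact: bopl2.
  move=> _ [z ->]; rewrite -[z *: v]addr0 inner_linr //; [|by apply: l2B => //; exact: bopl2|exact: l2_0].
  rewrite [inner _ 0]inner_conj ?inner0l ?rmorph0 ?addr0; [|exact: l2_0|by apply: l2B => //; exact: bopl2].
  by rewrite innerBl //; [rewrite proj1E // innerZl // divfK // subrr mulr0|exact: bopl2].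
move=> g [hg Hg]; rewrite opprB addrC subrK proj1E // innerZl // (inner_conj hg hv) Hg ?rmorph0 ?mulr0 //.
by exists 1; rewrite scale1r.
Qed.

Section ZeroEnergy.
Context {R : realType}.
Variables (V : int -> R) (p : nat) (S0 : R).
Let w := vpot V.
Hypothesis wS : l2le (wgt w p) S0.

Lemma fredholm_unit (N : bop R) : small_tails (N - Uop V) ->
  (forall phi, l2w 0 phi -> N phi = 0 -> phi = 0) -> exists X, N * X = 1 /\ X * N = 1.
Proof.
move=> st inj; have UU := Uop_sq V.
have E : Uop V * N = 1 + Uop V * (N - Uop V) by rewrite mulrBr UU addrC subrK.
have [Z [h1 h2]] : exists Z, (Uop V * N) * Z = 1 /\ Z * (Uop V * N) = 1.
  rewrite E; apply: fredholm; first by apply: small_tailsMl st => s; exact: Uop_offop.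
  move=> phi hp; rewrite -E boM // => h; apply: inj => //.
  have hN : l2w 0 (N phi) by exact: bopl2.
  by rewrite -[N phi]bo1 // -UU boM // h bop0.
exists (Z * Uop V); split; last by rewrite -mulrA.
by rewrite mulrA -[N * Z]mul1r -UU -!mulrA (mulrA (Uop V) N) (mulrA (Uop V * N)) h1 mul1r UU.
Qed.

Hypotheses (p7 : (7 <= p)%N) (reg : regular0 V).

Let v : seqZ R := vC V.
Let v1 : seqZ R := v1C V.
Let v2 : seqZ R := vmul V (fun n => n%:~R ^+ 2).

Let jp (k : nat) n : (k <= 7)%N -> jap n ^+ k <= jap n ^+ p :> R.
Proof. by move=> k7; apply: ler_weXn2l; [exact: jap_ge1|exact: leq_trans p7]. Qed.

Let hv : l2w 0 v.
Proof.
rewrite /v vC_vmul; apply: (vmul_l2 wS ler01) => n.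
by rewrite nc1 mul1r -[leLHS](expr0 (jap n)) jp.
Qed.

Let hv1 : l2w 0 v1.
Proof.
rewrite /v1 v1C_vmul; apply: (vmul_l2 wS ler01) => n.
rewrite mul1r -(rmorph_int (real_complex R)) ncC; apply: le_trans (int_le_jap n) _.
by rewrite -[leLHS]expr1 jp.
Qed.

Let hv2 : l2w 0 v2.
Proof.
apply: (vmul_l2 wS ler01) => n.
rewrite mul1r ncX -(rmorph_int (real_complex R)) ncC; apply: le_trans (jp n (isT : (2 <= 7)%N)).
by apply: lerXn2r; rewrite ?nnegrE ?jap_ge0 ?int_le_jap.
Qed.

Let solution0 (c1 c2 : R[i]) : (forall n : int, (V n)%:C * (c1 + c2 * n%:~R) = 0) -> c1 = 0 /\ c2 = 0.
Proof.
move=> H; have E : (fun n : int => c1 + c2 * n%:~R) = 0.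
  apply: (regular0_solution (C := nc c1 + nc c2) reg).
    move=> n; rewrite expr1 mulrDl; apply: le_trans (ncD _ _) _; apply: lerD.
      by rewrite ler_peMr ?nc_ge0 // jap_ge1.
    rewrite ncM -(rmorph_int (real_complex R)) ncC; apply: ler_wpM2l; [exact: nc_ge0|exact: int_le_jap].
  apply/funext => n.
  rewrite /Hop [LHS](_ : _ = bilap (fun n : int => c1 + c2 * n%:~R) n + mulop V (fun n : int => c1 + c2 * n%:~R) n) //.
  rewrite /mulop H addr0 /bilap /= lap_affine /lap.
  by rewrite [(0 : seqZ R) _](_ : _ = 0) // [(0 : seqZ R) (_ - _)](_ : _ = 0) // mulr0 !addr0 subr0.
have e0 := congr1 (fun f => f 0) E; have e1 := congr1 (fun f => f 1) E.
move: e0 e1; rewrite /= mulr0 addr0 => c10; rewrite c10 add0r mulr1 => c20.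
by split.
Qed.

Let v_neq0 : v <> 0.
Proof.
move=> v0; suff [/eqP] : (1 : R[i]) = 0 /\ (0 : R[i]) = 0 by rewrite oner_eq0.
apply: solution0 => n; rewrite potE !rmorphM /=.
have vn : (vpot V n)%:C = 0 :> R[i] by exact: (congr1 (fun f => f n) v0).
by rewrite vn mulr0 mul0r.
Qed.

Let al := inner v1 v / inner v v.
Let u : seqZ R := - al *: v + v1.

Let vv : inner v v != 0. Proof. by apply/eqP => /(inner_eq0 hv). Qed.
Let hu : l2w 0 u. Proof. exact: l2_lin. Qed.

Let u_neq0 : u <> 0.
Proof.
move=> u0; suff [_ /eqP] : - al = 0 /\ (1 : R[i]) = 0 by rewrite oner_eq0.
apply: solution0 => n; have h : - al * v n + v1 n = 0 := congr1 (fun f => f n) u0.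
rewrite potE !rmorphM /=.
transitivity ((vpot V n)%:C * (Upot V n)%:C * (- al * v n + v1 n)); last by rewrite h mulr0.
by rewrite /v /v1 /vC /v1C rmorphM /= rmorph_int; ring.
Qed.

Let uv : inner u v = 0.
Proof. by rewrite inner_lin // /al mulNr divfK // addNr. Qed.
Let vu : inner v u = 0. Proof. by rewrite (inner_conj hu hv) uv rmorph0. Qed.
Let v1E : v1 = al *: v + u. Proof. by rewrite /u scaleNr addrA subrr add0r. Qed.

Definition P1z : bop R := proj1 v.
Definition P2z : bop R := proj1 u.
Let P1 := P1z.
Let P2 := P2z.
Let Q := 1 - P1.
Let S := 1 - P1 - P2.

Let P11 : P1 * P1 = P1. Proof. exact: proj1_idem. Qed.
Let P22 : P2 * P2 = P2. Proof. exact: proj1_idem. Qed.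
Let P12 : P1 * P2 = 0. Proof. exact: proj1_orth. Qed.
Let P21 : P2 * P1 = 0. Proof. exact: proj1_orth. Qed.

Let P1v : P1 v = v. Proof. by rewrite proj1E // divff // scale1r. Qed.
Let P1u : P1 u = 0. Proof. by rewrite proj1E // uv mul0r scale0r. Qed.
Let P2v : P2 v = 0. Proof. by rewrite proj1E // vu mul0r scale0r. Qed.
Let P2u : P2 u = u.
Proof. by rewrite proj1E // divff ?scale1r //; apply/eqP => /(inner_eq0 hu). Qed.
Let Sv : S v = 0. Proof. by rewrite !boB // bo1 // P1v P2v subr0 subrr. Qed.
Let Su : S u = 0. Proof. by rewrite !boB // bo1 // P1u P2u subr0 subrr. Qed.

Lemma QprojE phi : l2w 0 phi -> Qproj V phi = Q phi.
Proof. exact: oproj_orth1. Qed.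

Lemma S0projE phi : l2w 0 phi -> S0proj V phi = S phi.
Proof.
move=> hp; have sub f : l2w 0 f -> l2w 0 (S f) by move=> hf; exact: bopl2.
apply: (oprojE (E := orth (span2 v v1)) (A := S)) => //; first by move=> f [].
  move=> f g [hf Hf] [hg Hg]; split; first exact: l2B.
  move=> e He; have [z [z' ze]] := He; rewrite innerBl //; last by rewrite ze; apply: l2_lin => //; exact: l2Z.
  by rewrite Hf // Hg // subrr.
have SE f : l2w 0 f -> S f = f - (inner f v / inner v v) *: v - (inner f u / inner u u) *: u.
  by move=> hf; rewrite !boB // bo1 // !proj1E.
have uu : inner u u != 0 by apply/eqP => /(inner_eq0 hu).
move=> f hf; split.
  split; first exact: sub.
  have hz (z : R[i]) g : l2w 0 g -> l2w 0 (z *: g) by exact: l2Z.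
  have hx : l2w 0 ((inner f v / inner v v) *: v) by exact: hz.
  have hy : l2w 0 ((inner f u / inner u u) *: u) by exact: hz.
  have hfx := l2B hf hx.
  have i1 : inner (S f) v = 0.
    by rewrite SE // (innerBl hfx hy hv) (innerBl hf hx hv) (innerZl _ hv hv) (innerZl _ hu hv) uv mulr0 subr0 divfK // subrr.
  have i2 : inner (S f) u = 0.
    rewrite SE // (innerBl hfx hy hu) (innerBl hf hx hu) (innerZl _ hv hu) (innerZl _ hu hu) vu mulr0 subr0.
    by rewrite divfK // subrr.
  move=> _ [z [z' ->]]; rewrite v1E scalerDr scalerA addrA -scalerDl.
  rewrite inner_linr //; [|exact: sub|exact: hz].
  rewrite i1 mulr0 add0r -[z' *: u]addr0 inner_linr //; [|exact: sub|exact: l2_0].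
  rewrite i2 mulr0 add0r inner_conj ?inner0l ?rmorph0 //; [exact: l2_0|exact: sub].
move=> g [hg Hg].
have gv : inner v g = 0.
  by rewrite (inner_conj hg hv) Hg ?rmorph0 //; exists 1, 0; rewrite scale1r scale0r addr0.
have gu : inner u g = 0.
  by rewrite (inner_conj hg hu) Hg ?rmorph0 //; exists (- al), 1; rewrite scale1r.
rewrite SE //.
have -> : f - (f - (inner f v / inner v v) *: v - (inner f u / inner u u) *: u)
   = (inner f v / inner v v) *: v + (inner f u / inner u u) *: u.
  by rewrite -addrA -opprD opprB addrC subrK.
by rewrite inner_lin //; [rewrite gv innerZl // gu !mulr0 addr0|exact: l2Z].
Qed.

Let g1 : growth p 1 (fun _ : int => 1 : R[i]).
Proof. by move=> x; rewrite nc1 mul1r exprn_ege1 ?jap_ge1. Qed.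

Let one_op : Op w (fun _ => 1) = inner v v *: P1.
Proof.
rewrite /P1 /P1z /proj1 scalerA divff // scale1r /v vC_vmul.
apply: (Op_separable wS g1); rewrite -?vC_vmul //.
by move=> n m; rewrite rmorph1 mulr1.
Qed.

Let growth_sq : exists C, growth p C (@ker2 R).
Proof.
have h : growth p 1 (fun x : int => x%:~R ^+ 2 : R[i]).
  move=> x; rewrite mul1r ncX -(rmorph_int (real_complex R)) ncC.
  apply: le_trans (jp x (isT : (2 <= 7)%N)).
  by apply: lerXn2r; rewrite ?nnegrE ?jap_ge0 ?int_le_jap.
by eexists; exact: (growthB (growthZ 4%:R h) g1).
Qed.

Let ker2_op : Op w (@ker2 R) = 4%:R *: (rk v2 v - 2%:R *: rk v1 v1 + rk v v2) - rk v v.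
Proof.
have [C g] := growth_sq; apply: bop_eq => phi hp; apply/funext => n.
have /l2P[c Hc] := hp.
rewrite (OpE (vpot_ge0 V) wS n g hp) !(boB, boD, boN, boZ) // !rkE // !(addsE, oppsE, scalesE).
have s (b : seqZ R) : (forall m, (b m)^* = b m) -> (forall m, nc (b m) <= jap m ^+ p) ->
    inner phi (vmul V b) = csum (fun m => b m * vmul V phi m) /\ sumle (fun m => b m * vmul V phi m) (S0 * c).
  by move=> h1 h2; split; [exact: inner_vmul|exact: (vmul_sumle wS)].
have [e0 s0] : inner phi v = csum (fun m => 1 * vmul V phi m) /\ sumle (fun m => 1 * vmul V phi m) (S0 * c).
  rewrite /v vC_vmul; apply: s => m; first by rewrite rmorph1.
  by have := g1 m; rewrite mul1r.
have [e1 s1] : inner phi v1 = csum (fun m => m%:~R * vmul V phi m) /\ sumle (fun m => m%:~R * vmul V phi m) (S0 * c).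
  rewrite /v1 v1C_vmul; apply: s => m; first by rewrite rmorph_int.
  rewrite -(rmorph_int (real_complex R)) ncC; apply: le_trans (int_le_jap m) _.
  by rewrite -[leLHS]expr1 jp.
have [e2 s2] : inner phi v2 = csum (fun m => m%:~R ^+ 2 * vmul V phi m) /\ sumle (fun m => m%:~R ^+ 2 * vmul V phi m) (S0 * c).
  apply: s => m; first by rewrite rmorphXn rmorph_int.
  rewrite ncX -(rmorph_int (real_complex R)) ncC.
  apply: le_trans (jp m (isT : (2 <= 7)%N)).
  by apply: lerXn2r; rewrite ?nnegrE ?jap_ge0 ?int_le_jap.
rewrite e0 e1 e2.
pose W := (w n)%:C; pose N : R[i] := n%:~R.
have -> : v n = W by [].
have -> : v1 n = W * N by rewrite /v1 v1C_vmul.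
have -> : v2 n = W * N ^+ 2 by [].
transitivity (W * (4%:R * N ^+ 2 - 1) * csum (fun m => 1 * vmul V phi m) + (- 8%:R * W * N * csum (fun m => m%:~R * vmul V phi m)
   + 4%:R * W * csum (fun m => m%:~R ^+ 2 * vmul V phi m))); last by ring.
have E := csumD (sumleZ (W * (4%:R * N ^+ 2 - 1)) s0) (sumleD (sumleZ (- 8%:R * W * N) s1) (sumleZ (4%:R * W) s2)).
rewrite (csumD (sumleZ _ s1) (sumleZ _ s2)) (csumZ _ s0) (csumZ _ s1) (csumZ _ s2) in E.
rewrite -{}E {s0 s1 s2 e0 e1 e2}.
apply: eq_csum => m; rewrite /cker /ker2 rmorphB /= -/W -/N /vmul; ring.
Qed.

Let ker2_Q : Op w (@ker2 R) * Q = - 8%:R *: rk v1 u + 4%:R *: (rk v v2 * Q).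
Proof.
have RQ f : l2w 0 f -> rk f v * Q = 0.
  by move=> hf; rewrite mulrBr mulr1 rk_proj1 // subrr.
have RU f : l2w 0 f -> rk f u * Q = rk f u.
  by move=> hf; rewrite mulrBr mulr1 rk_proj1_orth ?subr0.
have e : rk v1 v1 * Q = rk v1 u.
  by rewrite [in X in rk v1 X]v1E rk_linr // mulrDl -scalerAl RQ // scaler0 add0r RU.
have : (4%:R *: (rk v2 v - 2%:R *: rk v1 v1 + rk v v2) - rk v v) * Q =
    4%:R *: (rk v2 v * Q - 2%:R *: (rk v1 v1 * Q) + rk v v2 * Q) - rk v v * Q.
  by move: (Q) => q; rewrite mulrBl -scalerAl mulrDl mulrBl -scalerAl.
rewrite -ker2_op => ->; rewrite !RQ // e; move: (rk v1 u) (rk v v2 * Q) => x y.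
by pointwise; ring.
Qed.

Let Sv1 : S v1 = 0.
Proof. by rewrite v1E bop_lin // Sv Su scaler0 addr0. Qed.

Let P2v1 : P2 v1 = u.
Proof. by rewrite v1E bop_lin // P2v P2u scaler0 add0r. Qed.

Variable c : R[i].
Hypothesis c0 : c != 0.
Let K2 := c *: Op w (@ker2 R).
Let b := c * (- 8%:R * inner u u).

Let SKQ : S * K2 * Q = 0.
Proof.
rewrite /K2 -scalerAr -scalerAl -mulrA ker2_Q mulrDr -!scalerAr mul_rk // Sv1 rk0l //.
by rewrite mulrA mul_rk // Sv rk0l // mul0r !scaler0 addr0 scaler0.
Qed.

Let PKQ : P2 * K2 * Q = b *: P2.
Proof.
have uu : inner u u != 0 by apply/eqP => /(inner_eq0 hu).
rewrite /K2 -scalerAr -scalerAl -mulrA ker2_Q mulrDr -!scalerAr mul_rk // P2v1.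
rewrite mulrA mul_rk // P2v rk0l // mul0r scaler0 addr0.
rewrite /b /P2 /P2z /proj1 !scalerA; congr (_ *: _); field; exact: uu.
Qed.

Lemma b_neq0 : b != 0.
Proof.
have uu : inner u u != 0 by apply/eqP => /(inner_eq0 hu).
by rewrite !mulf_neq0 // oppr_eq0 pnatr_eq0.
Qed.

Variable a : R[i].
Hypothesis a0 : a != 0.
Let K0 := Op w (@ker3 R).
Let N0 := a *: P1 + b *: P2 + S * K2 * P1 + S * (Uop V + K0) * Q.

Lemma N0_invertible : exists X, N0 * X = 1 /\ X * N0 = 1.
Proof.
apply: fredholm_unit.
  have st1 X : small_tails (P1 * X) by apply: small_tailsMr; apply: small_tailsZ; exact: small_tails_rk.
  have st2 X : small_tails (P2 * X) by apply: small_tailsMr; apply: small_tailsZ; exact: small_tails_rk.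
  have stS X : small_tails X -> small_tails (S * X).
    by move=> h; rewrite !mulrBl mul1r; apply: small_tailsB => //; exact: small_tailsB.
  have [C2 hg2] := growth_sq.
  have p3 : (3 <= p)%N by apply: leq_trans p7.
  have k2 : small_tails K2 by apply: small_tailsZ; exact: (Op_tails (vpot_ge0 V) wS hg2).
  have k0 : small_tails K0 by exact: (Op_tails (vpot_ge0 V) wS (growth_ker3 p3)).
  have E : N0 - Uop V = a *: (P1 * 1) + b *: (P2 * 1) + S * K2 * P1 + S * K0 * Q
      - (P1 * Uop V * Q + P2 * Uop V * Q + Uop V * (P1 * 1)).
    have e : S * (Uop V + K0) * Q = Uop V - Uop V * P1 - P1 * Uop V * Q - P2 * Uop V * Q + S * K0 * Q.
      have SU : S * Uop V = Uop V - P1 * Uop V - P2 * Uop V.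
        by rewrite /S; move: (P1) (P2) => y1 y2; rewrite 2!mulrBl mul1r.
      have UQ : Uop V * Q = Uop V - Uop V * P1 by rewrite [Uop V * _]mulrBr mulr1.
      rewrite [S * (Uop V + K0)]mulrDr [(_ + S * K0) * Q]mulrDl SU -UQ; congr (_ + _).
      by move: (Q) (P1) (P2) => q y1 y2; rewrite 2!mulrBl.
    rewrite /N0 e !mulr1; move: (S * K2 * P1) (S * K0 * Q) (P1 * Uop V * Q) (P2 * Uop V * Q) (Uop V * P1) => x1 x2 x3 x4 x5.
    by move: (Uop V) (P1) (P2) => y1 y2 y3; pointwise; ring.
  rewrite E; apply: small_tailsB; last first.
    apply: small_tailsD; first by rewrite -!mulrA; apply: small_tailsD.
    by apply: small_tailsMl => // s; exact: Uop_offop.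
  apply: small_tailsD; last by apply: small_tailsMr; exact: stS.
  by apply: small_tailsD; [apply: small_tailsD; exact: small_tailsZ|apply: small_tailsMr; exact: stS].
move=> phi hp Nphi.
have l2b (X : bop R) f : l2w 0 f -> l2w 0 (X f) by exact: bopl2.
have P1S : P1 * S = 0 by rewrite !mulrBr mulr1 P11 P12 subrr subr0.
have P2S : P2 * S = 0 by rewrite !mulrBr mulr1 P22 P21 subr0 subrr.
have P1N : P1 * N0 = a *: P1.
  by rewrite /N0 left_corner // P11 P12 scaler0 addr0.
have P2N : P2 * N0 = b *: P2.
  by rewrite /N0 left_corner // P22 P21 scaler0 add0r.
have z1 : P1 phi = 0.
  have := boM P1 N0 hp; rewrite Nphi bop0 P1N boZ // => /eqP.
  by rewrite scaler_eq0 (negbTE a0) => /eqP.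
have z2 : P2 phi = 0.
  have := boM P2 N0 hp; rewrite Nphi bop0 P2N boZ // => /eqP.
  by rewrite scaler_eq0 (negbTE b_neq0) => /eqP.
have iv : inner phi v = 0.
  move: z1; rewrite proj1E // => /eqP; rewrite scaler_eq0 => /orP[|/eqP //].
  by rewrite mulf_eq0 invr_eq0 (negbTE vv) orbF => /eqP.
have iu : inner phi u = 0.
  have uu : inner u u != 0 by apply/eqP => /(inner_eq0 hu).
  move: z2; rewrite proj1E // => /eqP; rewrite scaler_eq0 => /orP[|/eqP //].
  by rewrite mulf_eq0 invr_eq0 (negbTE uu) orbF => /eqP.
have iv1 : inner phi v1 = 0 by rewrite v1E inner_linr // iv iu mulr0 addr0.
have SUK : S ((Uop V + K0) phi) = 0.
  have := corner_apply P1 P2 S K2 (Uop V + K0) a b hp.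
  by rewrite -/Q -/N0 Nphi z1 z2 !bop0 !scaler0 subr0 !add0r => <-.
pose f := (Uop V + K0) phi; have hf : l2w 0 f by exact: l2b.
have fE : f = (inner f v / inner v v - al * (inner f u / inner u u)) *: v + (inner f u / inner u u) *: v1.
  have fS : S f = f - P1 f - P2 f by rewrite boB // boB // bo1.
  have {1}-> : f = P1 f + P2 f.
    by have := SUK; rewrite -/f fS -addrA -opprD => /eqP; rewrite subr_eq0 => /eqP.
  rewrite /P1 /P2 /P1z /P2z !proj1E // v1E scalerDr scalerA addrA -scalerDl.
  by congr (_ *: _ + _); [ring|rewrite -v1E].
have p3 : (3 <= p)%N by apply: leq_trans p7.
exact: (injective_at_zero wS p3 reg hp iv iv1 fE).
Qed.

Lemma zero_inverse (W M : R -> bop R) (X : bop R) : E 3 1 W -> N0 * X = 1 -> X * N0 = 1 ->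
  (forall t, 0 < t < 1 -> M t = Uop V + (t%:C^-1 ^+ 3) *: (a *: P1 + t%:C ^+ 2 *: K2
     + t%:C ^+ 3 *: K0 + t%:C ^+ 4 *: W t)) ->
  [/\ exists d (A11 A21 A22 A23 A31 : bop R) (G : R -> bop R), [/\ 0 < d <= 1, bG d G & forall t, 0 < t < d ->
    let Y := S * X * S + t%:C *: (Q * A11 * Q) + (t ^+ 2)%:C *: (Q * A21 * Q + S * A22 + A23 * S)
       + (t ^+ 3)%:C *: A31 + (t ^+ 4)%:C *: G t in M t * Y = 1 /\ Y * M t = 1],
    N0 * S = S * (Uop V + K0) * S & X * S = S * X * S].
Proof.
move=> WE NX XN ME; split.
- exact: (inverse_two P11 P22 P12 P21 a0 b_neq0 SKQ PKQ NX XN WE ME).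
- exact: (corner_two_N _ _ _ _ _ P11 P22 P12 P21).
- exact: (corner_two P11 P22 P12 P21 a0 b_neq0 NX).
Qed.

Lemma leading_neq0 (z : R[i]) : z != 0 -> z * inner v v != 0.
Proof. by move=> z0; rewrite mulf_neq0. Qed.

Lemma one_opE : Op w (fun _ => 1) = inner v v *: P1. Proof. exact: one_op. Qed.

End ZeroEnergy.

Section SixteenEnergy.
Context {R : realType}.
Variables (V : int -> R) (p : nat) (S0 : R).
Let w := vpot V.
Hypotheses (wS : l2le (wgt w p) S0) (p3 : (3 <= p)%N) (reg : regular16 V).

Let v : seqZ R := vtC V.
Let ee (x : int) : R[i] := (-1) ^+ `|x|.
Let ee1 x : nc (ee x) = 1. Proof. by rewrite ncX ncN nc1 expr1n. Qed.

Let hv : l2w 0 v.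
Proof.
rewrite /v vtC_vmul; apply: (vmul_l2 wS ler01) => n.
by rewrite ee1 mul1r exprn_ege1 ?jap_ge1.
Qed.

Let v_neq0 : v <> 0.
Proof.
move=> v0; suff : ee = 0.
  by move/(congr1 (fun f => f 0)) => /eqP; rewrite /ee expr0 oner_eq0.
apply: (regular16_solution (C := 1) reg) => [n|]; first by rewrite ee1 expr0 mulr1.
rewrite (rmorph_nat (real_complex R) 16) -bilap_sign.
apply/funext => n; rewrite /Hop [LHS](_ : _ = bilap ee n + mulop V ee n) //.
have vn : v n = 0 by rewrite v0.
have wn : (vpot V n)%:C = 0 :> R[i].
  by apply/eqP; rewrite -nc_eq0; move/eqP: vn; rewrite /v vtC_vmul -nc_eq0 ncM ee1 mulr1.
by rewrite /mulop potE !rmorphM /= wn mulr0 mul0r addr0.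
Qed.

Let vv : inner v v != 0. Proof. by apply/eqP => /(inner_eq0 hv). Qed.

Definition Pt : bop R := proj1 v.
Let P := Pt.
Let Q := 1 - P.

Let PP : P * P = P. Proof. exact: proj1_idem. Qed.
Let PQ : P * Q = 0. Proof. by rewrite mulrBr mulr1 PP subrr. Qed.

Lemma QtprojE phi : l2w 0 phi -> Qtproj V phi = Q phi.
Proof. exact: oproj_orth1. Qed.

Lemma sign_opE : Op w ee = inner v v *: P.
Proof.
have g : growth p 1 ee by move=> x; rewrite ee1 mul1r exprn_ege1 ?jap_ge1.
rewrite /P /Pt /proj1 scalerA divff // scale1r /v vtC_vmul.
apply: (Op_separable wS g); rewrite -?vtC_vmul //.
by move=> n m; rewrite /ee rmorphXn rmorphN rmorph1 sign_sub.
Qed.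

Lemma sign_leading_neq0 (z : R[i]) : z != 0 -> z * inner v v != 0.
Proof. by move=> z0; rewrite mulf_neq0. Qed.

Variable a : R[i].
Hypothesis a0 : a != 0.
Let K0 := Op w (@ker16 R).
Let N0 := a *: P + Q * (Uop V + K0).

Lemma N16_invertible : exists X, N0 * X = 1 /\ X * N0 = 1.
Proof.
have p1 : (1 <= p)%N by apply: leq_trans p3.
apply: (fredholm_unit (V := V)).
  have st1 X : small_tails (P * X) by apply: small_tailsMr; apply: small_tailsZ; exact: small_tails_rk.
  have k0 : small_tails K0 by exact: (Op_tails (vpot_ge0 V) wS (growth_ker16 p1)).
  have E : N0 - Uop V = a *: (P * 1) - P * Uop V + (K0 - P * K0).
    rewrite /N0 mulr1 mulrBl mul1r mulrDr; move: (P * Uop V) (P * K0) => x y.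
    by move: (Uop V) (P) (K0) => z1 z2 z3; pointwise; ring.
  rewrite E; apply: small_tailsD; last exact: small_tailsB.
  by apply: small_tailsB => //; exact: small_tailsZ.
move=> phi hp Nphi; have l2b (X : bop R) f : l2w 0 f -> l2w 0 (X f) by exact: bopl2.
have PN : P * N0 = a *: P by rewrite /N0 mulrDr -scalerAr PP mulrA PQ mul0r addr0.
have z1 : P phi = 0.
  have := boM P N0 hp; rewrite Nphi bop0 PN boZ // => /eqP.
  by rewrite scaler_eq0 (negbTE a0) => /eqP.
have iv : inner phi v = 0.
  move: z1; rewrite proj1E // => /eqP; rewrite scaler_eq0 => /orP[|/eqP //].
  by rewrite mulf_eq0 invr_eq0 (negbTE vv) orbF => /eqP.
pose f := (Uop V + K0) phi; have hf : l2w 0 f by exact: l2b.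
have fE : f = (inner f v / inner v v) *: v.
  have := Nphi; rewrite /N0 boD // boZ // z1 scaler0 add0r boM // -/f boB // bo1 // proj1E //.
  by move=> /eqP; rewrite subr_eq0 => /eqP.
exact: (injective_at_sixteen wS p1 reg hp iv fE).
Qed.

Lemma sixteen_inverse (W M : R -> bop R) (X : bop R) : E 1 1 W -> N0 * X = 1 -> X * N0 = 1 ->
  (forall t, 0 < t < 1 -> M t = Uop V + t%:C^-1 *: (a *: P + t%:C *: (K0 + t%:C *: W t))) ->
  [/\ exists d (B11 : bop R) (G : R -> bop R), [/\ 0 < d <= 1, bG d G & forall t, 0 < t < d ->
    let Y := Q * X * Q + t%:C *: B11 + (t ^+ 2)%:C *: G t in M t * Y = 1 /\ Y * M t = 1],
    N0 * Q = Q * (Uop V + K0) * Q & X * Q = Q * X * Q].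
Proof.
move=> WE NX XN ME; split.
- exact: (inverse_one PP a0 NX XN WE ME).
- exact: (corner_one_N _ _ _ PP).
- exact: (corner_one PP a0 NX).
Qed.

End SixteenEnergy.

Section Cases.
Context {R : realType}.
Variables (V : int -> R) (p : nat) (S0 : R).
Hypothesis wS : l2le (wgt (vpot V) p) S0.

Let sgn_neq (pm : bool) (z : R) : (sgn pm + z%:C) != 0.
Proof.
rewrite eq_complex /= addr0 add0r negb_and /pmsign orbC; case: pm; rewrite ?oppr_eq0 ?oner_eq0 //.
Qed.

Lemma zero_case : (7 <= p)%N -> regular0 V ->
  let Q := 1 - P1z V in let S := 1 - P1z V - P2z V in
  exists A01 : bop R, forall pm, exists d (A11 A21 A22 A23 A31 : bop R) (G : R -> bop R),
  [/\ 0 < d <= 1, bG d G & forall t, 0 < t < d -> exists M : bop R,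
    (forall phi, l2w 0 phi -> Mop V pm t phi = M phi) /\
    let Y := S * A01 * S + t%:C *: (Q * A11 * Q) + (t ^+ 2)%:C *: (Q * A21 * Q + S * A22 + A23 * S)
       + (t ^+ 3)%:C *: A31 + (t ^+ 4)%:C *: G t in M * Y = 1 /\ Y * M = 1].
Proof.
move=> p7 reg Q S.
pose w := vpot V.
pose ii := inner (vC V) (vC V).
pose c pm : R[i] := (sgn (~~ pm) - 1) / 32%:R.
pose a pm : R[i] := - ((sgn (~~ pm) + 1) / 4%:R) * ii.
have c0 pm : c pm != 0.
  rewrite mulf_neq0 ?invr_eq0 ?pnatr_eq0 //; have := sgn_neq (~~ pm) (-1).
  by rewrite rmorphN rmorph1.
have a0 pm : a pm != 0.
  apply: (leading_neq0 wS p7 reg); rewrite oppr_eq0 mulf_neq0 ?invr_eq0 ?pnatr_eq0 //.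
  by have := sgn_neq (~~ pm) 1; rewrite rmorph1.
have [X HX] := choice (fun pm => N0_invertible wS p7 reg (c0 pm) (a0 pm)).
pose M pm (t : R) : bop R := Uop V + Op w (fker (t ^+ 2)%:C (beta (sgn (~~ pm)) (-1) t ^+ 2) (beta 1 1 t ^+ 2)).
have HM pm : exists2 W, E 3 1 W & forall t, 0 < t < 1 -> M pm t = Uop V + (t%:C^-1 ^+ 3) *: (a pm *: P1z V
   + t%:C ^+ 2 *: (c pm *: Op w (@ker2 R)) + t%:C ^+ 3 *: Op w (@ker3 R) + t%:C ^+ 4 *: W t).
  have [W WE HW] := expansion_at_zero pm (vpot_ge0 V) wS p7; exists W => // t td.
  by rewrite /M HW // (one_opE wS p7 reg) /a -[(_ * ii) *: _]scalerA.
have MM pm t phi : 0 < t < 1 -> l2w 0 phi -> Mop V pm t phi = M pm t phi.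
  move=> td hp; have [r1 r2 r3 r4 [r5 r6]] := zero_roots pm td.
  have /andP[t0 _] := td.
  by apply: (MopE wS _ t0 r1 r2 r3 r4 r5 r6 hp); apply: leq_trans p7.
exists (X true) => pm.
have [W WE HW] := HM pm; have [XN NX] := HX pm.
have [[d [A11 [A21 [A22 [A23 [A31 [G [d1 GE H]]]]]]]] NS XS] := zero_inverse wS p7 reg (c0 pm) (a0 pm) WE XN NX HW.
have [W' WE' HW'] := HM true; have [XN' NX'] := HX true.
have [_ NS' XS'] := zero_inverse wS p7 reg (c0 true) (a0 true) WE' XN' NX' HW'.
have XX : S * X pm * S = S * X true * S.
  by rewrite -XS -XS'; apply: (corner_inverse XN' NX _ XS'); rewrite NS NS'.
exists d, A11, A21, A22, A23, A31, G; split=> // t td; exists (M pm t).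
have t1 : 0 < t < 1 by case/andP: td => -> /lt_le_trans; apply; case/andP: d1.
split; first by move=> phi; exact: MM.
by rewrite -XX; exact: H.
Qed.

Lemma sixteen_case : (3 <= p)%N -> regular16 V ->
  let Q := 1 - Pt V in
  exists B01 : bop R, forall pm, exists d (B11 : bop R) (G : R -> bop R),
  [/\ 0 < d <= 1, bG d G & forall t, 0 < t < d -> exists M : bop R,
    (forall phi, l2w 0 phi -> Mop V pm (2 - t ^+ 2) phi = M phi) /\
    let Y := Q * B01 * Q + t%:C *: B11 + (t ^+ 2)%:C *: G t in M * Y = 1 /\ Y * M = 1].
Proof.
move=> p3 reg Q.
pose w := vpot V.
pose ii := inner (vtC V) (vtC V).
pose a pm : R[i] := sgn pm / 32%:R * ii.
have a0 pm : a pm != 0.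
  apply: (sign_leading_neq0 wS reg); rewrite mulf_neq0 ?invr_eq0 ?pnatr_eq0 //.
  by have := sgn_neq pm 0; rewrite rmorph0 addr0.
have [X HX] := choice (fun pm => N16_invertible wS p3 reg (a0 pm)).
pose M pm (t : R) : bop R := Uop V + Op w (fker ((2 - t ^+ 2) ^+ 2)%:C (- (beta (sgn pm) (-1) t ^+ 4)) (beta 1 1 (2 - t ^+ 2) ^+ 2)).
have HM pm : exists2 W, E 1 1 W & forall t, 0 < t < 1 -> M pm t = Uop V + t%:C^-1 *: (a pm *: Pt V
   + t%:C *: (Op w (@ker16 R) + t%:C *: W t)).
  have [W WE HW] := expansion_at_sixteen pm (vpot_ge0 V) wS p3; exists W => // t td.
  by rewrite /M HW // (sign_opE wS reg) /a -[(_ * ii) *: _]scalerA.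
have MM pm t phi : 0 < t < 1 -> l2w 0 phi -> Mop V pm (2 - t ^+ 2) phi = M pm t phi.
  move=> td hp; have [r1 r2 r3 r4 [r5 r6]] := sixteen_roots pm td.
  have /andP[t0 _] := tau_bounds td.
  by apply: (MopE wS _ (lt_trans ltr01 t0) r1 r2 r3 r4 r5 r6 hp); apply: leq_trans p3.
exists (X true) => pm.
have [W WE HW] := HM pm; have [XN NX] := HX pm.
have [[d [B11 [G [d1 GE H]]]] NS XS] := sixteen_inverse wS reg (a0 pm) WE XN NX HW.
have [W' WE' HW'] := HM true; have [XN' NX'] := HX true.
have [_ NS' XS'] := sixteen_inverse wS reg (a0 true) WE' XN' NX' HW'.
have XX : Q * X pm * Q = Q * X true * Q.
  by rewrite -XS -XS'; apply: (corner_inverse XN' NX _ XS'); rewrite NS NS'.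
exists d, B11, G; split=> // t td; exists (M pm t).
have t1 : 0 < t < 1 by case/andP: td => -> /lt_le_trans; apply; case/andP: d1.
split; first by move=> phi; exact: MM.
by rewrite -XX; exact: H.
Qed.

End Cases.

Section Conversion.
Context {R : realType}.
Implicit Types (F : opZ R) (M Y : bop R) (G : R -> bop R) (phi : seqZ R) (t d mu : R) (k : nat).

Lemma Bop_ext F M : (forall phi, l2w 0 phi -> F phi = M phi) -> Bop 0 0 F.
Proof.
move=> FM; apply: (Bop00 (onrm_ge0 M)).
  by move=> z f g hf hg; rewrite !FM ?bop_lin //; exact: l2_lin.
by move=> phi c H; rewrite FM; [exact: onrm_app|exact: l2le_l2 H].
Qed.

Lemma op_inverse_ext F F' M Y : (forall phi, l2w 0 phi -> F phi = M phi) ->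
  (forall phi, l2w 0 phi -> F' phi = Y phi) -> M * Y = 1 -> Y * M = 1 -> op_inverse F F'.
Proof.
move=> FM FY MY YM; split; [exact: Bop_ext FM|exact: Bop_ext FY|].
move=> phi h; have h1 := bopl2 Y h; have h2 := bopl2 M h.
by split; rewrite ?FY // ?FM // ?FY // -boM // ?MY ?YM bo1.
Qed.

Lemma opnorm_ext F M : (forall phi, l2w 0 phi -> F phi = M phi) -> opnorm 0 0 F = (onrm M)%:E.
Proof.
move=> FM; rewrite onrmE /opnorm; congr ereal_sup; apply/seteqP; split=> _ [phi p1 <-]; exists phi => //;
  by rewrite FM //; apply: le_lt_trans p1 _; rewrite ltry.
Qed.

Lemma op_derive_qder G mu (D : bop R) : qder G mu D -> op_derive (fun t => G t : opZ R) mu D.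
Proof.
move=> [C [d [C0 d0 H]]]; rewrite /op_derive.
have E (h : R) : opnorm 0 0 ((h^-1)%:C *: (bfun (G (mu + h)) - bfun (G mu)) - bfun D)
    = (onrm ((h^-1)%:C *: (G (mu + h) - G mu) - D))%:E.
  apply: opnorm_ext => phi hp; rewrite boB // boZ // boB //.
rewrite (funext E).
apply: cvg_EFin; first by near=> h.
apply: (@squeeze_cvgr _ _ _ _ (fun=> 0) (fun h : R => C * `|h|)); last first.
- rewrite -[X in _ --> X](mulr0 C); apply: cvgMr.
  rewrite -[X in _ --> X](@normr0 _ R); apply: cvg_norm; exact: cvg_within.
- exact: cvg_cst.
near=> h; rewrite onrm_ge0 /=.
have h0 : h != 0 by near: h; exact: nbhs_dnbhs_neq.
have hd : `|h| < d.
  near: h; apply: (@cvg_within _ _ _); apply/nbhs_ballP; exists d => // x; rewrite /ball /= sub0r normrN //.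
have -> : (h^-1)%:C *: (G (mu + h) - G mu) - D = (h^-1)%:C *: (G (mu + h) - G mu - h%:C *: D).
  by rewrite [RHS]scalerBr scalerA -rmorphM mulVf // scale1r.
apply: le_trans (onrmZ _ _) _; rewrite ncC normfV ler_pdivrMl ?normr_gt0 //.
by rewrite mulrC -mulrA -expr2; exact: H.
Unshelve. all: by end_near.
Qed.

Definition bP k d G := exists (D : R -> bop R) (C : R), 0 <= C /\ forall t, 0 < t < d ->
  [/\ qder G t (D t), onrm (G t) <= C * t ^+ k & t * onrm (D t) <= C * t ^+ k].

Lemma bP_bG d G : bG d G -> bP 0 d G.
Proof. by move=> [D [C [C0 H]]]; exists D, C; split=> // t /H; rewrite expr0 mulr1. Qed.

Lemma qder_t t : qder (fun s => s%:C *: (1 : bop R)) t 1.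
Proof.
exists 0, 1; split=> // h _; rewrite rmorphD /= scalerDl.
have -> : t%:C *: 1 + h%:C *: 1 - t%:C *: 1 - h%:C *: 1 = 0 :> bop R by abel.
by rewrite mul0r; exact: onrm0.
Qed.

Lemma bP_tM k d G : bP k d G -> bP k.+1 d (fun t => t%:C *: G t).
Proof.
move=> [D [C [C0 H]]]; exists (fun t => G t + t%:C *: D t), (C + C); split; first exact: addr_ge0.
move=> t td; have [h1 h2 h3] := H t td; have /andP[t0 _] := td.
have tC : t * (C * t ^+ k) = C * t ^+ k.+1 by rewrite exprS mulrCA.
have nt (X : bop R) : onrm (t%:C *: X) <= t * onrm X by apply: le_trans (onrmZ _ _) _; rewrite ncC gtr0_norm.
split.
- have := qderM (qder_t t) h1; rewrite mul1r -scalerAl mul1r.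
  by apply: qder_in td _ => s _; rewrite -scalerAl mul1r.
- apply: le_trans (nt _) _; rewrite mulrDl -tC; apply: ler_wpDr; first by rewrite !mulr_ge0 ?exprn_ge0 // ltW.
  by apply: ler_wpM2l => //; exact: ltW.
- apply: (@le_trans _ _ (t * (C * t ^+ k + C * t ^+ k))); last by rewrite mulrDr tC mulrDl.
  apply: ler_wpM2l; first exact: ltW.
  by apply: le_trans (onrmD _ _) _; apply: lerD => //; exact: le_trans (nt _) h3.
Qed.

Lemma is_Gamma_bP k d mu0 G : mu0 <= d -> bP k d G -> is_Gamma k%:R mu0 (fun t => G t : opZ R).
Proof.
move=> md [D [C [C0 H]]]; exists (fun t => D t : opZ R).
have tin mu : 0 < mu < mu0 -> 0 < mu < d by move=> /andP[-> /lt_le_trans ->].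
split.
  move=> mu /tin /H [h1 _ _]; split; [exact: bop_Bop|exact: bop_Bop|exact: op_derive_qder].
exists (C + C + 1); first by rewrite ltr_wpDl ?addr_ge0.
move=> mu /tin td; have [_ h2 h3] := H mu td; have /andP[t0 _] := td.
rewrite -!onrmE -EFinM -EFinD lee_fin powR_mulrn ?(ltW t0) //.
apply: le_trans (lerD h2 h3) _; rewrite -mulrDl; apply: ler_wpM2r; first by rewrite exprn_ge0 // ltW.
by rewrite lerDl.
Qed.

Lemma qder_sqrt G mu (D : bop R) : 0 < mu -> qder G (Num.sqrt mu) D ->
  qder (fun m => G (Num.sqrt m)) mu ((2 * Num.sqrt mu)^-1%:C *: D).
Proof.
move=> mu0 [C [d [C0 d0 H]]]; set t := Num.sqrt mu in H *.
have t0 : 0 < t by rewrite sqrtr_gt0.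
have t2 : t ^+ 2 = mu by rewrite sqr_sqrtr // ltW.
pose B := C / t ^+ 2 + onrm D / (2 * t ^+ 3).
exists B, (Num.min mu (d * t)); split.
- by rewrite /B addr_ge0 ?divr_ge0 ?mulr_ge0 ?exprn_ge0 ?onrm_ge0 ?(ltW t0).
- by rewrite lt_min mu0 mulr_gt0.
move=> h; rewrite lt_min => /andP[h1 h2].
have mh : 0 <= mu + h by have := ltr_norml h mu; rewrite h1 => /esym/andP[b1 b2]; lra.
set a := Num.sqrt (mu + h); have a0 : 0 <= a by exact: sqrtr_ge0.
have a2 : a ^+ 2 = mu + h by rewrite sqr_sqrtr.
pose s := a - t.
have at0 : 0 < a + t by rewrite ltr_wpDl.
have sE : s = h / (a + t).
  apply: (mulIf (lt0r_neq0 at0)); rewrite divfK ?lt0r_neq0 //.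
  transitivity (a ^+ 2 - t ^+ 2); first by rewrite /s; ring.
  by rewrite a2 t2 addrC addKr.
have Vat : (a + t)^-1 <= t^-1 by rewrite lef_pV2 ?posrE // lerDr.
have sle : `|s| <= `|h| / t.
  rewrite sE normrM normfV (gtr0_norm at0); apply: ler_wpM2l => //.
have sd : `|s| < d by apply: le_lt_trans sle _; rewrite ltr_pdivrMr.
have aE : a = t + s by rewrite /s addrC subrK.
have -> : G a - G t - h%:C *: ((2 * t)^-1%:C *: D)
    = (G (t + s) - G t - s%:C *: D) + (s - h / (2 * t))%:C *: D.
  rewrite -aE scalerA -rmorphM [(s - h / _)%:C]rmorphB scalerBl /=.
  by move: (G a) (G t) => x y; abel.
apply: le_trans (onrmD _ _) _; rewrite /B [leRHS]mulrDl; apply: lerD.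
  apply: le_trans (H s sd) _; rewrite -mulrA; apply: ler_wpM2l => //.
  apply: (@le_trans _ _ ((`|h| / t) ^+ 2)).
    by apply: lerXn2r; rewrite ?nnegrE ?divr_ge0 ?(ltW t0).
  by rewrite exprMn exprVn mulrC.
apply: le_trans (onrmZ _ _) _; rewrite ncC.
have -> : onrm D / (2 * t ^+ 3) * `|h| ^+ 2 = (`|h| ^+ 2 / (2 * t ^+ 3)) * onrm D by ring.
apply: ler_wpM2r; first exact: onrm_ge0.
have -> : s - h / (2 * t) = - (h * s) / ((a + t) * (2 * t)).
  have e : s - h / (2 * t) = h / (a + t) - h / (2 * t) by rewrite {1}sE.
  by rewrite e /s; field; rewrite !lt0r_neq0.
rewrite normrM normrN normrM normfV (gtr0_norm (mulr_gt0 at0 (mulr_gt0 (ltr0n R 2 : 0 < 2) t0))).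
apply: (@le_trans _ _ ((`|h| * (`|h| / t)) * (t * (2 * t))^-1)).
  apply: ler_pM => //; first by rewrite invr_ge0 !mulr_ge0 ?(ltW at0) ?(ltW t0).
    by apply: ler_wpM2l.
  rewrite lef_pV2 ?posrE ?mulr_gt0 //; apply: ler_wpM2r; first by rewrite mulr_ge0 // ltW.
  by rewrite lerDr.
rewrite le_eqVlt; apply/orP; left; apply/eqP; field; exact: lt0r_neq0.
Qed.

Lemma bG_sqrt d G : 0 < d <= 1 -> bG d G -> bG (d ^+ 2) (fun m => G (Num.sqrt m)).
Proof.
move=> /andP[d0 d1] [D [C [C0 H]]].
exists (fun m => (2 * Num.sqrt m)^-1%:C *: D (Num.sqrt m)), C; split=> // m /andP[m0 md].
have t0 : 0 < Num.sqrt m by rewrite sqrtr_gt0.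
have t2 : Num.sqrt m ^+ 2 = m by rewrite sqr_sqrtr // ltW.
have td : 0 < Num.sqrt m < d.
  rewrite t0 /= -(ltr_pXn2r (n := 2)) ?nnegrE ?sqrtr_ge0 ?(ltW d0) //.
  by rewrite t2.
have [h1 h2 h3] := H _ td; split=> //; first exact: qder_sqrt.
set t := Num.sqrt m in t0 t2 h3 *.
have V0 : 0 <= (2 * t)^-1 by rewrite invr_ge0 mulr_ge0 // ltW.
apply: le_trans (ler_wpM2l (ltW m0) (onrmZ _ _)) _; rewrite ncC (ger0_norm V0).
rewrite -t2 (_ : t ^+ 2 * ((2 * t)^-1 * onrm (D t)) = 2^-1 * (t * onrm (D t))); last by field; exact: lt0r_neq0.
apply: (@le_trans _ _ (1 * C)); last by rewrite mul1r.
apply: ler_pM => //; first by rewrite mulr_ge0 ?onrm_ge0 // ltW.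
by rewrite invf_le1 // ler1n.
Qed.

End Conversion.

Section Expansions.
Context {R : realType}.
Variables (V : int -> R) (beta : R).
Hypothesis hV : exists2 c : R, 0 < c & forall n : int, `|V n| <= c * jap n `^ (- beta).

Lemma expansion_zero : regular0 V -> 15 < beta -> exists2 m1 : R, 0 < m1 <= 1 &
  forall mu0 : R, 0 < mu0 <= m1 ->
    exists (A01 : opZ R) (A11 A21 A22 A23 A31 : bool -> opZ R)
           (Gamma4 : bool -> R -> opZ R),
    Bop 0 0 A01 /\
    forall pm : bool,
      [/\ Bop 0 0 (A11 pm), Bop 0 0 (A21 pm), Bop 0 0 (A22 pm),
          Bop 0 0 (A23 pm) & Bop 0 0 (A31 pm)] /\
      is_Gamma 4 mu0 (Gamma4 pm) /\
      forall mu : R, 0 < mu < mu0 ->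
        op_inverse (Mop V pm mu)
          ((S0proj V \o A01 \o S0proj V)
           + mu%:C *: (Qproj V \o A11 pm \o Qproj V)
           + (mu ^+ 2)%:C *: ((Qproj V \o A21 pm \o Qproj V)
                              + (S0proj V \o A22 pm)
                              + (A23 pm \o S0proj V))
           + (mu ^+ 3)%:C *: A31 pm
           + Gamma4 pm mu).
Proof.
move=> reg hb; have [c c0 Hc] := hV.
have [S0 wS] : exists S0, l2le (wgt (vpot V) 7) S0.
  by apply: (decay_wgt c0 Hc); rewrite (_ : 2 * 7 + 1 = 15) //; ring.
have [A01 H] := zero_case wS (leqnn 7) reg.
have [dt [A11t [A21t [A22t [A23t [A31t [Gt [/andP[dt0 dt1] GtE Ht]]]]]]]] := H true.
have [df [A11f [A21f [A22f [A23f [A31f [Gf [/andP[df0 df1] GfE Hf]]]]]]]] := H false.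
exists (Num.min dt df); first by rewrite lt_min dt0 df0 ge_min dt1.
move=> mu0 /andP[m0]; rewrite le_min => /andP[mt mf].
pose sel (X Y : bop R) (pm : bool) := if pm then X else Y.
pose G (pm : bool) (t : R) : bop R := t%:C *: (t%:C *: (t%:C *: (t%:C *: (if pm then Gt t else Gf t)))).
exists A01, (sel A11t A11f), (sel A21t A21f), (sel A22t A22f), (sel A23t A23f), (sel A31t A31f), (fun pm t => G pm t).
split; first exact: bop_Bop.
move=> pm; split; first by split; exact: bop_Bop.
have QE := QprojE wS (leqnn 7) reg; have SE := S0projE wS (leqnn 7) reg.
have l2b (X : bop R) f : l2w 0 f -> l2w 0 (X f) by exact: bopl2.
split.
  have gen d (F : R -> bop R) : bG d F -> mu0 <= d ->
      is_Gamma 4 mu0 (fun t => t%:C *: (t%:C *: (t%:C *: (t%:C *: F t))) : bop R).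
    by move=> FE md; apply: (is_Gamma_bP (k := 4) md); do 4 apply: bP_tM; exact: bP_bG.
  by case: pm; [exact: gen GtE mt|exact: gen GfE mf].
move=> mu /andP[mu_gt0 mu_lt].
have [M [HM [MY YM]]] : exists M : bop R, (forall phi, l2w 0 phi -> Mop V pm mu phi = M phi) /\
    let Q := 1 - P1z V in let S := 1 - P1z V - P2z V in
    let Y := S * A01 * S + mu%:C *: (Q * sel A11t A11f pm * Q) + (mu ^+ 2)%:C *: (Q * sel A21t A21f pm * Q
       + S * sel A22t A22f pm + sel A23t A23f pm * S)
       + (mu ^+ 3)%:C *: sel A31t A31f pm + (mu ^+ 4)%:C *: (if pm then Gt mu else Gf mu) in M * Y = 1 /\ Y * M = 1.
  case: pm; [apply: Ht|apply: Hf]; rewrite mu_gt0.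
    exact: lt_le_trans mu_lt mt.
  exact: lt_le_trans mu_lt mf.
apply: (op_inverse_ext HM _ MY YM) => phi hp.
have -> : (mu ^+ 4)%:C *: (if pm then Gt mu else Gf mu) = G pm mu.
  by rewrite /G !scalerA -!rmorphM; congr (_%:C *: _); ring.
rewrite [LHS](_ : _ = S0proj V (A01 (S0proj V phi)) + mu%:C *: Qproj V (sel A11t A11f pm (Qproj V phi))
  + (mu ^+ 2)%:C *: (Qproj V (sel A21t A21f pm (Qproj V phi)) + S0proj V (sel A22t A22f pm phi)
     + sel A23t A23f pm (S0proj V phi)) + (mu ^+ 3)%:C *: sel A31t A31f pm phi + G pm mu phi) //.
have hQ := l2b (1 - P1z V) _ hp; have hS := l2b (1 - P1z V - P2z V) _ hp.
rewrite !(QE phi hp) !(SE phi hp) !QE ?SE; try exact: l2b.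
move: (1 - P1z V) (1 - P1z V - P2z V) hQ hS => Q S hQ hS.
by rewrite !(boD, boZ) // !boM //; exact: l2b.
Qed.

Lemma expansion_sixteen : regular16 V -> 7 < beta -> exists2 m1 : R, 0 < m1 <= 1 &
  forall mu0 : R, 0 < mu0 <= m1 ->
    exists (B01 : opZ R) (B11 : bool -> opZ R) (Gamma1 : bool -> R -> opZ R),
    Bop 0 0 B01 /\
    forall pm : bool,
      Bop 0 0 (B11 pm) /\
      is_Gamma 1 mu0 (Gamma1 pm) /\
      forall mu : R, 0 < mu < mu0 ->
        op_inverse (Mop V pm (2 - mu))
          ((Qtproj V \o B01 \o Qtproj V)
           + (Num.sqrt mu)%:C *: B11 pm
           + Gamma1 pm mu).
Proof.
move=> reg hb; have [c c0 Hc] := hV.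
have [S0 wS] : exists S0, l2le (wgt (vpot V) 3) S0.
  by apply: (decay_wgt c0 Hc); rewrite (_ : 2 * 3 + 1 = 7) //; ring.
have [B01 H] := sixteen_case wS (leqnn 3) reg.
have [dt [B11t [Gt [/andP[dt0 dt1] GtE Ht]]]] := H true.
have [df [B11f [Gf [/andP[df0 df1] GfE Hf]]]] := H false.
exists (Num.min (dt ^+ 2) (df ^+ 2)).
  by rewrite lt_min !exprn_gt0 // ge_min exprn_ile1 // ltW.
move=> mu0 /andP[m0]; rewrite le_min => /andP[mt mf].
pose sel (X Y : bop R) (pm : bool) := if pm then X else Y.
pose G (pm : bool) (t : R) : bop R := t%:C *: (if pm then Gt (Num.sqrt t) else Gf (Num.sqrt t)).
exists B01, (sel B11t B11f), (fun pm t => G pm t).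
split; first exact: bop_Bop.
move=> pm; split; first exact: bop_Bop.
have QE := QtprojE wS reg.
have l2b (X : bop R) f : l2w 0 f -> l2w 0 (X f) by exact: bopl2.
split.
  have gen d (F : R -> bop R) : 0 < d <= 1 -> bG d F -> mu0 <= d ^+ 2 ->
      is_Gamma 1 mu0 (fun t => t%:C *: F (Num.sqrt t) : bop R).
    move=> d1 FE md; apply: (is_Gamma_bP (k := 1) md); apply: bP_tM; apply: bP_bG.
    exact: bG_sqrt.
  by case: pm; [apply: gen GtE mt; rewrite dt0|apply: gen GfE mf; rewrite df0].
move=> mu /andP[mu_gt0 mu_lt].
have s0 : 0 < Num.sqrt mu by rewrite sqrtr_gt0.
have s2 : Num.sqrt mu ^+ 2 = mu by rewrite sqr_sqrtr // ltW.
have sd d : 0 < d -> mu0 <= d ^+ 2 -> 0 < Num.sqrt mu < d.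
  move=> d0 md; rewrite s0 /= -(ltr_pXn2r (n := 2)) ?nnegrE ?sqrtr_ge0 ?(ltW d0) // s2.
  exact: lt_le_trans mu_lt md.
have [M [HM [MY YM]]] : exists M : bop R, (forall phi, l2w 0 phi -> Mop V pm (2 - mu) phi = M phi) /\
    let Q := 1 - Pt V in
    let Y := Q * B01 * Q + (Num.sqrt mu)%:C *: sel B11t B11f pm
       + mu%:C *: (if pm then Gt (Num.sqrt mu) else Gf (Num.sqrt mu)) in M * Y = 1 /\ Y * M = 1.
  by case: pm; [have := Ht _ (sd _ dt0 mt)|have := Hf _ (sd _ df0 mf)]; rewrite s2.
apply: (op_inverse_ext HM _ MY YM) => phi hp.
rewrite [LHS](_ : _ = Qtproj V (B01 (Qtproj V phi)) + (Num.sqrt mu)%:C *: sel B11t B11f pm phi + G pm mu phi) //.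
have hQ := l2b (1 - Pt V) _ hp.
rewrite !(QE phi hp) !QE; try exact: l2b.
move: (1 - Pt V) hQ => Q hQ.
by rewrite !(boD, boZ) // !boM //; exact: l2b.
Qed.

End Expansions.

Theorem theorem2p7 (R : realType) (V : int -> R) (beta : R)
  (hbeta : 0 < beta)
  (hV : exists2 c : R, 0 < c & forall n : int, `|V n| <= c * jap n `^ (- beta))
  (hH : forall lambda : R, 0 < lambda < 16 -> ~ eigenvalue_of (Hop V) lambda) :
  exists mu0 : R, 0 < mu0 < 2 /\
  (regular0 V -> 15 < beta ->
    exists (A01 : opZ R) (A11 A21 A22 A23 A31 : bool -> opZ R)
           (Gamma4 : bool -> R -> opZ R),
    Bop 0 0 A01 /\
    forall pm : bool,
      [/\ Bop 0 0 (A11 pm), Bop 0 0 (A21 pm), Bop 0 0 (A22 pm),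
          Bop 0 0 (A23 pm) & Bop 0 0 (A31 pm)] /\
      is_Gamma 4 mu0 (Gamma4 pm) /\
      forall mu : R, 0 < mu < mu0 ->
        op_inverse (Mop V pm mu)
          ((S0proj V \o A01 \o S0proj V)
           + mu%:C *: (Qproj V \o A11 pm \o Qproj V)
           + (mu ^+ 2)%:C *: ((Qproj V \o A21 pm \o Qproj V)
                              + (S0proj V \o A22 pm)
                              + (A23 pm \o S0proj V))
           + (mu ^+ 3)%:C *: A31 pm
           + Gamma4 pm mu)) /\
  (regular16 V -> 7 < beta ->
    exists (B01 : opZ R) (B11 : bool -> opZ R) (Gamma1 : bool -> R -> opZ R),
    Bop 0 0 B01 /\
    forall pm : bool,
      Bop 0 0 (B11 pm) /\
      is_Gamma 1 mu0 (Gamma1 pm) /\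
      forall mu : R, 0 < mu < mu0 ->
        op_inverse (Mop V pm (2 - mu))
          ((Qtproj V \o B01 \o Qtproj V)
           + (Num.sqrt mu)%:C *: B11 pm
           + Gamma1 pm mu)).
Proof.
have default (A : Prop) (B : R -> Prop) : (A -> exists2 m : R, 0 < m <= 1 & forall mu0, 0 < mu0 <= m -> B mu0) ->
    exists2 m : R, 0 < m <= 1 & forall mu0, 0 < mu0 <= m -> A -> B mu0.
  move=> H; have [a|na] := pselect A; last by exists 1; rewrite ?ltr01 ?lexx.
  by have [m m1 Hm] := H a; exists m => // mu0 h _; exact: Hm.
have [m1 /andP[m10 m11] H1] := default (regular0 V /\ 15 < beta) _ (fun h => expansion_zero hV h.1 h.2).
have [m2 /andP[m20 m21] H2] := default (regular16 V /\ 7 < beta) _ (fun h => expansion_sixteen hV h.1 h.2).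
exists (Num.min m1 m2); split.
  by rewrite lt_min m10 m20 gt_min (le_lt_trans m11) // ltr1n.
split=> h1 h2; [apply: H1|apply: H2] => //; by rewrite lt_min m10 m20 ge_min lexx ?orbT.
Qed.
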